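(* Let $M$ be a compact smooth manifold, and let $H\in\Psi^0_{1,0}(M)$ be a pseudodifferential operator of order $0$ which is self-adjoint as a bounded operator on $L^2(M)$, with principal symbol $\sigma(H)=a\in S^0_{1,0}(T^*M)$. Then $$\operatorname{Spec}_{\rm ess}(H)=\Big\{\lambda \;:\; \text{there exist } (x_j,\xi_j)\in T^*M,\ j\in\mathbb{N},\ \text{with } |\xi_j|\to\infty \text{ and } \lim_{j\to\infty}a(x_j,\xi_j)=\lambda\Big\}.$$
   Context: $M$ is without boundary. Fix a smooth positive density on $M$, defining $L^2(M)$, and a Riemannian metric on $M$, defining $|\xi|$ for $(x,\xi)\in T^*M$; all norms obtained this way are equivalent. Symbols: $S^m_{1,0}(T^*M)$ is the space of smooth complex-valued functions $a$ on $T^*M$ which in local coordinates satisfy $|\partial_x^\alpha\partial_\xi^\beta a(x,\xi)|\le C_{K,\alpha,\beta}(1+|\xi|)^{m-|\beta|}$ for all multi-indices $\alpha,\beta$ and all $x$ in compact sets $K$. $\Psi^m_{1,0}(M)$ is the corresponding class of pseudodifferential operators on $M$: operators which in local coordinates are, modulo smoothing operators, of the form $\operatorname{Op}(a)u(x)=(2\pi)^{-n}\int\int a(x,\xi)e^{i(x-y)\cdot\xi}u(y)\,dy\,d\xi$ with $a\in S^m_{1,0}$. The principal symbol $\sigma(H)$ is the class of the full symbol in $S^m_{1,0}/S^{m-1}_{1,0}$, and $a$ denotes any representative of it (the right-hand side of the claim does not depend on the choice). Operators in $\Psi^0_{1,0}(M)$ are bounded on $L^2(M)$. $\operatorname{Spec}_{\rm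 ess}(H)=\operatorname{Spec}(H)\setminus\operatorname{Spec}_{\rm d}(H)$, where the discrete spectrum $\operatorname{Spec}_{\rm d}(H)$ is the set of isolated points of $\operatorname{Spec}(H)$ that are eigenvalues of finite multiplicity. *)

(* Defs.v *)
From HB Require Import structures.
From mathcomp Require Import all_boot all_order all_algebra.
From mathcomp Require Import complex.
From mathcomp Require Import all_classical all_reals all_analysis.

Set Implicit Arguments.
Unset Strict Implicit.
Unset Printing Implicit Defensive.

Import Order.TTheory GRing.Theory Num.Theory.
Import numFieldNormedType.Exports.

Local Open Scope classical_set_scope.
Local Open Scope complex_scope.
Local Open Scope ring_scope.

Local Notation Re := complex.Re.
Local Notation Im := complex.Im.
Local Notation cmod := ComplexField.Normc.normc.

Section Smooth.
Context {R : realType}.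

Definition iter_derive {U V : normedModType R} (s : seq U) (f : U -> V) :
    U -> V :=
  foldr (fun v (g : U -> V) x => 'D_v g x) f s.

(* For open [A] and finite-dimensional [U], this is the usual C^infinity
   condition; it only depends on the restriction of [f] to [A]. *)
Definition smooth_on {U V : normedModType R} (A : set U) (f : U -> V) : Prop :=
  forall (s : seq U) (x : U), A x -> differentiable (iter_derive s f) x.

(* [R[i]] carries no normed [R]-module structure in the library, so the real
   and imaginary parts are differentiated separately. *)
Definition csmooth_on {U : normedModType R} (A : set U) (f : U -> R[i]) : Prop :=
  smooth_on A (fun x => Re (f x)) /\ smooth_on A (fun x => Im (f x)).

Definition citer_derive {U : normedModType R} (s : seq U) (f : U -> R[i])
    (x : U) : R[i] :=
  iter_derive s (fun x => Re (f x)) x +i* iter_derive s (fun x => Im (f x)) x.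

Definition cis (t : R) : R[i] := cos t +i* sin t.

End Smooth.

Section EuclideanSpace.
Context {R : realType}.

Definition dotv {n} (x y : 'rV[R]_n) : R := \sum_(i < n) x 0 i * y 0 i.

Definition enorm {n} (x : 'rV[R]_n) : R := Num.sqrt (dotv x x).

(* The library has no Lebesgue measure on ['rV[R]_n]: integrate the coordinates
   one after the other (Tonelli/Fubini). *)
Fixpoint int_rV (n : nat) : ('rV[R]_n -> \bar R) -> \bar R :=
  match n with
  | 0 => fun f => f 0
  | m.+1 => fun f =>
      (\int[lebesgue_measure]_t int_rV (fun y => f (row_mx (t : R)%:M y)))%E
  end.

Definition cint_rV {n} (f : 'rV[R]_n -> R[i]) : R[i] :=
  fine (int_rV (fun x => (Re (f x))%:E)) +i*
  fine (int_rV (fun x => (Im (f x))%:E)).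

(* Symbols over [V], an open subset of R^n, i.e. functions on V x R^n; the
   multi-indices [alpha], [beta] are given as lists of coordinate indices, so
   that |beta| is [size beta]. *)
Definition symbol_on {n} (m : R) (V : set 'rV[R]_n)
    (b : 'rV[R]_n * 'rV[R]_n -> R[i]) : Prop :=
  csmooth_on (V `*` setT) b /\
  forall K : set 'rV[R]_n, compact K -> K `<=` V ->
  forall alpha beta : seq 'I_n, exists C : R,
  forall x xi, K x ->
    cmod (citer_derive ([seq (delta_mx 0 i, 0) | i <- alpha] ++
                        [seq (0, delta_mx 0 i) | i <- beta]) b (x, xi))
    <= C * (1 + enorm xi) `^ (m - (size beta)%:R).

Definition Op {n} (b : 'rV[R]_n * 'rV[R]_n -> R[i]) (u : 'rV[R]_n -> R[i])
    (x : 'rV[R]_n) : R[i] :=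
  ((2 * pi) ^- n)%:C *
  cint_rV (fun xi => cint_rV (fun y => b (x, xi) * cis (dotv (x - y) xi) * u y)).

Definition kernel_op {n} (k : 'rV[R]_n * 'rV[R]_n -> R[i])
    (u : 'rV[R]_n -> R[i]) (x : 'rV[R]_n) : R[i] :=
  cint_rV (fun y => k (x, y) * u y).

Definition test_function {n} (V : set 'rV[R]_n) (u : 'rV[R]_n -> R[i]) : Prop :=
  csmooth_on setT u /\
  exists K, [/\ compact K, K `<=` V & forall x, ~ K x -> u x = 0].

End EuclideanSpace.

(* Charts need not have connected domain; [fwd] and [bwd] are irrelevant outside
   [dom] and [cod]. *)
Record chart (R : realType) (n : nat) (M : topologicalType) := Chart {
  dom : set M;
  cod : set 'rV[R]_n;
  fwd : M -> 'rV[R]_n;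
  bwd : 'rV[R]_n -> M;
  dom_open : open dom;
  cod_open : open cod;
  fwd_cod : forall p, dom p -> cod (fwd p);
  bwd_dom : forall x, cod x -> dom (bwd x);
  fwdK : forall p, dom p -> bwd (fwd p) = p;
  bwdK : forall x, cod x -> fwd (bwd x) = x;
  fwd_continuous : forall p, dom p -> {for p, continuous fwd};
  bwd_continuous : forall x, cod x -> {for x, continuous bwd} }.

Definition transition {R : realType} {n} {M : topologicalType}
    (k l : chart R n M) : 'rV[R]_n -> 'rV[R]_n := fwd l \o bwd k.

Definition smooth_transition {R : realType} {n} {M : topologicalType}
    (k l : chart R n M) : Prop :=
  smooth_on [set x | cod k x /\ dom l (bwd k x)] (transition k l).

Record smoothManifold (R : realType) (n : nat) := SmoothManifold {
  points :> ptopologicalType;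
  points_hausdorff : hausdorff_space points;
  points_second_countable : @second_countable points;
  charts : set (chart R n points);
  charts_cover : forall p, exists2 k, charts k & dom k p;
  charts_compatible : forall k l, charts k -> charts l -> smooth_transition k l;
  charts_maximal : forall k,
    (forall l, charts l -> smooth_transition k l /\ smooth_transition l k) ->
    charts k }.

Section Manifold.
Context {R : realType} {n : nat} {M : smoothManifold R n}.

Definition chart_at (p : M) : chart R n M := s2val (cid2 (charts_cover p)).

Definition smooth_function (f : M -> R[i]) : Prop :=
  forall k, charts k -> csmooth_on (cod k) (f \o bwd k).

(* A covector xi at [base] is given by its components (xi_1, ..., xi_n),
   xi = sum_i xi_i dx_i, in every chart around [base].  As [jacobian] acts on
   row vectors from the right, the change of components is by the transposed
   matrix.  The last field makes the representation unique. *)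
Record cotangent := Cotangent {
  base : M;
  components : chart R n M -> 'rV[R]_n;
  componentsE : forall k l, charts k -> charts l -> dom k base -> dom l base ->
    components k = components l *m (jacobian (transition k l) (fwd k base))^T;
  components_out : forall k, ~ (charts k /\ dom k base) -> components k = 0 }.

(* [metric_mx k x] is the matrix (g_ij(x)) of the metric in the chart [k]. *)
Record riemannianMetric := RiemannianMetric {
  metric_mx : chart R n M -> 'rV[R]_n -> 'M[R]_n;
  metric_smooth : forall k, charts k -> smooth_on (cod k) (metric_mx k);
  metric_sym : forall k x, charts k -> cod k x -> (metric_mx k x)^T = metric_mx k x;
  metric_pos : forall k x v, charts k -> cod k x -> v != 0 ->
    0 < dotv (v *m metric_mx k x) v;
  metric_change : forall k l p, charts k -> charts l -> dom k p -> dom l p ->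
    let J := jacobian (transition k l) (fwd k p) in
    metric_mx k (fwd k p) = J *m metric_mx l (fwd l p) *m J^T }.

(* The dual norm |xi| = (sum_ij g^ij xi_i xi_j)^(1/2); by [componentsE] and
   [metric_change] it does not depend on the chart used. *)
Definition conorm (g : riemannianMetric) (z : cotangent) : R :=
  let k := chart_at (base z) in
  Num.sqrt (dotv (components z k *m invmx (metric_mx g k (fwd k (base z))))
                 (components z k)).

End Manifold.
Arguments cotangent {R n} M.
Arguments riemannianMetric {R n} M.

Section PseudoDifferential.
Context {R : realType} {n : nat} {M : smoothManifold R n}.

(* [b] is the expression of [a] in the coordinates (x, xi) of T*M over [k]. *)
Definition local_expression (k : chart R n M) (a : cotangent M -> R[i])
    (b : 'rV[R]_n * 'rV[R]_n -> R[i]) : Prop :=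
  forall z : cotangent M, dom k (base z) -> a z = b (fwd k (base z), components z k).

Definition symbol (m : R) (a : cotangent M -> R[i]) : Prop :=
  forall k, charts k -> exists2 b, local_expression k a b & symbol_on m (cod k) b.

Definition pullback (k : chart R n M) (u : 'rV[R]_n -> R[i]) (p : M) : R[i] :=
  if `[< dom k p >] then u (fwd k p) else 0.

(* In the chart [k], and modulo an operator with kernel smooth on
   [cod k] x [cod k], the operator [A] is [Op b]. *)
Definition full_symbol (A : (M -> R[i]) -> (M -> R[i])) (m : R)
    (k : chart R n M) (b : 'rV[R]_n * 'rV[R]_n -> R[i]) : Prop :=
  symbol_on m (cod k) b /\
  exists2 r, csmooth_on (cod k `*` cod k) r &
    forall u, test_function (cod k) u -> forall x, cod k x ->
      A (pullback k u) (bwd k x) = Op b u x + kernel_op r u x.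

(* [A] is only meaningful on smooth functions.  All charts of the maximal atlas
   are used, including those with disconnected domain; since any two distinct
   points lie in the domain of such a chart, the condition contains the
   smoothness of the Schwartz kernel of [A] off the diagonal. *)
Definition pseudodifferential (m : R) (A : (M -> R[i]) -> (M -> R[i])) : Prop :=
  [/\ forall u, smooth_function u -> smooth_function (A u),
      forall (c : R[i]) u v, smooth_function u -> smooth_function v ->
        A (fun p => c * u p + v p) = (fun p => c * A u p + A v p) &
      forall k, charts k -> exists b, full_symbol A m k b].

(* [a] represents the class of the full symbol of [A] in S^m / S^(m-1). *)
Definition principal_symbol (m : R) (A : (M -> R[i]) -> (M -> R[i]))
    (a : cotangent M -> R[i]) : Prop :=
  symbol m a /\
  forall k b b0, charts k -> full_symbol A m k b -> local_expression k a b0 ->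
    symbol_on (m - 1) (cod k) (fun z => b z - b0 z).

End PseudoDifferential.

Definition borel {R : realType} {n} (M : smoothManifold R n) :=
  g_sigma_algebraType (@open M).

Section Hilbert.
Context {R : realType} {d} {T : measurableType d}.
Variable mu : {measure set T -> \bar R}.

Definition L2 (f : T -> R[i]) : Prop :=
  (fun x => Re (f x)) \in Lfun mu 2%:E /\ (fun x => Im (f x)) \in Lfun mu 2%:E.

Definition inner (f g : T -> R[i]) : R[i] :=
  (\int[mu]_x Re (f x * (g x)^*)) +i* (\int[mu]_x Im (f x * (g x)^*)).

Definition L2norm (f : T -> R[i]) : R := Num.sqrt (\int[mu]_x cmod (f x) ^+ 2).

(* The space L^2 is the quotient of [L2] by equality almost everywhere; its
   bounded operators are handled as maps on [L2] compatible with it. *)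
Record bounded_operator (H : (T -> R[i]) -> (T -> R[i])) : Prop := {
  bop_L2 : forall f, L2 f -> L2 (H f);
  bop_ae : forall f g, L2 f -> L2 g -> f = g %[ae mu] -> H f = H g %[ae mu];
  bop_linear : forall (c : R[i]) f g, L2 f -> L2 g ->
    H (fun x => c * f x + g x) = (fun x => c * H f x + H g x) %[ae mu];
  bop_bounded : exists C : R, forall f, L2 f -> L2norm (H f) <= C * L2norm f }.

Definition self_adjoint (H : (T -> R[i]) -> (T -> R[i])) : Prop :=
  forall f g, L2 f -> L2 g -> inner (H f) g = inner f (H g).

Definition resolvent_set (H : (T -> R[i]) -> (T -> R[i])) : set R[i] :=
  [set lambda | exists2 B, bounded_operator B & forall f, L2 f ->
     B (fun x => H f x - lambda * f x) = f %[ae mu] /\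
     (fun x => H (B f) x - lambda * B f x) = f %[ae mu] ].

Definition spectrum (H : (T -> R[i]) -> (T -> R[i])) : set R[i] :=
  ~` resolvent_set H.

Definition eigenfunction (H : (T -> R[i]) -> (T -> R[i])) (lambda : R[i])
    (f : T -> R[i]) : Prop :=
  L2 f /\ H f = (fun x => lambda * f x) %[ae mu].

Definition has_eigenvalue (H : (T -> R[i]) -> (T -> R[i])) (lambda : R[i]) :
    Prop :=
  exists2 f, eigenfunction H lambda f & ~ (f = cst 0 %[ae mu]).

Definition finite_multiplicity (H : (T -> R[i]) -> (T -> R[i]))
    (lambda : R[i]) : Prop :=
  exists (N : nat) (e : 'I_N -> T -> R[i]),
    forall f, eigenfunction H lambda f -> exists c : 'I_N -> R[i],
      f = (fun x => \sum_(i < N) c i * e i x) %[ae mu].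

Definition discrete_spectrum (H : (T -> R[i]) -> (T -> R[i])) : set R[i] :=
  [set lambda | [/\ isolated (spectrum H : set R[i]^o) lambda,
                    has_eigenvalue H lambda & finite_multiplicity H lambda] ].

Definition essential_spectrum (H : (T -> R[i]) -> (T -> R[i])) : set R[i] :=
  spectrum H `\` discrete_spectrum H.

End Hilbert.

Section L2Manifold.
Context {R : realType} {n : nat} {M : smoothManifold R n}.

(* [mu] is given by a smooth positive density: [mu = rho dx] in every chart. *)
Definition smooth_positive_density (mu : {measure set (borel M) -> \bar R})
    : Prop :=
  forall k : chart R n M, charts k -> exists rho : 'rV[R]_n -> R,
    [/\ smooth_on (cod k) rho, forall x, cod k x -> 0 < rho x &
        forall B : set (borel M), measurable B -> B `<=` dom k ->
          mu B = int_rV (fun x => (rho x * \1_(fwd k @` B) x)%:E)].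

End L2Manifold.

(* Main.v *)
(** [H] is tested on wave packets c(x) e^{i x.w} supported in a chart.  Expanding
   the symbol b of [H] along the fibre at w shows that, uniformly for c in a
   bounded family of smooth functions with support in a fixed compact set,
   H (c e^{i x.w}) = (b(., w) c + O(1 / |w|)) e^{i x.w}.
   Suppose that |a - lambda| >= d > 0 for large |xi|, where lambda is real.  Then
   the packets with amplitude phi / (b(., w) - lambda) are mapped by H - lambda to
   phi e^{i x.w}, up to a small error, so that the Fourier coefficients of phi u
   at large frequencies are controlled by (H - lambda) u.  By Plancherel's theorem,
   discretized with one frequency in each unit cell, and Bessel's inequality for
   almost orthogonal packets, |u|^2 <= C (|(H - lambda) u|^2 + sum_h |<u, h>|^2)
   with finitely many h; this makes lambda a point of the resolvent set or of the
   discrete spectrum.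
   Conversely, if a (x_j, xi_j) tends to lambda, packets of frequency xi_j
   concentrated near a cluster point of the x_j are approximate eigenfunctions
   that tend weakly to 0, which is Weyl's criterion for the essential spectrum. *)

Require Import Defs.
From HB Require Import structures.
From mathcomp Require Import all_boot all_order all_algebra.
From mathcomp Require Import complex.
From mathcomp Require Import all_classical all_reals all_analysis.
From mathcomp Require Import measurable_realfun ring lra.

Set Implicit Arguments.
Unset Strict Implicit.
Unset Printing Implicit Defensive.

Import Order.TTheory GRing.Theory Num.Theory.
Import numFieldNormedType.Exports.

Local Open Scope classical_set_scope.
Local Open Scope complex_scope.
Local Open Scope ring_scope.

Local Notation Re := complex.Re.
Local Notation Im := complex.Im.
Local Notation cmod := ComplexField.Normc.normc.

(** * Fredholm alternative and Weyl criterion *)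

(** No symbolic calculus is built: compositions and parametrices of pseudodifferential operators
    never occur. Self-adjointness moves [H] from an arbitrary vector onto a packet, and only [Op] of
    an explicit packet is computed. The full symbol meets the given [a] once, in the remainder of
    [quasimode]. A packet must also have a small image outside its chart. This comes from the
    maximal atlas: a chart with disconnected domain contains both the support and a far point, near
    which the symbol expansion, being local, vanishes. As [int_rV] is an iterated integral,
    exchanges of integrals have to hold on every slice; a product weight dominates all integrands
    for that purpose. The Hilbert space is real, with the real part of the inner product; complex
    information returns by testing with a packet and with its multiple by the imaginary unit. The
    finitely many h arise from the compactness of bounded sets of frequencies and a finite cover of
    M. Estimates are proved for smooth functions, whose pairings with packets are Fourier
    transforms, and extended by density. *)

Section Hilbert.
Context {R : realType} {V : lmodType R}.
Implicit Types (u v w x y f h : V) (T S L : V -> V).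

(* A complete real inner product, except that it may be degenerate: a.e. equal
   functions are not identified.  A bounded operator is given with its adjoint,
   and is then linear modulo null vectors. *)
Record hilbert (ip : V -> V -> R) : Prop := {
  ipC : forall u v, ip u v = ip v u;
  ipDZl : forall a u v w, ip (a *: u + v) w = a * ip u w + ip v w;
  ip_ge0 : forall u, 0 <= ip u u;
  ip_complete : forall u : nat -> V,
    (forall e : R, 0 < e -> exists N : nat, forall m k, (N <= m)%N -> (N <= k)%N ->
       ip (u m - u k) (u m - u k) <= e) ->
    exists l, forall e : R, 0 < e -> exists N : nat, forall k, (N <= k)%N ->
       ip (u k - l) (u k - l) <= e }.

Variables (ip : V -> V -> R) (hip : hilbert ip).
Local Notation q u := (ip u u).

Lemma ipDl u v w : ip (u + v) w = ip u w + ip v w.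
Proof. by have := ipDZl hip 1 u v w; rewrite scale1r mul1r. Qed.

Lemma ip0l w : ip 0 w = 0.
Proof. by have := ipDl 0 0 w; rewrite addr0 => /eqP; rewrite -subr_eq subrr => /eqP. Qed.

Lemma ipZl a u w : ip (a *: u) w = a * ip u w.
Proof. by have := ipDZl hip a u 0 w; rewrite addr0 ip0l addr0. Qed.

Lemma ipNl u w : ip (- u) w = - ip u w.
Proof. by rewrite -scaleN1r ipZl mulN1r. Qed.

Lemma ipDr u v w : ip w (u + v) = ip w u + ip w v.
Proof. by rewrite !(ipC hip w) ipDl. Qed.

Lemma ipZr a u w : ip w (a *: u) = a * ip w u.
Proof. by rewrite !(ipC hip w) ipZl. Qed.

Lemma ipNr u w : ip w (- u) = - ip w u.
Proof. by rewrite !(ipC hip w) ipNl. Qed.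

Lemma ip0r w : ip w 0 = 0.
Proof. by rewrite (ipC hip) ip0l. Qed.

Definition ipE := (ipDl, ipDr, ipNl, ipNr, ipZl, ipZr, ip0l, ip0r).

Lemma ip_suml (I : Type) (r : seq I) (P : pred I) (F : I -> V) w :
  ip (\sum_(i <- r | P i) F i) w = \sum_(i <- r | P i) ip (F i) w.
Proof. by apply: (big_morph (fun v => ip v w)); [move=> u v; rewrite ipDl | rewrite ip0l]. Qed.

(** The discriminant argument, for an arbitrary semidefinite form: [spectral_gap] applies it to a
    form other than [ip]. *)
Lemma form_cauchy (B : V -> V -> R) : (forall u v, B u v = B v u) ->
  (forall a u v w, B (a *: u + v) w = a * B u w + B v w) ->
  (forall u, 0 <= B u u) -> forall u v, B u v ^+ 2 <= B u u * B v v.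
Proof.
move=> BC BD B0 u v.
have H t : 0 <= t ^+ 2 * B v v + 2 * t * B u v + B u u.
  have := B0 (t *: v + u); rewrite BD !(BC _ (t *: v + u)) !BD (BC v u).
  by move=> h; apply: (le_trans h); rewrite le_eqVlt; apply/orP; left; apply/eqP; ring.
have := B0 u; have := B0 v; move: H.
move: (B u u) (B v v) (B u v) => a b c H b0 a0.
have [b00|bn] := eqVneq b 0.
  have [->|cn] := eqVneq c 0; first by rewrite b00 expr0n mulr0.
  (* For [b = 0] the quadratic is affine in its parameter, and at this [t] it takes the value -1. *)
  have := H (- (a + 1) / (2 * c)); set t := _ / _.
  have : 2 * t * c = - (a + 1) by rewrite /t; field.
  nra.
have := H (- c / b); set t := _ / _.
have tb : t * b = - c by rewrite /t; field.
nra.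
Qed.

Lemma ip_cauchy u v : ip u v ^+ 2 <= q u * q v.
Proof. exact: form_cauchy (ipC hip) (ipDZl hip) (ip_ge0 hip) u v. Qed.

Lemma ip_null u w : q u = 0 -> ip u w = 0.
Proof.
move=> qu; have := ip_cauchy u w; rewrite qu mul0r => h.
by apply/eqP; rewrite -sqrf_eq0 eq_le h sqr_ge0.
Qed.

Lemma ip_congr u v w : q (u - v) = 0 -> ip u w = ip v w.
Proof. by move=> /(@ip_null _ w); rewrite !ipE; lra. Qed.

Lemma q_congr u v : q (u - v) = 0 -> q u = q v.
Proof. by move=> h; rewrite (ip_congr u h) (ipC hip) (ip_congr v h). Qed.

Lemma q_scale a u : q (a *: u) = a ^+ 2 * q u.
Proof. by rewrite !ipE; ring. Qed.

Lemma q_opp u : q (- u) = q u.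
Proof. by rewrite !ipE; ring. Qed.

Lemma q_add u v : q (u + v) = q u + 2 * ip u v + q v.
Proof. by rewrite !ipE (ipC hip v u); ring. Qed.

Lemma q_sub u v : q (u - v) = q u - 2 * ip u v + q v.
Proof. by rewrite !ipE (ipC hip v u); ring. Qed.

Lemma q_add_le u v : q (u + v) <= 2 * q u + 2 * q v.
Proof. by have := ip_ge0 hip (u - v); rewrite q_sub q_add; lra. Qed.

Lemma q_sub_le u v : q (u - v) <= 2 * q u + 2 * q v.
Proof. by have := q_add_le u (- v); rewrite q_opp. Qed.

Lemma eq_from_ip u v : (forall w, ip u w = ip v w) -> q (u - v) = 0.
Proof. by move=> h; rewrite ipDl ipNl !h subrr. Qed.

Definition adjoint T S := forall u v, ip (T u) v = ip u (S v).

Lemma adjoint_sym T S : adjoint T S -> adjoint S T.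
Proof. by move=> h u v; rewrite (ipC hip) -h (ipC hip). Qed.

Lemma adjoint_lin T S a u v w : adjoint T S ->
  ip (T (a *: u + v)) w = a * ip (T u) w + ip (T v) w.
Proof. by move=> h; rewrite !h ipDZl. Qed.

Lemma adjoint_sub T S u v w : adjoint T S ->
  ip (T (u - v)) w = ip (T u) w - ip (T v) w.
Proof. by move=> h; rewrite !h !ipE. Qed.

Lemma adjoint_qsub T S u v : adjoint T S -> q (T (u - v)) = q (T u - T v).
Proof.
by move=> h; apply: q_congr; apply: eq_from_ip => w; rewrite (adjoint_sub _ _ _ h) !ipE.
Qed.

Lemma small_eq0 (x : R) : (forall e : R, 0 < e -> `|x| <= e) -> x = 0.
Proof.
move=> h; apply/normr0_eq0/eqP; rewrite eq_le normr_ge0 andbT.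
by apply/ler_addgt0Pl => e e0; rewrite addr0; apply: h.
Qed.

Lemma archi_inv (e : R) : 0 < e -> exists N : nat, forall k, (N <= k)%N -> (k.+1%:R)^-1 <= e.
Proof.
exists (Num.bound e^-1) => k hk.
rewrite -[leRHS]invrK lef_pV2 ?posrE ?invr_gt0 ?ltr0Sn//.
apply: (le_trans (ltW (archi_boundP _))); first by rewrite invr_ge0 ltW.
by rewrite ler_nat; apply: (leq_trans hk).
Qed.

(* Minimize the distance to the subspace: the parallelogram identity makes a
   minimizing sequence Cauchy. *)
Lemma projection (X : V -> Prop) u : X 0 ->
  (forall a x y, X x -> X y -> X (a *: x + y)) ->
  exists2 v, (forall x, X x -> ip v x = 0) &
    forall e : R, 0 < e -> exists2 x, X x & q (u - v - x) <= e.
Proof.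
move=> X0 XD.
pose A := [set r | exists2 x, X x & r = q (u - x)].
have A0 : A !=set0 by exists (q (u - 0)), 0.
have lA : has_lbound A by exists 0 => _ [x _ ->]; apply: ip_ge0.
pose d := inf A.
have dle x : X x -> d <= q (u - x) by move=> Xx; apply: ge_inf => //; exists x.
have /choice[xs xsP] : forall k : nat, exists x, X x /\ q (u - x) <= d + (k.+1%:R)^-1.
  move=> k; have k0 : 0 < (k.+1%:R : R)^-1 by rewrite invr_gt0.
  by have [_ [x Xx ->] /ltW h] := inf_adherent k0 (conj A0 lA); exists x.
have Xs k : X (xs k) by have [] := xsP k.
have qs k : q (u - xs k) <= d + (k.+1%:R)^-1 by have [] := xsP k.
have [|v vP] := ip_complete hip (u := fun k => u - xs k).
  move=> e e0; have [|N NP] := archi_inv (e := e / 4); first lra.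
  exists N => m k Nm Nk.
  (* The midpoint lies in [X], so its distance to [u] is at least [d]; this is what bounds the
     distance of the two terms. *)
  have Xh : X ((1 / 2) *: xs m + (1 / 2) *: xs k).
    by apply: (XD) => //; rewrite -[_ *: xs k]addr0; apply: XD.
  have := dle _ Xh; have := qs m; have := qs k; have := NP _ Nm; have := NP _ Nk.
  rewrite !ipE.
  by move: (d) k.+1%:R^-1 m.+1%:R^-1 => *; lra.
exists v.
  move=> h Xh; apply: small_eq0 => e e0.
  pose c := q h + 1.
  have c0 : 1 <= c by rewrite /c; have := ip_ge0 hip h; lra.
  pose e' := e ^+ 2 / (4 * c).
  have e'0 : 0 < e' by rewrite divr_gt0 ?exprn_gt0; lra.
  have [N NP] := archi_inv e'0; have [N' N'P] := vP _ e'0.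
  pose k := maxn N N'; have := NP k (leq_maxl _ _); have := N'P k (leq_maxr _ _).
  set y := u - xs k => h1 h2.
  (* Displacing [y] by [t *: h] lowers its square norm by at least [t ^+ 2 * c], while the almost
     minimality of [y] allows at most [e']. *)
  have h3 : ip y h ^+ 2 <= c * e'.
    pose t := ip y h / c.
    have tc : t * c = ip y h by rewrite /t; field; lra.
    have Xt : X (t *: h + xs k) by apply: XD.
    have := dle _ Xt; have := qs k; rewrite -/y.
    have -> : u - (t *: h + xs k) = y - t *: h by rewrite opprD addrA addrAC.
    rewrite q_sub q_scale ipZr.
    have : t ^+ 2 * q h <= t ^+ 2 * c by rewrite ler_wpM2l ?sqr_ge0 /c; lra.
    have -> : t * ip y h = t ^+ 2 * c by rewrite -tc; ring.
    have -> : ip y h ^+ 2 = c * (t ^+ 2 * c) by rewrite -tc; ring.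
    move=> h3 h4 h5; rewrite ler_wpM2l//; first lra.
    by move: h2 h3 h4 h5; move: (d) (k.+1%:R^-1) (t ^+ 2 * c) (t ^+ 2 * q h) (q y) (e') => *; lra.
  have h4 : ip (y - v) h ^+ 2 <= c * e'.
    apply: (le_trans (ip_cauchy _ _)); rewrite mulrC ler_pM ?ip_ge0 ?hip//.
    by rewrite /c; lra.
  have ce : c * e' = (e / 2) ^+ 2 by rewrite /e'; field; lra.
  have -> : ip v h = ip y h - ip (y - v) h by rewrite !ipE; ring.
  rewrite ce in h3 h4.
  have b z : z ^+ 2 <= (e / 2) ^+ 2 -> `|z| <= e / 2.
    by move=> hz; rewrite -ler_sqr ?nnegrE ?real_normK ?num_real//; lra.
  apply: (le_trans (ler_normB _ _)); have := b _ h3; have := b _ h4; lra.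
move=> e e0; have [N NP] := vP _ e0; exists (xs N) => //.
by rewrite addrAC; apply: NP.
Qed.

Definition tends (y : nat -> V) u := forall e : R, 0 < e ->
  exists N : nat, forall k, (N <= k)%N -> q (y k - u) <= e.

Definition bounded_by (K : R) T := 0 < K /\ forall v, q (T v) <= K * q v.

Definition bounded_below T := exists C : R, forall v, q v <= C * q (T v).

Lemma tends_closed T S u (y : nat -> V) K f : adjoint T S -> bounded_by K T ->
  tends y u -> tends (T \o y) f -> q (T u - f) = 0.
Proof.
move=> aT [K0 TK] yu yf; apply: small_eq0 => e e0; rewrite ger0_norm ?ip_ge0//.
have e1 : 0 < e / (4 * K) by rewrite divr_gt0// mulr_gt0.
have [|N NP] := yf (e / 4); first lra.
have [N' N'P] := yu _ e1.
pose k := maxn N N'; have h1 := NP k (leq_maxl _ _); have h2 := N'P k (leq_maxr _ _).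
have -> : T u - f = (T u - T (y k)) + (T (y k) - f) by rewrite addrA subrK.
apply: (le_trans (q_add_le _ _)); rewrite -(adjoint_qsub _ _ aT).
have h3 : q (u - y k) <= e / (4 * K) by rewrite -q_opp opprB.
have h4 : q (T (u - y k)) <= K * (e / (4 * K)).
  by apply: (le_trans (TK _)); rewrite ler_wpM2l// ltW.
have -> : e = 2 * (K * (e / (4 * K))) + 2 * (e / 4) by field; lra.
by rewrite lerD// ler_wpM2l.
Qed.

Lemma below_pos T : bounded_below T -> exists2 C : R, 0 < C & forall v, q v <= C * q (T v).
Proof.
move=> [C CP]; exists (`|C| + 1); first by rewrite ltr_wpDl.
move=> v; apply: (le_trans (CP v)); rewrite ler_wpM2r ?ip_ge0//.
by rewrite ler_wpDr// ler_norm.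
Qed.

(** Projection onto the closure of the range of [T]: the remaining part [v] is orthogonal to
    [T (S v)], which says that [q (S v) = 0]. *)
Lemma range_approx T S u : adjoint T S ->
  exists2 v, q (S v) = 0 & forall e : R, 0 < e -> exists x, q (u - v - T x) <= e.
Proof.
move=> aT.
have [||v vP vA] := @projection (fun x => exists w, q (x - T w) = 0) u.
- by exists 0; rewrite sub0r q_opp aT ip0l.
- move=> a x y [w wP] [z zP]; exists (a *: w + z); apply: eq_from_ip => h.
  by rewrite (adjoint_lin _ _ _ _ aT) !ipE (ip_congr _ wP) (ip_congr _ zP).
exists v.
  have := vP (T (S v)); rewrite -(adjoint_sym aT) => -> //.
  by exists (S v); rewrite subrr ip0l.
move=> e e0; have [x [w wP] h] := vA _ e0; exists w.
rewrite -(@q_congr (u - v - x))//.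
by rewrite opprB addrC subrKA -q_opp opprB.
Qed.

(** The lower bound for [T] makes its range closed; the one for [S] makes the orthogonal complement
    of the range null. *)
Lemma adjoint_onto T S K f : adjoint T S -> bounded_by K T -> bounded_below T ->
  bounded_below S -> exists u, q (T u - f) = 0.
Proof.
move=> aT TK /below_pos[C C0 CP] [C' CP'].
have [v qv vA] := range_approx f aT.
have {}qv : q v = 0 by apply/eqP; rewrite eq_le ip_ge0// (le_trans (CP' _))// qv mulr0.
have /choice[y yP] : forall k : nat, exists x, q (f - T x) <= (k.+1%:R)^-1.
  move=> k; have /vA[x xP] : 0 < (k.+1%:R : R)^-1 by rewrite invr_gt0.
  exists x; rewrite (@q_congr _ (f - v - T x))//.
  by rewrite opprB addrA subrK opprB addrC subrK.
have [|u yu] := ip_complete hip (u := y).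
  move=> e e0; have [|N NP] := archi_inv (e := e / (4 * C)).
    by rewrite divr_gt0// mulr_gt0.
  exists N => m k Nm Nk; apply: (le_trans (CP _)); rewrite (adjoint_qsub _ _ aT).
  have -> : T (y m) - T (y k) = (f - T (y k)) - (f - T (y m)).
    by rewrite opprB [RHS]addrC subrKA.
  have -> : e = C * (2 * (e / (4 * C)) + 2 * (e / (4 * C))) by field; lra.
  rewrite ler_wpM2l//; first exact: ltW.
  apply: (le_trans (q_sub_le _ _)).
  by rewrite lerD// ler_wpM2l// (le_trans (yP _))// NP.
exists u; apply: (tends_closed aT TK yu) => e e0; have [N NP] := archi_inv e0.
by exists N => k /NP h; rewrite -q_opp opprB; apply: (le_trans (yP k)).
Qed.

Definition op_shift T t u := T u - t *: u.

Lemma shift_comp T s t u : adjoint T T ->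
  q (op_shift T s (op_shift T t u) - (T (T u) - (s + t) *: T u + (s * t) *: u)) = 0.
Proof.
move=> aT; apply: eq_from_ip => w.
by rewrite !(ipE, aT); ring.
Qed.

Lemma bounded_below_comp T s t u C C' : adjoint T T -> 0 < C ->
  (forall v, q v <= C * q (op_shift T s v)) -> (forall v, q v <= C' * q (op_shift T t v)) ->
  0 < C' -> q u <= C' * C * q (T (T u) - (s + t) *: T u + (s * t) *: u).
Proof.
move=> aT C0 h h' C'0; rewrite -(q_congr (shift_comp s t u aT)).
by apply: (le_trans (h' _)); rewrite -mulrA ler_wpM2l// ltW.
Qed.

(* If m^2 is the infimum of |Tu|^2/|u|^2, then T^2 - m^2 >= 0 is not bounded
   below, so T - m or T + m is not either. *)
Lemma spectral_gap T K (r : R) : adjoint T T -> bounded_by K T -> 0 < r ->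
  (forall t : R, `|t| < r -> bounded_below (op_shift T t)) ->
  forall u, r ^+ 2 * q u <= q (T u).
Proof.
move=> aT [K0 TK] r0 gap u; rewrite leNgt; apply/negP => hu.
have qu0 : 0 < q u.
  rewrite lt_def ip_ge0// andbT; apply/eqP => qu; move: hu.
  by rewrite qu mulr0 ltNge ip_ge0.
pose A := [set x | exists2 v, q v = 1 & x = q (T v)].
have qTZ a v : q (T (a *: v)) = a ^+ 2 * q (T v).
  have -> : a *: v = a *: v + 0 by rewrite addr0.
  have h w : ip (T (a *: v + 0)) w = a * ip (T v) w.
    by rewrite (adjoint_lin _ _ _ _ aT) (aT 0) ip0l addr0.
  by rewrite h (ipC hip) h; ring.
have unit v : 0 < q v -> A (q (T v) / q v).
  exists ((Num.sqrt (q v))^-1 *: v).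
    by rewrite q_scale exprVn sqr_sqrtr ?ltW// mulVf// gt_eqF.
  by rewrite qTZ exprVn sqr_sqrtr ?ltW// mulrC.
have A0 : A !=set0 by exists (q (T u) / q u); apply: unit.
have lA : has_lbound A by exists 0 => _ [v _ ->]; apply: ip_ge0.
pose mu := inf A.
have mu0 : 0 <= mu by apply: lb_le_inf => // _ [v _ ->]; apply: ip_ge0.
have mule v : mu * q v <= q (T v).
  have [v0|] := ltP 0 (q v); first by rewrite -ler_pdivlMr//; apply: ge_inf => //; apply: unit.
  by have := ip_ge0 hip (T v); nra.
have mur : mu < r ^+ 2.
  apply: le_lt_trans (_ : q (T u) / q u < _); first by apply: ge_inf => //; apply: unit.
  by rewrite ltr_pdivrMr.
pose m := Num.sqrt mu; have m0 : 0 <= m := sqrtr_ge0 _.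
have mm : m ^+ 2 = mu by rewrite sqr_sqrtr.
have mr : m < r by rewrite -ltr_sqr ?nnegrE ?(ltW r0)// mm.
have /gap/below_pos[C1 C10 C1P] : `|m| < r by rewrite ger0_norm.
have /gap/below_pos[C2 C20 C2P] : `|- m| < r by rewrite normrN ger0_norm.
pose B x y := ip (T x) (T y) - mu * ip x y.
have BC x y : B x y = B y x by rewrite /B (ipC hip (T x)) (ipC hip x).
have BD a x y z : B (a *: x + y) z = a * B x z + B y z.
  by rewrite /B (adjoint_lin _ _ _ _ aT) !ipE; ring.
have B0 x : 0 <= B x x by rewrite subr_ge0.
have PB x : q (T (T x) - mu *: x) <= K * B x x.
  set y := T (T x) - _.
  have yB : q y = B x y by rewrite ipDl ipNl ipZl aT.
  have := form_cauchy BC BD B0 x y.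
  have : B y y <= K * q y by rewrite /B; have := TK y; have := ip_ge0 hip y; nra.
  have := B0 x; have := ip_ge0 hip y.
  have [->|] := eqVneq (q y) 0; first by move=> *; rewrite mulr_ge0// ltW.
  nra.
have fin x : q x <= C2 * C1 * (K * B x x).
  have := @bounded_below_comp T m (- m) x C1 C2 aT C10 C1P C2P C20.
  rewrite subrr scale0r subr0 mulrN -expr2 mm scaleNr => h; apply: (le_trans h).
  by rewrite ler_wpM2l ?PB// mulr_ge0// ltW.
have D0 : 0 < C2 * C1 * K * 2 by rewrite !mulr_gt0.
have e0 : 0 < (C2 * C1 * K * 2)^-1 by rewrite invr_gt0.
(* A unit vector whose value is this close to the infimum [mu] contradicts [fin]. *)
have [_ [x qx ->] h] := inf_adherent e0 (conj A0 lA).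
have := fin x; rewrite /B qx => h1.
have h2 : q (T x) - mu < (C2 * C1 * K * 2)^-1 by rewrite ltrBlDl.
have : C2 * C1 * K * (q (T x) - mu) <= C2 * C1 * K * (C2 * C1 * K * 2)^-1.
  by rewrite ler_wpM2l ?ltW// !mulr_gt0.
have -> : C2 * C1 * K * (C2 * C1 * K * 2)^-1 = 1 / 2.
  by rewrite invfM mulrA divff ?mul1r// gt_eqF// !mulr_gt0.
lra.
Qed.

Definition coef2 (l : seq V) u := \sum_(f <- l) ip u f ^+ 2.

Lemma coef2_ge0 l u : 0 <= coef2 l u.
Proof. by apply: sumr_ge0 => f _; apply: sqr_ge0. Qed.

Lemma coef2_add l u v : coef2 l (u + v) <= 2 * coef2 l u + 2 * coef2 l v.
Proof.
rewrite !mulr_sumr -big_split/=; apply: ler_sum => f _; rewrite ipDl.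
by have := sqr_ge0 (ip u f - ip v f); nra.
Qed.

Lemma coef2Z l a u : coef2 l (a *: u) = a ^+ 2 * coef2 l u.
Proof. by rewrite mulr_sumr; apply: eq_bigr => f _; rewrite ipZl exprMn. Qed.

Lemma coef2_le l u : coef2 l u <= (\sum_(f <- l) q f) * q u.
Proof.
rewrite mulr_suml; apply: ler_sum => f _.
by rewrite mulrC; apply: ip_cauchy.
Qed.

Lemma coef2_eq0 l u f : coef2 l u = 0 -> f \in l -> ip u f = 0.
Proof.
move=> h fl; apply/eqP; rewrite -sqrf_eq0.
move/eqP: h; rewrite psumr_eq0 => [/allP /(_ _ fl)//|g _]; exact: sqr_ge0.
Qed.

Fixpoint orthonormal (l : seq V) : Prop :=
  if l is e :: l' then [/\ q e = 1, forall f, f \in l' -> ip e f = 0 & orthonormal l'] else True.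

Lemma orthonormal_norm l e : orthonormal l -> e \in l -> q e = 1.
Proof.
by elim: l => //= a l IH [qa _ ol]; rewrite in_cons => /orP[/eqP ->//|]; apply: IH.
Qed.

Definition proj_on (l : seq V) u := \sum_(e <- l) ip u e *: e.

Lemma proj_coef l u e : orthonormal l -> e \in l -> ip (proj_on l u) e = ip u e.
Proof.
elim: l => //= a l IH [qa al ol]; rewrite /proj_on big_cons ipDl ipZl => /orP[/eqP ->|el].
  rewrite qa mulr1 ip_suml big_seq big1 ?addr0// => f fl.
  by rewrite ipZl (ipC hip f) al// mulr0.
by rewrite al// mulr0 add0r; apply: IH.
Qed.

Lemma ip_proj l u w : ip (proj_on l u) w = \sum_(e <- l) ip u e * ip e w.
Proof. by rewrite ip_suml; apply: eq_bigr => e _; rewrite ipZl. Qed.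

Lemma ip_proj0 l u w : orthonormal l -> (forall e, e \in l -> ip w e = 0) -> ip w (proj_on l u) = 0.
Proof.
by move=> ol h; rewrite (ipC hip) ip_proj big_seq big1// => e el; rewrite (ipC hip e) h ?mulr0.
Qed.

Lemma ip_resid l u e : orthonormal l -> e \in l -> ip (u - proj_on l u) e = 0.
Proof. by move=> ol el; rewrite ipDl ipNl proj_coef// subrr. Qed.

Lemma coef2_resid l u : orthonormal l -> coef2 l (u - proj_on l u) = 0.
Proof. by move=> ol; rewrite /coef2 big_seq big1// => e el; rewrite ip_resid// expr0n. Qed.

(** A vector whose remainder is null is skipped, so the normalization never divides by zero. *)
Lemma gram_schmidt (l : seq V) : exists2 l', orthonormal l' &
  forall e, e \in l -> q (e - proj_on l' e) = 0.
Proof.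
elim: l => [|a l [l' ol' IH]]; first by exists [::].
have [a0|a0] := eqVneq (q (a - proj_on l' a)) 0.
  by exists l' => // e; rewrite in_cons => /orP[/eqP ->|/IH].
pose b := (Num.sqrt (q (a - proj_on l' a)))^-1 *: (a - proj_on l' a).
have bo f : f \in l' -> ip b f = 0 by move=> fl; rewrite ipZl (ip_resid a ol' fl) mulr0.
have qb : q b = 1 by rewrite q_scale exprVn sqr_sqrtr ?mulVf// ip_ge0.
exists (b :: l') => // e; rewrite in_cons => el.
have -> : e - proj_on (b :: l') e = (e - proj_on l' e) - ip e b *: b.
  by rewrite /proj_on big_cons opprD addrA addrAC.
have eb d : ip d b = ip (d - proj_on l' d) b by rewrite ipDl ipNl (ipC hip (proj_on _ _)) ip_proj0// subr0.
move: el => /orP[/eqP ->|/IH e0].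
  rewrite q_sub eb q_scale ipZr qb ipZr.
  set s := q _; have s0 : 0 <= s by apply: ip_ge0.
  have : Num.sqrt s ^+ 2 = s by rewrite sqr_sqrtr.
  have : Num.sqrt s != 0 by rewrite sqrtr_eq0 -ltNge lt_def a0.
  by move: (Num.sqrt s) => t t0 <-; field.
by rewrite eb (ip_null _ e0) scale0r subr0.
Qed.

Lemma proj_eq l u v : q (u - v) = 0 -> q (u - proj_on l u) = q (v - proj_on l v).
Proof.
move=> h; have -> : proj_on l u = proj_on l v by apply: eq_bigr => e _; rewrite (ip_congr _ h).
by apply: q_congr; rewrite opprB addrA subrK.
Qed.

(** The error functionals are kept in two lists: those in [phi] are arbitrary, those in [es] will be
    orthonormal null vectors of [T]. [estimate_kernel] empties the first list into the second. *)
Definition estimate T (phi es : seq V) := exists C : R, forall u,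
  q u <= C * (q (T u) + coef2 phi u + coef2 es u).

(** If the functional of [f] cannot be dropped, there are vectors normalized by [ip u f = 1] on
    which the other terms tend to zero. They form a Cauchy sequence, because the term of [f]
    vanishes on their differences; [w] is the limit. *)
Lemma kernel_vector T K f (l : seq V) : adjoint T T -> bounded_by K T ->
  (exists C : R, forall u, q u <= C * (q (T u) + ip u f ^+ 2 + coef2 l u)) ->
  ~ (exists C : R, forall u, q u <= C * (q (T u) + coef2 l u)) ->
  exists w, [/\ ip w f = 1, q (T w) = 0 & coef2 l w = 0].
Proof.
move=> aT TK [C0 C0P] nC.
pose S u := q (T u) + coef2 l u.
have S0 u : 0 <= S u by rewrite addr_ge0 ?ip_ge0 ?coef2_ge0.
pose C := `|C0| + 1; have Cp : 0 < C by rewrite ltr_wpDl.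
have CP u : q u <= C * (S u + ip u f ^+ 2).
  apply: (le_trans (C0P u)); rewrite addrAC ler_wpM2r ?addr_ge0 ?sqr_ge0 ?ip_ge0 ?coef2_ge0//.
  by rewrite ler_wpDr// ler_norm.
have qTZ a v : q (T (a *: v)) = a ^+ 2 * q (T v).
  have h w : ip (T (a *: v)) w = a * ip (T v) w by rewrite aT ipZl aT.
  by rewrite h (ipC hip) h; ring.
have SZ a u : S (a *: u) = a ^+ 2 * S u by rewrite /S qTZ coef2Z mulrDr.
have Ssub u v : S (u - v) <= 2 * S u + 2 * S v.
  rewrite /S (adjoint_qsub _ _ aT); have := q_sub_le (T u) (T v).
  have := coef2_add l u (- v); rewrite -(scaleN1r v) coef2Z; lra.
have SM : exists2 M : R, 0 < M & forall u, S u <= M * q u.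
  have [K0 KP] := TK; exists (K + \sum_(f <- l) q f).
    by rewrite ltr_wpDr// sumr_ge0// => ? _; apply: ip_ge0.
  by move=> u; rewrite mulrDl lerD ?coef2_le.
have /choice[y yP] : forall k : nat, exists u, ip u f = 1 /\ S u <= 2 * C / (k.+1)%:R.
  (* Negating the estimate with the constant [c] and inserting [CP] leaves (C + k + 1) S u < C (ip u
     f)^2, so division of [u] by [ip u f] makes [S] small. *)
  move=> k; pose c := 2 * C + k.+1%:R.
  have k0 : 0 < (k.+1%:R : R) by rewrite ltr0Sn.
  have [u uP] : exists u, c * S u < q u.
    apply: contrapT => h; apply: nC; exists c => u; rewrite leNgt; apply/negP => h'.
    by apply: h; exists u.
  have af : ip u f != 0.
    have := CP u; have := S0 u.
    by rewrite /c in uP; nra.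
  have a2 : 0 < ip u f ^+ 2 by rewrite exprn_even_gt0.
  exists ((ip u f)^-1 *: u); rewrite ipZl mulVf// SZ exprVn.
  rewrite -(ler_pM2l a2) mulrA divff ?gt_eqF// mulrA ler_pdivlMr//.
  have := CP u; have := S0 u; rewrite /c in uP; nra.
have yf k : ip (y k) f = 1 by have [] := yP k.
have yS k : S (y k) <= 2 * C / (k.+1)%:R by have [] := yP k.
have small e : 0 < e -> exists N : nat, forall k, (N <= k)%N -> S (y k) <= e.
  move=> e0; have [|N NP] := archi_inv (e := e / (2 * C)); first by rewrite divr_gt0// mulr_gt0.
  exists N => k /NP h; apply: (le_trans (yS k)).
  by rewrite mulrC -ler_pdivlMr// mulr_gt0.
have [|w wP] := ip_complete hip (u := y).
  move=> e e0; have [|N NP] := small (e / (4 * C)); first by rewrite divr_gt0// mulr_gt0.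
  exists N => m k Nm Nk; apply: (le_trans (CP _)).
  rewrite ipDl ipNl !yf subrr expr0n addr0.
  have -> : e = C * (2 * (e / (4 * C)) + 2 * (e / (4 * C))) by field; lra.
  rewrite ler_wpM2l//; first exact: ltW.
  by apply: (le_trans (Ssub _ _)); rewrite lerD// ler_wpM2l// NP.
have Sw : S w = 0.
  apply: small_eq0 => e e0; rewrite ger0_norm//; have [M M0 MP] := SM.
  have [|N NP] := small (e / 4); first lra.
  have [|N' N'P] := wP (e / (4 * M)); first by rewrite divr_gt0// mulr_gt0.
  pose k := maxn N N'; have h1 := NP k (leq_maxl _ _); have h2 := N'P k (leq_maxr _ _).
  have -> : w = y k - (y k - w) by rewrite opprB addrC subrK.
  apply: (le_trans (Ssub _ _)).
  have -> : e = 2 * (e / 4) + 2 * (M * (e / (4 * M))) by field; lra.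
  by rewrite lerD ?ler_wpM2l// (le_trans (MP _))// ler_wpM2l// ltW.
exists w; move: Sw; rewrite /S => Sw.
have qTw : q (T w) = 0.
  by apply/eqP; rewrite eq_le ip_ge0// andbT; have := coef2_ge0 l w; lra.
split => //; last by move: Sw; rewrite qTw add0r.
apply/eqP; rewrite -subr_eq0; apply/eqP; apply: small_eq0 => e e0.
have [|N NP] := wP (e ^+ 2 / (q f + 1)).
  by rewrite divr_gt0 ?exprn_gt0// ltr_wpDl ?ip_ge0.
have := NP N (leqnn _); have := ip_cauchy (y N - w) f.
rewrite !ipE yf; set X := (X in X * q f); move=> h1 h2.
have f0 : 0 <= q f := ip_ge0 hip f.
have h3 : X * (q f + 1) <= e ^+ 2 by rewrite -ler_pdivlMr//; lra.
have X0 : 0 <= X by have := ip_ge0 hip (y N - w); rewrite !ipE.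
rewrite -ler_sqr ?nnegrE ?normr_ge0 ?real_normK ?num_real ?(ltW e0)//; nra.
Qed.

(** Induction on [phi]: its head is dropped if the shorter estimate holds, and otherwise traded for
    the null vector supplied by [kernel_vector]. *)
Lemma estimate_kernel T K phi es : adjoint T T -> bounded_by K T ->
  estimate T phi es -> orthonormal es -> (forall e, e \in es -> q (T e) = 0) ->
  exists2 es', estimate T [::] es' & orthonormal es' /\ forall e, e \in es' -> q (T e) = 0.
Proof.
move=> aT TK; elim: phi es => [|f phi IH] es est oes kes; first by exists es.
have [h|h] := pselect (estimate T phi es); first exact: (IH es).
pose l := phi ++ es.
have lE u : coef2 l u = coef2 phi u + coef2 es u by rewrite /coef2 big_cat.
have est' : exists C : R, forall u, q u <= C * (q (T u) + ip u f ^+ 2 + coef2 l u).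
  move: est => [C CP]; exists C => u; apply: (le_trans (CP u)).
  by rewrite /(coef2 (f :: _)) big_cons lE !addrA.
have [|w [wf Tw lw]] := @kernel_vector T K f l aT TK est'.
  by move=> [C CP]; apply: h; exists C => u; apply: (le_trans (CP u)); rewrite lE addrA.
have qw0 : 0 < q w.
  rewrite lt_def ip_ge0// andbT; apply/eqP => h0; have := ip_null f h0; rewrite wf => /eqP.
  by rewrite oner_eq0.
pose e := (Num.sqrt (q w))^-1 *: w.
have qe : q e = 1 by rewrite q_scale exprVn sqr_sqrtr ?ltW// mulVf// gt_eqF.
have TeZ u : ip (T e) u = 0.
  by rewrite aT ipZl -aT (ip_null _ Tw) mulr0.
have le : coef2 l e = 0 by rewrite coef2Z lw mulr0.
apply: (IH (e :: es)); last 2 first.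
- split => // g ges; apply: (coef2_eq0 le); by rewrite mem_cat ges orbT.
- by move=> g; rewrite in_cons => /orP[/eqP ->//|]; apply: kes.
have [C1 C1P] := est'; pose C := `|C1| + 1; have C0 : 0 < C by rewrite ltr_wpDl.
have CP u : q u <= C * (q (T u) + ip u f ^+ 2 + coef2 l u).
  apply: (le_trans (C1P u)); rewrite ler_wpM2r ?addr_ge0 ?sqr_ge0 ?ip_ge0 ?coef2_ge0//.
  by rewrite ler_wpDr// ler_norm.
have Tsub u a : q (T (u - a *: e)) = q (T u).
  rewrite (adjoint_qsub _ _ aT); have := q_sub (T u) (T (a *: e)) => ->.
  have z v : ip (T (a *: e)) v = 0 by rewrite aT ipZl -aT TeZ mulr0.
  by rewrite (ipC hip (T u)) !z; ring.
have lsub u a : coef2 l (u - a *: e) = coef2 l u.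
  apply: eq_big_seq => g gl; rewrite ipDl ipNl ipZl.
  by rewrite (coef2_eq0 le gl) mulr0 subr0.
have ef : ip e f != 0 by rewrite ipZl wf mulr1 invr_eq0 sqrtr_eq0 -ltNge.
exists (C + 1) => v; rewrite /(coef2 (e :: es)) big_cons -/(coef2 es v).
pose p := v - ip v e *: e.
have pe : ip p e = 0 by rewrite ipDl ipNl ipZl qe mulr1 subrr.
have hp : q p <= C * (q (T v) + coef2 l v).
  (* Subtracting this multiple of [e] annihilates the functional of [f] and changes neither [T] nor
     [coef2 l]; the norm does not decrease, since [p] is orthogonal to [e]. *)
  pose t := ip p f / ip e f.
  have := CP (p - t *: e); rewrite Tsub lsub q_sub ipZr pe q_scale qe.
  have -> : ip (p - t *: e) f = 0 by rewrite ipDl ipNl ipZl divfK// subrr.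
  rewrite Tsub lsub; have := sqr_ge0 t; lra.
have qv : q v = q p + ip v e ^+ 2.
  by rewrite /p q_sub q_scale ipZr qe; ring.
rewrite qv; rewrite lE in hp.
have := coef2_ge0 phi v; have := coef2_ge0 es v; have := ip_ge0 hip (T v).
have := sqr_ge0 (ip v e); rewrite -/(coef2 phi v); nra.
Qed.

(** Zero as a point of the discrete spectrum of a self-adjoint [T], with isolation phrased through
    lower bounds of the shifted operators. *)
Definition isolated_finite T := [/\ exists2 e, q e = 1 & q (T e) = 0,
  exists es : seq V, forall f, q (T f) = 0 -> q (f - proj_on es f) = 0 &
  exists2 r : R, 0 < r & forall t : R, t != 0 -> `|t| < r -> bounded_below (op_shift T t)].

(** Once the error functionals are an orthonormal list of null vectors, the estimate bounds [T]
    below on their complement. A small nonzero shift preserves this bound, and on the span of the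
    list it acts as a nonzero multiple of the identity. *)
Theorem fredholm_alternative T K phi : adjoint T T -> bounded_by K T ->
  estimate T phi [::] -> bounded_below T \/ isolated_finite T.
Proof.
move=> aT TK est.
have [//|//|es [C1 C1P] [oes kes]] := estimate_kernel aT TK est.
pose C := `|C1| + 1; have C0 : 0 < C by rewrite ltr_wpDl.
have CP u : q u <= C * (q (T u) + coef2 es u).
  have := C1P u; rewrite /(coef2 [::]) big_nil addr0 => h; apply: (le_trans h).
  by rewrite ler_wpM2r ?addr_ge0 ?ip_ge0 ?coef2_ge0// ler_wpDr// ler_norm.
case: es => [|e es] in oes kes C1P CP *.
  by left; exists C => u; have := CP u; rewrite /coef2 big_nil addr0.
right; set l := e :: es in oes kes C1P CP *.
have Tproj u w : ip (T (proj_on l u)) w = 0.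
  rewrite aT ip_proj big_seq big1// => g gl.
  by rewrite -aT (ip_null _ (kes g gl)) mulr0.
have Tres u : q (T (u - proj_on l u)) = q (T u).
  by rewrite (adjoint_qsub _ _ aT) q_sub (ipC hip (T u)) !Tproj; ring.
have resP u : q (u - proj_on l u) <= C * q (T u).
  by have := CP (u - proj_on l u); rewrite coef2_resid// addr0 Tres.
split.
- by exists e; [case: oes | apply: kes; rewrite mem_head].
- exists l => f f0; apply/eqP; rewrite eq_le ip_ge0// andbT.
  by have := resP f; rewrite f0 mulr0.
(* On the complement q p <= C q (T p), so a shift with t^2 <= 1 / (4 C) can be absorbed; the minimum
   with 1 turns the bound on |t| into one on t^2. *)
have r0 : 0 < (4 * C)^-1 by rewrite invr_gt0 mulr_gt0.
exists (Num.min 1 (4 * C)^-1); first by rewrite lt_min ltr01.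
move=> t t0; rewrite lt_min => /andP[t1 t2].
have tt : 0 < t ^+ 2 by rewrite exprn_even_gt0.
have t3 : t ^+ 2 <= (4 * C)^-1.
  rewrite -real_normK ?num_real//; apply: (le_trans _ (ltW t2)).
  by rewrite ler_piMr ?normr_ge0// ltW.
pose m := Num.min (4 * C)^-1 (t ^+ 2).
have m0 : 0 < m by rewrite lt_min r0.
exists m^-1 => u; rewrite mulrC ler_pdivlMr//.
pose p := u - proj_on l u; pose w := proj_on l u.
have pw : ip p w = 0 by apply: ip_proj0 => // g gl; apply: ip_resid.
have uE : u = p + w by rewrite subrK.
have qu : q u = q p + q w by rewrite uE q_add pw; ring.
have Tu v : ip (T u) v = ip (T p) v.
  by rewrite (adjoint_sub _ _ _ aT) Tproj subr0.
have -> : q (op_shift T t u) = q (T p - t *: p) + t ^+ 2 * q w.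
  have : q (op_shift T t u - (T p - t *: p - t *: w)) = 0.
    by apply: eq_from_ip => v; rewrite !ipE Tu {2}uE !ipE; ring.
  move=> /q_congr ->; rewrite q_sub q_scale.
  have -> : ip (T p - t *: p) (t *: w) = 0.
    by rewrite ipZr ipDl ipNl ipZl pw aT (ipC hip) Tproj; ring.
  by ring.
have := resP u; rewrite -Tres => hp.
have h2 : q (T p) <= 2 * q (T p - t *: p) + 2 * (t ^+ 2 * q p).
  by have := q_add_le (T p - t *: p) (t *: p); rewrite subrK q_scale.
have mC : m <= (4 * C)^-1 by rewrite ge_min lexx.
have mt : m <= t ^+ 2 by rewrite ge_min lexx orbT.
rewrite qu mulrDl lerD//; last by rewrite mulrC ler_wpM2r ?ip_ge0.
have p0 := ip_ge0 hip p.
have h3 : t ^+ 2 * q p <= (4 * C)^-1 * q p by rewrite ler_wpM2r.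
have h4 : q p * m <= (4 * C)^-1 * q p by rewrite mulrC ler_wpM2r.
have h5 : (4 * C)^-1 * q p * 4 <= q (T p).
  rewrite -(ler_pM2l C0); apply: le_trans hp.
  by rewrite le_eqVlt; apply/orP; left; apply/eqP; field; lra.
lra.
Qed.

(** For the second part, a gap around 0 yields r^2 |T u|^2 <= |T^2 u|^2, that is, a lower bound for
    [T] on the closure of its range, the complement of its kernel. A unit vector with small image
    and small coefficients along a finite-dimensional kernel then cannot exist. *)
Theorem weyl_criterion T K : adjoint T T -> bounded_by K T ->
  (forall (e : R) (hs : seq V), 0 < e -> exists u, [/\ q u = 1, q (T u) <= e &
     forall h, h \in hs -> ip u h ^+ 2 <= e]) ->
  ~ bounded_below T /\
  ~ ((exists es : seq V, forall f, q (T f) = 0 -> exists c : V -> R,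
        q (f - \sum_(e <- es) c e *: e) = 0) /\
     (exists2 r : R, 0 < r & forall t : R, t != 0 -> `|t| < r -> bounded_below (op_shift T t))).
Proof.
move=> aT TK W; split.
  move=> /below_pos[C C0 CP]; have [|u [qu Tu _]] := W (2 * C)^-1 [::].
    by rewrite invr_gt0 mulr_gt0.
  have := CP u.
  have : C * q (T u) <= C * (2 * C)^-1 by rewrite ler_wpM2l// ltW.
  have -> : C * (2 * C)^-1 = 1 / 2 by field; lra.
  lra.
move=> [[es esP] [r r0 rP]].
have [es' oes' es'P] := gram_schmidt es.
have ker f : q (T f) = 0 -> q (f - proj_on es' f) = 0.
  move=> /esP[c cP].
  rewrite (proj_eq _ cP).
  set g := \sum_(e <- es) _.
  have h w : ip (g - proj_on es' g) w = 0.
    have -> : g - proj_on es' g = \sum_(e <- es) c e *: (e - proj_on es' e).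
      under [RHS]eq_bigr do rewrite scalerBr.
      rewrite sumrB; congr (_ - _).
      under [RHS]eq_bigr do rewrite scaler_sumr.
      rewrite exchange_big; apply: eq_bigr => e _.
      by rewrite ip_suml scaler_suml; apply: eq_bigr => d _; rewrite ipZl scalerA.
    rewrite ip_suml big_seq big1// => e ees; rewrite ipZl.
    by rewrite (ip_null _ (es'P e ees)) mulr0.
  exact: h.
have [K0 KP] := TK.
have r2 : 0 < r ^+ 2 by rewrite exprn_gt0.
have gap u : r ^+ 2 * q (T u) <= q (T (T u)).
  (* Q - t factors as (T - s)(T + s) with s^2 = t + r^2 / 2 and 0 < s < r, so [Q] has a gap of
     radius r^2 / 2. Expanding what [spectral_gap] says about [Q] gives the claim. *)
  pose Q u := T (T u) - (r ^+ 2 / 2) *: u.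
  have aQ : adjoint Q Q.
    by move=> v w; rewrite !ipE !aT.
  have bQ : bounded_by (2 * (K * K) + 2 * (r ^+ 2 / 2) ^+ 2) Q.
    have KK : 0 < K * K by rewrite mulr_gt0.
    split; first by have := sqr_ge0 (r ^+ 2 / 2); lra.
    move=> v; apply: (le_trans (q_sub_le _ _)); rewrite q_scale.
    have : q (T (T v)) <= K * (K * q v) by rewrite (le_trans (KP _))// ler_wpM2l ?KP// ltW.
    lra.
  have r20 : 0 < r ^+ 2 / 2 by rewrite divr_gt0.
  have gQ (t : R) : `|t| < r ^+ 2 / 2 -> bounded_below (op_shift Q t).
    move=> tr; pose s := Num.sqrt (t + r ^+ 2 / 2).
    have t1 : - (r ^+ 2 / 2) < t < r ^+ 2 / 2 by rewrite -ltr_norml.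
    have ss : s ^+ 2 = t + r ^+ 2 / 2 by rewrite sqr_sqrtr; lra.
    have s0 : 0 < s by rewrite sqrtr_gt0; lra.
    have sr : s < r by rewrite -ltr_sqr ?nnegrE ?ltW// ss; lra.
    have [||C1 C10 C1P] := below_pos (rP s _ _); [by rewrite gt_eqF|by rewrite gtr0_norm|].
    have [||C2 C20 C2P] := below_pos (rP (- s) _ _).
      by rewrite oppr_eq0 gt_eqF.
      by rewrite normrN gtr0_norm.
    exists (C2 * C1) => v.
    have := @bounded_below_comp T s (- s) v C1 C2 aT C10 C1P C2P C20.
    rewrite subrr scale0r subr0 mulrN -expr2 ss => h; apply: (le_trans h).
    by rewrite /op_shift -[T (T v) - _ - _]addrA -opprD -scalerDl [r ^+ 2 / 2 + t]addrC scaleNr.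
  have := spectral_gap aQ bQ r20 gQ u.
  rewrite q_sub q_scale ipZr.
  have -> : ip (T (T u)) u = q (T u) by rewrite aT.
  lra.
pose M := (size es')%:R : R.
(* The component [v] of [u] in the kernel will have square norm at most M^2 e, the rest at most 4 e
   / r^2; with this [e] twice their sum stays below 1. *)
pose e := (16 * (M * M + 1 + r ^- 2))^-1.
have ir : 0 < r ^- 2 by rewrite invr_gt0.
have MM : 0 <= M * M by rewrite mulr_ge0.
have De : 0 < 16 * (M * M + 1 + r ^- 2) by lra.
have e0 : 0 < e by rewrite invr_gt0.
have [u [qu Tu hu]] := W e es' e0.
have [v Tv vA] := range_approx u aT.
have qTv : q (T v) = 0 by [].
have Tu' : forall w, ip (T (u - v)) w = ip (T u) w.
  by move=> w; rewrite (adjoint_sub _ _ _ aT) (ip_null _ qTv) subr0.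
have uv : ip u v = q v.
  apply/eqP; rewrite -subr_eq0 -ipNl -ipDl; apply/eqP/small_eq0 => d d0.
  have [|x xP] := vA (d ^+ 2 / (q v + 1)).
    by rewrite divr_gt0 ?exprn_gt0// ltr_wpDl ?ip_ge0.
  have -> : ip (u - v) v = ip (u - v - T x) v.
    by rewrite (ipDl _ (- T x)) ipNl aT (ipC hip x) (ip_null _ qTv) subr0.
  have v0 := ip_ge0 hip v.
  have := ip_cauchy (u - v - T x) v; have := ip_ge0 hip (u - v - T x).
  have {}xP : q (u - v - T x) * (q v + 1) <= d ^+ 2 by rewrite -ler_pdivlMr//; lra.
  move=> h1 h2; rewrite -ler_sqr ?nnegrE ?normr_ge0 ?real_normK ?num_real ?(ltW d0)//; nra.
have qv : q v <= M * M * e.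
  have vE : q v = \sum_(d <- es') ip v d * ip u d.
    rewrite -{1}uv (ipC hip) (ip_congr u (ker v qTv)) ip_proj.
    by apply: eq_bigr => d _; rewrite (ipC hip d).
  have eq0 : 0 <= e * q v by rewrite mulr_ge0 ?ip_ge0// ltW.
  have h : q v ^+ 2 <= M * (M * e * q v).
    apply: le_trans (_ : (M * Num.sqrt (e * q v)) ^+ 2 <= _); last first.
      by rewrite exprMn sqr_sqrtr// expr2 !mulrA lexx.
    rewrite ler_sqr ?nnegrE ?ip_ge0 ?mulr_ge0 ?sqrtr_ge0//.
    rewrite {1}vE /M -sum1_size natr_sum mulr_suml big_seq [leRHS]big_seq.
    apply: ler_sum => d dl; rewrite mul1r.
    apply: (le_trans (ler_norm _)); rewrite -sqrtr_sqr ler_wsqrtr// exprMn mulrC.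
    apply: ler_pM; rewrite ?sqr_ge0 ?hu//.
    by have := ip_cauchy v d; rewrite (orthonormal_norm oes' dl) mulr1.
  have [->|v0] := eqVneq (q v) 0; first by rewrite !mulr_ge0// ltW.
  have {}v0 : 0 < q v by rewrite lt_def v0 ip_ge0.
  by rewrite -(ler_pM2r v0) -expr2; apply: (le_trans h); lra.
(* [u - v] is only a limit of vectors [T x]; [gap] is applied to [x], and the error is made
   arbitrarily small. *)
have quv : q (u - v) <= 4 / r ^+ 2 * q (T u).
  apply/ler_addgt0Pl => d d0.
  pose d' := d / (1 + 4 * K / r ^+ 2 + 4).
  have Kr : 0 <= 4 * K / r ^+ 2 by rewrite divr_ge0 ?ltW// mulr_gt0.
  have D0 : 0 < 1 + 4 * K / r ^+ 2 + 4 by lra.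
  have [|x xP] := vA d'; first by rewrite divr_gt0.
  have h1 : q (u - v) <= 2 * q (u - v - T x) + 2 * q (T x).
    by have := q_add_le (u - v - T x) (T x); rewrite subrK.
  have h2 : q (T (T x)) <= 2 * q (T u) + 2 * (K * q (u - v - T x)).
    have := q_sub_le (T (u - v)) (T (u - v - T x)); rewrite -(adjoint_qsub _ _ aT).
    rewrite opprB addrC subrK => h; apply: (le_trans h); rewrite Tu' (ipC hip) Tu'.
    by rewrite lerD2l ler_wpM2l.
  have h3 : q (T x) <= q (T (T x)) / r ^+ 2 by rewrite ler_pdivlMr// mulrC.
  have h4 : q (T (T x)) / r ^+ 2 <= (2 * q (T u) + 2 * (K * q (u - v - T x))) / r ^+ 2.
    by rewrite ler_pM2r.
  have h5 : (1 + 4 * K / r ^+ 2 + 4) * q (u - v - T x) <= d.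
    by rewrite mulrC -ler_pdivlMr.
  have := ip_ge0 hip (u - v - T x).
  move: h1 h3 h4 h5; move: (q (u - v)) (q (u - v - T x)) (q (T x)) (q (T (T x))) (q (T u)) (r ^+ 2)^-1.
  by clear => a b c f g i *; lra.
have := q_add_le (u - v) v; rewrite subrK qu => h1.
have h2 : 4 / r ^+ 2 * q (T u) <= 4 / r ^+ 2 * e.
  by rewrite ler_wpM2l// divr_ge0// ltW.
have h3 : 16 * (M * M + 1 + r ^- 2) * e = 1 by rewrite mulfV// gt_eqF.
have h4 : 0 <= M * M * e by rewrite mulr_ge0// ltW.
move: h2 h3 h4 quv qv h1 e0; move: (e) (M * M) (r ^+ 2)^-1 (q (u - v)) (q v) (q (T u)).
by clear => *; lra.
Qed.

End Hilbert.

(** * Integration on R^n *)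

Section Euclid.
Context {R : realType}.

(* R^n with its coordinates split off one after the other, as in [int_rV]. *)
Fixpoint euclid (n : nat) : {d : measure_display & measurableType d} :=
  match n with
  | 0 => existT _ _ (unit : measurableType _)
  | m.+1 => existT _ _ ((measurableTypeR R * projT2 (euclid m))%type : measurableType _)
  end.

Definition E n := projT2 (euclid n).

(** The product is packed together with its sigma-finiteness, which the recursion in [leb] has to
    carry along. *)
Definition prod_measure d1 d2 (T1 : measurableType d1) (T2 : measurableType d2)
    (m1 : {sigma_finite_measure set T1 -> \bar R})
    (m2 : {sigma_finite_measure set T2 -> \bar R}) :
    {sigma_finite_measure set (T1 * T2)%type -> \bar R} :=
  HB.pack (m1 \x m2)%E
    (lebesgue_integral_fubini.measure_function_Measure_isSigmaFinite__to__measure_function_isSFinite m1 m2)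
    (lebesgue_integral_fubini.measure_function_Measure_isSigmaFinite__to__measure_function_isSigmaFinite m1 m2).

Fixpoint leb (n : nat) : {sigma_finite_measure set (E n) -> \bar R} :=
  match n with
  | 0 => (dirac (tt : E 0) : {sigma_finite_measure set (E 0) -> \bar R})
  | m.+1 => prod_measure lebesgue_measure (leb m)
  end.

Fixpoint vec (n : nat) : E n -> 'rV[R]_n :=
  match n with
  | 0 => fun _ => 0
  | m.+1 => fun e => row_mx (e.1 : R)%:M (@vec m e.2)
  end.

Arguments vec {n}.

Lemma row_mxS0 n (t : R) (y : 'rV[R]_n) : (row_mx t%:M y : 'rV_n.+1) 0 ord0 = t.
Proof.
have -> : ord0 = lshift n (ord0 : 'I_1) by apply/val_inj.
by apply: etrans (row_mxEl _ _ _ _) _; rewrite mxE.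
Qed.

Lemma row_mxSS n (t : R) (y : 'rV[R]_n) i : (row_mx t%:M y : 'rV_n.+1) 0 (lift ord0 i) = y 0 i.
Proof.
have -> : lift ord0 i = rshift 1 i by apply/val_inj.
exact: (row_mxEr _ _ _ _).
Qed.

Lemma row_mxS_eta n (x : 'rV[R]_n.+1) : x = row_mx (x 0 ord0)%:M (\row_i x 0 (lift ord0 i)).
Proof.
apply/rowP => i; case: (unliftP ord0 i) => [j|] ->; first by rewrite row_mxSS mxE.
by rewrite row_mxS0.
Qed.

Lemma vec_measurable n i : measurable_fun setT (fun e : E n => vec e 0 i : R).
Proof.
elim: n i => [[]//|n IH] i; case: (unliftP ord0 i) => [j|] ->.
  have -> : (fun e : E n.+1 => vec e 0 (lift ord0 j)) = (fun e : E n => vec e 0 j) \o snd.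
    by apply/funext => e ; rewrite row_mxSS.
  exact: (measurableT_comp (IH j) measurable_snd).
have -> : (fun e : E n.+1 => vec e 0 ord0) = fst.
  by apply/funext => e ; rewrite row_mxS0.
exact: measurable_fst.
Qed.

Lemma vec_surj n (x : 'rV[R]_n) : exists e : E n, vec e = x.
Proof.
elim: n x => [|n IH] x; first by exists tt; apply/rowP => -[].
have [e eE] := IH (\row_i x 0 (lift ord0 i)).
by exists (x 0 ord0, e); rewrite [RHS]row_mxS_eta /= eE.
Qed.

Lemma rV_ball n (x y : 'rV[R]_n) e : 0 < e -> ball x e y <-> forall i, ball (x 0 i) e (y 0 i).
Proof.
split=> [[_ h] i|h]; first exact: h.
by split=> // i j; rewrite ord1.
Qed.

Lemma ratr_near (a : R) e : 0 < e -> exists r : rat, `|a - ratr r| < e.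
Proof.
move=> e0; have [|r] := @rat_in_itvoo R (a - e) (a + e); first lra.
by rewrite in_itv/= => /andP[h1 h2]; exists r; rewrite ltr_distlC; lra.
Qed.

(** An open set is the countable union of the balls inside it with rational centre and radius 1 / (k
    + 1); a ball of the sup norm is a finite intersection of conditions on coordinates. *)
Lemma open_vec n (U : set 'rV[R]_n) : open U -> measurable (vec @^-1` U).
Proof.
move=> oU.
pose q (p : 'rV[rat]_n) : 'rV[R]_n := map_mx ratr p.
pose B (pk : 'rV[rat]_n * nat) := ball (q pk.1) (pk.2.+1%:R)^-1 : set 'rV[R]_n.
pose D := [set pk | B pk `<=` U].
have -> : vec @^-1` U = \bigcup_(pk in D) (vec @^-1` (B pk)).
  apply/seteqP; split => [e Ue|e [pk Dpk]]; last exact: Dpk.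
  have /nbhs_ballP[r r0 rU] := open_nbhs_nbhs (conj oU Ue).
  have [k kr] : exists k : nat, (k.+1%:R)^-1 < r / 2 :> R.
    exists (Num.bound (r / 2)^-1); rewrite -[ltRHS]invrK ltf_pV2 ?posrE ?invr_gt0 ?divr_gt0//.
    apply: (lt_le_trans (archi_boundP _)); first by rewrite invr_ge0 divr_ge0 ?ltW.
    by rewrite ler_nat.
  have /choice[p pP] : forall i : 'I_n, exists r : rat, `|vec e 0 i - ratr r| < (k.+1%:R)^-1.
    by move=> i; apply: ratr_near.
  exists (\row_i p i, k) => /=; last first.
    by apply/rV_ball => [|i]; rewrite ?invr_gt0// /ball/= !mxE distrC.
  have k0 : 0 < (k.+1%:R : R)^-1 by rewrite invr_gt0.
  move=> y /(rV_ball _ _ k0) By; apply: rU; apply/rV_ball => // i.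
  have := By i; have := pP i; rewrite /ball/= !mxE => h1 h2.
  have -> : vec e 0 i - y 0 i = (vec e 0 i - ratr (p i)) + (ratr (p i) - y 0 i).
    by rewrite addrA subrK.
  apply: (le_lt_trans (ler_normD _ _)); rewrite (splitr r).
  by rewrite ltrD// (lt_trans _ kr).
rewrite bigcup_mkcond; apply: countable_bigcupT_measurable => // pk.
case: ifPn => // _.
have k0 : 0 < (pk.2.+1%:R : R)^-1 by rewrite invr_gt0.
have -> : vec @^-1` B pk = \bigcap_(i in [set: 'I_n]) (fun e : E n => vec e 0 i : R) @^-1`
    ball (q pk.1 0 i) (pk.2.+1%:R)^-1.
  apply/seteqP; split => [e /(rV_ball _ _ k0) h i _|e h]; first exact: h.
  by apply/(rV_ball _ _ k0) => i; apply: h.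
apply: fin_bigcap_measurable; first exact: finite_finset.
move=> i _; rewrite -[_ @^-1` _]setTI; apply: vec_measurable => //.
by apply: open_measurable; apply: ball_open.
Qed.

Definition vmeas n (F : 'rV[R]_n -> R) := measurable_fun setT (F \o vec).

Lemma continuous_vmeas n (F : 'rV[R]_n -> R) : continuous F -> vmeas F.
Proof.
move=> cF; apply: (measurability _ (RGenOpens.measurableE R)).
move=> _ [_ [a [b ->] <-]]; rewrite setTI comp_preimage.
apply: open_vec; apply: open_comp => [x _|]; [exact: cF|exact: interval_open].
Qed.

Lemma vmeas_slice n (F : 'rV[R]_n.+1 -> R) t : vmeas F -> vmeas (fun y : 'rV_n => F (row_mx t%:M y)).
Proof. by move=> mF; apply: (measurableT_comp mF (measurable_pair1 (t : measurableTypeR R))). Qed.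

(** A product of one-variable factors: slices of a dominated function are dominated in the same way,
    and the integral is computed one coordinate at a time. *)
Definition weight n (x : 'rV[R]_n) : R := \prod_i (1 + x 0 i ^+ 2)^-1.

Lemma weight_factor (t : R) : 0 < (1 + t ^+ 2)^-1 <= 1.
Proof.
have := sqr_ge0 t => h; have h1 : 1 <= 1 + t ^+ 2 by rewrite lerDl.
by rewrite invr_gt0 invf_le1 (lt_le_trans ltr01 h1).
Qed.

Lemma weight_factor_ge0 (t : R) : 0 <= (1 + t ^+ 2)^-1.
Proof. by have /andP[/ltW] := weight_factor t. Qed.

Lemma weight_factor_continuous : continuous (fun t : R => (1 + t ^+ 2)^-1).
Proof.
move=> t; apply: cvgV; first by rewrite gt_eqF// ltr_pwDl// sqr_ge0.
by apply: cvgD; [exact: cvg_cst|exact: exprn_continuous].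
Qed.

Lemma weight_gt0 n (x : 'rV[R]_n) : 0 < weight x.
Proof. by apply: prodr_gt0 => i _; have /andP[] := weight_factor (x 0 i). Qed.

Lemma weight_ge0 n (x : 'rV[R]_n) : 0 <= weight x.
Proof. exact: ltW (weight_gt0 x). Qed.

Lemma weight_le1 n (x : 'rV[R]_n) : weight x <= 1.
Proof.
apply: prodr_ile1 => i _; have /andP[h ->] := weight_factor (x 0 i).
by rewrite ltW.
Qed.

Lemma weightS n t (y : 'rV[R]_n) : weight (row_mx t%:M y : 'rV_n.+1) = (1 + t ^+ 2)^-1 * weight y.
Proof.
rewrite /weight big_ord_recl row_mxS0; congr (_ * _).
by apply: eq_bigr => i _; rewrite row_mxSS.
Qed.

Lemma weight_vmeas n : vmeas (@weight n).
Proof.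
apply: (@measurable_prod _ (E n) R setT _ _ (fun i (e : E n) => (1 + vec e 0 i ^+ 2)^-1)) => i _.
have -> : (fun e : E n => (1 + vec e 0 i ^+ 2)^-1) =
    (fun t : R => (1 + t ^+ 2)^-1) \o (fun e => vec e 0 i) by [].
apply: measurableT_comp; last exact: vec_measurable.
apply: continuous_measurable_fun; exact: weight_factor_continuous.
Qed.

Lemma weight_emeasurable n : measurable_fun setT (fun e : E n => (weight (vec e))%:E).
Proof. apply/measurable_EFinP; exact: weight_vmeas. Qed.

Lemma integral_weight1 : (\int[lebesgue_measure]_(t in [set: R]) ((1 + t ^+ 2)^-1)%:E = pi%:E)%E.
Proof.
have ct := weight_factor_continuous.
rewrite ge0_symfun_integralT//; last 2 first.
- exact: weight_factor_ge0.
- by move=> t /=; rewrite sqrrN.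
rewrite -set_itvcy (@ge0_continuous_FTC2y _ _ atan 0 (pi / 2)).
- by rewrite atan0 sube0 -EFinM mulrCA divff// mulr1.
- by move=> t _; exact: weight_factor_ge0.
- exact: continuous_subspaceT.
- exact: cvgy_atan.
- by move=> t _.
- by apply: cvg_at_right_filter; exact: continuous_atan.
- by move=> t _; rewrite derive1E; apply: (@derive_val _ _ _ _ _ _ _ (is_derive1_atan t)).
Qed.

Lemma integral_weight n : (\int[leb n]_e (weight (vec e))%:E = (pi ^+ n)%:E)%E.
Proof.
elim: n => [|n IH].
  by rewrite integral_dirac// diracT mul1e /weight big_ord0.
rewrite [LHS](fubini_tonelli1 _ (@weight_emeasurable n.+1)) => [|e]; last by rewrite lee_fin weight_ge0.
rewrite /fubini_F /=.
under eq_integral => t _.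
  under eq_integral do rewrite weightS EFinM.
  rewrite ge0_integralZl_EFin//; last 2 first.
  - exact: weight_emeasurable.
  - exact: weight_factor_ge0.
  rewrite IH muleC.
over.
- by move=> e _; rewrite lee_fin weight_ge0.
rewrite ge0_integralZl_EFin//; last 3 first.
- by move=> t _; rewrite lee_fin weight_factor_ge0.
- apply/measurable_EFinP; apply: continuous_measurable_fun; exact: weight_factor_continuous.
- by rewrite exprn_ge0// pi_ge0.
by rewrite integral_weight1 exprSr.
Qed.

(* The class on which [int_rV] is an integral for the product measure and
   satisfies Fubini's theorem without exceptional null sets. *)
Definition wbounded n (F : 'rV[R]_n -> R) :=
  vmeas F /\ exists C : R, forall x, `|F x| <= C * weight x.

Lemma wbounded_slice n (F : 'rV[R]_n.+1 -> R) t :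
  wbounded F -> wbounded (fun y : 'rV_n => F (row_mx t%:M y)).
Proof.
move=> [mF [C CF]]; split; first exact: vmeas_slice.
exists (C * (1 + t ^+ 2)^-1) => y; apply: (le_trans (CF _)).
by rewrite weightS mulrA.
Qed.

Lemma wbounded_integrable n (F : 'rV[R]_n -> R) : wbounded F ->
  (leb n).-integrable setT (EFin \o F \o vec).
Proof.
move=> [mF [C CF]]; apply/integrableP; split; first exact/measurable_EFinP.
apply: (@le_lt_trans _ _ (\int[leb n]_e (C%:E * (weight (vec e))%:E))%E).
  apply: ge0_le_integral => //.
  - by apply/measurable_EFinP; exact: measurableT_comp.
  - by apply: emeasurable_funM => //; exact: weight_emeasurable.
  - by move=> e _ ; rewrite lee_fin.
have C0 : 0 <= C.
  by have := CF 0; rewrite -ler_pdivrMr ?weight_gt0//; apply: le_trans; rewrite divr_ge0 ?weight_ge0.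
rewrite ge0_integralZl_EFin//.
- by rewrite integral_weight ltry.
- by move=> e _; rewrite lee_fin weight_ge0.
- exact: weight_emeasurable.
Qed.

Lemma int_rV_wbounded n (F : 'rV[R]_n -> R) : wbounded F ->
  (int_rV (EFin \o F) = \int[leb n]_e (F (vec e))%:E)%E.
Proof.
elim: n F => [|n IH] F wF .
  by rewrite integral_dirac// diracT mul1e.
rewrite -[RHS](@integral12_prod_meas1 _ _ _ _ _ lebesgue_measure (leb n)
  (fun e : measurableTypeR R * E n => (F (@vec n.+1 e))%:E)); last exact: (wbounded_integrable wF).
apply: eq_integral => t _; apply: IH; exact: wbounded_slice.
Qed.

Definition rint n (F : 'rV[R]_n -> R) : R := fine (int_rV (EFin \o F)).

Lemma rintE n (F : 'rV[R]_n -> R) : wbounded F ->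
  rint F = \int[leb n]_e F (vec e).
Proof. by move=> wF; rewrite /rint int_rV_wbounded. Qed.

Lemma wbounded_weight n : wbounded (@weight n).
Proof.
split; first exact: weight_vmeas.
by exists 1 => x; rewrite mul1r ger0_norm// weight_ge0.
Qed.

Lemma rint_weight n : rint (@weight n) = pi ^+ n.
Proof. by rewrite /rint int_rV_wbounded ?integral_weight//; exact: wbounded_weight. Qed.

Lemma wboundedD n (F G : 'rV[R]_n -> R) : wbounded F -> wbounded G -> wbounded (fun x => F x + G x).
Proof.
move=> [mF [C CF]] [mG [D DG]]; split; first exact: measurable_funD.
exists (C + D) => x; apply: (le_trans (ler_normD _ _)).
by rewrite mulrDl lerD.
Qed.

Lemma wboundedM n (F G : 'rV[R]_n -> R) : wbounded F -> vmeas G ->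
  (exists C, forall x, `|G x| <= C) -> wbounded (fun x => G x * F x).
Proof.
move=> [mF [C CF]] mG [D DG]; split; first exact: measurable_funM.
exists (D * C) => x; rewrite normrM -mulrA; apply: ler_pM => //.
Qed.

Lemma vmeas_cst n (c : R) : vmeas (fun _ : 'rV_n => c).
Proof. exact: measurable_cst. Qed.

Lemma wboundedZ n c (F : 'rV[R]_n -> R) : wbounded F -> wbounded (fun x => c * F x).
Proof.
by move=> wF; apply: wboundedM => //; [exact: vmeas_cst|exists `|c|].
Qed.

Lemma rintD n (F G : 'rV[R]_n -> R) : wbounded F -> wbounded G ->
  rint (fun x => F x + G x) = rint F + rint G.
Proof.
move=> wF wG; rewrite !rintE//; last exact: wboundedD.
by rewrite RintegralD//; exact: wbounded_integrable.
Qed.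

Lemma rintZ n c (F : 'rV[R]_n -> R) : wbounded F -> rint (fun x => c * F x) = c * rint F.
Proof.
move=> wF; rewrite !rintE//; last exact: wboundedZ.
by rewrite RintegralZl//; exact: wbounded_integrable.
Qed.

Lemma rintB n (F G : 'rV[R]_n -> R) : wbounded F -> wbounded G ->
  rint (fun x => F x - G x) = rint F - rint G.
Proof.
move=> wF wG; rewrite -mulN1r -rintZ// -rintD//; last exact: wboundedZ.
by congr rint; apply/funext => x; rewrite mulN1r.
Qed.

Lemma le_rint n (F G : 'rV[R]_n -> R) : wbounded F -> wbounded G ->
  (forall x, F x <= G x) -> rint F <= rint G.
Proof.
move=> wF wG h; rewrite !rintE//; apply: le_Rintegral => //; exact: wbounded_integrable.
Qed.

Lemma rint_ge0 n (F : 'rV[R]_n -> R) : (forall x, 0 <= F x) -> wbounded F -> 0 <= rint F.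
Proof. by move=> h wF; rewrite rintE//; apply: Rintegral_ge0. Qed.

Lemma rint_norm n (F G : 'rV[R]_n -> R) : wbounded F -> wbounded G ->
  (forall x, `|F x| <= G x) -> `|rint F| <= rint G.
Proof.
move=> wF wG h; rewrite ler_norml -mulN1r -rintZ//; apply/andP; split; apply: le_rint => //.
- exact: wboundedZ.
- by move=> x; rewrite mulN1r; have := h x; rewrite ler_norml => /andP[].
- by move=> x; have := h x; rewrite ler_norml => /andP[].
Qed.

Definition wbounded2 n m (F : 'rV[R]_n -> 'rV[R]_m -> R) :=
  measurable_fun setT (fun e : E n * E m => F (vec e.1) (vec e.2)) /\
  exists C : R, forall x y, `|F x y| <= C * (weight x * weight y).

Lemma wbounded2_swap n m (F : 'rV[R]_n -> 'rV[R]_m -> R) :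
  wbounded2 F -> wbounded2 (fun y x => F x y).
Proof.
move=> [mF [C CF]]; split; last by exists C => y x; rewrite [weight y * _]mulrC.
exact: (measurableT_comp mF (@measurable_swap _ _ (E m) (E n))).
Qed.

Lemma wbounded2_wbounded n m (F : 'rV[R]_n -> 'rV[R]_m -> R) x : wbounded2 F -> wbounded (F x).
Proof.
move=> [mF [C CF]]; have [e eE] := vec_surj x; split.
  by rewrite -eE; apply: (measurableT_comp mF (measurable_pair1 e)).
by exists (C * weight x) => y; rewrite -mulrA.
Qed.

Lemma wbounded2_integrable n m (F : 'rV[R]_n -> 'rV[R]_m -> R) : wbounded2 F ->
  (leb n \x leb m)%E.-integrable setT (fun e : E n * E m => (F (vec e.1) (vec e.2))%:E).
Proof.
move=> [mF [C CF]].
apply/integrable12ltyP; first exact/measurable_EFinP.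
apply: (@le_lt_trans _ _ (\int[leb n]_x (`|C| * pi ^+ m * weight (vec x))%:E)%E).
  apply: ge0_le_integral => //.
  - by move=> e _; apply: integral_ge0.
  - apply: (measurable_fun_fubini_tonelli_F (fun e : E n * E m => `|(F (vec e.1) (vec e.2))%:E|%E)) => //.
    by do 2 apply: measurableT_comp => //.
  - by apply/measurable_EFinP/measurable_funM => //; exact: weight_vmeas.
  move=> e _.
  apply: (@le_trans _ _ (\int[leb m]_y ((`|C| * weight (vec e))%:E * (weight (vec y))%:E))%E).
    apply: ge0_le_integral => //.
    - apply/measurable_EFinP/measurableT_comp => //.
      by apply: (measurableT_comp mF (measurable_pair1 e)).
    - by apply: emeasurable_funM => //; exact: weight_emeasurable.
    - move=> y _; apply: (le_trans (CF _ _)).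
      by rewrite mulrA ler_wpM2r ?weight_ge0// ler_wpM2r ?weight_ge0// ler_norm.
  rewrite ge0_integralZl_EFin//.
  - by rewrite integral_weight mulrAC.
  - by move=> y _; rewrite lee_fin weight_ge0.
  - exact: weight_emeasurable.
  - by rewrite mulr_ge0 ?weight_ge0.
under eq_integral do rewrite EFinM.
rewrite ge0_integralZl_EFin//.
- by rewrite integral_weight ltry.
- by move=> e _; rewrite lee_fin weight_ge0.
- exact: weight_emeasurable.
- by rewrite mulr_ge0 ?exprn_ge0 ?pi_ge0.
Qed.

Lemma wbounded2_rint n m (F : 'rV[R]_n -> 'rV[R]_m -> R) :
  wbounded2 F -> wbounded (fun x => rint (F x)).
Proof.
move=> wF; have [mF [C CF]] := wF.
have iF := wbounded2_integrable wF.
split.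
  have /measurable_int mI := integrable_fubini_F iF.
  have -> : vmeas (fun x => rint (F x)) = measurable_fun setT
      (fine \o fubini_F (leb m) (fun e : E n * E m => (F (vec e.1) (vec e.2))%:E)).
    congr measurable_fun; apply/funext => e; rewrite /= rintE//.
    exact: wbounded2_wbounded.
  exact: measurableT_comp.
exists (C * pi ^+ m) => x.
have wx := wbounded2_wbounded x wF.
have wb : wbounded (fun y : 'rV_m => C * weight x * weight y).
  exact/wboundedZ/wbounded_weight.
apply: (le_trans (rint_norm wx wb _)); first by move=> y; rewrite -mulrA.
by rewrite (rintZ _ (@wbounded_weight m)) rint_weight mulrAC.
Qed.

End Euclid.

(** * Exchange of integrals, and complex-valued integrands *)

Section Fubini.
Context {R : realType}.

(** Domination by the product of the weights makes every slice integrable, so that both iterated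
    integrals are those of the product measure without exceptional sets. *)
Lemma rint_fubini n m (F : 'rV[R]_n -> 'rV[R]_m -> R) : wbounded2 F ->
  rint (fun x => rint (F x)) = rint (fun y => rint (fun x => F x y)).
Proof.
move=> wF; have wG := wbounded2_swap wF.
rewrite !rintE; [|exact: wbounded2_rint wG|exact: wbounded2_rint wF].
congr fine; transitivity (\int[leb n]_x \int[leb m]_y (F (vec x) (vec y))%:E)%E.
  apply: eq_integral => x _; rewrite rintE; last exact: wbounded2_wbounded.
  rewrite fineK//; apply: integrable_fin_num => //.
  exact: (wbounded_integrable (wbounded2_wbounded (vec x) wF)).
rewrite (Fubini (wbounded2_integrable wF)).
apply: eq_integral => y _; rewrite rintE; last exact: (wbounded2_wbounded _ wG).
rewrite fineK//; apply: integrable_fin_num => //.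
exact: (wbounded_integrable (wbounded2_wbounded (vec y) wG)).
Qed.

Lemma rintS n (F : 'rV[R]_n.+1 -> R) : wbounded F ->
  rint F = \int[lebesgue_measure]_(t in [set: R]) rint (fun y : 'rV_n => F (row_mx t%:M y)).
Proof.
move=> wF; congr fine; apply: eq_integral => t _.
rewrite fineK// int_rV_wbounded; last exact: wbounded_slice.
by apply: integrable_fin_num => //; exact: wbounded_integrable (wbounded_slice _ wF).
Qed.

Lemma rint0E (F : 'rV[R]_0 -> R) : rint F = F 0.
Proof. by []. Qed.

Definition bounded1 (h : R -> R) :=
  measurable_fun setT h /\ exists C : R, forall t, `|h t| <= C * (1 + t ^+ 2)^-1.

Lemma wbounded_prod n (h : 'I_n -> R -> R) : (forall i, bounded1 (h i)) ->
  wbounded (fun x : 'rV_n => \prod_i h i (x 0 i)).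
Proof.
move=> hh; split.
  apply: (@measurable_prod _ (E n) R setT _ _ (fun i (e : E n) => h i (vec e 0 i))) => i _.
  by apply: (measurableT_comp (proj1 (hh i))); exact: vec_measurable.
have /choice[C CP] : forall i, exists C : R, forall t, `|h i t| <= C * (1 + t ^+ 2)^-1.
  by move=> i; have [] := hh i.
exists (\prod_i C i) => x; rewrite normr_prod -big_split.
by apply: ler_prod => i _; rewrite normr_ge0 CP.
Qed.

Lemma bounded1_integrable (h : R -> R) :
  bounded1 h -> lebesgue_measure.-integrable setT (EFin \o h).
Proof.
move=> [mh [C CP]]; apply/integrableP; split; first exact/measurable_EFinP.
apply: (@le_lt_trans _ _ (\int[lebesgue_measure]_t (`|C|%:E * ((1 + t ^+ 2)^-1)%:E))%E).
  apply: ge0_le_integral => //.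
  - by do 2 apply: measurableT_comp => //.
  - apply/measurable_EFinP/measurable_funM => //.
    apply: continuous_measurable_fun; exact: weight_factor_continuous.
  - move=> t _; apply: (le_trans (CP t)).
    by rewrite ler_wpM2r ?ler_norm ?weight_factor_ge0.
rewrite ge0_integralZl_EFin//; last 2 first.
- by move=> t _; rewrite lee_fin weight_factor_ge0.
- apply/measurable_EFinP; apply: continuous_measurable_fun; exact: weight_factor_continuous.
by rewrite integral_weight1 ltry.
Qed.

Lemma rint_prod n (h : 'I_n -> R -> R) : (forall i, bounded1 (h i)) ->
  rint (fun x : 'rV_n => \prod_i h i (x 0 i)) =
  \prod_i \int[lebesgue_measure]_(t in [set: R]) h i t.
Proof.
elim: n h => [|n IH] h hh; first by rewrite rint0E !big_ord0.
rewrite rintS; last exact: wbounded_prod.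
rewrite big_ord_recl -IH; last by move=> i.
have -> : (fun t : R => rint (fun y : 'rV_n => \prod_i h i (row_mx t%:M y 0 i))) =
    (fun t => rint (fun y : 'rV_n => \prod_(i < n) h (lift ord0 i) (y 0 i)) * h ord0 t).
  apply/funext => t; rewrite mulrC -rintZ; last by apply: (wbounded_prod (h := fun i => h (lift ord0 i))) => i.
  congr rint; apply/funext => y; rewrite big_ord_recl row_mxS0; congr (_ * _).
  by apply: eq_bigr => i _; rewrite row_mxSS.
rewrite [RHS]mulrC; rewrite RintegralZl//; exact: bounded1_integrable.
Qed.

Lemma cmodE (z : R[i]) : cmod z = Num.sqrt (Re z ^+ 2 + Im z ^+ 2).
Proof. by case: z. Qed.

Lemma normc_ge0 (z : R[i]) : 0 <= cmod z.
Proof. by rewrite cmodE. Qed.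

Lemma normc_sqr (z : R[i]) : cmod z ^+ 2 = Re z ^+ 2 + Im z ^+ 2.
Proof. by rewrite cmodE sqr_sqrtr// addr_ge0 ?sqr_ge0. Qed.

Lemma normcM (z w : R[i]) : cmod (z * w) = cmod z * cmod w.
Proof. exact: ComplexField.Normc.normcM. Qed.

Lemma normcD (z w : R[i]) : cmod (z + w) <= cmod z + cmod w.
Proof.
rewrite -ler_sqr ?nnegrE ?addr_ge0 ?normc_ge0// sqrrD !normc_sqr.
case: z w => [a b] [c d] .
have h : a * c + b * d <= cmod (a +i* b) * cmod (c +i* d).
  apply: (le_trans (ler_norm _)).
  rewrite -ler_sqr ?nnegrE ?mulr_ge0 ?normc_ge0// exprMn !normc_sqr/= real_normK ?num_real//.
  by have := sqr_ge0 (a * d - b * c); lra.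
move: h; rewrite !cmodE/=; lra.
Qed.

Lemma normc_Re (z : R[i]) : `|Re z| <= cmod z.
Proof. by rewrite cmodE -sqrtr_sqr ler_wsqrtr// lerDl sqr_ge0. Qed.

Lemma normc_Im (z : R[i]) : `|Im z| <= cmod z.
Proof. by rewrite cmodE -sqrtr_sqr ler_wsqrtr// lerDr sqr_ge0. Qed.

Lemma normc_le (z : R[i]) : cmod z <= `|Re z| + `|Im z|.
Proof.
rewrite -ler_sqr ?nnegrE ?normc_ge0// normc_sqr sqrrD !real_normK ?num_real//.
by rewrite lerD2r lerDl.
Qed.

Lemma normc0 : cmod (0 : R[i]) = 0.
Proof. by rewrite cmodE expr0n addr0 sqrtr0. Qed.

Lemma normc1 : cmod (1 : R[i]) = 1.
Proof. by rewrite cmodE expr0n expr1n addr0 sqrtr1. Qed.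

Lemma normcN (z : R[i]) : cmod (- z) = cmod z.
Proof. by case: z => a b; rewrite !cmodE !sqrrN. Qed.

Lemma normcR (a : R) : cmod (a%:C) = `|a|.
Proof. by rewrite cmodE expr0n addr0 sqrtr_sqr. Qed.

Lemma normc_cis (t : R) : cmod (cis t) = 1.
Proof. by rewrite cmodE cos2Dsin2 sqrtr1. Qed.

Lemma normc_conj (z : R[i]) : cmod z^* = cmod z.
Proof. by case: z => a b; rewrite !cmodE sqrrN. Qed.

Lemma normc_sum (I : Type) (r : seq I) (P : pred I) (F : I -> R[i]) :
  cmod (\sum_(i <- r | P i) F i) <= \sum_(i <- r | P i) cmod (F i).
Proof.
elim/big_rec2: _ => [|i y x _ h]; first by rewrite normc0.
exact: le_trans (normcD _ _) (lerD (lexx _) h).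
Qed.

Lemma Re_add (z w : R[i]) : Re (z + w) = Re z + Re w. Proof. by case: z w => ? ? []. Qed.
Lemma Im_add (z w : R[i]) : Im (z + w) = Im z + Im w. Proof. by case: z w => ? ? []. Qed.
Lemma Re_mul (z w : R[i]) : Re (z * w) = Re z * Re w - Im z * Im w. Proof. by case: z w => ? ? []. Qed.
Lemma Im_mul (z w : R[i]) : Im (z * w) = Re z * Im w + Im z * Re w. Proof. by case: z w => ? ? []. Qed.

Lemma complexE2 (z w : R[i]) : Re z = Re w -> Im z = Im w -> z = w.
Proof. by case: z w => a b [c d] /= -> ->. Qed.

Lemma cisD (s t : R) : cis (s + t) = cis s * cis t.
Proof. by apply: complexE2; rewrite /= ?cosD ?sinD; ring. Qed.

Lemma cisN (t : R) : cis (- t) = (cis t)^*.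
Proof. by rewrite /cis cosN sinN. Qed.

Definition cmeasurable d (T : measurableType d) (f : T -> R[i]) :=
  measurable_fun setT (fun x => Re (f x)) /\ measurable_fun setT (fun x => Im (f x)).

Lemma cmeasurableD d (T : measurableType d) (f g : T -> R[i]) :
  cmeasurable f -> cmeasurable g -> cmeasurable (fun x => f x + g x).
Proof.
move=> [a b] [c e]; split.
  by under eq_fun do rewrite Re_add; apply: measurable_funD.
by under eq_fun do rewrite Im_add; apply: measurable_funD.
Qed.

Lemma cmeasurableM d (T : measurableType d) (f g : T -> R[i]) :
  cmeasurable f -> cmeasurable g -> cmeasurable (fun x => f x * g x).
Proof.
move=> [a b] [c e]; split.
  by under eq_fun do rewrite Re_mul; apply: measurable_funB; apply: measurable_funM.
by under eq_fun do rewrite Im_mul; apply: measurable_funD; apply: measurable_funM.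
Qed.

Lemma cmeasurable_comp d1 d2 (T1 : measurableType d1) (T2 : measurableType d2)
    (f : T2 -> R[i]) (h : T1 -> T2) : measurable_fun setT h -> cmeasurable f ->
  cmeasurable (fun x => f (h x)).
Proof.
by move=> mh [a b]; split; [apply: (measurableT_comp a mh)|apply: (measurableT_comp b mh)].
Qed.

Definition cwbounded n (f : 'rV[R]_n -> R[i]) :=
  wbounded (fun x => Re (f x)) /\ wbounded (fun x => Im (f x)).

Definition cmeas n (f : 'rV[R]_n -> R[i]) :=
  vmeas (fun x => Re (f x)) /\ vmeas (fun x => Im (f x)).

Lemma cwboundedP n (f : 'rV[R]_n -> R[i]) (C : R) : cmeas f ->
  (forall x, cmod (f x) <= C * weight x) -> cwbounded f.
Proof.
move=> [mr mi] h; split; split=> //; exists C => x.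
  exact: le_trans (normc_Re _) (h x).
exact: le_trans (normc_Im _) (h x).
Qed.

Lemma cwbounded_bound n (f : 'rV[R]_n -> R[i]) : cwbounded f ->
  exists C : R, forall x, cmod (f x) <= C * weight x.
Proof.
move=> [[_ [C CP]] [_ [D DP]]]; exists (C + D) => x.
by apply: (le_trans (normc_le _)); rewrite mulrDl lerD.
Qed.

Lemma cwbounded_meas n (f : 'rV[R]_n -> R[i]) : cwbounded f -> cmeas f.
Proof. by move=> [[? _] [? _]]. Qed.

Lemma cmeasD n (f g : 'rV[R]_n -> R[i]) : cmeas f -> cmeas g -> cmeas (fun x => f x + g x).
Proof. exact: (@cmeasurableD _ (E n)). Qed.

Lemma cmeasM n (f g : 'rV[R]_n -> R[i]) : cmeas f -> cmeas g -> cmeas (fun x => f x * g x).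
Proof. exact: (@cmeasurableM _ (E n)). Qed.

Lemma cmeas_cst n (c : R[i]) : cmeas (fun _ : 'rV[R]_n => c).
Proof. by split; exact: vmeas_cst. Qed.

Lemma cmeas_real n (F : 'rV[R]_n -> R) : vmeas F -> cmeas (fun x => (F x)%:C).
Proof. by split => //; exact: vmeas_cst. Qed.

Lemma cmeas_cis n (F : 'rV[R]_n -> R) : vmeas F -> cmeas (fun x => cis (F x)).
Proof.
by split; apply: measurableT_comp => //; apply: continuous_measurable_fun;
  [exact: continuous_cos|exact: continuous_sin].
Qed.

Lemma cmeas_conj n (f : 'rV[R]_n -> R[i]) : cmeas f -> cmeas (fun x => (f x)^*).
Proof.
move=> [a b]; split; rewrite /vmeas /comp.
  by congr (measurable_fun _ _) : a; apply/funext => e /=; case: (f _).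
have -> : (fun e : E n => Im (f (vec e))^*) = (fun e => - Im (f (vec e))).
  by apply/funext => e; case: (f _).
exact: measurable_funN.
Qed.

Lemma dotv_vmeas n (z : 'rV[R]_n) : vmeas (fun x => dotv x z).
Proof.
apply: (@measurable_sum _ (E n) R setT _ _ (fun i (e : E n) => vec e 0 i * z 0 i)) => i.
by apply: measurable_funM => //; exact: vec_measurable.
Qed.

Lemma dotvC n (x y : 'rV[R]_n) : dotv x y = dotv y x.
Proof. by apply: eq_bigr => i _; rewrite mulrC. Qed.

Lemma dotvDl n (x y z : 'rV[R]_n) : dotv (x + y) z = dotv x z + dotv y z.
Proof. by rewrite -big_split; apply: eq_bigr => i _; rewrite mxE mulrDl. Qed.

Lemma dotvZl n c (x z : 'rV[R]_n) : dotv (c *: x) z = c * dotv x z.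
Proof. by rewrite mulr_sumr; apply: eq_bigr => i _; rewrite mxE mulrA. Qed.

Lemma dotvNl n (x z : 'rV[R]_n) : dotv (- x) z = - dotv x z.
Proof. by rewrite -scaleN1r dotvZl mulN1r. Qed.

Lemma dotvBl n (x y z : 'rV[R]_n) : dotv (x - y) z = dotv x z - dotv y z.
Proof. by rewrite dotvDl dotvNl. Qed.

Lemma dotvBr n (x y z : 'rV[R]_n) : dotv z (x - y) = dotv z x - dotv z y.
Proof. by rewrite !(dotvC z) dotvBl. Qed.

Lemma dotv_ge0 n (x : 'rV[R]_n) : 0 <= dotv x x.
Proof. by apply: sumr_ge0 => i _; rewrite sqr_ge0. Qed.

Lemma cint_add n (f g : 'rV[R]_n -> R[i]) : cwbounded f -> cwbounded g ->
  cint_rV (fun x => f x + g x) = cint_rV f + cint_rV g.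
Proof.
move=> [fr fi] [gr gi]; apply: complexE2; rewrite /=.
  by rewrite -rintD//; congr rint; apply/funext => x; rewrite Re_add.
by rewrite -rintD//; congr rint; apply/funext => x; rewrite Im_add.
Qed.

Lemma cint_scale n c (f : 'rV[R]_n -> R[i]) : cwbounded f ->
  cint_rV (fun x => c * f x) = c * cint_rV f.
Proof.
move=> [fr fi]; apply: complexE2; rewrite ?Re_mul ?Im_mul.
  rewrite -!rintZ// -rintB; [|exact: wboundedZ..].
  by congr rint; apply/funext => x; rewrite Re_mul.
rewrite -!rintZ// -rintD; [|exact: wboundedZ..].
by congr rint; apply/funext => x; rewrite Im_mul.
Qed.

Lemma cwboundedM n (f g : 'rV[R]_n -> R[i]) C : cwbounded f -> cmeas g ->
  (forall x, cmod (g x) <= C) -> cwbounded (fun x => g x * f x).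
Proof.
move=> wf mg gC; have [D DP] := cwbounded_bound wf.
apply: (@cwboundedP _ _ (C * D)); first exact: cmeasM (cwbounded_meas wf).
by move=> x; rewrite normcM -mulrA ler_pM ?normc_ge0.
Qed.

Lemma cwboundedZ n c (f : 'rV[R]_n -> R[i]) : cwbounded f -> cwbounded (fun x => c * f x).
Proof. by move=> wf; apply: (cwboundedM wf (cmeas_cst n c) (C := cmod c)) => x. Qed.

Lemma cwboundedD n (f g : 'rV[R]_n -> R[i]) : cwbounded f -> cwbounded g ->
  cwbounded (fun x => f x + g x).
Proof.
move=> wf wg; have [C CP] := cwbounded_bound wf; have [D DP] := cwbounded_bound wg.
apply: (@cwboundedP _ _ (C + D)); first by apply: cmeasD; exact: cwbounded_meas.
by move=> x; rewrite mulrDl; apply: (le_trans (normcD _ _)); rewrite lerD.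
Qed.

Lemma cwbounded0 n : cwbounded (fun _ : 'rV[R]_n => 0).
Proof.
apply: (@cwboundedP _ _ 0); first exact: cmeas_cst.
by move=> x; rewrite normc0 mul0r.
Qed.

Lemma cint0 n : cint_rV (fun _ : 'rV[R]_n => 0) = 0.
Proof.
have := cint_scale 0 (@cwbounded0 n); rewrite [RHS]mul0r => h; rewrite -[RHS]h.
by rewrite mul0r.
Qed.

Lemma cwbounded_sum n (I : Type) (r : seq I) (F : I -> 'rV[R]_n -> R[i]) :
  (forall i, cwbounded (F i)) -> cwbounded (fun x => \sum_(i <- r) F i x).
Proof.
move=> wF; elim: r => [|i r IH].
  by have := @cwbounded0 n; congr cwbounded; apply/funext => x; rewrite big_nil.
have := cwboundedD (wF i) IH.
by congr cwbounded; apply/funext => x; rewrite big_cons.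
Qed.

Lemma cint_sum n (I : Type) (r : seq I) (F : I -> 'rV[R]_n -> R[i]) :
  (forall i, cwbounded (F i)) ->
  cint_rV (fun x => \sum_(i <- r) F i x) = \sum_(i <- r) cint_rV (F i).
Proof.
move=> wF; elim: r => [|i r IH].
  by rewrite big_nil -[RHS](@cint0 n); congr cint_rV; apply/funext => x; rewrite big_nil.
rewrite big_cons -IH -cint_add//; last exact: cwbounded_sum.
by congr cint_rV; apply/funext => x; rewrite big_cons.
Qed.

(** The factor 2 comes from estimating the real and imaginary parts separately. *)
Lemma cint_le n (f : 'rV[R]_n -> R[i]) (G : 'rV[R]_n -> R) : cwbounded f -> wbounded G ->
  (forall x, cmod (f x) <= G x) -> cmod (cint_rV f) <= 2 * rint G.
Proof.
move=> [fr fi] wG h; apply: (le_trans (normc_le _)); rewrite mulrDl mul1r.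
apply: lerD; apply: rint_norm => // x; apply: le_trans (h x).
  exact: normc_Re.
exact: normc_Im.
Qed.

Lemma cint_weight_le n (f : 'rV[R]_n -> R[i]) C : cmeas f ->
  (forall x, cmod (f x) <= C * weight x) -> cmod (cint_rV f) <= C * (2 * pi ^+ n).
Proof.
move=> mf h; have wf := cwboundedP mf h.
apply: (le_trans (cint_le wf (wboundedZ C (@wbounded_weight R n)) h)).
by rewrite rintZ ?rint_weight; [rewrite mulrCA|exact: wbounded_weight].
Qed.

Lemma cwbounded_le n (f : 'rV[R]_n -> R[i]) (G : 'rV[R]_n -> R) : cmeas f -> wbounded G ->
  (forall x, cmod (f x) <= G x) -> cwbounded f.
Proof.
move=> mf [_ [C CP]] h; apply: (cwboundedP mf (C := C)) => x.
exact: le_trans (h x) (le_trans (ler_norm _) (CP x)).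
Qed.

Definition cwbounded2 n m (F : 'rV[R]_n -> 'rV[R]_m -> R[i]) :=
  wbounded2 (fun x y => Re (F x y)) /\ wbounded2 (fun x y => Im (F x y)).

Lemma cint_fubini n m (F : 'rV[R]_n -> 'rV[R]_m -> R[i]) : cwbounded2 F ->
  cint_rV (fun x => cint_rV (F x)) = cint_rV (fun y => cint_rV (fun x => F x y)).
Proof.
by move=> [wr wi]; apply: complexE2; exact: rint_fubini.
Qed.

Definition cmeas2 n m (F : 'rV[R]_n -> 'rV[R]_m -> R[i]) :=
  measurable_fun setT (fun e : E n * E m => Re (F (vec e.1) (vec e.2))) /\
  measurable_fun setT (fun e : E n * E m => Im (F (vec e.1) (vec e.2))).

Lemma cwbounded2P n m (F : 'rV[R]_n -> 'rV[R]_m -> R[i]) C : cmeas2 F ->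
  (forall x y, cmod (F x y) <= C * (weight x * weight y)) -> cwbounded2 F.
Proof.
move=> [mr mi] h; split; split=> //; exists C => x y; apply: le_trans (h x y).
  exact: normc_Re.
exact: normc_Im.
Qed.

Lemma cmeas2_fst n m (f : 'rV[R]_n -> R[i]) : cmeas f -> cmeas2 (fun x (_ : 'rV[R]_m) => f x).
Proof. exact: (@cmeasurable_comp _ _ (E n * E m)%type (E n) _ _ measurable_fst). Qed.

Lemma cmeas2_snd n m (f : 'rV[R]_m -> R[i]) : cmeas f -> cmeas2 (fun (_ : 'rV[R]_n) y => f y).
Proof. exact: (@cmeasurable_comp _ _ (E n * E m)%type (E m) _ _ measurable_snd). Qed.

Lemma cmeas2M n m (f g : 'rV[R]_n -> 'rV[R]_m -> R[i]) : cmeas2 f -> cmeas2 g ->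
  cmeas2 (fun x y => f x y * g x y).
Proof. exact: (@cmeasurableM _ (E n * E m)%type). Qed.

Lemma cmeas2_cis n (c : R) : cmeas2 (fun x y : 'rV[R]_n => cis (c * dotv x y)).
Proof.
have md : measurable_fun setT (fun e : E n * E n => c * dotv (vec e.1) (vec e.2)).
  apply: measurable_funM => //.
  apply: (@measurable_sum _ (E n * E n)%type R setT _ _
    (fun i (e : E n * E n) => vec e.1 0 i * vec e.2 0 i)) => i.
  apply: measurable_funM; first exact: (measurableT_comp (vec_measurable i) measurable_fst).
  exact: (measurableT_comp (vec_measurable i) measurable_snd).
by split; apply: (measurableT_comp _ md); apply: continuous_measurable_fun;
  [exact: continuous_cos|exact: continuous_sin].
Qed.

Lemma cwbounded2_cint n m (F : 'rV[R]_n -> 'rV[R]_m -> R[i]) :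
  cwbounded2 F -> cwbounded (fun x => cint_rV (F x)).
Proof. by move=> [wr wi]; split; exact: wbounded2_rint. Qed.

End Fubini.

(** * Smooth functions *)

Section Smooth.
Context {R : realType}.

Section General.
Context {U V : normedModType R}.
Implicit Types (A B : set U) (f g : U -> V).

Lemma iter_derive_rcons (s : seq U) v f :
  iter_derive (rcons s v) f = iter_derive s (fun x => 'D_v f x).
Proof. by rewrite /iter_derive foldr_rcons. Qed.

Lemma eq_on_open A f g x : open A -> A x -> (forall y, A y -> f y = g y) ->
  \near x, f x = g x.
Proof. by move=> oA Ax h; near=> y; apply: h; near: y; exact: open_nbhs_nbhs. Unshelve. all: end_near. Qed.

Lemma derive_eq_on A f g v x : open A -> A x -> (forall y, A y -> f y = g y) ->
  'D_v f x = 'D_v g x.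
Proof.
move=> oA Ax h; have [->|v0] := eqVneq v 0; first by rewrite !derive0.
by apply: near_eq_derive; exact: (eq_on_open oA).
Qed.

Lemma iter_derive_eq_on A f g s x : open A -> A x -> (forall y, A y -> f y = g y) ->
  iter_derive s f x = iter_derive s g x.
Proof.
move=> oA + h; elim: s x => [|v s IH] x Ax ; first exact: h.
exact: (derive_eq_on _ oA Ax).
Qed.

(** The case to which locality of differentiability reduces: the difference of two functions that
    agree near a point vanishes there. *)
Lemma differentiable_near0 (k : U -> V) x : (\near x, k x = 0) -> differentiable k x.
Proof.
move=> k0.
have kx : k x = 0 by exact: (nbhs_singleton k0).
have k1 : \forall z \near 0, k (z + x) = 0.
  by move: k0; rewrite (near_shift 0 x) subr0.
have H : k \o shift x = cst (k x) + \0 +o_ 0 id.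
  apply/eqaddoP => e e0; near=> h.
  rewrite !fctE kx addr0 subr0.
  suff -> : k (h + x) = 0 by rewrite normr0 mulr_ge0// ltW.
  by near: h.
have c0 : continuous (0 : U -> V) by exact: cst_continuous.
by apply/diff_locallyP; rewrite (diff_unique c0 H).
Unshelve. all: end_near. Qed.

Lemma differentiable_eq_on A f g x : open A -> A x -> (forall y, A y -> f y = g y) ->
  differentiable f x -> differentiable g x.
Proof.
move=> oA Ax h df.
have -> : g = f + (g - f) by apply/funext => y; rewrite addrC subrK.
apply: differentiableD => //; apply: differentiable_near0.
by apply: (eq_on_open oA Ax) => y Ay; rewrite !fctE h// subrr.
Qed.

Lemma smooth_on_eq A f g : open A -> (forall y, A y -> f y = g y) ->
  smooth_on A f -> smooth_on A g.
Proof.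
move=> oA h sf s x Ax; apply: (differentiable_eq_on oA Ax _ (sf s x Ax)) => y Ay.
exact: (iter_derive_eq_on _ oA Ay).
Qed.

Lemma smooth_onS A B f : B `<=` A -> smooth_on A f -> smooth_on B f.
Proof. by move=> BA sf s x /BA; apply: sf. Qed.

Lemma smooth_onU A B f : smooth_on A f -> smooth_on B f -> smooth_on (A `|` B) f.
Proof. by move=> sA sB s x [/sA|/sB]. Qed.

Lemma smooth_on_derive A f v : smooth_on A f -> smooth_on A (fun x => 'D_v f x).
Proof. by move=> sf s; rewrite -iter_derive_rcons; apply: sf. Qed.

Lemma smooth_on_diff A f x : smooth_on A f -> A x -> differentiable f x.
Proof. by move=> /(_ [::]) h /h. Qed.

Lemma smooth_on_continuous A f x : smooth_on A f -> A x -> {for x, continuous f}.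
Proof. by move=> sf Ax; apply: differentiable_continuous; apply: smooth_on_diff Ax. Qed.

(** The product and chain rules produce several terms; with finite sums added, a class of single
    products becomes stable under derivatives. *)
Inductive sums (P : (U -> V) -> Prop) : (U -> V) -> Prop :=
| sums0 : sums P 0
| sums1 f of P f : sums P f
| sumsD f g of sums P f & sums P g : sums P (f + g).

Lemma smooth_coind A (P : (U -> V) -> Prop) : open A ->
  (forall f, P f -> forall x, A x -> differentiable f x) ->
  (forall f v, P f -> exists2 g, sums P g & forall x, A x -> 'D_v f x = g x) ->
  forall f, sums P f -> smooth_on A f.
Proof.
move=> oA Pd PD; have Sd g x : sums P g -> A x -> differentiable g x.
  elim=> [_|f Pf|f1 f2 _ d1 _ d2 Ax]; [|exact: Pd|by apply: differentiableD; auto].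
  exact: (@differentiable_cst _ U V 0 x).
have SD g v : sums P g -> exists2 h, sums P h & forall x, A x -> 'D_v g x = h x.
  elim=> [|f /PD//|f1 f2 S1 [h1 T1 E1] S2 [h2 T2 E2]].
    by exists 0 => [|x _]; [exact: sums0|exact: (derive_cst (0 : V))].
  exists (h1 + h2) => [|x Ax]; first exact: sumsD.
  by rewrite deriveD ?E1 ?E2//; apply: diff_derivable; exact: Sd Ax.
move=> f Sf s; elim/last_ind: s f Sf => [|s v IH] f Sf x Ax; first exact: Sd Ax.
rewrite iter_derive_rcons; have [g Sg gE] := SD f v Sf.
apply: (differentiable_eq_on oA Ax _ (IH g Sg x Ax)) => y Ay; apply/esym.
exact: (iter_derive_eq_on _ oA Ay).
Qed.

Lemma smooth_on_cst A (c : V) : smooth_on A (fun _ : U => c).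
Proof.
move=> s x _; suff [c' ->] : exists c', iter_derive s (fun _ : U => c) = cst c'.
  exact: differentiable_cst.
elim: s => [|v s [c' IH]] /=; first by exists c.
by exists 0; apply/funext => y; rewrite IH derive_cst.
Qed.

Lemma smooth_onD A f g : open A -> smooth_on A f -> smooth_on A g ->
  smooth_on A (fun x => f x + g x).
Proof.
move=> oA sf sg; apply: (smooth_coind (P := smooth_on A) oA).
- by move=> h sh x; exact: smooth_on_diff.
- by move=> h v sh; exists (fun x => 'D_v h x) => //; apply: sums1; exact: smooth_on_derive.
- by apply: sumsD; exact: sums1.
Qed.

Lemma smooth_on_linear A (l : {linear U -> V}) : continuous l -> smooth_on A l.
Proof.
move=> cl s x _.
case/lastP: s => [|s v]; first exact: linear_differentiable.
rewrite iter_derive_rcons.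
have -> : (fun y => 'D_v l y) = cst (l v).
  apply/funext => y; rewrite deriveE; last exact: linear_differentiable.
  by rewrite diff_lin.
exact: (smooth_on_cst (A := setT)).
Qed.

End General.

Section Product.
Context {U : normedModType R}.
Implicit Types (A : set U) (f g : U -> R).

Lemma smooth_onM A f g : open A -> smooth_on A f -> smooth_on A g ->
  smooth_on A (fun x => f x * g x).
Proof.
move=> oA sf sg.
pose P h := exists f g : U -> R, [/\ smooth_on A f, smooth_on A g & h = f * g].
apply: (smooth_coind (P := P)) => //; last by apply: sums1; exists f, g.
- by move=> _ [h [k [sh sk ->]]] x Ax; apply: differentiableM; exact: smooth_on_diff Ax.
move=> _ v [h [k [sh sk ->]]]; exists (h * (fun x => 'D_v k x) + k * (fun x => 'D_v h x)).
  by apply: sumsD; apply: sums1; do 2 eexists; (split; last reflexivity) => //; exact: smooth_on_derive.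
by move=> x Ax; rewrite deriveM//; apply: diff_derivable; exact: smooth_on_diff Ax.
Qed.

Lemma smooth_onN A f : open A -> smooth_on A f -> smooth_on A (fun x => - f x).
Proof.
move=> oA sf; have := smooth_onM oA (@smooth_on_cst U R A (-1)) sf.
by congr smooth_on; apply/funext => x; rewrite mulN1r.
Qed.

Lemma smooth_onB A f g : open A -> smooth_on A f -> smooth_on A g ->
  smooth_on A (fun x => f x - g x).
Proof. by move=> oA sf sg; apply: smooth_onD => //; apply: smooth_onN. Qed.

Lemma smooth_on_sum A (I : Type) (r : seq I) (F : I -> U -> R) : open A ->
  (forall i, smooth_on A (F i)) -> smooth_on A (fun x => \sum_(i <- r) F i x).
Proof.
move=> oA sF; elim: r => [|i r IH].
  by have := @smooth_on_cst U R A 0; congr smooth_on; apply/funext => x; rewrite big_nil.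
have := smooth_onD oA (sF i) IH.
by congr smooth_on; apply/funext => x; rewrite big_cons.
Qed.

(** [h] lists the successive derivatives of the outer function; the stable class consists of the
    products of a smooth function with some [h k \o f]. *)
Lemma smooth_on_comp1 A (D : set R) (h : nat -> R -> R) f : open A ->
  (forall k t, D t -> is_derive t (1 : R) (h k) (h k.+1 t)) ->
  (forall x, A x -> D (f x)) -> smooth_on A f -> smooth_on A (fun x => h 0 (f x)).
Proof.
move=> oA hD fD sf.
have dh k x : A x -> differentiable (h k) (f x).
  by move=> Ax; apply/derivable1_diffP; have [] := hD k _ (fD x Ax).
have hd k x : A x -> differentiable (h k \o f) x.
  by move=> Ax; apply: differentiable_comp; [exact: smooth_on_diff Ax|exact: dh].
have hDv k x v : A x -> 'D_v (h k \o f) x = 'D_v f x * h k.+1 (f x).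
  move=> Ax; have df := smooth_on_diff sf Ax.
  rewrite !deriveE//; last exact: hd.
  rewrite diff_comp//=; last exact: dh.
  by rewrite diff1E ?derive1E; [rewrite (@derive_val _ _ _ _ _ _ _ (hD k _ (fD x Ax)))|exact: dh].
pose P g := exists k (b : U -> R), smooth_on A b /\ g = b * (h k \o f).
apply: (smooth_coind (P := P)) => //.
- move=> _ [k [b [sb ->]]] x Ax; apply: differentiableM; last exact: hd.
  exact: smooth_on_diff Ax.
- move=> _ v [k [b [sb ->]]].
  exists ((fun x => 'D_v b x) * (h k \o f) + (fun x => b x * 'D_v f x) * (h k.+1 \o f)).
    by apply: sumsD; apply: sums1; do 2 eexists; (split; last reflexivity);
      last (apply: smooth_onM => //); exact: smooth_on_derive.
  move=> x Ax; rewrite deriveM; last by apply: diff_derivable; exact: hd.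
    by rewrite hDv// !fctE /GRing.scale/=; ring.
  by apply: diff_derivable; exact: smooth_on_diff Ax.
- apply: sums1; exists 0%N, (fun _ => 1); split; first exact: smooth_on_cst.
  by rewrite [RHS]mul1r.
Qed.

End Product.

Section Coordinates.
Context {U : normedModType R} {m : nat}.
Implicit Types (A : set U) (T : U -> 'rV[R]_m).

Lemma diff_coord (M : 'rV[R]_m) i :
  'd (fun N : 'rV[R]_m => N 0 i) M = (fun N : 'rV[R]_m => N 0 i) :> ('rV[R]_m -> R).
Proof.
have ll : linear (fun N : 'rV[R]_m => N 0 i) by move=> a x y; rewrite !mxE.
pose lM := GRing.isLinear.Build _ _ _ _ _ ll.
pose l : {linear 'rV[R]_m -> R} := HB.pack (fun N : 'rV[R]_m => N 0 i) lM.
have -> : (fun N : 'rV[R]_m => N 0 i) = l by [].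
by apply: diff_lin; exact: coord_continuous.
Qed.

Lemma coord_derive T v x i : differentiable T x -> 'D_v T x 0 i = 'D_v (fun y => T y 0 i) x.
Proof.
move=> dT; have dc := @differentiable_coord R 1 m (T x) 0 i.
rewrite deriveE// [RHS]deriveE; last exact: (differentiable_comp dT dc).
transitivity (('d (fun N : 'rV[R]_m => N 0 i : R) (T x) \o 'd T x) v); last by rewrite -(diff_comp dT dc).
exact: esym (congr1 (fun F : 'rV[R]_m -> R => F ('d T x v)) (diff_coord (T x) i)).
Qed.

Lemma smooth_on_coord A T i : open A -> smooth_on A T -> smooth_on A (fun x => T x 0 i).
Proof.
move=> oA sT.
pose P h := exists2 T, smooth_on A T & h = (fun x : U => (T x : 'rV[R]_m) 0 i).
apply: (smooth_coind (P := P)) => //; last by apply: sums1; exists T.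
- move=> _ [T' s ->] x Ax; apply: (@differentiable_comp _ _ _ _ T' (fun N => N 0 i)).
    exact: smooth_on_diff Ax.
  exact: differentiable_coord.
- move=> _ v [T' s ->]; exists (fun x => 'D_v T' x 0 i).
    by apply: sums1; exists (fun x => 'D_v T' x) => //; exact: smooth_on_derive.
  by move=> x Ax; rewrite coord_derive//; exact: smooth_on_diff Ax.
Qed.

Lemma row_sum_coord (x : 'rV[R]_m) : x = \sum_i x 0 i *: delta_mx 0 i.
Proof. exact: row_sum_delta. Qed.

Lemma differentiable_row T x : (forall i, differentiable (fun y => T y 0 i) x) ->
  differentiable T x.
Proof.
move=> dT.
have -> : T = \sum_i (fun y => T y 0 i *: delta_mx 0 i).
  apply/funext => y; rewrite {1}[T y]row_sum_coord.
  by elim/big_rec2: _ => // i a b _ ->.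
by apply: differentiable_sum => i; apply: differentiableZl.
Qed.

Lemma derive_comp (f : 'rV[R]_m -> R) T v x : differentiable T x -> differentiable f (T x) ->
  'D_v (f \o T) x = \sum_i 'D_v (fun y => T y 0 i) x * 'D_(delta_mx 0 i) f (T x).
Proof.
move=> dT df; rewrite deriveE; last exact: differentiable_comp.
rewrite diff_comp//= -(deriveE v dT) [X in 'd f _ X]row_sum_coord linear_sum.
by apply: eq_bigr => i _; rewrite linearZ -(coord_derive _ _ dT) (deriveE _ df).
Qed.

(** The stable class consists of the products [b * (h \o T)] with [b] and [h] smooth: the chain rule
    gives one such term for each coordinate. *)
Lemma smooth_on_comp A (B : set 'rV[R]_m) (f : 'rV[R]_m -> R) T : open A -> open B ->
  (forall x, A x -> B (T x)) -> smooth_on A T -> smooth_on B f -> smooth_on A (f \o T).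
Proof.
move=> oA oB TB sT sf.
have hd h x : smooth_on B h -> A x -> differentiable (h \o T) x.
  move=> sh Ax; apply: differentiable_comp; first exact: smooth_on_diff Ax.
  exact: smooth_on_diff sh (TB x Ax).
pose P g := exists (b : U -> R) (h : 'rV[R]_m -> R),
  [/\ smooth_on A b, smooth_on B h & g = b * (h \o T)].
apply: (smooth_coind (P := P)) => //.
- move=> _ [b [h [sb sh ->]]] x Ax; apply: differentiableM; last exact: hd.
  exact: smooth_on_diff Ax.
- move=> _ v [b [h [sb sh ->]]].
  exists ((fun x => 'D_v b x) * (h \o T) + \sum_i
      (fun x => b x * 'D_v (fun y => T y 0 i) x) * ((fun y => 'D_(delta_mx 0 i) h y) \o T)).
    apply: sumsD; last apply: big_ind => [||i _]; [|exact: sums0|exact: sumsD|].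
      by apply: sums1; do 2 eexists; split; last reflexivity; [exact: smooth_on_derive|].
    apply: sums1; do 2 eexists; split; last reflexivity; last exact: smooth_on_derive.
    by apply: smooth_onM => //; apply: smooth_on_derive; exact: smooth_on_coord.
  move=> x Ax; rewrite deriveM; last by apply: diff_derivable; exact: hd.
    rewrite derive_comp; [|exact: smooth_on_diff Ax|exact: smooth_on_diff sh (TB x Ax)].
    rewrite addrC; congr (_ + _); first exact: mulrC.
    by rewrite fct_sumE [LHS]mulr_sumr; apply: eq_bigr => i _; exact: mulrA.
  by apply: diff_derivable; exact: smooth_on_diff Ax.
- apply: sums1; exists (fun _ => 1), f; split => //; first exact: smooth_on_cst.
  by rewrite [RHS]mul1r.
Qed.

End Coordinates.

Section Affine.
Context {U W V : normedModType R}.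

(* Along an affine map the difference quotients agree, with no differentiability. *)
Lemma iter_derive_affine (L : U -> W) (l : U -> W) (f : W -> V) (s : seq U) :
  (forall x h v, L (h *: v + x) = h *: l v + L x) ->
  iter_derive s (f \o L) = iter_derive (map l s) f \o L.
Proof.
move=> Ll; elim: s => //= v s ->; apply/funext => x .
set g := iter_derive _ f; rewrite /derive.
have -> : (fun h : R => h^-1 *: (((g \o L) \o +%R^~ x) (h *: v) - (g \o L) x)) =
    (fun h => h^-1 *: ((g \o +%R^~ (L x)) (h *: l v) - g (L x))) by apply/funext => h /=; rewrite Ll.
by [].
Qed.

Lemma smooth_on_affine (A : set U) (B : set W) (L : U -> W) (l : U -> W) (f : W -> V) :
  (forall x h v, L (h *: v + x) = h *: l v + L x) ->
  (forall x, A x -> differentiable L x) -> (forall x, A x -> B (L x)) ->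
  smooth_on B f -> smooth_on A (f \o L).
Proof.
move=> Ll dL AB sf s x Ax; rewrite (iter_derive_affine _ _ Ll).
by apply: differentiable_comp; [exact: dL|apply: sf; exact: AB].
Qed.

End Affine.

Section Complex.
Context {U : normedModType R}.
Implicit Types (A : set U) (f g : U -> R[i]).

Definition cderive (v : U) f (x : U) : R[i] :=
  'D_v (fun x => Re (f x)) x +i* 'D_v (fun x => Im (f x)) x.

Lemma citer_derive_cons v s f : citer_derive (v :: s) f = cderive v (citer_derive s f).
Proof. by []. Qed.

Lemma citer_derive_rcons v s f : citer_derive (rcons s v) f = citer_derive s (cderive v f).
Proof. by rewrite /citer_derive !iter_derive_rcons. Qed.

Lemma citer_derive_eq_on A f g s x : open A -> A x -> (forall y, A y -> f y = g y) ->
  citer_derive s f x = citer_derive s g x.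
Proof.
move=> oA Ax h; congr (_ +i* _);
by apply: (iter_derive_eq_on _ oA Ax) => y Ay; rewrite h.
Qed.

Lemma csmooth_on_eq A f g : open A -> (forall y, A y -> f y = g y) ->
  csmooth_on A f -> csmooth_on A g.
Proof.
move=> oA h [sr si]; split; [move: sr|move: si];
by apply: smooth_on_eq => // y Ay; rewrite h.
Qed.

Lemma csmooth_onS A B f : B `<=` A -> csmooth_on A f -> csmooth_on B f.
Proof. by move=> BA [sr si]; split; apply: smooth_onS BA _. Qed.

Lemma csmooth_onU A B f : csmooth_on A f -> csmooth_on B f -> csmooth_on (A `|` B) f.
Proof. by move=> [a b] [c d]; split; apply: smooth_onU. Qed.

Lemma csmooth_on_derive A f v : csmooth_on A f -> csmooth_on A (cderive v f).
Proof. by move=> [sr si]; split; apply: smooth_on_derive. Qed.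

Lemma csmooth_on_citer A f s : csmooth_on A f -> csmooth_on A (citer_derive s f).
Proof. by move=> sf; elim: s => // v s IH; rewrite citer_derive_cons; apply: csmooth_on_derive. Qed.

Lemma csmooth_on_cst A c : csmooth_on A (fun _ : U => c).
Proof. by split; exact: smooth_on_cst. Qed.

Lemma csmooth_onD A f g : open A -> csmooth_on A f -> csmooth_on A g ->
  csmooth_on A (fun x => f x + g x).
Proof.
move=> oA [fr fi] [gr gi]; split.
  by have := smooth_onD oA fr gr; congr smooth_on; apply/funext => x; rewrite Re_add.
by have := smooth_onD oA fi gi; congr smooth_on; apply/funext => x; rewrite Im_add.
Qed.

Lemma csmooth_onM A f g : open A -> csmooth_on A f -> csmooth_on A g ->
  csmooth_on A (fun x => f x * g x).
Proof.
move=> oA [fr fi] [gr gi]; split.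
  have := smooth_onB oA (smooth_onM oA fr gr) (smooth_onM oA fi gi).
  by congr smooth_on; apply/funext => x; rewrite Re_mul.
have := smooth_onD oA (smooth_onM oA fr gi) (smooth_onM oA fi gr).
by congr smooth_on; apply/funext => x; rewrite Im_mul.
Qed.

Lemma csmooth_on_real A (f : U -> R) : smooth_on A f -> csmooth_on A (fun x => (f x)%:C).
Proof. by split => //; exact: smooth_on_cst. Qed.

Lemma csmooth_on_conj A f : open A -> csmooth_on A f -> csmooth_on A (fun x => (f x)^*).
Proof.
move=> oA [fr fi]; split.
  by move: fr; congr smooth_on; apply/funext => x; case: (f x).
by have := smooth_onN oA fi; congr smooth_on; apply/funext => x; case: (f x).
Qed.

Lemma derive_mul_sum (p1 p2 p3 p4 : U -> R) (e : R) v x :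
  derivable p1 x v -> derivable p2 x v -> derivable p3 x v -> derivable p4 x v ->
  'D_v (fun y => p1 y * p2 y + e * (p3 y * p4 y)) x =
  'D_v p1 x * p2 x + p1 x * 'D_v p2 x + e * ('D_v p3 x * p4 x + p3 x * 'D_v p4 x).
Proof.
move=> d1 d2 d3 d4.
have D12 := is_deriveM (DeriveDef d1 erefl) (DeriveDef d2 erefl).
have D34 := is_deriveM (DeriveDef d3 erefl) (DeriveDef d4 erefl).
have D := is_deriveD D12 (is_deriveZ e D34).
rewrite (@derive_val _ _ _ _ _ _ _ D) /GRing.scale/=; ring.
Qed.

Lemma cderiveM A f g v x : csmooth_on A f -> csmooth_on A g -> A x ->
  cderive v (fun x => f x * g x) x = cderive v f x * g x + f x * cderive v g x.
Proof.
move=> [fr fi] [gr gi] Ax.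
have d (h : U -> R) : smooth_on A h -> derivable h x v.
  by move=> sh; apply: diff_derivable; exact: smooth_on_diff Ax.
apply: complexE2; rewrite ?Re_add ?Im_add ?Re_mul ?Im_mul /=.
  have -> : (fun x => Re (f x * g x)) =
     (fun x => Re (f x) * Re (g x) + (-1) * (Im (f x) * Im (g x))).
    by apply/funext => y; rewrite Re_mul; ring.
  by rewrite (derive_mul_sum _ (d _ fr) (d _ gr) (d _ fi) (d _ gi)); ring.
have -> : (fun x => Im (f x * g x)) =
   (fun x => Re (f x) * Im (g x) + 1 * (Im (f x) * Re (g x))).
  by apply/funext => y; rewrite Im_mul; ring.
by rewrite (derive_mul_sum _ (d _ fr) (d _ gi) (d _ fi) (d _ gr)); ring.
Qed.

Lemma cderiveD A f g v x : csmooth_on A f -> csmooth_on A g -> A x ->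
  cderive v (fun x => f x + g x) x = cderive v f x + cderive v g x.
Proof.
move=> [fr fi] [gr gi] Ax.
have d (h : U -> R) : smooth_on A h -> derivable h x v.
  by move=> sh; apply: diff_derivable; exact: smooth_on_diff Ax.
apply: complexE2; rewrite /=.
  have -> : (fun x => Re (f x + g x)) = (fun x => Re (f x)) + (fun x => Re (g x)).
    by apply/funext => y; rewrite Re_add.
  by rewrite deriveD//; exact: d.
have -> : (fun x => Im (f x + g x)) = (fun x => Im (f x)) + (fun x => Im (g x)).
  by apply/funext => y; rewrite Im_add.
by rewrite deriveD//; exact: d.
Qed.

Lemma cderive_cst v c x : cderive v (fun _ : U => c) x = 0.
Proof. by rewrite /cderive !derive_cst. Qed.

End Complex.
End Smooth.

(** * Families of smooth functions with uniform bounds *)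

Section Families.
Context {R : realType} {n : nat}.
Local Notation rV := 'rV[R]_n.
Local Notation e_ i := (delta_mx 0 i : rV).
Implicit Types (V K : set rV).

Definition wderive (s : seq 'I_n) (f : rV -> R[i]) : rV -> R[i] :=
  citer_derive [seq e_ i | i <- s] f.

(** The index will carry the frequency of a packet, or a point of a compact set, in which the
    estimates must be uniform. *)
Definition ubounded (I : Type) K (F : I -> rV -> R[i]) : Prop :=
  forall s, exists C : R, forall i x, K x -> cmod (wderive s (F i) x) <= C.

Definition ufamily (I : Type) V K (F : I -> rV -> R[i]) : Prop :=
  (forall i, csmooth_on V (F i)) /\ ubounded K F.

Lemma citer_derive_nil (f : rV -> R[i]) : citer_derive [::] f = f.
Proof. by apply/funext => x; rewrite /citer_derive /=; case: (f x). Qed.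

Lemma wderive_nil f : wderive [::] f = f.
Proof. exact: citer_derive_nil. Qed.

Lemma wderive_cons j s f : wderive (j :: s) f = cderive (e_ j) (wderive s f).
Proof. by []. Qed.

Lemma wderive_rcons j s f : wderive (rcons s j) f = wderive s (cderive (e_ j) f).
Proof. by rewrite /wderive map_rcons citer_derive_rcons. Qed.

Lemma wderive_eq_on V f g s x : open V -> V x -> (forall y, V y -> f y = g y) ->
  wderive s f x = wderive s g x.
Proof. exact: citer_derive_eq_on. Qed.

Lemma ufamily_bound (I : Type) V K (F : I -> rV -> R[i]) : ufamily V K F -> exists C : R, forall i x, K x -> cmod (F i x) <= C.
Proof.
by move=> [_ /(_ [::])[C CP]]; exists C => i x Kx; have := CP i x Kx; rewrite wderive_nil.
Qed.

Lemma ufamily_derive (I : Type) V K (F : I -> rV -> R[i]) j : ufamily V K F -> ufamily V K (fun i => cderive (e_ j) (F i)).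
Proof.
move=> [sF bF]; split=> [i|s]; first exact: csmooth_on_derive.
by have [C CP] := bF (rcons s j); exists C => i x Kx; rewrite -wderive_rcons; apply: CP.
Qed.

Lemma wderive_cst s (c : R[i]) : wderive s (fun _ : rV => c) = (fun _ => if s is [::] then c else 0).
Proof.
case/lastP: s => [|s j]; first by rewrite wderive_nil.
rewrite wderive_rcons.
have -> : cderive (e_ j) (fun _ : rV => c) = fun _ => 0 by apply/funext => x; exact: cderive_cst.
have {}z : forall t, wderive t (fun _ : rV => 0 : R[i]) = fun _ => 0.
  elim=> [|k t IH]; first by rewrite wderive_nil.
  by rewrite wderive_cons IH; apply/funext => x; exact: cderive_cst.
by case: s.
Qed.

Lemma ufamily_cst (I : Type) V K (c : I -> R[i]) C : (forall i, cmod (c i) <= C) ->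
  ufamily V K (fun i _ => c i).
Proof.
move=> cC; split=> [i|s]; first exact: csmooth_on_cst.
exists (Num.max C 0) => i x _; rewrite wderive_cst; case: s => [|_ _].
  by rewrite le_max cC.
by rewrite normc0 le_max lexx orbT.
Qed.

Section Class.
Context (I : Type) (V K : set rV) (oV : open V) (KV : K `<=` V).
Implicit Types F G : I -> rV -> R[i].

Lemma ubounded_coind (P : (I -> rV -> R[i]) -> Prop) :
  (forall F, P F -> exists C : R, forall i x, K x -> cmod (F i x) <= C) ->
  (forall F j, P F -> exists2 G, P G & forall i x, V x -> cderive (e_ j) (F i) x = G i x) ->
  forall F, P F -> ubounded K F.
Proof.
move=> Pb PD F PF s; elim/last_ind: s F PF => [|s j IH] F PF.
  by have [C CP] := Pb F PF; exists C => i x Kx; rewrite wderive_nil; apply: CP.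
have [G PG GE] := PD F j PF; have [C CP] := IH G PG; exists C => i x Kx.
rewrite wderive_rcons (@wderive_eq_on V _ (G i))//; first exact: CP.
  exact: KV.
by apply: GE.
Qed.

Lemma ufamilyD F G : ufamily V K F -> ufamily V K G -> ufamily V K (fun i x => F i x + G i x).
Proof.
move=> uF uG; split.
  by move=> i; have [sF _] := uF; have [sG _] := uG; apply: csmooth_onD.
apply: (ubounded_coind (P := fun H => exists F G, [/\ ufamily V K F, ufamily V K G &
    H = (fun i x => F i x + G i x)])); last by exists F, G.
  move=> _ [F1 [G1 [u1 u2 ->]]]; have [C CP] := ufamily_bound u1; have [D DP] := ufamily_bound u2; exists (C + D) => i x Kx.
  by apply: (le_trans (normcD _ _)); rewrite lerD ?CP ?DP.
move=> _ j [F1 [G1 [uF1 uG1 ->]]].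
exists (fun i x => cderive (e_ j) (F1 i) x + cderive (e_ j) (G1 i) x).
  by do 2 eexists; split; last (by []); exact: ufamily_derive.
by move=> i x Vx; have [sF _] := uF1; have [sG _] := uG1; exact: cderiveD Vx.
Qed.

(** Products alone are not stable under derivatives, sums of products are; this is the class given
    to [ubounded_coind]. *)
Inductive ufam_mul : (I -> rV -> R[i]) -> Prop :=
| ufam_mul1 F G of ufamily V K F & ufamily V K G : ufam_mul (fun i x => F i x * G i x)
| ufam_mulD F G of ufam_mul F & ufam_mul G : ufam_mul (fun i x => F i x + G i x).

Lemma ufam_mul_smooth F i : ufam_mul F -> csmooth_on V (F i).
Proof.
elim=> [F1 G1 [s1 _] [s2 _]|F1 G1 _ s1 _ s2]; [exact: csmooth_onM|exact: csmooth_onD].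
Qed.

Lemma ufamilyM F G : ufamily V K F -> ufamily V K G -> ufamily V K (fun i x => F i x * G i x).
Proof.
move=> uF uG; have PFG := ufam_mul1 uF uG.
split=> [i|]; first exact: (ufam_mul_smooth i PFG).
apply: (ubounded_coind (P := ufam_mul)) PFG.
  move=> H; elim=> [F1 G1 /ufamily_bound[C CP] /ufamily_bound[D DP]|F1 G1 _ [C CP] _ [D DP]].
    by exists (C * D) => i x Kx; rewrite normcM ler_pM ?normc_ge0 ?CP ?DP.
  by exists (C + D) => i x Kx; apply: (le_trans (normcD _ _)); rewrite lerD ?CP ?DP.
move=> H j; elim=> [F1 G1 u1 u2|F1 G1 m1 [F2 m1' E1] m2 [G2 m2' E2]].
  exists (fun i x => cderive (e_ j) (F1 i) x * G1 i x + F1 i x * cderive (e_ j) (G1 i) x).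
    by apply: ufam_mulD; apply: ufam_mul1 => //; exact: ufamily_derive.
  by move=> i x Vx; have [sF _] := u1; have [sG _] := u2; exact: cderiveM Vx.
exists (fun i x => F2 i x + G2 i x); first exact: ufam_mulD.
move=> i x Vx; rewrite -E1// -E2//; apply: (@cderiveD _ _ V) => //; exact: ufam_mul_smooth.
Qed.

Lemma csmooth_on_inv f : csmooth_on V f -> (forall x, V x -> f x != 0) ->
  csmooth_on V (fun x => (f x)^-1).
Proof.
move=> sf f0; have [sr si] := sf.
have sq : smooth_on V (fun x => Re (f x) * Re (f x) + Im (f x) * Im (f x)).
  by apply: smooth_onD => //; apply: smooth_onM.
(* The k-th derivative of 1 / t. The inverse of [f] is its conjugate times 1 / |f|^2. *)
pose h (k : nat) (t : R) : R := (-1) ^+ k * k`!%:R * (t ^+ k.+1)^-1.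
have sinv : smooth_on V (fun x => h 0%N (Re (f x) * Re (f x) + Im (f x) * Im (f x))).
  apply: (@smooth_on_comp1 R _ V [set t | t != 0]) => //.
    move=> k t /= t0.
    have dX := @is_deriveX R R id k.+1 t 1 1 (is_derive_id _ _).
    have tk : (id ^+ k.+1 : R -> R) t != 0 by rewrite !fctE expf_neq0.
    have dV := DeriveDef (derivableV tk (@ex_derive _ _ _ _ _ _ _ dX)) (deriveV tk (@ex_derive _ _ _ _ _ _ _ dX)).
    have dZ := is_deriveZ ((-1) ^+ k * k`!%:R) dV.
    have E : (h k : R -> R) = ((-1) ^+ k * k`!%:R) *: (fun x : R => ((id ^+ k.+1 : R -> R) x)^-1).
      by rewrite !fctE.
    rewrite E; apply: is_derive_eq dZ _.
    rewrite (@derive_val _ _ _ _ _ _ _ dX) !fctE /h /GRing.scale/= natrM !exprS.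
    by field; rewrite expf_neq0.
  move=> x Vx ; have := f0 x Vx; case: (f x) => a b /=; apply: contra => /eqP h0.
  have a2 := sqr_ge0 a; have b2 := sqr_ge0 b.
  have a0 : a ^+ 2 = 0 by lra.
  have b0 : b ^+ 2 = 0 by lra.
  by move/eqP: a0; move/eqP: b0; rewrite !sqrf_eq0 => /eqP -> /eqP ->.
have := csmooth_onM oV (csmooth_on_conj oV sf) (csmooth_on_real sinv).
apply: csmooth_on_eq => // x Vx; have := f0 x Vx; case: (f x) => a b /= ab0.
have ab : a ^+ 2 + b ^+ 2 != 0.
  apply: contra ab0 => /eqP h0; have a2 := sqr_ge0 a; have b2 := sqr_ge0 b.
  have a0 : a ^+ 2 = 0 by lra.
  have b0 : b ^+ 2 = 0 by lra.
  by move/eqP: a0; move/eqP: b0; rewrite !sqrf_eq0 => /eqP -> /eqP ->.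
rewrite /h mul1r mul1r.
apply/eqP; rewrite eq_complex /=; apply/andP; split; apply/eqP; field; exact: ab.
Qed.

Lemma cderive_inv f j x : csmooth_on V f -> (forall x, V x -> f x != 0) -> V x ->
  cderive (e_ j) (fun x => (f x)^-1) x = - cderive (e_ j) f x * (f x)^-1 ^+ 2.
Proof.
move=> sf f0 Vx; have sv := csmooth_on_inv sf f0.
have := cderiveM (e_ j) sf sv Vx.
have -> : cderive (e_ j) (fun x => f x * (f x)^-1) x = 0.
  have := @citer_derive_eq_on _ _ V (fun x => f x * (f x)^-1) (fun=> 1) [:: e_ j] x oV Vx.
  rewrite !citer_derive_cons !citer_derive_nil cderive_cst; apply => y Vy.
  by rewrite divff// f0.
move/eqP; rewrite eq_sym addrC addr_eq0 => /eqP h.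
apply: (mulfI (f0 x Vx)); rewrite h; field; exact: f0.
Qed.

(** The stable class consists of A F^(-k) with [A] a bounded family. Nonvanishing on the open [V]
    gives smoothness, the lower bound [d] on [K] gives the bounds. *)
Lemma ufamilyV F (d : R) : ufamily V K F -> (forall i x, V x -> F i x != 0) -> 0 < d ->
  (forall i x, K x -> d <= cmod (F i x)) -> ufamily V K (fun i x => (F i x)^-1).
Proof.
move=> uF F0 d0 dF; have [sF _] := uF.
split=> [i|]; first exact: csmooth_on_inv (F0 i).
apply: (ubounded_coind (P := fun H => exists k A, ufamily V K A /\
   H = (fun i x => A i x * (F i x)^-1 ^+ k))); last 1 first.
- exists 1%N, (fun _ _ => 1); split.
    by apply: (@ufamily_cst I V K _ 1) => i; rewrite normc1.
  by apply/funext => i; apply/funext => x; rewrite mul1r.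
  move=> _ [k [A [uA ->]]]; have [C CP] := ufamily_bound uA; exists (C * d^-1 ^+ k) => i x Kx.
  rewrite normcM ler_pM ?normc_ge0 ?CP//.
  have h : cmod ((F i x)^-1) <= d^-1.
    have : cmod (F i x) * cmod ((F i x)^-1) = 1 by rewrite -normcM divff ?normc1// F0//; exact: KV.
    have := dF i x Kx; move=> h1 h2.
    rewrite -[leRHS]mul1r ler_pdivlMr// mulrC -h2; exact: (ler_wpM2r (normc_ge0 _) h1).
  elim: k => [|k IH]; first by rewrite normc1.
  by rewrite !exprS normcM ler_pM ?normc_ge0.
move=> _ j [k [A [uA ->]]].
exists (fun i x => (cderive (e_ j) (A i) x * F i x + (- k%:R) * A i x * cderive (e_ j) (F i) x)
   * (F i x)^-1 ^+ k.+1).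
  exists k.+1; eexists; split; last by [].
  apply: ufamilyD; first by apply: ufamilyM => //; exact: ufamily_derive.
  apply: ufamilyM; last exact: ufamily_derive.
  by apply: ufamilyM => //; apply: (@ufamily_cst I V K (fun=> - k%:R) (cmod (- k%:R))).
move=> i x Vx; have [sA _] := uA.
have sv := csmooth_on_inv (sF i) (F0 i).
have sX m : csmooth_on V (fun x => (F i x)^-1 ^+ m).
  elim: m => [|m IH].
    have := csmooth_on_cst V 1; congr csmooth_on.
  by have := csmooth_onM oV sv IH; congr csmooth_on; apply/funext => y; rewrite exprS.
rewrite (cderiveM _ (sA i) (sX k) Vx).
have -> : cderive (e_ j) (fun x => (F i x)^-1 ^+ k) x =
    - k%:R * cderive (e_ j) (F i) x * (F i x)^-1 ^+ k.+1.
  elim: k => [|k IH].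
    by rewrite oppr0 !mul0r -[RHS](cderive_cst (e_ j) 1 x).
  have -> : (fun x => (F i x)^-1 ^+ k.+1) = (fun x => (F i x)^-1 * (F i x)^-1 ^+ k).
    by apply/funext => y; rewrite exprS.
  rewrite (cderiveM _ sv (sX k) Vx) IH (cderive_inv _ (sF i) (F0 i) Vx).
  by rewrite !exprS; ring.
have Fx := F0 i x Vx; rewrite !exprS; field.
exact: Fx.
Qed.

End Class.

Lemma ufamilyS (I : Type) V V' K K' (F : I -> rV -> R[i]) : V' `<=` V -> K' `<=` K ->
  ufamily V K F -> ufamily V' K' F.
Proof.
move=> VV KK [sF bF]; split=> [i|s]; first exact: csmooth_onS VV (sF i).
by have [C CP] := bF s; exists C => i x /KK; apply: CP.
Qed.

Lemma ufamily_reindex (I J : Type) V K (F : I -> rV -> R[i]) (h : J -> I) :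
  ufamily V K F -> ufamily V K (fun j => F (h j)).
Proof.
move=> [sF bF]; split=> [i|s]; first exact: sF.
by have [C CP] := bF s; exists C => i x; apply: CP.
Qed.

Lemma compact_bound K (f : rV -> R) : compact K -> {within K, continuous f} ->
  exists C : R, forall x, K x -> `|f x| <= C.
Proof.
move=> cK cf; have [[x0 Kx0]|K0] := pselect (K !=set0); last first.
  by exists 0 => x Kx; exfalso; apply: K0; exists x.
have [a Ka aP] := EVT_max_rV (ex_intro _ x0 Kx0) cK cf.
have [b Kb bP] := EVT_min_rV (ex_intro _ x0 Kx0) cK cf.
exists (`|f a| + `|f b|) => x Kx.
rewrite ler_norml; have := aP x; have := bP x; rewrite !inE => h1 h2.
have {}h1 := h1 Kx; have {}h2 := h2 Kx.
have := ler_norm (f a); have := ler_norm (- f b); rewrite normrN.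
by have := normr_ge0 (f a); have := normr_ge0 (f b); lra.
Qed.

Lemma smooth_compact_bound V K (f : rV -> R) : compact K -> K `<=` V -> smooth_on V f ->
  exists C : R, forall x, K x -> `|f x| <= C.
Proof.
move=> cK KV sf; apply: compact_bound => //.
by apply: continuous_in_subspaceT => x; rewrite inE => /KV; apply: smooth_on_continuous.
Qed.

Lemma ufamily_indep (I : Type) V K (f : rV -> R[i]) : compact K -> K `<=` V ->
  csmooth_on V f -> ufamily V K (fun _ : I => f).
Proof.
move=> cK KV sf; split=> // s.
have [sr si] := csmooth_on_citer [seq e_ i | i <- s] sf.
have [C CP] := smooth_compact_bound cK KV sr; have [D DP] := smooth_compact_bound cK KV si.
exists (C + D) => _ x Kx; apply: (le_trans (normc_le _)).
by rewrite lerD ?CP ?DP.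
Qed.

Definition tfamily (I : Type) K (F : I -> rV -> R[i]) : Prop :=
  ufamily setT K F /\ forall i x, ~ K x -> F i x = 0.

Lemma wderive_out K f s x : closed K -> (forall x, ~ K x -> f x = 0) -> ~ K x -> wderive s f x = 0.
Proof.
move=> cK f0 Kx; rewrite (@wderive_eq_on (~` K) _ (fun=> 0)) ?wderive_cst//; first by case: s.
exact: closed_openC.
Qed.

Lemma csmooth_supp V K f : open V -> closed K -> K `<=` V -> csmooth_on V f ->
  (forall x, ~ K x -> f x = 0) -> csmooth_on setT f.
Proof.
move=> oV cK KV sf f0.
apply: (@csmooth_onS _ _ (V `|` ~` K)).
  by move=> x _; have [/KV|] := pselect (K x); [left|right].
apply: csmooth_onU => //; apply: (@csmooth_on_eq _ _ _ (fun=> 0)).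
- exact: closed_openC.
- by move=> y Ky; rewrite f0.
- exact: csmooth_on_cst.
Qed.

Lemma tfamilyD (I : Type) K (F G : I -> rV -> R[i]) : tfamily K F -> tfamily K G -> tfamily K (fun i x => F i x + G i x).
Proof.
move=> [uF F0] [uG G0]; split=> [|i x Kx]; last by rewrite F0// G0// addr0.
by apply: ufamilyD => //; exact: openT.
Qed.

Lemma tfamily_derive (I : Type) K (F : I -> rV -> R[i]) j : closed K -> tfamily K F -> tfamily K (fun i => cderive (e_ j) (F i)).
Proof.
move=> cK [uF F0]; split=> [|i x Kx]; first exact: ufamily_derive.
by have := wderive_out [:: j] cK (F0 i) Kx.
Qed.

Section TClass.
Context (I : Type) (V K : set rV) (oV : open V) (cK : closed K) (KV : K `<=` V).
Implicit Types F G : I -> rV -> R[i].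

Lemma tfamilyM F G : ufamily V K F -> tfamily K G -> tfamily K (fun i x => F i x * G i x).
Proof.
move=> uF [uG G0]; split=> [|i x Kx]; last by rewrite G0// mulr0.
have uG' : ufamily V K G by apply: ufamilyS uG.
have [sM bM] := ufamilyM oV KV uF uG'.
split=> // i; apply: (csmooth_supp oV cK KV) => // x Kx.
by rewrite G0// mulr0.
Qed.

End TClass.

Lemma tfamilyZ (I : Type) K (F : I -> rV -> R[i]) (c : I -> R[i]) C : closed K ->
  (forall i, cmod (c i) <= C) -> tfamily K F -> tfamily K (fun i x => c i * F i x).
Proof.
move=> cK cC tF; apply: (tfamilyM openT cK (@subsetT _ K) _ tF); exact: (ufamily_cst _ _ cC).
Qed.

Lemma tfamily_sum (I J : Type) K (r : seq J) (F : J -> I -> rV -> R[i]) : closed K ->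
  (forall j, tfamily K (F j)) -> tfamily K (fun i x => \sum_(j <- r) F j i x).
Proof.
move=> cK tF; elim: r => [|j r IH].
  have -> : (fun i x => \sum_(j <- [::]) F j i x) = fun (_ : I) (_ : rV) => 0 : R[i].
    by apply/funext => i; apply/funext => x; rewrite big_nil.
  by split=> //; apply: (@ufamily_cst I setT K (fun=> 0) 0) => i; rewrite normc0.
have := tfamilyD (tF j) IH; congr tfamily.
by apply/funext => i; apply/funext => x; rewrite big_cons.
Qed.

Lemma tfamily_bound (I : Type) K (F : I -> rV -> R[i]) : tfamily K F ->
  exists C : R, forall i x, cmod (F i x) <= C.
Proof.
move=> [/ufamily_bound[C CP] F0]; exists (Num.max C 0) => i x.
have [Kx|Kx] := pselect (K x); first by rewrite le_max CP.
by rewrite F0// normc0 le_max lexx orbT.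
Qed.

End Families.

(** * The Fourier transform *)

Section Fourier.
Context {R : realType}.
Local Notation e_ i := (delta_mx 0 i).

Definition cube n (M : R) : set 'rV[R]_n := [set x | forall i, `|x 0 i| <= M].

Lemma compact_cube n M : compact (@cube n M).
Proof.
apply: (@rV_compact R n (fun _ => [set t : R | `|t| <= M])) => _; have -> : [set t : R | `|t| <= M] = `[- M, M]%classic.
  by apply/seteqP; split => t /=; rewrite ler_norml.
exact: segment_compact.
Qed.

Lemma closed_cube n M : closed (@cube n M).
Proof. by apply: compact_closed; [exact: norm_hausdorff|exact: compact_cube]. Qed.

Lemma weight_cube n M (x : 'rV[R]_n) : cube M x -> (1 + M ^+ 2)^-1 ^+ n <= weight x.
Proof.
move=> Mx; rewrite -[n in _ ^+ n]card_ord -prodr_const; apply: ler_prod => i _.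
have /andP[h1 h2] := weight_factor M; rewrite ltW//=.
have /andP[h3 h4] := weight_factor (x 0 i).
rewrite lef_pV2 ?posrE; [|by rewrite -invr_gt0|by rewrite -invr_gt0].
rewrite lerD2l -[x 0 i ^+ 2]real_normK ?num_real//.
by rewrite ler_sqr ?nnegrE ?Mx// (le_trans _ (Mx i)).
Qed.

Lemma bounded_cube_weight n (F : 'rV[R]_n -> R) M C : (forall x, `|F x| <= C) ->
  (forall x, ~ cube M x -> F x = 0) -> forall x, `|F x| <= C * (1 + M ^+ 2) ^+ n * weight x.
Proof.
move=> FC F0 x; have C0 : 0 <= C := le_trans (normr_ge0 _) (FC x).
have [Mx|Mx] := pselect (cube M x); last first.
  by rewrite F0// normr0 !mulr_ge0 ?weight_ge0// exprn_ge0// addr_ge0 ?sqr_ge0.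
apply: (le_trans (FC x)); rewrite -mulrA ler_peMr//.
have M0 : 0 < 1 + M ^+ 2 by have := sqr_ge0 M; lra.
apply: (@le_trans _ _ ((1 + M ^+ 2) ^+ n * (1 + M ^+ 2)^-1 ^+ n)).
  by rewrite -exprMn divff ?gt_eqF// expr1n.
by rewrite ler_wpM2l ?weight_cube// exprn_ge0// ltW.
Qed.

Lemma smooth_vmeas n (F : 'rV[R]_n -> R) : smooth_on setT F -> vmeas F.
Proof. by move=> sF; apply: continuous_vmeas => x; exact: smooth_on_continuous sF I. Qed.

Lemma smooth_cube_bound n (F : 'rV[R]_n -> R) M : smooth_on setT F ->
  (forall x, ~ cube M x -> F x = 0) -> exists C : R, forall x, `|F x| <= C.
Proof.
move=> sF F0; have [C CP] := smooth_compact_bound (@compact_cube n M) (@subsetT _ _) sF.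
exists (Num.max C 0) => x; have [Mx|Mx] := pselect (cube M x); first by rewrite le_max CP.
by rewrite F0// normr0 le_max lexx orbT.
Qed.

Lemma smooth_cube_wbounded n (F : 'rV[R]_n -> R) M : smooth_on setT F ->
  (forall x, ~ cube M x -> F x = 0) -> wbounded F.
Proof.
move=> sF F0; split; first exact: smooth_vmeas.
have [C CP] := smooth_cube_bound sF F0.
by exists (C * (1 + M ^+ 2) ^+ n); exact: bounded_cube_weight.
Qed.

Lemma derive_out n (F : 'rV[R]_n -> R) M v x : (forall x, ~ cube M x -> F x = 0) ->
  ~ cube M x -> 'D_v F x = 0.
Proof.
move=> F0 Mx; rewrite (@derive_eq_on _ _ _ (~` cube M) _ (cst 0)) ?derive_cst//.
exact/closed_openC/closed_cube.
Qed.

Lemma int_derive_compact (g : R -> R) M : smooth_on setT g -> (forall t, M < `|t| -> g t = 0) ->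
  \int[lebesgue_measure]_(t in [set: R]) 'D_1 g t = 0.
Proof.
move=> sg g0.
pose a := `|M| + 1; have a0 : 0 < a by rewrite ltr_wpDl.
have Ma : M < a by rewrite /a; have := ler_norm M; lra.
have oM : open [set t : R | M < `|t|].
  apply: (@open_comp _ _ (fun t : R => `|t|) [set y | M < y]); last exact: open_gt.
  by move=> t _; exact: norm_continuous.
have f0 t : M < `|t| -> 'D_1 g t = 0.
  by move=> Mt; rewrite (@derive_eq_on _ _ _ [set t : R | M < `|t|] _ (cst 0)) ?derive_cst.
have cg (h : R -> R) : smooth_on setT h -> continuous h.
  by move=> sh t; exact: smooth_on_continuous sh I.
rewrite /Rintegral; have -> : (\int[lebesgue_measure]_t ('D_1 g t)%:E =
    \int[lebesgue_measure]_(t in `[(- a)%R, a]) ('D_1 g t)%:E)%E.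
  rewrite [RHS]integral_mkcond; apply: eq_integral => t _.
  rewrite /patch; case: ifPn => //; rewrite notin_setE /= in_itv => /negP.
  rewrite -ler_norml -ltNge => at_; rewrite f0//; exact: lt_trans at_.
rewrite (@continuous_FTC2 _ _ g).
- by rewrite (g0 a) ?gtr0_norm// (g0 (- a)) ?normrN ?gtr0_norm// subee.
- lra.
- by apply: continuous_subspaceT; apply: cg; exact: smooth_on_derive.
- split.
  + by move=> t _; apply: diff_derivable; exact: smooth_on_diff sg I.
  + by apply: cvg_at_right_filter; exact: cg.
  + by apply: cvg_at_left_filter; exact: cg.
- by move=> t _; rewrite derive1E.
Qed.

Lemma row_mx_differentiable n (t : R) (y : 'rV[R]_n) :
  differentiable (fun y : 'rV[R]_n => row_mx t%:M y : 'rV_n.+1) y.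
Proof.
apply: differentiable_row => i; case: (unliftP ord0 i) => [j|] ->.
  have -> : (fun y : 'rV[R]_n => (row_mx t%:M y : 'rV_n.+1) 0 (lift ord0 j)) = (fun y => y 0 j).
    by apply/funext => z; rewrite row_mxSS.
  exact: differentiable_coord.
have -> : (fun y : 'rV[R]_n => (row_mx t%:M y : 'rV_n.+1) 0 ord0) = cst t.
  by apply/funext => z; rewrite row_mxS0.
exact: differentiable_cst.
Qed.

Lemma row_mx_differentiable0 n (t : R) (y : 'rV[R]_n) :
  differentiable (fun t : R => row_mx t%:M y : 'rV_n.+1) t.
Proof.
apply: differentiable_row => i; case: (unliftP ord0 i) => [j|] ->.
  have -> : (fun t : R => (row_mx t%:M y : 'rV_n.+1) 0 (lift ord0 j)) = cst (y 0 j).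
    by apply/funext => z; rewrite row_mxSS.
  exact: differentiable_cst.
have -> : (fun t : R => (row_mx t%:M y : 'rV_n.+1) 0 ord0) = id.
  by apply/funext => z; rewrite row_mxS0.
by case: (is_diff_id t).
Qed.

Lemma row_mx_affine n (t : R) (x : 'rV[R]_n) h v :
  (row_mx t%:M (h *: v + x) : 'rV_n.+1) = h *: row_mx (0 : 'M[R]_1) v + row_mx t%:M x.
Proof. by rewrite scale_row_mx add_row_mx scaler0 add0r. Qed.

Lemma row_mx_affine0 n (y : 'rV[R]_n) (t h v : R) :
  (row_mx (h *: v + t)%:M y : 'rV_n.+1) = h *: row_mx v%:M (0 : 'rV_n) + row_mx t%:M y.
Proof.
apply/rowP => i; rewrite [RHS]mxE [X in _ = X + _]mxE.
case: (unliftP ord0 i) => [j|] ->; last by rewrite !row_mxS0.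
by rewrite !row_mxSS mxE mulr0 add0r.
Qed.

Lemma row_mx_delta n (j : 'I_n) :
  (row_mx (0 : 'M[R]_1) (e_ j : 'rV[R]_n) : 'rV[R]_n.+1) = e_ (lift ord0 j).
Proof.
apply/rowP => i; case: (unliftP ord0 i) => [k|] ->.
  have -> : (0 : 'M[R]_1) = (0 : R)%:M by apply/matrixP => a b; rewrite !mxE mul0rn.
  by rewrite row_mxSS !mxE.
have -> : (0 : 'M[R]_1) = (0 : R)%:M by apply/matrixP => a b; rewrite !mxE mul0rn.
by rewrite row_mxS0 !mxE.
Qed.

Lemma row_mx_delta0 n : (row_mx (1 : R)%:M (0 : 'rV_n) : 'rV[R]_n.+1) = e_ ord0.
Proof.
apply/rowP => i; case: (unliftP ord0 i) => [k|] ->; first by rewrite row_mxSS !mxE.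
by rewrite row_mxS0 !mxE.
Qed.

Lemma rint1E (h : 'rV[R]_1 -> R) : wbounded h ->
  rint h = \int[lebesgue_measure]_(t in [set: R]) h t%:M.
Proof.
move=> wh; congr fine; apply: eq_integral => t _.
by congr (h _)%:E; apply/rowP => i; rewrite ord1 row_mxS0 !mxE.
Qed.

Lemma wbounded2_row n (F : 'rV[R]_n.+1 -> R) : wbounded F ->
  wbounded2 (fun (x : 'rV[R]_1) (y : 'rV_n) => F (row_mx x y)).
Proof.
move=> [mF [C CF]]; split.
  have mp : measurable_fun setT
      (fun e : E 1 * E n => ((e.1).1 : measurableTypeR R, e.2) : E n.+1).
    apply: measurable_fun_pair; last exact: measurable_snd.
    exact: (measurableT_comp measurable_fst measurable_fst).
  have := measurableT_comp mF mp; congr measurable_fun; apply/funext => -[[t []] y] /=.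
  have -> // : (row_mx t%:M 0 : 'rV[R]_1) = t%:M.
  by apply/rowP => i; rewrite ord1 row_mxS0 !mxE.
exists C => x y; apply: (le_trans (CF _)).
have -> : x = (x 0 0)%:M by apply/rowP => i; rewrite ord1 !mxE.
rewrite weightS.
by rewrite /weight big_ord_recl big_ord0 mulr1 !mxE.
Qed.

(** The first coordinate is integrated outermost, so its case exchanges the integrals before using
    the one-variable result; the other coordinates are treated by induction inside the slices. *)
Lemma rint_derive n (G : 'rV[R]_n -> R) M j : smooth_on setT G ->
  (forall x, ~ cube M x -> G x = 0) -> rint (fun x => 'D_(e_ j) G x) = 0.
Proof.
elim: n G j => [|n IH] G j sG G0; first by case: j.
have wF : wbounded (fun x => 'D_(e_ j) G x).
  by apply: (smooth_cube_wbounded (M := M)); [exact: smooth_on_derive|move=> x; exact: derive_out].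
move: wF; case: (unliftP ord0 j) => [k|] -> wF.
  rewrite rintS//; apply: etrans (_ : \int[lebesgue_measure]_(t in [set: R]) 0 = 0).
    congr fine; apply: eq_integral => t _; congr (_%:E).
    have := IH (fun y => G (row_mx t%:M y)) k; rewrite -row_mx_delta => <-.
    - congr rint; apply/funext => y.
      have := iter_derive_affine G [:: e_ k] (@row_mx_affine n t).
      by move=> /(congr1 (fun f => f y)).
    - apply: (@smooth_on_affine _ _ _ _ setT setT _ (fun v => row_mx (0 : 'M[R]_1) v : 'rV_n.+1)) => //.
        exact: row_mx_affine.
      by move=> y _; exact: row_mx_differentiable.
    - move=> y My; apply: G0 => h; apply: My => i.
      by have := h (lift ord0 i); rewrite row_mxSS.
  by rewrite /Rintegral integral0.
have w2 := wbounded2_row wF.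
transitivity (rint (fun x : 'rV[R]_1 => rint (fun y : 'rV_n => 'D_(e_ ord0) G (row_mx x y)))).
  by rewrite (rintS wF) (rint1E (wbounded2_rint w2)).
rewrite (rint_fubini w2).
have -> : (fun y : 'rV_n => rint (fun x : 'rV[R]_1 => 'D_(e_ ord0) G (row_mx x y))) =
    fun=> 0 * weight (0 : 'rV_n).
  apply/funext => y; rewrite mul0r rint1E; last exact: wbounded2_wbounded (wbounded2_swap w2).
  have E : (fun t => 'D_1 (fun t0 => G (row_mx t0%:M y)) t) =
      (fun t => 'D_(row_mx (1 : R)%:M 0) G (row_mx t%:M y)).
    have := @iter_derive_affine _ R^o _ _ _ _ G [:: 1] (@row_mx_affine0 n y).
    by move=> /(congr1 (fun f : R -> R => f)).
  have := @int_derive_compact (fun t => G (row_mx t%:M y)) M; rewrite -row_mx_delta0 => <-.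
  - by rewrite E.
  - apply: (@smooth_on_affine _ _ _ _ setT setT _ (fun v : R => row_mx v%:M (0 : 'rV_n) : 'rV_n.+1)) => //.
      by move=> t h v; exact: row_mx_affine0.
    by move=> t _; exact: row_mx_differentiable0.
  - move=> t Mt; apply: G0 => h; have := h ord0; rewrite row_mxS0.
    by rewrite leNgt Mt.
have -> : (fun _ : 'rV[R]_n => 0 * weight (0 : 'rV[R]_n)) = (fun x : 'rV_n => 0 * weight x).
  by apply/funext => x; rewrite !mul0r.
by rewrite (rintZ _ (@wbounded_weight R n)) mul0r.
Qed.

Lemma cint_derive n (f : 'rV[R]_n -> R[i]) M j : csmooth_on setT f ->
  (forall x, ~ cube M x -> f x = 0) -> cint_rV (cderive (e_ j) f) = 0.
Proof.
move=> [sr si] f0; apply: complexE2.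
  by apply: rint_derive sr _ => x /f0 ->.
by apply: rint_derive si _ => x /f0 ->.
Qed.

Lemma csmooth_cwbounded n (f : 'rV[R]_n -> R[i]) M : csmooth_on setT f ->
  (forall x, ~ cube M x -> f x = 0) -> cwbounded f.
Proof.
move=> [sr si] f0; split; [apply: smooth_cube_wbounded sr _|apply: smooth_cube_wbounded si _];
by move=> x /f0 ->.
Qed.

Section Waves.
Context {n : nat}.
Implicit Types (z : 'rV[R]_n).

Lemma derive_comp1 {U : normedModType R} (h : R -> R) (f : U -> R) (x v : U) (dh : R) :
  differentiable f x -> is_derive (f x) (1 : R) h dh -> 'D_v (h \o f) x = 'D_v f x * dh.
Proof.
move=> df hh; have dh' : differentiable h (f x) by apply/derivable1_diffP.
rewrite !deriveE//; last exact: differentiable_comp.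
by rewrite diff_comp//= diff1E// derive1E (@derive_val _ _ _ _ _ _ _ hh).
Qed.

Lemma smooth_coord (A : set 'rV[R]_n) i : open A -> smooth_on A (fun x => x 0 i).
Proof.
move=> oA; apply: (smooth_on_coord (T := id) i oA).
by apply: (@smooth_on_linear _ _ _ A idfun) => x.
Qed.

Lemma smooth_dotv A z : open A -> smooth_on A (fun x => dotv x z).
Proof.
move=> oA; apply: smooth_on_sum => // i; apply: smooth_onM => //; first exact: smooth_coord.
exact: smooth_on_cst.
Qed.

Lemma derive_dotv z v (x : 'rV[R]_n) : 'D_v (fun x => dotv x z) x = dotv v z.
Proof.
have ll : linear (fun x => dotv x z) by move=> a b c; rewrite dotvDl dotvZl.
pose lM := GRing.isLinear.Build _ _ _ _ _ ll.
pose l : {linear 'rV[R]_n -> R} := HB.pack (fun x => dotv x z) lM.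
have cl : continuous l by move=> y; apply: smooth_on_continuous (smooth_dotv z openT) I.
rewrite -[fun x => _]/(l : _ -> _) deriveE; last exact: linear_differentiable.
by rewrite diff_lin.
Qed.

Lemma is_derive_shift_cos (c t : R) : is_derive t (1 : R) (fun t => cos (t + c)) (- sin (t + c)).
Proof.
have h := @is_derive1_comp R cos (fun t => t + c) t (- sin (t + c)) 1 (is_derive_cos _) _.
rewrite -[X in is_derive _ _ _ X]mulr1.
have := is_deriveD (is_derive_id t (1 : R)) (is_derive_cst c t (1 : R)); rewrite addr0.
exact.
Qed.

(** The phase makes the family stable: each derivative shifts it by pi / 2. Sine is obtained with
    the phase -pi / 2. *)
Lemma smooth_cos {U : normedModType R} (A : set U) (f : U -> R) (c : R) : open A ->
  smooth_on A f -> smooth_on A (fun x => cos (f x + c)).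
Proof.
move=> oA sf.
have := @smooth_on_comp1 R U A setT (fun k t => cos (t + (c + k%:R * (pi / 2)))) f oA.
have -> : (fun x => cos (f x + (c + 0%:R * (pi / 2)))) = (fun x => cos (f x + c)).
  by rewrite mul0r addr0.
apply => // k t _.
have -> : cos (t + (c + k.+1%:R * (pi / 2))) = - sin (t + (c + k%:R * (pi / 2))).
  by rewrite -cosDpihalf; congr cos; ring.
exact: is_derive_shift_cos.
Qed.

Lemma csmooth_cis {U : normedModType R} (A : set U) (f : U -> R) : open A ->
  smooth_on A f -> csmooth_on A (fun x => cis (f x)).
Proof.
move=> oA sf; split.
  have := smooth_cos 0 oA sf; congr smooth_on; apply/funext => x.
  by rewrite addr0.
have := smooth_cos (- (pi / 2)) oA sf; congr smooth_on; apply/funext => x.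
by rewrite -sinDpihalf subrK.
Qed.

Lemma cderive_cis {U : normedModType R} (f : U -> R) (x v : U) : differentiable f x ->
  cderive v (fun x => cis (f x)) x = (0 +i* 'D_v f x) * cis (f x).
Proof.
move=> df; apply: complexE2; rewrite /cderive/=.
  have := derive_comp1 v df (is_derive_cos (f x)); rewrite /comp => ->; ring.
have := derive_comp1 v df (is_derive_sin (f x)); rewrite /comp => ->; ring.
Qed.

Definition fourier (f : 'rV[R]_n -> R[i]) z : R[i] := cint_rV (fun y => f y * cis (- dotv y z)).

Lemma csmooth_wave A z : open A -> csmooth_on A (fun y => cis (- dotv y z)).
Proof. by move=> oA; apply: csmooth_cis => //; apply: smooth_onN => //; exact: smooth_dotv. Qed.

Lemma cderive_wave z v y :
  cderive v (fun y => cis (- dotv y z)) y = (0 +i* (- dotv v z)) * cis (- dotv y z).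
Proof.
have dd : differentiable (fun y => dotv y z) y by exact: smooth_on_diff (smooth_dotv z openT) I.
rewrite cderive_cis; last exact: differentiableN.
have dv : derivable (fun y => dotv y z) y v by exact: diff_derivable.
by rewrite (deriveN dv) derive_dotv.
Qed.

Lemma cwbounded_wave (f : 'rV[R]_n -> R[i]) M z : csmooth_on setT f ->
  (forall x, ~ cube M x -> f x = 0) -> cwbounded (fun y => f y * cis (- dotv y z)).
Proof.
move=> sf f0; apply: (csmooth_cwbounded (M := M)) => [|x /f0 ->]; last by rewrite mul0r.
by apply: csmooth_onM => //; [exact: openT|exact: csmooth_wave openT].
Qed.

Lemma dotv_delta (j : 'I_n) z : dotv (e_ j) z = z 0 j.
Proof.
rewrite /dotv (bigD1 j)//= big1 ?addr0 => [|i ij]; first by rewrite mxE !eqxx mul1r.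
by rewrite mxE (negbTE ij) mul0r.
Qed.

Lemma fourier_derive (f : 'rV[R]_n -> R[i]) M j z : csmooth_on setT f ->
  (forall x, ~ cube M x -> f x = 0) ->
  fourier (cderive (e_ j) f) z = (0 +i* z 0 j) * fourier f z.
Proof.
move=> sf f0; have sw := csmooth_wave z openT.
have sfw := csmooth_onM openT sf sw.
have fw0 x : ~ cube M x -> f x * cis (- dotv x z) = 0 by move=> /f0 ->; rewrite mul0r.
have h1 := cint_derive j sfw fw0.
have w1 : cwbounded (fun y => cderive (e_ j) f y * cis (- dotv y z)).
  apply: (csmooth_cwbounded (M := M)).
    by apply: csmooth_onM => //; [exact: openT|exact: csmooth_on_derive].
  move=> x Mx; have := wderive_out [:: j] (@closed_cube n M) f0 Mx.
  by rewrite wderive_cons wderive_nil => ->; rewrite mul0r.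
have w2 : cwbounded (fun y => f y * cis (- dotv y z)) by exact: csmooth_cwbounded sfw fw0.
have : cint_rV (fun y => cderive (e_ j) f y * cis (- dotv y z) +
    (0 +i* (- z 0 j)) * (f y * cis (- dotv y z))) = 0.
  rewrite -[RHS]h1; congr cint_rV; apply/funext => y.
  rewrite (@cderiveM _ _ setT)// cderive_wave dotv_delta; ring.
rewrite cint_add//; last exact: cwboundedZ.
rewrite cint_scale// => /eqP; rewrite addr_eq0 => /eqP h.
by rewrite [LHS]h; simpc.
Qed.

Lemma fourier_sub (f g : 'rV[R]_n -> R[i]) M z : csmooth_on setT f -> csmooth_on setT g ->
  (forall x, ~ cube M x -> f x = 0) -> (forall x, ~ cube M x -> g x = 0) ->
  fourier (fun x => f x + (-1) * g x) z = fourier f z - fourier g z.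
Proof.
move=> sf sg f0 g0.
have wf := cwbounded_wave z sf f0; have wg := cwbounded_wave z sg g0.
rewrite -[X in _ = _ + X]mulN1r -(cint_scale _ wg) -(cint_add wf (cwboundedZ _ wg)).
by congr cint_rV; apply/funext => y; ring.
Qed.

Lemma fourier_le (f : 'rV[R]_n -> R[i]) M C z : csmooth_on setT f ->
  (forall x, ~ cube M x -> f x = 0) -> (forall x, cmod (f x) <= C) ->
  cmod (fourier f z) <= C * (1 + M ^+ 2) ^+ n * (2 * pi ^+ n).
Proof.
move=> sf f0 fC.
apply: cint_weight_le; first exact: cwbounded_meas (cwbounded_wave z sf f0).
move=> x; rewrite normcM normc_cis mulr1.
have := @bounded_cube_weight n (fun x => cmod (f x)) M C.
move=> /(_ _ _ x); rewrite ger0_norm ?normc_ge0//; apply.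
  by move=> y; rewrite ger0_norm ?normc_ge0.
by move=> y /f0 ->; rewrite normc0.
Qed.

(* Multiplication of the transform by (1 + z_j^2) is the operator 1 - d_j^2. *)
Lemma fourier_weight (I : Type) K M (F : I -> 'rV[R]_n -> R[i]) (p : nat) :
  closed K -> K `<=` cube M -> tfamily K F ->
  exists2 G, tfamily K G &
    forall i z, fourier (F i) z = (weight z ^+ p)%:C * fourier (G i) z.
Proof.
move=> cK KM.
have step (r : seq 'I_n) (F' : I -> 'rV[R]_n -> R[i]) : tfamily K F' -> exists2 G, tfamily K G &
    forall i z, fourier (F' i) z = (\prod_(j <- r) (1 + z 0 j ^+ 2)^-1)%:C * fourier (G i) z.
  elim: r F' => [|j r IH] F' tF.
    by exists F' => // i z; rewrite big_nil mul1r.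
  pose G i x := F' i x + (-1) * cderive (e_ j) (cderive (e_ j) (F' i)) x.
  have tD := tfamily_derive j cK tF; have tDD := tfamily_derive j cK tD.
  have tG : tfamily K G.
    by apply: tfamilyD => //; apply: (tfamilyZ (c := fun=> -1) (C := cmod (-1))).
  have [H tH HE] := IH G tG; exists H => // i z.
  have out (F1 : I -> 'rV[R]_n -> R[i]) : tfamily K F1 -> forall x, ~ cube M x -> F1 i x = 0.
    by move=> [_ h] x Mx; apply: h => /KM.
  have sm (F1 : I -> 'rV[R]_n -> R[i]) : tfamily K F1 -> csmooth_on setT (F1 i).
    by move=> [[h _] _].
  have : fourier (G i) z = (1 + z 0 j ^+ 2)%:C * fourier (F' i) z.
    rewrite (fourier_sub z (sm _ tF) (sm _ tDD) (out _ tF) (out _ tDD)).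
    rewrite (fourier_derive j z (sm _ tD) (out _ tD)) (fourier_derive j z (sm _ tF) (out _ tF)).
    by apply: complexE2; rewrite /=; ring.
  rewrite HE => h; rewrite big_cons.
  have /andP[+ _] := weight_factor (z 0 j); rewrite invr_gt0 => z0.
  have -> : ((1 + z 0 j ^+ 2)^-1 * \prod_(j0 <- r) (1 + z 0 j0 ^+ 2)^-1)%:C * fourier (H i) z =
    ((1 + z 0 j ^+ 2)^-1)%:C * ((\prod_(j0 <- r) (1 + z 0 j0 ^+ 2)^-1)%:C * fourier (H i) z).
    by rewrite mulrA -rmorphM.
  by rewrite h mulrA -rmorphM mulVf ?gt_eqF// mul1r.
elim: p F => [|p IH] F tF; first by exists F => // i z; rewrite mul1r.
have [G tG GE] := step (index_enum 'I_n) F tF; have [H tH HE] := IH G tG.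
exists H => // i z; rewrite GE HE mulrA -rmorphM.
by rewrite exprS.
Qed.

Theorem fourier_decay (I : Type) K M (F : I -> 'rV[R]_n -> R[i]) (p : nat) :
  closed K -> K `<=` cube M -> tfamily K F ->
  exists C : R, forall i z, cmod (fourier (F i) z) <= C * weight z ^+ p.
Proof.
move=> cK KM tF; have [G tG GE] := fourier_weight p cK KM tF.
have [C CP] := tfamily_bound tG; have [[sG _] G0] := tG.
exists (C * (1 + M ^+ 2) ^+ n * (2 * pi ^+ n)) => i z.
rewrite GE normcM normcR ger0_norm ?exprn_ge0 ?weight_ge0// mulrC.
rewrite ler_wpM2r ?exprn_ge0 ?weight_ge0//; apply: fourier_le => //.
by move=> x Mx; apply: G0 => /KM.
Qed.

End Waves.
End Fourier.

(** * Integrals of damped waves *)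

Section HalfLine.
Context {R : realType}.
Notation mu := lebesgue_measure.

(** The summand 1 keeps the integrand nonnegative, as the fundamental theorem on a half-line
    requires; the phase [d] covers both cosine and sine. *)
Definition damped (e s d t : R) := expR (- e * t) * (1 + cos (s * t + d)).

Definition damped_prim (e s d t : R) := expR (- e * t) *
  (- e^-1 + (e ^+ 2 + s ^+ 2)^-1 * (s * sin (s * t + d) - e * cos (s * t + d))).

Lemma is_derive_continuous (f : R -> R) (t df : R) : is_derive t (1 : R) f df ->
  {for t, continuous f}.
Proof. by move=> h; apply: differentiable_continuous; apply/derivable1_diffP. Qed.

Lemma is_derive_lin (s d t : R) : is_derive t (1 : R) (fun t => s * t + d) s.
Proof.
have := is_deriveD (is_deriveZ s (is_derive_id t (1 : R))) (is_derive_cst d t (1 : R)).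
by rewrite addr0 /GRing.scale/= mulr1.
Qed.

Lemma is_derive_compl (f : R -> R) (s d t df : R) : is_derive (s * t + d) (1 : R) f df ->
  is_derive t (1 : R) (fun t => f (s * t + d)) (s * df).
Proof.
move=> hf; rewrite [s * df]mulrC.
have := @is_derive1_comp R f (fun t => s * t + d) t df s hf (is_derive_lin s d t).
exact.
Qed.

Lemma is_derive_exp_lin (e t : R) : is_derive t (1 : R) (fun t => expR (- e * t)) (- e * expR (- e * t)).
Proof.
have := @is_derive_compl expR (- e) 0 t _ (is_derive_expR _).
by rewrite addr0; congr is_derive; apply/funext => u; rewrite addr0.
Qed.

Lemma is_derive_damped_prim (e s d t : R) : 0 < e ->
  is_derive t (1 : R) (damped_prim e s d) (damped e s d t).
Proof.
move=> e0; have es : e ^+ 2 + s ^+ 2 != 0 by rewrite gt_eqF// ltr_pwDl ?exprn_gt0// sqr_ge0.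
have h1 := @is_derive_compl sin s d t _ (is_derive_sin _).
have h2 := @is_derive_compl cos s d t _ (is_derive_cos _).
have h3 := is_deriveB (is_deriveZ s h1) (is_deriveZ e h2).
have h4 := is_deriveD (is_derive_cst (- e^-1) t (1 : R)) (is_deriveZ (e ^+ 2 + s ^+ 2)^-1 h3).
have h5 := is_deriveM (is_derive_exp_lin e t) h4.
move: h5; rewrite /damped.
set D := (X in is_derive _ _ _ X -> _) => h5; suff <- : D = expR (- e * t) * (1 + cos (s * t + d)) by exact: h5.
have -> : D = expR (- e * t) * (0 + (e ^+ 2 + s ^+ 2)^-1 *
      (s * (s * cos (s * t + d)) - e * (s * - sin (s * t + d)))) +
    (- e^-1 + (e ^+ 2 + s ^+ 2)^-1 * (s * sin (s * t + d) - e * cos (s * t + d))) *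
    (- e * expR (- e * t)) by [].
by field; rewrite es gt_eqF.
Qed.

Lemma expR_lin_cvg0 (e : R) : 0 < e -> expR (- e * t) @[t --> +oo] --> (0 : R).
Proof.
move=> e0; have := @cvgr_expR R => h.
have : expR (- (e * t)) @[t --> +oo] --> (0 : R).
  apply: (cvg_comp (G := pinfty_nbhs R) (fun t => e * t) (fun t => expR (- t))) => //.
  by apply: gt0_cvgMry.
by under eq_fun do rewrite -mulNr.
Qed.

Lemma damped_prim_cvg0 (e s d : R) : 0 < e -> damped_prim e s d t @[t --> +oo] --> (0 : R).
Proof.
move=> e0; have h := expR_lin_cvg0 e0.
pose B := e^-1 + `|(e ^+ 2 + s ^+ 2)^-1| * (`|s| + e).
have hB t : `|damped_prim e s d t| <= B * expR (- e * t).
  rewrite normrM mulrC (ger0_norm (expR_ge0 _)) ler_wpM2r ?expR_ge0//.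
  apply: (le_trans (ler_normD _ _)).
  have ei : 0 <= e^-1 by rewrite invr_ge0 ltW.
  rewrite normrN (ger0_norm ei) lerD2l normrM.
  rewrite ler_wpM2l//; apply: (le_trans (ler_normB _ _)); rewrite !normrM lerD//.
    by rewrite ler_piMr// sin_max.
  by rewrite (gtr0_norm e0) ler_piMr ?cos_max// ltW.
apply/cvgr0Pnorm_lt => x x0.
have := @cvgMr _ _ _ _ _ B _ h; rewrite mulr0 => h0.
have hx := (cvgr0Pnorm_lt _).1 (h0 _) x x0.
near=> t; apply: (le_lt_trans (hB t)).
apply: (le_lt_trans (ler_norm _)); near: t; exact: hx.
Unshelve. all: by end_near.
Qed.

Lemma damped_ge0 (e s d t : R) : 0 <= damped e s d t.
Proof.
apply: mulr_ge0; first exact: expR_ge0.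
by have := cos_max (s * t + d).
Qed.

Lemma continuous_damped (e s d : R) : continuous (damped e s d).
Proof.
move=> t; apply: cvgM.
  exact: is_derive_continuous (is_derive_exp_lin e t).
apply: cvgD; first exact: cvg_cst.
exact: is_derive_continuous (@is_derive_compl cos s d t _ (is_derive_cos _)).
Qed.

Lemma integral_damped (e s d : R) : 0 < e ->
  (\int[mu]_(t in `[0%R, +oo[) (damped e s d t)%:E =
   (e^-1 + (e ^+ 2 + s ^+ 2)^-1 * (e * cos d - s * sin d))%:E)%E.
Proof.
move=> e0; rewrite (@ge0_continuous_FTC2y R (damped e s d) (damped_prim e s d) 0 0).
- rewrite add0e /damped_prim mulr0 expR0 mulr0 add0r; congr (_%:E); ring.
- by move=> t _; exact: damped_ge0.
- exact/continuous_subspaceT/continuous_damped.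
- exact: damped_prim_cvg0.
- by move=> t _; case: (is_derive_damped_prim s d t e0).
- by apply: cvg_at_right_filter; exact: is_derive_continuous (is_derive_damped_prim s d 0 e0).
- move=> t _; rewrite derive1E; exact: (@derive_val _ _ _ _ _ _ _ (is_derive_damped_prim s d t e0)).
Qed.

Lemma integral_damped_full (e s d : R) : 0 < e ->
  (\int[mu]_t (expR (- e * `|t|) * (1 + cos (s * t + d)))%:E =
   (2 * e^-1 + (e ^+ 2 + s ^+ 2)^-1 * (2 * e * cos d))%:E)%E.
Proof.
move=> e0; have dneg t : damped e (- s) d (- t) = expR (e * t) * (1 + cos (s * t + d)).
  by rewrite /damped !mulrNN.
have cneg : continuous (fun t => damped e (- s) d (- t)).
  by move=> t; apply: (cvg_comp (@GRing.opp R) (damped e (- s) d)); [exact: opp_continuous|exact: continuous_damped].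
have cf : continuous (fun t => expR (- e * `|t|) * (1 + cos (s * t + d))).
  move=> t; apply: cvgM; last first.
    have hc := @is_derive_compl cos s d t _ (is_derive_cos _).
    apply: cvgD; first exact: cvg_cst.
    exact: is_derive_continuous hc.
  apply: (cvg_comp (fun t => - e * `|t|) expR); last exact: continuous_expR.
  by apply: cvgMr; exact: norm_continuous.
have m (A : set R) : measurable A ->
    measurable_fun A (fun t : R => (expR (- e * `|t|) * (1 + cos (s * t + d)))%:E).
  by move=> mA; apply/measurable_EFinP; apply: measurable_funTS; exact: continuous_measurable_fun.
rewrite -(setUv `[0%R, +oo[) setCitvr ge0_integral_setU//=; last 2 first.
- by apply: m; exact: measurableU.
- by rewrite -setCitvr; apply/disj_setPCl.
have -> : (\int[mu]_(t in `[0%R, +oo[) (expR (- e * `|t|) * (1 + cos (s * t + d)))%:E =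
    \int[mu]_(t in `[0%R, +oo[) (damped e s d t)%:E)%E.
  apply: eq_integral => t; rewrite inE/= in_itv andbT => t0.
  by rewrite ger0_norm.
have -> : (\int[mu]_(t in `]-oo, 0%R[) (expR (- e * `|t|) * (1 + cos (s * t + d)))%:E =
    \int[mu]_(t in `]-oo, (- 0)%R]) (damped e (- s) d (- t))%:E)%E.
  transitivity (\int[mu]_(t in `]-oo, 0%R[) (damped e (- s) d (- t))%:E)%E.
    apply: eq_integral => t; rewrite inE => t0.
    by rewrite ler0_norm ?mulrNN ?dneg// ltW.
  rewrite oppr0; apply: integral_itv_bndo_bndc; apply/measurable_EFinP.
  by apply: measurable_funTS; exact: continuous_measurable_fun.
rewrite ge0_integration_by_substitutionNy; last 2 first.
- exact/continuous_subspaceT.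
- by move=> t _; exact: damped_ge0.
have -> : (\int[mu]_(t in `[0%R, +oo[) (((fun t => damped e (- s) d (- t)) \o @GRing.opp R) t)%:E =
    \int[mu]_(t in `[0%R, +oo[) (damped e (- s) d t)%:E)%E.
  by apply: eq_integral => t _ /=; rewrite opprK.
rewrite !integral_damped// -EFinD; congr (_%:E); rewrite sqrrN; ring.
Qed.

(** Squaring 1 + x / 2 <= exp (x / 2) at x = e |t| gives the quadratic decay. *)
Lemma exp_abs_le (e t : R) : 0 < e <= 1 -> expR (- e * `|t|) <= 4 / e ^+ 2 * (1 + t ^+ 2)^-1.
Proof.
move=> /andP[e0 e1]; have h : 1 + e / 2 * `|t| <= expR (e / 2 * `|t|).
  by apply: expR_ge1Dx.
have p0 : 0 < 1 + t ^+ 2 by rewrite ltr_pwDl// sqr_ge0.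
have -> : expR (- e * `|t|) = (expR (e / 2 * `|t|) ^+ 2)^-1.
  by rewrite -expRM_natl -expRN; congr expR; field.
have -> : 4 / e ^+ 2 * (1 + t ^+ 2)^-1 = ((e / 2) ^+ 2 * (1 + t ^+ 2))^-1.
  by field; rewrite !gt_eqF.
rewrite lef_pV2 ?posrE ?mulr_gt0 ?expR_gt0 ?divr_gt0//.
have hs : (1 + e / 2 * `|t|) ^+ 2 <= expR (e / 2 * `|t|) ^+ 2.
  by rewrite ler_sqr ?nnegrE ?expR_ge0// addr_ge0// mulr_ge0// divr_ge0// ltW.
apply: le_trans hs; rewrite mulrDr -(real_normK (num_real t)) -exprMn sqrrD.
have : 0 <= e / 2 * `|t| by rewrite mulr_ge0// divr_ge0// ltW.
have : (e / 2) ^+ 2 <= 1 by rewrite expr_le1//; lra.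
lra.
Qed.

Lemma bounded1_damped (e s d : R) : 0 < e <= 1 ->
  bounded1 (fun t => expR (- e * `|t|) * cos (s * t + d)).
Proof.
move=> e01; split.
  apply: continuous_measurable_fun => t; apply: cvgM; last first.
    exact: is_derive_continuous (@is_derive_compl cos s d t _ (is_derive_cos _)).
  apply: (cvg_comp (fun t => - e * `|t|) expR); last exact: continuous_expR.
  by apply: cvgMr; exact: norm_continuous.
exists (4 / e ^+ 2) => t; rewrite normrM (ger0_norm (expR_ge0 _)).
by apply: le_trans (exp_abs_le t e01); rewrite ler_piMr ?cos_max.
Qed.

(* The even part of the wave is positive after adding 1; the value at s = 0, d = pi / 2 gives the integral of the damping alone. *)
Lemma Rintegral_damped (e s d : R) : 0 < e <= 1 ->
  \int[mu]_(t in [set: R]) (expR (- e * `|t|) * cos (s * t + d)) =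
  2 * e * cos d * (e ^+ 2 + s ^+ 2)^-1.
Proof.
move=> e01; have e0 : 0 < e by case/andP: e01.
have i1 : mu.-integrable setT (EFin \o (fun t => expR (- e * `|t|))).
  have := bounded1_integrable (bounded1_damped 0 0 e01); congr (_.-integrable _ (EFin \o _)).
  by apply/funext => t; rewrite mul0r addr0 cos0 mulr1.
have i2 := bounded1_integrable (bounded1_damped s d e01).
have F (s' d' : R) : \int[mu]_(t in [set: R]) (expR (- e * `|t|) * (1 + cos (s' * t + d'))) =
    2 * e^-1 + (e ^+ 2 + s' ^+ 2)^-1 * (2 * e * cos d').
  by rewrite /Rintegral integral_damped_full.
have E0 : \int[mu]_(t in [set: R]) expR (- e * `|t|) = 2 * e^-1.
  have := F 0 (pi / 2); rewrite cos_pihalf !mulr0 addr0 => <-.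
  apply: eq_Rintegral => t _; by rewrite mul0r add0r cos_pihalf addr0 mulr1.
have := F s d.
have -> : \int[mu]_(t in [set: R]) (expR (- e * `|t|) * (1 + cos (s * t + d))) =
   \int[mu]_(t in [set: R]) (expR (- e * `|t|) + expR (- e * `|t|) * cos (s * t + d)).
  by apply: eq_Rintegral => t _; rewrite mulrDr mulr1.
by rewrite RintegralD// E0 => /addrI ->; ring.
Qed.

Lemma Rintegral_poisson (e x : R) : 0 < e ->
  \int[mu]_(t in [set: R]) (e * (e ^+ 2 + (x - t) ^+ 2)^-1) = pi.
Proof.
move=> e0; have := integral_weight1 (R := R).
have dF : ((fun t : R => e^-1 * t + (- (x / e))) : R -> R)^`()%classic = cst e^-1.
  apply/funext => t; rewrite derive1E.
  exact: (@derive_val _ _ _ _ _ _ _ (is_derive_lin e^-1 (- (x / e)) t)).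
have ei : 0 < e^-1 by rewrite invr_gt0.
(* The substitution (t - x) / e reduces the kernel to 1 / (1 + t^2). *)
rewrite (@increasing_ge0_integration_by_substitutionT R (fun t => e^-1 * t + (- (x / e)))); last 9 first.
- by move=> a b ab; rewrite ltrD2r ltr_pM2l.
- by rewrite dF; exact: cst_continuous.
- by rewrite dF; exact: is_cvg_cst.
- by rewrite dF; exact: is_cvg_cst.
- by move=> t.
- apply/cvgrNyPle => A; near=> t.
  rewrite -lerBrDr ler_pdivrMl//.
- apply/cvgryPge => A; near=> t.
  rewrite -lerBlDr ler_pdivlMl//.
- exact: weight_factor_continuous.
- by move=> t; rewrite invr_ge0 addr_ge0// sqr_ge0.
rewrite /Rintegral => hpi; transitivity (fine (pi%:E : \bar R)) => //; rewrite -hpi.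
congr fine; apply: eq_integral => t _; congr (_%:E).
rewrite dF.
have h1 : 0 < e ^+ 2 + (x - t) ^+ 2 by rewrite ltr_pwDl ?exprn_gt0// sqr_ge0.
have -> : e / (e ^+ 2 + (x - t) ^+ 2) = e^-1 / (1 + (e^-1 * t + - (x / e)) ^+ 2).
  have -> : 1 + (e^-1 * t + - (x / e)) ^+ 2 = (e ^+ 2 + (x - t) ^+ 2) / e ^+ 2.
    by field; rewrite gt_eqF.
  by field; rewrite !gt_eqF.
by rewrite mulrC.
Unshelve. all: by end_near.
Qed.

End HalfLine.

(** * Fourier inversion by damping the frequencies *)

Section Inversion.
Context {R : realType}.

(** Abel's convergence factor: with it the frequency integral may be exchanged with the one defining
    the transform, and its own transform is a product of Poisson kernels. *)
Definition damping n (e : R) (z : 'rV[R]_n) := \prod_i expR (- e * `|z 0 i|).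

Lemma damping_ge0 n e (z : 'rV[R]_n) : 0 <= damping e z.
Proof. by apply: prodr_ge0 => i _. Qed.

Lemma wbounded_damping n (e : R) : 0 < e <= 1 -> wbounded (@damping n e).
Proof.
move=> e01; apply: (wbounded_prod (h := fun _ t => expR (- e * `|t|))) => i.
have := bounded1_damped 0 0 e01; congr bounded1.
by apply/funext => t; rewrite mul0r addr0 cos0 mulr1.
Qed.

Lemma damping_le1 n e (z : 'rV[R]_n) : 0 < e -> damping e z <= 1.
Proof.
move=> e0; apply: prodr_ile1 => i _; rewrite expR_ge0 -expR0 ler_expR mulNr oppr_le0.
by rewrite mulr_ge0// ltW.
Qed.

Lemma one_sub_damping n e (z : 'rV[R]_n) : 1 - damping e z <= e * \sum_i `|z 0 i|.
Proof.
have -> : damping e z = expR (- (e * \sum_i `|z 0 i|)).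
  rewrite mulr_sumr -sumrN expR_sum; apply: eq_bigr => i _; by rewrite mulNr.
have := expR_ge1Dx (- (e * \sum_i `|z 0 i|)).
by rewrite lerBlDr -lerBlDl.
Qed.

(** The phase [d] receives the contribution of the coordinate split off, which lets the induction on
    [n] close. *)
Lemma rint_damping n (e d : R) (s : 'rV[R]_n) : 0 < e <= 1 ->
  rint (fun z => damping e z * cos (dotv s z + d)) =
  cos d * \prod_i (2 * (e * (e ^+ 2 + s 0 i ^+ 2)^-1)).
Proof.
move=> e01; elim: n s d => [|n IH] s d.
  by rewrite rint0E /damping /dotv !big_ord0 mulr1 mul1r add0r.
have w : wbounded (fun z => damping e z * cos (dotv s z + d)).
  have wd := @wbounded_damping n.+1 e e01.
  suff : wbounded (fun z => cos (dotv s z + d) * damping e z).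
    by congr wbounded; apply/funext => z; rewrite mulrC.
  apply: (wboundedM wd); last by exists 1 => z; exact: cos_max.
  apply: (measurableT_comp (f := cos)).
    by apply: continuous_measurable_fun; exact: continuous_cos.
  have h := dotv_vmeas s; apply: measurable_funD => //.
  by move: h; congr measurable_fun; apply/funext => u ; rewrite dotvC.
pose s' : 'rV[R]_n := \row_i s 0 (lift ord0 i).
rewrite (rintS w) big_ord_recl.
have -> : (fun t : R => rint (fun y : 'rV_n => damping e (row_mx t%:M y : 'rV_n.+1) *
     cos (dotv s (row_mx t%:M y) + d))) = (fun t : R =>
     \prod_(i < n) (2 * (e * (e ^+ 2 + s 0 (lift ord0 i) ^+ 2)^-1)) *
     (expR (- e * `|t|) * cos (s 0 ord0 * t + d))).
  apply/funext => t; have := IH s' (s 0 ord0 * t + d) => IHs.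
  have E y : damping e (row_mx t%:M y : 'rV_n.+1) * cos (dotv s (row_mx t%:M y) + d) =
      expR (- e * `|t|) * (damping e y * cos (dotv s' y + (s 0 ord0 * t + d))).
    rewrite /damping /dotv !big_ord_recl !row_mxS0 mulrA; congr (_ * _ * cos _).
      by apply: eq_bigr => i _; rewrite row_mxSS.
    rewrite [X in X + d]addrC -addrA; congr (_ + _).
    by apply: eq_bigr => i _; rewrite row_mxSS mxE.
  have wn : wbounded (fun z => damping e z * cos (dotv s' z + (s 0 ord0 * t + d))).
    have := wboundedZ (expR (e * `|t|)) (wbounded_slice t w); congr wbounded.
    by apply/funext => y; rewrite E mulrA -expRD mulNr subrr expR0 mul1r.
  rewrite (funext E) (rintZ _ wn) IHs.
  rewrite mulrA mulrC; congr (_ * _).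
  by apply: eq_bigr => i _; rewrite mxE.
rewrite RintegralZl//; last exact: bounded1_integrable (bounded1_damped _ _ e01).
by rewrite (Rintegral_damped _ _ e01); ring.
Qed.

Lemma cint_damping n (e : R) (s : 'rV[R]_n) : 0 < e <= 1 ->
  cint_rV (fun z => (damping e z)%:C * cis (dotv s z)) =
  (\prod_i (2 * (e * (e ^+ 2 + s 0 i ^+ 2)^-1)))%:C.
Proof.
move=> e01; apply: complexE2; rewrite /=.
  have := rint_damping 0 s e01; rewrite cos0 mul1r => <-; congr rint.
  by apply/funext => z; rewrite mul0r subr0 addr0.
have := rint_damping (- (pi / 2)) s e01; rewrite cosN cos_pihalf [RHS]mul0r => h.
rewrite -[RHS]h; congr rint.
by apply/funext => z; rewrite mul0r addr0 -sinDpihalf subrK.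
Qed.

Lemma bounded1_poisson (e x : R) (m : R -> R) : 0 < e -> continuous m ->
  (forall t, 0 <= m t <= 1) -> bounded1 (fun t => e * (e ^+ 2 + (x - t) ^+ 2)^-1 * m t).
Proof.
move=> e0 cm m01; have p0 t : 0 < e ^+ 2 + (x - t) ^+ 2 by rewrite ltr_pwDl ?exprn_gt0// sqr_ge0.
split.
  apply: continuous_measurable_fun => t; apply: cvgM; last exact: cm.
  apply: cvgM; first exact: cvg_cst.
  apply: cvgV; first by rewrite gt_eqF.
  apply: cvgD; first exact: cvg_cst.
  apply: (cvg_comp (fun t => x - t) (fun u => u ^+ 2)); last exact: exprn_continuous.
  by apply: cvgB; [exact: cvg_cst|exact: cvg_id].
exists (e * ((1 + 2 * x ^+ 2) / e ^+ 2 + 2)) => t; have /andP[m0 m1] := m01 t.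
rewrite !normrM (ger0_norm m0) (gtr0_norm e0) gtr0_norm ?invr_gt0//.
have q0 : 0 < 1 + t ^+ 2 by rewrite ltr_pwDl// sqr_ge0.
apply: (@le_trans _ _ (e * (e ^+ 2 + (x - t) ^+ 2)^-1)).
  by rewrite ler_piMr// mulr_ge0 ?invr_ge0 ?ltW.
rewrite -mulrA ler_pM2l// ler_pdivlMr// mulrC ler_pdivrMr// mulrDl !mulrDr.
have -> : (1 + 2 * x ^+ 2) / e ^+ 2 * e ^+ 2 = 1 + 2 * x ^+ 2 by field; rewrite gt_eqF.
have : 0 <= (1 + 2 * x ^+ 2) / e ^+ 2 * (x - t) ^+ 2.
  by rewrite mulr_ge0 ?sqr_ge0// divr_ge0 ?sqr_ge0// addr_ge0// mulr_ge0// sqr_ge0.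
have := sqr_ge0 (t - 2 * x).
nra.
Qed.

Lemma bounded1_poisson1 (e x : R) : 0 < e -> bounded1 (fun t => e * (e ^+ 2 + (x - t) ^+ 2)^-1).
Proof.
move=> e0; have h := @bounded1_poisson e x (cst 1) e0.
suff : bounded1 (fun t => e * (e ^+ 2 + (x - t) ^+ 2)^-1 * cst 1 t).
  by congr bounded1; apply/funext => t; rewrite mulr1.
by apply: h => t; [exact: cst_continuous|rewrite ler01 lexx].
Qed.

(** A bounded replacement for (x - t)^2: it is bounded below away from [x], and its integral against
    the Poisson kernel is O(e). *)
Definition moment (x t : R) := (x - t) ^+ 2 * (1 + (x - t) ^+ 2)^-1.

Lemma moment01 x t : 0 <= moment x t <= 1.
Proof.
have h := sqr_ge0 (x - t); have q0 : 0 < 1 + (x - t) ^+ 2 by rewrite ltr_pwDl.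
apply/andP; split; first by rewrite mulr_ge0// invr_ge0 ltW.
by rewrite ler_pdivrMr// mul1r lerDr.
Qed.

Lemma moment_continuous x : continuous (moment x).
Proof.
have c t : (x - t0) ^+ 2 @[t0 --> t] --> (x - t) ^+ 2.
  apply: (cvg_comp (fun t => x - t) (fun u => u ^+ 2)); last exact: exprn_continuous.
  by apply: cvgB; [exact: cvg_cst|exact: cvg_id].
move=> t; apply: cvgM; first exact: c.
apply: cvgV; first by rewrite gt_eqF// ltr_pwDl// sqr_ge0.
by apply: cvgD; [exact: cvg_cst|exact: c].
Qed.

Lemma Rintegral_poisson_moment (e x : R) : 0 < e ->
  \int[lebesgue_measure]_(t in [set: R]) (e * (e ^+ 2 + (x - t) ^+ 2)^-1 * moment x t) <= e * pi.
Proof.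
move=> e0.
have i1 := bounded1_integrable (bounded1_poisson x e0 (@moment_continuous x) (moment01 x)).
have i2 := bounded1_integrable (bounded1_poisson1 x ltr01).
rewrite -(Rintegral_poisson x ltr01) -RintegralZl//; apply: le_Rintegral => //.
  have [mh [C hC]] := bounded1_poisson1 x ltr01; apply: bounded1_integrable; split.
    exact: measurable_funM.
  exists (e * C) => t; rewrite normrM (gtr0_norm e0) -mulrA ler_pM2l//.
move=> t _; rewrite mul1r expr1n -mulrA ler_pM2l// mulrA.
have h := sqr_ge0 (x - t); have q0 : 0 < 1 + (x - t) ^+ 2 by rewrite ltr_pwDl.
have q0i : 0 <= (1 + (x - t) ^+ 2)^-1 by rewrite invr_ge0 ltW.
apply: ler_piMl => //; rewrite mulrC ler_pdivrMr ?mul1r ?lerDr ?sqr_ge0//.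
by rewrite ltr_pwDl ?exprn_gt0.
Qed.

(** The product of Poisson kernels, not normalized: its total mass is pi^n. *)
Definition poisson n (e : R) (x y : 'rV[R]_n) := \prod_i (e * (e ^+ 2 + (x 0 i - y 0 i) ^+ 2)^-1).

Lemma poisson_factor n (e : R) (x y : 'rV[R]_n) j :
  poisson e x y * moment (x 0 j) (y 0 j) =
  \prod_i (e * (e ^+ 2 + (x 0 i - y 0 i) ^+ 2)^-1 * (if i == j then moment (x 0 i) (y 0 i) else 1)).
Proof.
rewrite big_split; congr (_ * _); rewrite (bigD1 j)//= eqxx big1 ?mulr1// => i ij.
by rewrite (negbTE ij).
Qed.

Section Kernel.
Context (n : nat) (e : R) (e0 : 0 < e) (x : 'rV[R]_n).
Local Notation m_ j i := (fun t => if i == j then moment (x 0 i) t else 1).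

Lemma mswitch_continuous (i j : 'I_n) : continuous (m_ j i).
Proof. by case: (i == j); [exact: moment_continuous|move=> t; exact: cvg_cst]. Qed.

Lemma mswitch01 (i j : 'I_n) t : 0 <= m_ j i t <= 1.
Proof. by case: (i == j); [exact: moment01|rewrite ler01 lexx]. Qed.

Lemma wbounded_poisson_moment (j : 'I_n) :
  wbounded (fun y => poisson e x y * moment (x 0 j) (y 0 j)).
Proof.
have := wbounded_prod (h := fun i t => e * (e ^+ 2 + (x 0 i - t) ^+ 2)^-1 * m_ j i t)
  (fun i => bounded1_poisson (x 0 i) e0 (@mswitch_continuous i j) (mswitch01 i j)).
by congr wbounded; apply/funext => y; rewrite poisson_factor.
Qed.

Lemma rint_poisson_moment (j : 'I_n) :
  rint (fun y => poisson e x y * moment (x 0 j) (y 0 j)) <= e * pi ^+ n.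
Proof.
have E : (fun y => poisson e x y * moment (x 0 j) (y 0 j)) =
   (fun y : 'rV_n => \prod_i (fun i t => e * (e ^+ 2 + (x 0 i - t) ^+ 2)^-1 * m_ j i t) i (y 0 i)).
  by apply/funext => y; rewrite poisson_factor.
rewrite E (rint_prod (h := fun i t => e * (e ^+ 2 + (x 0 i - t) ^+ 2)^-1 * m_ j i t)); last first.
  move=> i; exact: (@bounded1_poisson e (x 0 i) (m_ j i) e0 (@mswitch_continuous i j) (mswitch01 i j)).
rewrite (bigD1 j)//= eqxx.
have -> : \prod_(i < n | i != j) \int[lebesgue_measure]_(t in [set: R])
    (e * (e ^+ 2 + (x 0 i - t) ^+ 2)^-1 * (if i == j then moment (x 0 i) t else 1)) =
    \prod_(i < n | i != j) (pi : R).
  apply: eq_bigr => i ij; rewrite (negbTE ij) -[RHS](Rintegral_poisson (x 0 i) e0).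
  by apply: eq_Rintegral => t _; rewrite mulr1.
have -> : e * pi ^+ n = e * pi * \prod_(i < n | i != j) (pi : R).
  rewrite -mulrA; rewrite -[in LHS](card_ord n) -prodr_const (bigD1 j)//.
apply: ler_wpM2r; last exact: Rintegral_poisson_moment.
by apply: prodr_ge0 => i _; exact: pi_ge0.
Qed.

Lemma wbounded_poisson : wbounded (poisson e x).
Proof.
exact: (wbounded_prod (h := fun i t => e * (e ^+ 2 + (x 0 i - t) ^+ 2)^-1)
  (fun i => bounded1_poisson1 (x 0 i) e0)).
Qed.

Lemma rint_poisson : rint (poisson e x) = pi ^+ n.
Proof.
rewrite (rint_prod (h := fun i t => e * (e ^+ 2 + (x 0 i - t) ^+ 2)^-1)
  (fun i => bounded1_poisson1 (x 0 i) e0)).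
transitivity (\prod_(i < n) (pi : R)); last by rewrite prodr_const card_ord.
by apply: eq_bigr => i _; exact: Rintegral_poisson.
Qed.

Lemma poisson_ge0 y : 0 <= poisson e x y.
Proof.
apply: prodr_ge0 => i _; rewrite mulr_ge0 ?invr_ge0 ?addr_ge0 ?sqr_ge0//; exact: ltW.
Qed.

End Kernel.

Section InversionTheorem.
Context (n : nat) (f : 'rV[R]_n -> R[i]) (M : R) (sf : csmooth_on setT f)
  (f0 : forall x, ~ cube M x -> f x = 0).

(** The integrand does not decay in [z]. Multiplied by the weight of [z] it is dominated in both
    variables, so the integral is measurable in [z]; the weight is then divided out. *)
Lemma fourier_meas : cmeas (fourier f).
Proof.
have wf := csmooth_cwbounded sf f0; have [C CP] := cwbounded_bound wf.
have w2 : cwbounded2 (fun z y : 'rV_n => (weight z)%:C * (f y * cis (- dotv y z))).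
  apply: (@cwbounded2P _ _ _ _ C).
    apply: cmeas2M; first by apply: cmeas2_fst; apply: cmeas_real; exact: weight_vmeas.
    apply: cmeas2M; first exact: cmeas2_snd (cwbounded_meas wf).
    have := @cmeas2_cis R n (-1); congr cmeas2; apply/funext => z; apply/funext => y.
    by rewrite mulN1r dotvC.
  move=> z y; rewrite !normcM normc_cis mulr1 normcR ger0_norm ?weight_ge0// mulrCA.
  by rewrite ler_wpM2l ?weight_ge0.
have := cwbounded_meas (cwbounded2_cint w2) => h.
have mi : vmeas (fun z : 'rV[R]_n => \prod_i (1 + z 0 i ^+ 2)).
  apply: (@measurable_prod _ (E n) R setT _ _ (fun i (e : E n) => 1 + vec e 0 i ^+ 2)) => i _.
  by apply: measurable_funD => //; apply: measurable_funX; exact: vec_measurable.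
have := cmeasM (cmeas_real mi) h; congr cmeas; apply/funext => z.
rewrite (cint_scale _ (cwbounded_wave z sf f0)) mulrA -rmorphM -big_split/= big1 ?mul1r//.
by move=> i _; rewrite mulfV// gt_eqF// ltr_pwDl// sqr_ge0.
Qed.

(** Near [x] the function varies by at most [h]; elsewhere some [moment] is bounded below, and its
    integral is O(e). As [C] depends on [h], the width [e] is chosen last. *)
Lemma poisson_approx x (h : R) : 0 < h -> exists C : R, forall e, 0 < e ->
  cmod (cint_rV (fun y => (poisson e x y)%:C * f y) - (pi ^+ n)%:C * f x) <=
  2 * (h * pi ^+ n + e * C).
Proof.
move=> h0; have wf := csmooth_cwbounded sf f0.
have [B BP] : exists B : R, forall y, cmod (f y) <= B.
  have [C CP] := cwbounded_bound wf; exists `|C| => y; apply: (le_trans (CP y)).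
  apply: (le_trans (ler_norm _)); rewrite normrM ler_piMr// ger0_norm ?weight_ge0//; exact: weight_le1.
have [d d0 dP] : exists2 d : R, 0 < d & forall y : 'rV[R]_n, (forall i, `|x 0 i - y 0 i| < d) -> cmod (f y - f x) <= h.
  have h2 : 0 < h / 2 by rewrite divr_gt0.
  have /cvgr_dist_lt/(_ _ h2) := smooth_on_continuous sf.1 (I : setT x).
  have /cvgr_dist_lt/(_ _ h2) := smooth_on_continuous sf.2 (I : setT x).
  move=> /nbhs_ballP[d1 /= d10 h1] /nbhs_ballP[d2 /= d20 h2'].
  exists (Num.min d1 d2); first by rewrite lt_min d10.
  move=> y hy; apply: (le_trans (normc_le _)); rewrite [leRHS]splitr; apply: lerD; apply: ltW.
    have := h2' y; rewrite distrC; case: (f x) (f y) => ? ? [? ?] ; apply.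
    by apply/rV_ball => // i; have := hy i; rewrite lt_min => /andP[].
  have := h1 y; rewrite distrC; case: (f x) (f y) => ? ? [? ?] ; apply.
  by apply/rV_ball => // i; have := hy i; rewrite lt_min => /andP[].
(* 2 B bounds the oscillation of [f]; the other factor is the inverse of the least value of [moment]
   at distance [d] or more. *)
pose K := 2 * B * ((1 + d ^+ 2) / d ^+ 2).
have B0 : 0 <= B := le_trans (normc_ge0 _) (BP 0).
have K0 : 0 <= K by rewrite !mulr_ge0 ?invr_ge0 ?addr_ge0 ?sqr_ge0.
have key y : cmod (f y - f x) <= h + K * \sum_j moment (x 0 j) (y 0 j).
  have S0 : 0 <= \sum_j moment (x 0 j) (y 0 j).
    by apply: sumr_ge0 => j _; have /andP[] := moment01 (x 0 j) (y 0 j).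
  have [hy|] := pselect (forall i, `|x 0 i - y 0 i| < d).
    by apply: (le_trans (dP _ hy)); rewrite lerDl mulr_ge0.
  move=> /existsNP[j /negP]; rewrite -leNgt => dj.
  have : cmod (f y - f x) <= 2 * B.
    by apply: (le_trans (normcD _ _)); rewrite normcN mulrDl mul1r lerD.
  move=> /le_trans; apply; rewrite -[leLHS]add0r; apply: lerD; first exact: ltW.
  rewrite -mulrA ler_peMr ?mulr_ge0//.
  have mj : d ^+ 2 / (1 + d ^+ 2) <= moment (x 0 j) (y 0 j).
    rewrite /moment; have : d ^+ 2 <= (x 0 j - y 0 j) ^+ 2.
      by rewrite -(real_normK (num_real (x 0 j - y 0 j))) ler_sqr ?nnegrE// ltW.
    have := sqr_ge0 d; move: (d ^+ 2) (_ ^+ 2) => u v u0 uv.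
    rewrite ler_pdivrMr ?ltr_pwDl// mulrAC ler_pdivlMr ?ltr_pwDl ?(le_trans u0)//.
    by rewrite !mulrDr !mulr1 lerD// mulrC.
  apply: (@le_trans _ _ ((1 + d ^+ 2) / d ^+ 2 * (d ^+ 2 / (1 + d ^+ 2)))).
    have p1 : 0 < 1 + d ^+ 2 by rewrite ltr_pwDl ?sqr_ge0.
    by rewrite mulrA mulfVK ?divff// gt_eqF// exprn_gt0.
  apply: ler_wpM2l; first by rewrite mulr_ge0 ?invr_ge0 ?addr_ge0 ?sqr_ge0.
  apply: (le_trans mj); rewrite (bigD1 j)//= lerDl sumr_ge0// => i _.
  by have /andP[] := moment01 (x 0 i) (y 0 i).
exists (K * \sum_(j < n) pi ^+ n) => e e0.
have wp := wbounded_poisson e0 x.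
have cp : cwbounded (fun y => (poisson e x y)%:C).
  by apply: (cwbounded_le _ wp) => [|y]; [exact: cmeas_real wp.1|rewrite normcR ger0_norm ?poisson_ge0].
have cpf : cwbounded (fun y => (poisson e x y)%:C * f y).
  have := cwboundedM cp (cwbounded_meas wf) BP; congr cwbounded; exact: mulrC.
have cpx : cwbounded (fun y => - f x * (poisson e x y)%:C) := cwboundedZ _ cp.
have cpi : cint_rV (fun y => (poisson e x y)%:C) = (pi ^+ n)%:C.
  apply: complexE2 => /=; first exact: rint_poisson.
  by have := congr1 (@complex.Re R) (@cint0 R n).
have -> : cint_rV (fun y => (poisson e x y)%:C * f y) - (pi ^+ n)%:C * f x =
    cint_rV (fun y => (poisson e x y)%:C * (f y - f x)).
  rewrite -cpi mulrC -mulNr -(cint_scale _ cp) -(cint_add cpf cpx).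
  by congr cint_rV; apply/funext => y; ring.
pose G y := h * poisson e x y + K * \sum_j (poisson e x y * moment (x 0 j) (y 0 j)).
have wS (r : seq 'I_n) : wbounded (fun y => \sum_(j <- r) (poisson e x y * moment (x 0 j) (y 0 j))) /\
    rint (fun y => \sum_(j <- r) (poisson e x y * moment (x 0 j) (y 0 j))) <= \sum_(j <- r) (e * pi ^+ n).
  elim: r => [|j r [IH1 IH2]].
    have -> : (fun y : 'rV[R]_n => \sum_(j <- [::]) (poisson e x y * moment (x 0 j) (y 0 j))) = (fun y => 0 * poisson e x y).
      by apply/funext => y; rewrite big_nil mul0r.
    by split; [exact: wboundedZ|rewrite (rintZ _ wp) mul0r big_nil].
  have -> : (fun y : 'rV[R]_n => \sum_(j <- j :: r) (poisson e x y * moment (x 0 j) (y 0 j))) =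
     (fun y => poisson e x y * moment (x 0 j) (y 0 j) + \sum_(j <- r) (poisson e x y * moment (x 0 j) (y 0 j))).
    by apply/funext => y; rewrite big_cons.
  have wj := wbounded_poisson_moment e0 x j; split; first exact: wboundedD.
  by rewrite (rintD wj IH1) big_cons lerD//; exact: rint_poisson_moment.
have [wS1 wS2] := wS (index_enum 'I_n).
have wG : wbounded G by apply: wboundedD; [exact: wboundedZ|exact: wboundedZ].
apply: (@le_trans _ _ (2 * rint G)); last first.
  rewrite ler_pM2l// (rintD (wboundedZ h wp) (wboundedZ K wS1)) (rintZ h wp) (rintZ K wS1).
  rewrite rint_poisson// lerD2l mulrCA ler_wpM2l// mulr_sumr; exact: wS2.
apply: cint_le => //.
  have := cwboundedD cpf cpx; congr cwbounded; apply/funext => y; ring.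
move=> y; rewrite normcM normcR ger0_norm ?poisson_ge0// /G -mulr_sumr.
rewrite [h * _]mulrC mulrCA -mulrDr ler_wpM2l ?poisson_ge0//; exact: key.
Qed.

Theorem fourier_inversion x :
  cint_rV (fun z => fourier f z * cis (dotv x z)) = ((2 * pi) ^+ n)%:C * f x.
Proof.
(* Two powers of the weight: one absorbs the factor |z_i| in [one_sub_damping], the other remains
   integrable. *)
have [C1 C1P] : exists C : R, forall z, cmod (fourier f z) <= C * weight z ^+ 2.
  have tf : tfamily (cube M) (fun _ : unit => f).
    by split=> // ; apply: ufamily_indep => //; exact: compact_cube.
  have [C CP] := fourier_decay 2 (@closed_cube _ _ _) (@subset_refl _ _) tf.
  by exists C => z; exact: CP tt z.
pose C := `|C1|.
have CP z : cmod (fourier f z) <= C * weight z ^+ 2.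
  by apply: (le_trans (C1P z)); rewrite ler_wpM2r ?exprn_ge0 ?weight_ge0// ler_norm.
have C0 : 0 <= C := normr_ge0 _.
have wf := csmooth_cwbounded sf f0; have [B BP] := cwbounded_bound wf.
have mg : cmeas (fun z => fourier f z * cis (dotv x z)).
  apply: cmeasM; first exact: fourier_meas.
  by apply: cmeas_cis; have := dotv_vmeas x; congr vmeas; apply/funext => z; rewrite dotvC.
have wg : cwbounded (fun z => fourier f z * cis (dotv x z)).
  apply: (cwboundedP mg (C := C)) => z; rewrite normcM normc_cis mulr1; apply: (le_trans (CP z)).
  by rewrite ler_wpM2l// ler_piMl ?weight_ge0// weight_le1.
set g := fun z => _ in mg wg *.
(* Fubini brings the damped frequency integral inside, where it equals 2^n times the Poisson
   kernel. *)
have D e : 0 < e <= 1 -> cint_rV (fun z => (damping e z)%:C * g z) =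
    (2 ^+ n)%:C * cint_rV (fun y => (poisson e x y)%:C * f y).
  move=> e01; have e0 : 0 < e by case/andP: e01.
  pose F (z y : 'rV[R]_n) := (damping e z)%:C * cis (dotv (x - y) z) * f y.
  have wd := @wbounded_damping n e e01; have [_ [B' B'P]] := wd.
  have mF : cmeas2 F.
    apply: cmeas2M; last exact: cmeas2_snd (cwbounded_meas wf).
    apply: cmeas2M; first by apply: cmeas2_fst; apply: cmeas_real; exact: wd.1.
    have m1 : cmeas2 (fun z y : 'rV[R]_n => cis (dotv x z)).
      by apply: cmeas2_fst; apply: cmeas_cis; have := dotv_vmeas x; congr vmeas; apply/funext => z; rewrite dotvC.
    have := cmeas2M m1 (@cmeas2_cis R n (-1)); congr cmeas2; apply/funext => z; apply/funext => y.
    by rewrite -cisD dotvBl mulN1r [dotv z y]dotvC.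
  have w2 : cwbounded2 F.
    apply: (@cwbounded2P _ _ _ _ (B' * B) mF) => z y.
    rewrite !normcM normc_cis mulr1 normcR mulrACA; apply: ler_pM => //; exact: normc_ge0.
  transitivity (cint_rV (fun z => cint_rV (F z))).
    congr cint_rV; apply/funext => z.
    have -> : (damping e z)%:C * g z = (damping e z)%:C * cis (dotv x z) * fourier f z.
      by rewrite mulrCA mulrC.
    rewrite -(cint_scale _ (cwbounded_wave z sf f0)).
    by congr cint_rV; apply/funext => y; rewrite /F dotvBl cisD; ring.
  rewrite (cint_fubini w2).
  have cp : cwbounded (fun y => (poisson e x y)%:C * f y).
    have [C' C'P] := (wbounded_poisson e0 x).2; apply: (@cwboundedM _ _ _ _ `|C'| wf (cmeas_real (wbounded_poisson e0 x).1)) => y.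
    rewrite normcR; apply: (le_trans (C'P y)); apply: (le_trans (ler_norm _)).
    by rewrite normrM ler_piMr// ger0_norm ?weight_ge0// weight_le1.
  rewrite -(cint_scale _ cp); congr cint_rV; apply/funext => y.
  have wz : cwbounded (fun z => (damping e z)%:C * cis (dotv (x - y) z)).
    apply: (cwbounded_le (G := damping e) _ wd).
      apply: cmeasM; first exact: cmeas_real wd.1.
      by apply: cmeas_cis; have := dotv_vmeas (x - y); congr vmeas; apply/funext => z; rewrite dotvC.
    by move=> z; rewrite normcM normc_cis mulr1 normcR ger0_norm ?damping_ge0.
  rewrite mulrA mulrC.
  have -> : (fun z => F z y) = (fun z => f y * ((damping e z)%:C * cis (dotv (x - y) z))).
    by apply/funext => z; rewrite mulrC.
  rewrite (cint_scale _ wz) (cint_damping _ e01) -rmorphM; congr (_ * _%:C).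
  rewrite big_split prodr_const card_ord; congr (_ * _); apply: eq_bigr => i _.
  by rewrite !mxE.
have near e : 0 < e <= 1 -> cmod (cint_rV g - cint_rV (fun z => (damping e z)%:C * g z)) <=
    e * (n%:R * C * (2 * pi ^+ n)).
  move=> e01; have e0 : 0 < e by case/andP: e01.
  have wd := @wbounded_damping n e e01.
  have wdg : cwbounded (fun z => (damping e z)%:C * g z).
    apply: (cwboundedM wg (C := 1)); first exact: cmeas_real wd.1.
    by move=> z; rewrite normcR ger0_norm ?damping_ge0// damping_le1.
  rewrite -mulN1r -(cint_scale _ wdg) -(cint_add wg (cwboundedZ _ wdg)) mulrA.
  apply: cint_weight_le.
    by apply: cmeasD => //; exact: cwbounded_meas (cwboundedZ _ wdg).
  move=> z; have -> : g z + -1 * ((damping e z)%:C * g z) = (1 - damping e z)%:C * g z.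
    ring.
  rewrite normcM normcR ger0_norm; last by rewrite subr_ge0 damping_le1.
  rewrite normcM normc_cis mulr1.
  have zw i : `|z 0 i| * weight z <= 1.
    rewrite /weight (bigD1 i)//= mulrA; apply: mulr_ile1.
    - by rewrite mulr_ge0 ?invr_ge0 ?addr_ge0 ?sqr_ge0.
    - by apply: prodr_ge0 => k _; rewrite invr_ge0 addr_ge0 ?sqr_ge0.
    - rewrite ler_pdivrMr ?ltr_pwDl ?sqr_ge0// -(real_normK (num_real (z 0 i))).
      move: `|z 0 i| => u; nra.
    - apply: prodr_ile1 => k _; have /andP[k0 ->] := weight_factor (z 0 k); rewrite andbT; exact: ltW.
  apply: (@le_trans _ _ (e * (\sum_i `|z 0 i|) * (C * weight z ^+ 2))).
    apply: ler_pM => //; [by rewrite subr_ge0 damping_le1|exact: normc_ge0|exact: one_sub_damping].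
  have -> : e * (\sum_i `|z 0 i|) * (C * weight z ^+ 2) =
     (e * C * weight z) * \sum_i (`|z 0 i| * weight z) by rewrite -mulr_suml; ring.
  have -> : e * (n%:R * C) * weight z = (e * C * weight z) * n%:R by ring.
  apply: ler_wpM2l; first by rewrite !mulr_ge0 ?weight_ge0// ltW.
  rewrite -[X in X%:R]card_ord -[X in _ <= X]mulr1 mulr_natl -sumr_const; exact: ler_sum.
apply/eqP; rewrite -subr_eq0; apply/eqP; apply: ComplexField.Normc.eq0_normc.
apply/eqP; rewrite eq_le normc_ge0 andbT; apply/ler_addgt0Pr => h h0; rewrite add0r.
pose q := 2 ^+ n * (2 * pi ^+ n) : R.
have q0 : 0 < q by rewrite !mulr_gt0 ?exprn_gt0 ?pi_gt0.
have hq0 : 0 < h / 2 / q by rewrite !divr_gt0.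
have [C' CP'] := poisson_approx x hq0.
pose Q := n%:R * C * (2 * pi ^+ n) + 2 ^+ n * 2 * `|C'| + 1.
have Q0 : 0 < Q.
  rewrite ltr_pwDr// addr_ge0 ?mulr_ge0 ?exprn_ge0//; exact: pi_ge0.
pose e := Num.min 1 (h / 2 / Q).
have e0 : 0 < e by rewrite lt_min ltr01 !divr_gt0.
have e1 : e <= 1 by rewrite ge_min lexx.
have e01 : 0 < e <= 1 by rewrite e0.
have -> : cint_rV g - ((2 * pi) ^+ n)%:C * f x =
   (cint_rV g - cint_rV (fun z => (damping e z)%:C * g z)) +
   (2 ^+ n)%:C * (cint_rV (fun y => (poisson e x y)%:C * f y) - (pi ^+ n)%:C * f x).
  rewrite (D e e01) mulrBr mulrA -rmorphM -exprMn; ring.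
apply: (le_trans (normcD _ _)); rewrite normcM normcR ger0_norm ?exprn_ge0//.
have h1 := near e e01; have h2 := CP' e e0.
have h3 : 2 ^+ n * (2 * (h / 2 / q * pi ^+ n + e * C')) <= h / 2 + e * (2 ^+ n * 2 * `|C'|).
  have -> : 2 ^+ n * (2 * (h / 2 / q * pi ^+ n + e * C')) = h / 2 / q * q + e * (2 ^+ n * 2 * C').
    rewrite /q; ring.
  rewrite mulfVK ?gt_eqF// lerD2l ler_wpM2l ?(ltW e0)// ler_wpM2l ?ler_norm//.
have h4 : e * Q <= h / 2 by rewrite -ler_pdivlMr// ge_min lexx orbT.
have h5 : e * (n%:R * C * (2 * pi ^+ n)) + e * (2 ^+ n * 2 * `|C'|) <= e * Q.
  by rewrite -mulrDr ler_wpM2l ?(ltW e0)// lerDl.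
have h6 := ler_wpM2l (exprn_ge0 n (ler0n R 2)) h2.
apply: (le_trans (lerD h1 (le_trans h6 h3))).
rewrite addrCA [leRHS]splitr; apply: lerD => //; exact: le_trans h5 h4.
Qed.

End InversionTheorem.
End Inversion.

Section Plancherel.
Context {R : realType} {n : nat}.

(** Both sides come from the double integral of the conjugate of f(x) times the transform at z times
    e^(i x.z): inversion evaluates it in one order, the definition of the transform in the other. *)
Theorem plancherel (f : 'rV[R]_n -> R[i]) M : csmooth_on setT f ->
  (forall x, ~ cube M x -> f x = 0) ->
  rint (fun x => cmod (f x) ^+ 2) = (2 * pi) ^- n * rint (fun z => cmod (fourier f z) ^+ 2).
Proof.
move=> sf f0; have wf := csmooth_cwbounded sf f0; have [B BP] := cwbounded_bound wf.
have [C CP] : exists C : R, forall z, cmod (fourier f z) <= C * weight z ^+ 1.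
  have tf : tfamily (cube M) (fun _ : unit => f).
    by split=> // ; apply: ufamily_indep => //; exact: compact_cube.
  have [C CP] := fourier_decay 1 (@closed_cube _ _ _) (@subset_refl _ _) tf.
  by exists C => z; exact: CP tt z.
have mf := fourier_meas sf f0.
pose F (x z : 'rV[R]_n) := (f x)^* * (fourier f z * cis (dotv x z)).
have w2 : cwbounded2 F.
  apply: (@cwbounded2P _ _ _ _ (B * C)).
    apply: cmeas2M; first by apply: cmeas2_fst; apply: cmeas_conj; exact: cwbounded_meas wf.
    apply: cmeas2M; first exact: cmeas2_snd mf.
    have := @cmeas2_cis R n 1; congr cmeas2; apply/funext => x; apply/funext => z.
    by rewrite mul1r.
  move=> x z; rewrite !normcM normc_cis mulr1 normc_conj mulrACA.
  by apply: ler_pM; rewrite ?normc_ge0.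
have sq (w : R[i]) : w^* * w = (cmod w ^+ 2)%:C.
  by rewrite normc_sqr; case: w => a b; apply: complexE2 => /=; ring.
have wsq (h : 'rV[R]_n -> R[i]) : cwbounded h -> cwbounded (fun x => (h x)^* * h x).
  move=> wh; have [D DP] := cwbounded_bound wh; apply: (cwboundedM (C := `|D|) wh).
    by apply: cmeas_conj; exact: cwbounded_meas.
  move=> x; rewrite normc_conj; apply: (le_trans (DP x)); apply: (le_trans (ler_norm _)).
  by rewrite normrM ler_piMr// ger0_norm ?weight_ge0// weight_le1.
have H := cint_fubini w2.
have HL : cint_rV (fun x => cint_rV (F x)) = ((2 * pi) ^+ n)%:C * cint_rV (fun x => (f x)^* * f x).
  rewrite -(cint_scale _ (wsq _ wf)); congr cint_rV; apply/funext => x.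
  have wg : cwbounded (fun z => fourier f z * cis (dotv x z)).
    apply: (cwboundedP (C := C)) => [|z]; last by rewrite normcM normc_cis mulr1.
    apply: cmeasM => //; apply: cmeas_cis; have := dotv_vmeas x; congr vmeas.
    by apply/funext => z; rewrite dotvC.
  by rewrite (cint_scale _ wg) (fourier_inversion sf f0) mulrCA.
have HR : cint_rV (fun z => cint_rV (fun x => F x z)) = cint_rV (fun z => (fourier f z)^* * fourier f z).
  congr cint_rV; apply/funext => z.
  have wc : cwbounded (fun x => (f x)^* * cis (dotv x z)).
    apply: (cwboundedP (C := B)) => [|x]; last by rewrite normcM normc_cis mulr1 normc_conj.
    apply: cmeasM; first by apply: cmeas_conj; exact: cwbounded_meas wf.
    by apply: cmeas_cis; exact: dotv_vmeas.
  have -> : (fun x => F x z) = (fun x => fourier f z * ((f x)^* * cis (dotv x z))).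
    by apply/funext => x; rewrite mulrCA.
  rewrite (cint_scale _ wc) mulrC; congr (_ * _).
  have ww := cwbounded_wave z sf f0.
  apply: complexE2 => /=.
    by congr rint; apply/funext => x; rewrite cisN; case: (f x) (cis _) => a b [c d] /=; ring.
  rewrite -mulN1r -(rintZ _ ww.2); congr rint; apply/funext => x.
  by rewrite cisN; case: (f x) (cis _) => a b [c d] /=; ring.
rewrite HL HR in H; have := congr1 (@complex.Re R) H; rewrite /= mul0r subr0 -!/(rint _) => h.
have -> : rint (fun x => cmod (f x) ^+ 2) = rint (fun x => Re ((f x)^* * f x)).
  by congr rint; apply/funext => x; rewrite sq.
have -> : rint (fun z => cmod (fourier f z) ^+ 2) = rint (fun z => Re ((fourier f z)^* * fourier f z)).
  by congr rint; apply/funext => x; rewrite sq.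
by rewrite -h mulKf// expf_neq0// mulf_neq0 ?pnatr_eq0// gt_eqF// pi_gt0.
Qed.

End Plancherel.

(** * One frequency in each unit cell *)

Section Cells.
Context {R : realType} {n : nat}.
Local Notation box N := {ffun 'I_n -> 'I_N.*2}.

(* The index [m < 2 N] stands for the cell [m - N, m - N + 1[ of [-N, N[. *)
Definition corner N (m : 'I_N.*2) : R := m%:R - N%:R.

Definition cell N (m : box N) : set 'rV[R]_n :=
  [set z | forall i, corner (m i) <= z 0 i < corner (m i) + 1].

Definition cell_fun N (m : box N) (z : 'rV[R]_n) : R :=
  \prod_i \1_(`[corner (m i), corner (m i) + 1[%classic) (z 0 i).

Lemma cell_funE N (m : box N) z : cell_fun m z = \1_(cell m) z.
Proof.
rewrite /cell_fun [RHS]indicE; case: (pselect (cell m z)) => [h|h].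
  rewrite mem_set// big1// => i _; rewrite indicE mem_set//=; exact: h.
rewrite memNset//; move/existsNP : h => [i hi].
by rewrite (bigD1 i)//= indicE memNset ?mul0r.
Qed.

Lemma cell_cover N (z : 'rV[R]_n) : (forall i, - N%:R <= z 0 i < N%:R) -> exists m : box N, cell m z.
Proof.
move=> h; have hi i : exists k : 'I_N.*2, corner k <= z 0 i < corner k + 1.
  have /andP[h1 h2] := h i; pose t := z 0 i + N%:R.
  have t0 : 0 <= t by rewrite -lerBlDr sub0r.
  have /andP[b1 b2] := truncn_itv t0.
  have kN : (Num.truncn t < N.*2)%N.
    rewrite -(ltr_nat R); apply: (le_lt_trans b1); rewrite -addnn natrD ltrD2r//.
  exists (Ordinal kN); rewrite lerBlDr b1 -addrA [X in _ + X]addrC addrA ltrBrDr natr1; exact: b2.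
exists [ffun i => sval (cid (hi i))] => i; rewrite ffunE; exact: svalP (cid (hi i)).
Qed.

Lemma bounded1_cell N (k : 'I_N.*2) : bounded1 (\1_(`[corner k, corner k + 1[%classic) : R -> R).
Proof.
split; first exact: measurable_indic.
exists (1 + (`|corner k| + 1) ^+ 2) => t; rewrite indicE.
have p0 : 0 < 1 + t ^+ 2 by rewrite ltr_pwDl// sqr_ge0.
case: (boolP (t \in _)) => /= [|_]; last first.
  by rewrite normr0 mulr_ge0 ?invr_ge0 ?addr_ge0 ?sqr_ge0.
rewrite inE/= in_itv/= => /andP[h1 h2].
rewrite normr1 ler_pdivlMr// mul1r lerD2l -(real_normK (num_real t)) ler_sqr ?nnegrE ?addr_ge0//.
have := ler_norm (corner k); have := ler_norm (- corner k); rewrite normrN.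
by have [t0|t0] := ler0P t; move: `|corner k| => u; lra.
Qed.

Lemma wbounded_cell N (m : box N) : wbounded (cell_fun m).
Proof. exact: (wbounded_prod (h := fun i => \1_(`[corner (m i), corner (m i) + 1[%classic)) (fun i => bounded1_cell (m i))). Qed.

Lemma rint_cell N (m : box N) : rint (cell_fun m) = 1.
Proof.
rewrite (rint_prod (h := fun i => \1_(`[corner (m i), corner (m i) + 1[%classic)) (fun i => bounded1_cell (m i))).
rewrite big1// => i _; rewrite /Rintegral integral_indic//= setIT lebesgue_measure_itv lte_fin ltrDl ltr01.
by rewrite -EFinD addrAC subrr add0r.
Qed.

(* Choosing in every cell a point where F is at least half of its supremum turns an integral into a sum over a separated family of points. *)
Lemma rint_le_cells (F : 'rV[R]_n -> R) C (h : R) : wbounded F -> (forall z, 0 <= F z) ->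
  (forall z, F z <= C * weight z ^+ 2) -> 0 < h ->
  exists N, exists2 p : box N -> 'rV[R]_n, forall m, cell m (p m) &
    rint F <= h + 2 * \sum_m F (p m).
Proof.
move=> wF F0 FC h0.
pose C' := `|C| * pi ^+ n.
(* Outside the box one of the two powers of the weight is at most 1 / (N + 1), and the other
   integrates to pi^n; the tail is thus at most [h]. *)
have [N NP] : exists N : nat, C' <= h * N.+1%:R.
  by exists (Num.truncn (C' / h)); rewrite -ler_pdivrMl// mulrC ltW// truncnS_gt.
exists N.+1.
have near (m : box N.+1) : exists2 z, cell m z & forall z', cell m z' -> F z' <= 2 * F z.
  pose S := [set F z | z in cell m].
  have S0 : S !=set0.
    exists (F (\row_i corner (m i))), (\row_i corner (m i)) => // i.
    by rewrite mxE lexx ltrDl ltr01.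
  have Sub : has_sup S.
    split=> //; exists `|C| => _ [z _ <-]; apply: (le_trans (FC z)); apply: (le_trans (ler_norm _)).
    rewrite normrM ler_piMr// ger0_norm ?exprn_ge0 ?weight_ge0// exprn_ile1 ?weight_ge0//.
    exact: weight_le1.
  have ub z : cell m z -> F z <= sup S by move=> mz; apply: ub_le_sup; [exact: Sub.2|exists z].
  have [s0|s0] := ltP 0 (sup S).
    have s2 : 0 < sup S / 2 by rewrite divr_gt0.
    have [_ [z mz <-] hz] := sup_adherent s2 Sub.
    exists z => // z' mz'; apply: (le_trans (ub _ mz')); lra.
  have [_ [z mz _]] := S0; exists z => // z' mz'; apply: (le_trans (ub _ mz')).
  by apply: (le_trans s0); rewrite mulr_ge0.
pose p (m : box N.+1) := s2val (cid2 (near m)).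
have pF m z : cell m z -> F z <= 2 * F (p m) by exact: (s2valP' (cid2 (near m))).
exists p => [m|]; first exact: (s2valP (cid2 (near m))).
have wS (r : seq (box N.+1)) : wbounded (fun z => \sum_(m <- r) 2 * F (p m) * cell_fun m z) /\
    rint (fun z => \sum_(m <- r) 2 * F (p m) * cell_fun m z) = \sum_(m <- r) 2 * F (p m).
  elim: r => [|m r [IH1 IH2]].
    have -> : (fun z : 'rV[R]_n => \sum_(m <- [::]) 2 * F (p m) * cell_fun m z) = (fun z => 0 * weight z).
      by apply/funext => y; rewrite big_nil mul0r.
    split; first exact: wboundedZ (@wbounded_weight R n).
    by rewrite (rintZ _ (@wbounded_weight R n)) mul0r big_nil.
  have -> : (fun z : 'rV[R]_n => \sum_(m <- m :: r) 2 * F (p m) * cell_fun m z) =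
     (fun z => 2 * F (p m) * cell_fun m z + \sum_(m <- r) 2 * F (p m) * cell_fun m z).
    by apply/funext => y; rewrite big_cons.
  have wm := wboundedZ (2 * F (p m)) (wbounded_cell m); split; first exact: wboundedD.
  by rewrite (rintD wm IH1) IH2 (rintZ _ (wbounded_cell m)) rint_cell mulr1 big_cons.
have [wS1 wS2] := wS (index_enum _).
have ww := wboundedZ (`|C| / N.+1%:R) (@wbounded_weight R n).
apply: (@le_trans _ _ (rint (fun z => `|C| / N.+1%:R * weight z + \sum_m 2 * F (p m) * cell_fun m z))); last first.
  rewrite (rintD ww wS1) wS2 (rintZ _ (@wbounded_weight R n)) rint_weight mulr_sumr lerD2r.
  by rewrite mulrAC ler_pdivrMr.
apply: le_rint => //; first exact: wboundedD.
move=> z; have S0 : 0 <= \sum_m 2 * F (p m) * cell_fun m z.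
  by apply: sumr_ge0 => m _; rewrite cell_funE !mulr_ge0.
have w0 : 0 <= `|C| / N.+1%:R * weight z by rewrite !mulr_ge0 ?weight_ge0.
have [zb|zb] := pselect (forall i, - N.+1%:R <= z 0 i < N.+1%:R).
  have [m mz] := cell_cover zb; apply: (le_trans (pF m z mz)); apply: ler_wpDl => //.
  rewrite (bigD1 m)//= cell_funE indicE mem_set// mulr1 lerDl.
  by apply: sumr_ge0 => k _; rewrite cell_funE !mulr_ge0.
apply: ler_wpDr => //; apply: (le_trans (FC z)).
apply: (@le_trans _ _ (`|C| * weight z ^+ 2)).
  by rewrite ler_wpM2r ?exprn_ge0 ?weight_ge0// ler_norm.
rewrite -mulrA ler_wpM2l// ler_wpM2r ?weight_ge0//.
move/existsNP : zb => [i hi]; rewrite /weight (bigD1 i)//=.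
have p1 : \prod_(k < n | k != i) (1 + z 0 k ^+ 2)^-1 <= 1.
  by apply: prodr_ile1 => k _; have /andP[k0 ->] := weight_factor (z 0 k); rewrite andbT; exact: ltW.
have q0 : 0 <= (1 + z 0 i ^+ 2)^-1 by rewrite invr_ge0 addr_ge0 ?sqr_ge0.
apply: (le_trans (ler_piMr q0 p1)); rewrite lef_pV2 ?posrE ?ltr_pwDl ?sqr_ge0//.
have zN : N.+1%:R <= `|z 0 i|.
  move/negP: hi; rewrite negb_and -ltNge -leNgt => /orP[h1|h1].
    have := ler_norm (- z 0 i); rewrite normrN; apply: le_trans.
    by move: h1; rewrite ltrNr => /ltW.
  by apply: (le_trans h1); exact: ler_norm.
have N1 : (1 : R) <= N.+1%:R by rewrite ler1n.
move: `|z 0 i| zN N1 => u; nra.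
Qed.

(** t / (1 + |t|) takes values between -1 and 1, and its increment at an integer t is at least 1 /
    (4 (1 + t^2)); telescoping gives 4 times 2. *)
Lemma sum_weight1 (a k : nat) : \sum_(l < k) (1 + (l%:R - a%:R) ^+ 2)^-1 <= 8 :> R.
Proof.
pose G (t : R) := t / (1 + `|t|).
have G1 t : `|G t| <= 1.
  have p : 0 < 1 + `|t| by rewrite ltr_pwDl.
  by rewrite normrM normfV (gtr0_norm p) ler_pdivrMr// mul1r lerDr.
have step (l : nat) : (1 + (l%:R - a%:R) ^+ 2)^-1 <= 4 * (G (l.+1%:R - a%:R) - G (l%:R - a%:R)).
  have -> : l.+1%:R - a%:R = l%:R - a%:R + 1 :> R by rewrite -natr1 addrAC.
  have [al|la] := leqP a l.
    have : 0 <= l%:R - a%:R :> R by rewrite subr_ge0 ler_nat.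
    move: (l%:R - a%:R) => t t0; rewrite /G !ger0_norm ?addr_ge0//.
    have p1 : 0 < 1 + t by rewrite ltr_pwDl.
    have p2 : 0 < 1 + (t + 1) by rewrite ltr_pwDl ?addr_ge0.
    have -> : 4 * ((t + 1) / (1 + (t + 1)) - t / (1 + t)) = 4 / ((1 + (t + 1)) * (1 + t)).
      by field; rewrite !gt_eqF.
    rewrite ler_pdivlMr ?mulr_gt0// mulrC ler_pdivrMr; nra.
  have : l%:R - a%:R <= -1 :> R by rewrite lerBlDl lerBrDr natr1 ler_nat.
  move: (l%:R - a%:R) => t t1; rewrite /G !ler0_norm; [|lra|lra].
  have p1 : 0 < 1 + - t by lra.
  have p2 : 0 < 1 + - (t + 1) by lra.
  have -> : 4 * ((t + 1) / (1 + - (t + 1)) - t / (1 + - t)) = 4 / ((1 + - (t + 1)) * (1 + - t)).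
    by field; rewrite !gt_eqF.
  rewrite ler_pdivlMr ?mulr_gt0// mulrC ler_pdivrMr; nra.
have tel : \sum_(l < k) (1 + (l%:R - a%:R) ^+ 2)^-1 <= 4 * (G (k%:R - a%:R) - G (0%:R - a%:R)).
  elim: k => [|k IH]; first by rewrite big_ord0 subrr.
  by rewrite big_ord_recr; apply: (le_trans (lerD IH (step k))); rewrite -mulrDr addrC subrKA.
apply: (le_trans tel); have := G1 (k%:R - a%:R); have := G1 (0%:R - a%:R).
rewrite !ler_norml; lra.
Qed.

(* Points of distinct cells are separated, so the Gram matrix of the corresponding packets has bounded row sums. *)
Lemma sum_weight_shift N (p : box N -> 'rV[R]_n) (v : 'rV[R]_n) (a : 'I_n -> nat) :
  (forall m, cell m (p m)) -> (forall i, (a i)%:R - N%:R <= v 0 i < (a i)%:R - N%:R + 1) ->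
  \sum_m weight (p m - v) <= 32 ^+ n.
Proof.
move=> pP vP.
have h m : weight (p m - v) <= \prod_i (4 * (1 + ((m i)%:R - (a i)%:R) ^+ 2)^-1).
  apply: ler_prod => i _; rewrite invr_ge0 !mxE.
  have q0 (t : R) : 0 < 1 + t ^+ 2 by rewrite ltr_pwDl ?sqr_ge0.
  rewrite ler_pdivlMr// ler_pdivrMl//.
  have := pP m i; have := vP i; rewrite /corner.
  move: (p m 0 i) (v 0 i) ((m i)%:R) ((a i)%:R) => x y c e /andP[h1 h2] /andP[h3 h4].
  (* Points lie in their unit cells, so the difference of two points is within 1 of the difference
     of the indices. This costs a factor 4 in each coordinate, whence 32 = 4 * 8. *)
  have h5 : `|(x - y) - (c - e)| <= 1 by rewrite ler_norml; lra.
  have : (x - y - (c - e)) ^+ 2 <= 1 by rewrite -(real_normK (num_real _)) exprn_ile1.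
  move: (x - y) (c - e) => u w; nra.
apply: (le_trans (ler_sum _ (fun m _ => h m))).
rewrite -(bigA_distr_bigA (fun i (l : 'I_N.*2) => 4 * (1 + (l%:R - (a i)%:R) ^+ 2)^-1)).
apply: (@le_trans _ _ (\prod_(i < n) 32)); last by rewrite prodr_const card_ord.
apply: ler_prod => i _; apply/andP; split.
  by apply: sumr_ge0 => l _; rewrite mulr_ge0// invr_ge0 addr_ge0 ?sqr_ge0.
rewrite -mulr_sumr (_ : 32 = 4 * 8) ?ler_pM2l//; last by rewrite -natrM.
exact: sum_weight1.
Qed.

Lemma sum_weight_cells N (p : box N -> 'rV[R]_n) (m0 : box N) : (forall m, cell m (p m)) ->
  \sum_m weight (p m - p m0) <= 32 ^+ n.
Proof. by move=> pP; apply: (@sum_weight_shift _ p _ (fun i => m0 i)) => // i; exact: pP. Qed.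

End Cells.

(** * Wave packets *)

Section Bracket.
Context {R : realType} {n : nat}.
Implicit Types (z w : 'rV[R]_n).

(** The Japanese bracket, in the form that occurs in [symbol_on]. *)
Definition jb z : R := 1 + enorm z.

Lemma enorm_ge0 z : 0 <= enorm z. Proof. exact: sqrtr_ge0. Qed.

Lemma enorm_sqr z : enorm z ^+ 2 = \sum_i z 0 i ^+ 2.
Proof.
rewrite sqr_sqrtr ?dotv_ge0//.
Qed.

Lemma jb_ge1 z : 1 <= jb z. Proof. by rewrite lerDl enorm_ge0. Qed.
Lemma jb_gt0 z : 0 < jb z. Proof. exact: lt_le_trans ltr01 (jb_ge1 z). Qed.
Lemma jb_ge0 z : 0 <= jb z. Proof. exact: ltW (jb_gt0 z). Qed.

Lemma dotv_cauchy z w : dotv z w <= enorm z * enorm w.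
Proof.
have [w0|w0] := eqVneq (enorm w) 0.
  have : enorm w ^+ 2 = 0 by rewrite w0 expr0n.
  rewrite enorm_sqr => /eqP; rewrite psumr_eq0 => [/allP h|i _]; last exact: sqr_ge0.
  rewrite w0 mulr0 /dotv big1// => i _; have := h i (mem_index_enum i).
  by rewrite sqrf_eq0 => /eqP ->; rewrite mulr0.
have w1 : 0 < enorm w by rewrite lt_neqAle eq_sym w0 enorm_ge0.
have wE : enorm w ^+ 2 = dotv w w by rewrite sqr_sqrtr ?dotv_ge0.
have zE : enorm z ^+ 2 = dotv z z by rewrite sqr_sqrtr ?dotv_ge0.
have h := dotv_ge0 (enorm w *: z - enorm z *: w).
move: h; rewrite dotvBl !dotvBr !dotvZl ![dotv _ (_ *: _)]dotvC !dotvZl -wE -zE [dotv w z]dotvC.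
have [z0|z0] := eqVneq (enorm z) 0.
  have : enorm z ^+ 2 = 0 by rewrite z0 expr0n.
  rewrite enorm_sqr => /eqP; rewrite psumr_eq0 => [/allP h|i _]; last exact: sqr_ge0.
  move=> _; rewrite z0 mul0r /dotv big1// => i _; have := h i (mem_index_enum i).
  by rewrite sqrf_eq0 => /eqP ->; rewrite mul0r.
have z1 : 0 < enorm z by rewrite lt_neqAle eq_sym z0 enorm_ge0.
move=> h; have p := mulr_gt0 z1 w1; rewrite -(ler_pM2l p).
nra.
Qed.

Lemma enormD z w : enorm (z + w) <= enorm z + enorm w.
Proof.
rewrite -ler_sqr ?nnegrE ?addr_ge0 ?enorm_ge0// sqrrD.
rewrite ![_ ^+ 2]sqr_sqrtr ?dotv_ge0// dotvDl ![dotv _ (_ + _)]dotvC !dotvDl [dotv w z]dotvC.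
by have := dotv_cauchy z w; lra.
Qed.

Lemma enormZ c z : enorm (c *: z) = `|c| * enorm z.
Proof.
rewrite /enorm dotvZl dotvC dotvZl mulrA sqrtrM ?sqr_ge0//.
by rewrite sqrtr_sqr.
Qed.

Lemma enormN z : enorm (- z) = enorm z.
Proof. by rewrite -scaleN1r enormZ normrN normr1 mul1r. Qed.

Lemma jbD z w : jb (z + w) <= jb z * jb w.
Proof.
have := enormD z w; have := enorm_ge0 z; have := enorm_ge0 w; rewrite /jb.
nra.
Qed.

Lemma coord_enorm z i : `|z 0 i| <= enorm z.
Proof.
rewrite -ler_sqr ?nnegrE ?enorm_ge0// enorm_sqr real_normK ?num_real// (bigD1 i)//= lerDl.
by apply: sumr_ge0 => j _; exact: sqr_ge0.
Qed.

Lemma jb_weight z : jb z ^+ 2 * weight z <= 2.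
Proof.
have [_ h] : 0 <= \sum_i z 0 i ^+ 2 /\ 1 + \sum_i z 0 i ^+ 2 <= (weight z)^-1.
  rewrite /weight prodfV invrK; elim/big_rec2: _ => [|i p s _ [s0 IH]]; first by rewrite addr0.
  have u0 := sqr_ge0 (z 0 i); split; first exact: addr_ge0.
  by nra.
rewrite -ler_pdivlMr ?weight_gt0// ; apply: (@le_trans _ _ (2 * (1 + \sum_i z 0 i ^+ 2))).
  rewrite /jb -enorm_sqr.
  have := sqr_ge0 (enorm z - 1); nra.
by rewrite ler_pM2l.
Qed.

(** Peetre's inequality for the product weight: a translation by [w] costs a power of the bracket of
    [w]. *)
Lemma weight_shift z w : weight (z - w) <= 2 ^+ n * jb w ^+ n.*2 * weight z.
Proof.
rewrite -mul2n exprM.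
have -> : 2 ^+ n * (jb w ^+ 2) ^+ n = \prod_(i < n) (2 * jb w ^+ 2) :> R.
  by rewrite prodr_const card_ord -exprMn.
rewrite -big_split; apply: ler_prod => i _; rewrite invr_ge0 addr_ge0 ?sqr_ge0//= !mxE.
have q0 (t : R) : 0 < 1 + t ^+ 2 by rewrite ltr_pwDl ?sqr_ge0.
rewrite ler_pdivlMr// ler_pdivrMl//.
apply: (@le_trans _ _ ((1 + (z 0 i - w 0 i) ^+ 2) * (2 * (1 + w 0 i ^+ 2)))).
  have := sqr_ge0 ((z 0 i - w 0 i) - w 0 i); have := sqr_ge0 ((z 0 i - w 0 i) * w 0 i).
  nra.
apply: ler_wpM2l; first exact: ltW.
rewrite ler_pM2l// sqrrD expr1n mul1r -addrA lerD2l ler_wpDl//.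
  by rewrite mulrn_wge0// enorm_ge0.
by rewrite -(real_normK (num_real (w 0 i))) ler_sqr ?nnegrE ?enorm_ge0//; exact: coord_enorm.
Qed.

Lemma weight_jb p z : weight z ^+ p <= 2 ^+ p * jb z ^- p.*2.
Proof.
rewrite -mul2n exprM -exprVn -exprMn; apply: lerXn2r; rewrite ?nnegrE ?weight_ge0//.
  by rewrite mulr_ge0// invr_ge0 exprn_ge0// jb_ge0.
rewrite ler_pdivlMr ?exprn_gt0 ?jb_gt0// mulrC; exact: jb_weight.
Qed.

End Bracket.

Section Taylor1.
Context {R : realType}.

Lemma mvt_bound (f f' : R -> R) B t : (forall t, is_derive t (1 : R) f (f' t)) -> f 0 = 0 ->
  (forall t, 0 <= t <= 1 -> `|f' t| <= B) -> 0 <= t <= 1 -> `|f t| <= B.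
Proof.
move=> df f0 fB /andP[t0 t1].
have B0 : 0 <= B by apply: le_trans (fB 0 _); rewrite ?lexx ?ler01.
move: t0; rewrite le_eqVlt => /predU1P[<-|t0]; first by rewrite f0 normr0.
have cf : {within `[0, t], continuous f}.
  by apply: continuous_subspaceT => s; apply: differentiable_continuous; apply/derivable1_diffP.
have [c] := MVT t0 (fun s _ => df s) cf; rewrite in_itv => /andP[c0 ct].
rewrite f0 !subr0 => ->; rewrite normrM.
have := fB c; rewrite (ltW c0) (le_trans (ltW ct) t1) => /(_ isT) h.
by rewrite -[leRHS]mulr1; apply: ler_pM => //; rewrite ger0_norm// ltW.
Qed.

(** [h] lists the successive derivatives. The induction hypothesis is applied to the derivative
    [h 1], and the mean value bound returns to [h 0]. *)
Lemma taylor_bound N (h : nat -> R -> R) B : (forall k t, is_derive t (1 : R) (h k) (h k.+1 t)) ->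
  (forall t, 0 <= t <= 1 -> `|h N t| <= B) -> forall t, 0 <= t <= 1 ->
  `|h 0 t - \sum_(k < N) t ^+ k / k`!%:R * h k 0| <= B.
Proof.
elim: N h => [|N IH] h dh hB t t01; first by rewrite big_ord0 subr0 hB.
pose f t := h 0 t - \sum_(k < N.+1) t ^+ k / k`!%:R * h k 0.
pose f' t := h 1 t - \sum_(k < N) t ^+ k / k`!%:R * h k.+1 0.
apply: (mvt_bound (f := f) (f' := f')) => //; last first.
- exact: (IH (fun k => h k.+1)).
- rewrite /f big_ord_recl big1 ?addr0 ?invr1 ?mul1r ?subrr// => i _.
  by rewrite expr0n !mul0r.
move=> s; rewrite /f.
have dX (k : nat) : is_derive s (1 : R) (fun t => t ^+ k.+1 / k.+1`!%:R * h k.+1 0)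
    (s ^+ k / k`!%:R * h k.+1 0).
  have -> : (fun t => t ^+ k.+1 / k.+1`!%:R * h k.+1 0) =
    (h k.+1 0 / k.+1`!%:R) \*: (fun t : R => t ^+ k.+1).
    by apply/funext => u; rewrite /= /GRing.scale/=; ring.
  have EX : (id : R -> R) ^+ k.+1 = (fun t : R => t ^+ k.+1).
    by apply/funext => u; elim: k.+1 => // m; rewrite !exprS => <-.
  have := is_deriveZ (h k.+1 0 / k.+1`!%:R) (is_deriveX k.+1 (is_derive_id s (1 : R))).
  rewrite EX; set D := (X in is_derive _ _ _ X -> _) => hD.
  suff <- : D = s ^+ k / k`!%:R * h k.+1 0 by exact: hD.
  have -> : D = h k.+1 0 / k.+1`!%:R * (k.+1%:R * s ^+ k * 1) by [].
  rewrite natrM.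
  have : k`!%:R != 0 :> R by rewrite pnatr_eq0 -lt0n fact_gt0.
  have : k.+1%:R != 0 :> R by rewrite pnatr_eq0.
  move: (k.+1%:R) (k`!%:R) (s ^+ k) (h k.+1 0) => a b c d a0 b0.
  by field; rewrite b0.
have dS : is_derive s (1 : R) (fun t => \sum_(k < N) t ^+ k.+1 / k.+1`!%:R * h k.+1 0)
     (\sum_(k < N) s ^+ k / k`!%:R * h k.+1 0).
  have := @is_derive_sum R R^o R^o N (fun k t => t ^+ k.+1 / k.+1`!%:R * h k.+1 0) s 1 _ (fun k => dX k).
  by rewrite fct_sumE.
have -> : (fun t => h 0 t - \sum_(k < N.+1) t ^+ k / k`!%:R * h k 0) =
    (h 0 \- cst (h 0 0)) \- (fun t => \sum_(k < N) t ^+ k.+1 / k.+1`!%:R * h k.+1 0).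
  apply/funext => u; rewrite big_ord_recl invr1 !mul1r opprD addrA.
  by [].
have := is_deriveB (is_deriveB (dh 0%N s) (is_derive_cst (h 0%N 0) s (1 : R))) dS.
by rewrite subr0.
Qed.

End Taylor1.

(** * Symbols along the fibre *)

Section Symbols.
Context {R : realType} {n : nat} (V : set 'rV[R]_n) (oV : open V).
Local Notation rV := 'rV[R]_n.
Local Notation e_ i := (delta_mx 0 i : rV).
Implicit Types (b : rV * rV -> R[i]) (K : set rV).

Definition fiber_derive (i : 'I_n) b := cderive ((0, e_ i) : rV * rV) b.

Lemma symbol_on_smooth m b : symbol_on (- m%:R) V b -> csmooth_on (V `*` setT) b.
Proof. by case. Qed.

(** Orders are written [- m%:R]: a derivative in the fibre raises the natural number [m], and the
    bounds become integer powers of [jb]. *)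
Lemma symbol_fiber_derive m b i : symbol_on (- m%:R) V b ->
  symbol_on (- m.+1%:R) V (fiber_derive i b).
Proof.
move=> [sb hb]; split; first exact: csmooth_on_derive.
move=> K cK KV al be; have [C CP] := hb K cK KV al (rcons be i).
exists C => x xi Kx; have := CP x xi Kx.
rewrite map_rcons -rcons_cat citer_derive_rcons size_rcons.
have -> : - m%:R - (size be).+1%:R = - m.+1%:R - (size be)%:R :> R.
  by ring.
exact.
Qed.

Lemma powR_jb (m k : nat) (z : rV) : (1 + enorm z : R) `^ (- m%:R - k%:R) = jb z ^- (m + k).
Proof. by rewrite -opprD -natrD powRN powR_mulrn// jb_ge0. Qed.

Lemma slice_affine (z x : rV) (h : R) v :
  ((h *: v + x, z) : rV * rV) = h *: ((v, 0) : rV * rV) + (x, z).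
Proof. by congr pair; rewrite /= ?scaler0 ?add0r. Qed.

Lemma slice_smooth_real (f : rV * rV -> R) z : smooth_on (V `*` setT) f ->
  smooth_on V (fun x => f (x, z)).
Proof.
apply: (@smooth_on_affine _ _ _ _ V (V `*` setT) (fun y : rV => (y, z)) (fun v : rV => (v, 0) : rV * rV)).
- exact: slice_affine.
- by move=> x Vx.
- by move=> x Vx.
Qed.

Lemma slice_smooth b z : csmooth_on (V `*` setT) b -> csmooth_on V (fun x => b (x, z)).
Proof. by move=> [sr si]; split; [exact: slice_smooth_real sr|exact: slice_smooth_real si]. Qed.

Lemma wderive_slice b z s :
  wderive s (fun x => b (x, z)) = (fun x => citer_derive [seq ((e_ i, 0) : rV * rV) | i <- s] b (x, z)).
Proof.
apply/funext => x; congr (_ +i* _).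
  have := iter_derive_affine (fun p => Re (b p)) [seq e_ i | i <- s] (slice_affine z).
  by rewrite -map_comp => /(congr1 (fun f => f x)).
have := iter_derive_affine (fun p => Im (b p)) [seq e_ i | i <- s] (slice_affine z).
by rewrite -map_comp => /(congr1 (fun f => f x)).
Qed.

Lemma wderiveZ (c : R[i]) (f : rV -> R[i]) s x : csmooth_on V f -> V x ->
  wderive s (fun x => c * f x) x = c * wderive s f x.
Proof.
move=> sf; elim: s x => [|i s IH] x Vx; first by rewrite !wderive_nil.
rewrite !wderive_cons.
have := citer_derive_eq_on [:: e_ i] oV Vx IH; rewrite !citer_derive_cons !citer_derive_nil => ->.
rewrite (@cderiveM _ _ V)//; last 2 first.
- exact: csmooth_on_cst.
- exact: csmooth_on_citer.
by rewrite cderive_cst mul0r add0r.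
Qed.

(** The frequency becomes the index of the family; [jb (w i) ^+ m] compensates the decay of a symbol
    of order -m. *)
Lemma symbol_ufamily (I : Type) (w : I -> rV) m b K : compact K -> K `<=` V ->
  symbol_on (- m%:R) V b -> ufamily V K (fun i x => (jb (w i) ^+ m)%:C * b (x, w i)).
Proof.
move=> cK KV sb; have [sb' hb] := sb; split.
  by move=> i; apply: csmooth_onM => //; [exact: csmooth_on_cst|exact: slice_smooth].
move=> s; have [C CP] := hb K cK KV s [::]; exists C => i x Kx.
rewrite wderiveZ ?wderive_slice; [|exact: slice_smooth|exact: KV].
rewrite normcM normcR ger0_norm ?exprn_ge0 ?jb_ge0// mulrC -ler_pdivlMr ?exprn_gt0 ?jb_gt0//.
by have := CP x (w i) Kx; rewrite cats0 powR_jb addn0.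
Qed.

Section Tay.
Context {I : Type} (w : I -> rV).

(** The sum of d_xi^alpha b(x, w) D^alpha c over sequences of [k] indices, with D = -i d. A
    multi-index occurs once for each ordering, which is why [expansion] divides by k!. *)
Fixpoint tay k b (c : I -> rV -> R[i]) (i : I) (x : rV) : R[i] :=
  if k is k'.+1 then \sum_j tay k' (fiber_derive j b) (fun i x => (0 -i* 1) * cderive (e_ j) (c i) x) i x
  else b (x, w i) * c i x.

Lemma tfamilyZc (J : Type) K (F : J -> rV -> R[i]) (c : R[i]) : closed K -> tfamily K F ->
  tfamily K (fun i x => c * F i x).
Proof. by move=> cK; exact: (tfamilyZ (c := fun=> c) (C := cmod c)). Qed.

Lemma tay_tfamily k m b c K : compact K -> K `<=` V -> symbol_on (- m%:R) V b -> tfamily K c ->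
  tfamily K (fun i x => (jb (w i) ^+ (m + k))%:C * tay k b c i x).
Proof.
move=> cK KV; have ccK := compact_closed (@norm_hausdorff _ _) cK.
elim: k m b c => [|k IH] m b c sb tc.
  rewrite addn0; have := tfamilyM oV ccK KV (symbol_ufamily w cK KV sb) tc.
  by congr tfamily; apply/funext => i; apply/funext => x ; rewrite mulrA.
have h j := IH _ _ _ (symbol_fiber_derive j sb) (tfamilyZc (0 -i* 1) ccK (tfamily_derive j ccK tc)).
have := tfamily_sum (index_enum 'I_n) ccK h; congr tfamily; apply/funext => i; apply/funext => x .
by rewrite mulr_sumr; rewrite addSnnS.
Qed.

End Tay.

(** The k-th derivative of [b] in the fibre along [v], that is, the Taylor term whose inverse
    transform is [tay]. *)
Fixpoint pol k b (x z : rV) (v : rV) : R[i] :=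
  if k is k'.+1 then \sum_j (v 0 j)%:C * pol k' (fiber_derive j b) x z v else b (x, z).

Lemma normc_sum_le (J : finType) (F : J -> R[i]) (G : J -> R) : (forall j, cmod (F j) <= G j) ->
  cmod (\sum_j F j) <= \sum_j G j.
Proof. by move=> h; apply: (le_trans (normc_sum _ _ _)); exact: ler_sum. Qed.

Lemma pol_bound k m b K : compact K -> K `<=` V -> symbol_on (- m%:R) V b ->
  exists C : R, forall x z v, K x -> cmod (pol k b x z v) <= C * jb v ^+ k * jb z ^- (m + k).
Proof.
move=> cK KV; elim: k m b => [|k IH] m b sb.
  have [_ hb] := sb; have [C CP] := hb K cK KV [::] [::]; exists C => x z v Kx.
  have := CP x z Kx; rewrite mulr1 powR_jb.
  have -> : citer_derive ([seq ((e_ i, 0) : rV * rV) | i <- [::]] ++ [seq ((0, e_ i) : rV * rV) | i <- [::]]) b = b.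
    by apply/funext => p; rewrite /citer_derive/=; case: (b p).
  exact.
have h j := cid (IH _ _ (symbol_fiber_derive j sb)).
exists (\sum_j sval (h j)) => x z v Kx ; rewrite !mulr_suml.
apply: normc_sum_le => j; have hj := svalP (h j) x z v Kx; rewrite -addSnnS.
rewrite normcM normcR exprS mulrCA -!mulrA ler_pM ?normc_ge0//.
  by apply: (le_trans (coord_enorm v j)); rewrite lerDr.
by rewrite mulrA.
Qed.

Lemma dir_sum (f : rV * rV -> R) (x z v : rV) : differentiable f (x, z) ->
  'D_((0, v) : rV * rV) f (x, z) = \sum_j v 0 j * 'D_((0, e_ j) : rV * rV) f (x, z).
Proof.
move=> df; have -> : ((0, v) : rV * rV) = \sum_j v 0 j *: ((0, e_ j) : rV * rV).
  rewrite {1}(row_sum_coord v).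
  rewrite [RHS]surjective_pairing; congr pair.
    by rewrite (raddf_sum fst) big1// => j _ /=; rewrite scaler0.
  by rewrite (raddf_sum snd).
by rewrite deriveE// linear_sum; apply: eq_bigr => j _; rewrite deriveE// linearZ.
Qed.

Lemma is_derive_ray (f : rV * rV -> R) (x z v : rV) t : smooth_on (V `*` setT) f -> V x ->
  is_derive t (1 : R) (fun t : R => f (x, z + t *: v))
    (\sum_j v 0 j * 'D_((0, e_ j) : rV * rV) f (x, z + t *: v)).
Proof.
move=> sf Vx.
have df : differentiable f (x, z + t *: v) by apply: smooth_on_diff sf _.
pose L (t : R) : rV * rV := (x, z + t *: v).
have aff (t0 h s : R) : L (h *: s + t0) = h *: (0, s *: v) + L t0.
  congr pair; rewrite /= ?scaler0 ?add0r//.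
  by rewrite scalerDl scalerA addrCA.
have dL : differentiable L t.
  apply: differentiable_pair; first exact: differentiable_cst.
  apply: differentiableD; first exact: differentiable_cst.
  by case: (is_diff_id t).
have := @iter_derive_affine _ R^o _ _ L (fun s => (0, s *: v)) f [:: 1] aff.
move=> /(congr1 (fun f => f t)); rewrite /= scale1r => E.
have dfL : differentiable (f \o L) t by exact: differentiable_comp.
rewrite -(dir_sum v df); apply: DeriveDef => //; exact: diff_derivable.
Qed.

Lemma Re_sum (J : Type) (r : seq J) (F : J -> R[i]) : Re (\sum_(j <- r) F j) = \sum_(j <- r) Re (F j).
Proof. by rewrite raddf_sum. Qed.
Lemma Im_sum (J : Type) (r : seq J) (F : J -> R[i]) : Im (\sum_(j <- r) F j) = \sum_(j <- r) Im (F j).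
Proof. by rewrite raddf_sum. Qed.

Lemma is_derive_pol k b x z v t : csmooth_on (V `*` setT) b -> V x ->
  is_derive t (1 : R) (fun t : R => Re (pol k b x (z + t *: v) v)) (Re (pol k.+1 b x (z + t *: v) v)) /\
  is_derive t (1 : R) (fun t : R => Im (pol k b x (z + t *: v) v)) (Im (pol k.+1 b x (z + t *: v) v)).
Proof.
move=> + Vx; elim: k b => [|k IH] b sb.
  have hr := is_derive_ray z v t sb.1 Vx; have hi := is_derive_ray z v t sb.2 Vx.
  rewrite Re_sum Im_sum; split.
    by move: hr; congr is_derive; apply: eq_bigr => j _; rewrite Re_mul mul0r subr0.
  by move: hi; congr is_derive; apply: eq_bigr => j _; rewrite Im_mul mul0r addr0.
have h j := IH _ (csmooth_on_derive ((0, e_ j) : rV * rV) sb).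
split.
  have := @is_derive_sum R R^o R^o n (fun j t => v 0 j * Re (pol k (fiber_derive j b) x (z + t *: v) v)) t 1 _
    (fun j => is_deriveZ (v 0 j) (h j).1).
  congr is_derive.
    apply/funext => u; rewrite fct_sumE Re_sum; apply: eq_bigr => j _.
    by rewrite Re_mul mul0r subr0.
  rewrite Re_sum; apply: eq_bigr => j _.
  by rewrite [in RHS]Re_mul mul0r subr0.
have := @is_derive_sum R R^o R^o n (fun j t => v 0 j * Im (pol k (fiber_derive j b) x (z + t *: v) v)) t 1 _
    (fun j => is_deriveZ (v 0 j) (h j).2).
congr is_derive.
  apply/funext => u; rewrite fct_sumE Im_sum; apply: eq_bigr => j _.
  by rewrite Im_mul mul0r addr0.
rewrite Im_sum; apply: eq_bigr => j _.
by rewrite [in RHS]Im_mul mul0r addr0.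
Qed.

Lemma symbol_taylor N b K : compact K -> K `<=` V -> symbol_on (- 0%:R) V b ->
  exists C : R, forall x z v, K x ->
    cmod (b (x, z + v) - \sum_(k < N) (k`!%:R^-1)%:C * pol k b x z v) <= C * jb v ^+ N.*2 * jb z ^- N.
Proof.
move=> cK KV sb; have [C0 CP0] := pol_bound N cK KV sb; pose C := `|C0|.
have CP x z v : K x -> cmod (pol N b x z v) <= C * jb v ^+ N * jb z ^- N.
  move=> Kx; apply: (le_trans (CP0 x z v Kx)); rewrite -!mulrA ler_wpM2r ?ler_norm//.
  by rewrite mulr_ge0 ?invr_ge0 ?exprn_ge0 ?jb_ge0.
exists (2 * C) => x z v Kx; pose B := C * jb v ^+ N.*2 * jb z ^- N.
(* The bracket at [z] is at most the one at the intermediate point times [jb v]; replacing the decay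
   there by decay at [z] doubles the exponent of [jb v]. *)
have hB t : 0 <= t <= 1 -> cmod (pol N b x (z + t *: v) v) <= B.
  move=> /andP[t0 t1]; apply: (le_trans (CP _ _ _ Kx)); rewrite /B -!mulrA ler_wpM2l ?normr_ge0//.
  rewrite -addnn exprD -mulrA ler_wpM2l ?exprn_ge0 ?jb_ge0//.
  rewrite -[leLHS]mul1r ler_pdivrMr ?exprn_gt0 ?jb_gt0// mulrAC ler_pdivlMr ?exprn_gt0 ?jb_gt0//.
  rewrite mul1r -exprMn [jb v * _]mulrC.
  apply: lerXn2r; rewrite ?nnegrE ?mulr_ge0 ?jb_ge0//.
  have {1}-> : z = (z + t *: v) + (- t) *: v by rewrite scaleNr addrK.
  apply: (le_trans (jbD _ _)); rewrite ler_wpM2l ?jb_ge0// lerD2l enormZ normrN ger0_norm//.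
  by rewrite ler_piMl ?enorm_ge0.
have [sb' _] := sb; have Vx := KV _ Kx.
have E0 : z = z + 0 *: v by rewrite scale0r addr0.
have E1 : z + v = z + 1 *: v by rewrite scale1r.
have hr := @taylor_bound R N (fun k t => Re (pol k b x (z + t *: v) v)) B
  (fun k t => (is_derive_pol k z v t sb' Vx).1) _ 1 _.
have hi := @taylor_bound R N (fun k t => Im (pol k b x (z + t *: v) v)) B
  (fun k t => (is_derive_pol k z v t sb' Vx).2) _ 1 _.
apply: (le_trans (normc_le _)).
have -> : 2 * C * jb v ^+ N.*2 * jb z ^- N = B + B by rewrite /B; ring.
apply: lerD.
  have := hr _ _; rewrite -E1 -E0 => h.
  apply: le_trans (h _ _); rewrite ?ler01 ?lexx//.
    rewrite raddfB/= Re_sum le_eqVlt; apply/orP; left; apply/eqP; congr (`|_ - _|)%R; apply: eq_bigr => k _.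
    by rewrite Re_mul mul0r subr0 expr1n mul1r.
  by move=> t t01; apply: (le_trans (normc_Re _)); exact: hB.
have := hi _ _; rewrite -E1 -E0 => h.
apply: le_trans (h _ _); rewrite ?ler01 ?lexx//.
  rewrite raddfB/= Im_sum le_eqVlt; apply/orP; left; apply/eqP; congr (`|_ - _|)%R; apply: eq_bigr => k _.
  by rewrite Im_mul mul0r addr0 expr1n mul1r.
by move=> t t01; apply: (le_trans (normc_Im _)); exact: hB.
Qed.

End Symbols.

(** * Operators applied to packets *)

Section Expansion.
Context {R : realType} {n : nat}.
Local Notation rV := 'rV[R]_n.
Local Notation e_ i := (delta_mx 0 i : rV).
Implicit Types (b : rV * rV -> R[i]) (K X : set rV).

Definition packet (c : rV -> R[i]) (w y : rV) : R[i] := c y * cis (dotv y w).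

Lemma packet_smooth c w : csmooth_on setT c -> csmooth_on setT (packet c w).
Proof.
move=> sc; apply: csmooth_onM => //; first exact: openT.
by apply: csmooth_cis; [exact: openT|apply: smooth_dotv; exact: openT].
Qed.

Lemma fourier_packet c w z : fourier (packet c w) z = fourier c (z - w).
Proof.
congr cint_rV; apply/funext => y; rewrite -mulrA -cisD; congr (_ * cis _).
by rewrite dotvBr; ring.
Qed.

Lemma compact_bound_gen (T : topologicalType) (A : set T) (f : T -> R) : compact A ->
  {within A, continuous f} -> exists C : R, forall x, A x -> `|f x| <= C.
Proof.
move=> cA cf; have [M [_ hM]] := compact_bounded (continuous_compact cf cA).
by exists (M + 1) => x Ax; apply: (hM (M + 1)); [rewrite ltrDl|exists x].
Qed.

Lemma compact_in_cube K : compact K -> exists M : R, K `<=` cube M.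
Proof.
move=> cK.
have h i : exists C : R, forall x, K x -> `|x 0 i| <= C.
  by apply: compact_bound_gen cK _; apply: continuous_subspaceT => x; exact: coord_continuous.
pose C i := sval (cid (h i)); have CP i : forall x, K x -> `|x 0 i| <= C i := svalP (cid (h i)).
exists (\sum_i `|C i|) => x Kx i; apply: (le_trans (CP i x Kx)).
by rewrite (bigD1 i)//=; apply: (le_trans (ler_norm _)); rewrite lerDl sumr_ge0.
Qed.

Section OnePacket.
Context (M : R) (c : rV -> R[i]) (sc : csmooth_on setT c) (c0 : forall x, ~ cube M x -> c x = 0).

(** The wave only translates the transform, so the factor z - w corresponds to -i d acting on the
    amplitude alone. *)
Lemma fourier_shift w j z :
  fourier (packet (fun y => (0 -i* 1) * cderive (e_ j) c y) w) z =
  (z 0 j - w 0 j)%:C * fourier (packet c w) z.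
Proof.
rewrite !fourier_packet.
have sd : csmooth_on setT (cderive (e_ j) c) by exact: csmooth_on_derive.
have d0 x : ~ cube M x -> cderive (e_ j) c x = 0.
  by move=> Mx; have := wderive_out [:: j] (@closed_cube R n M) c0 Mx.
have -> : fourier (fun y => (0 -i* 1) * cderive (e_ j) c y) (z - w) =
    (0 -i* 1) * fourier (cderive (e_ j) c) (z - w).
  rewrite -(cint_scale _ (cwbounded_wave (z - w) sd d0)); congr cint_rV.
  by apply/funext => y; rewrite mulrA.
rewrite (fourier_derive j (z - w) sc c0); rewrite !mxE.
by apply: complexE2; rewrite /=; ring.
Qed.

Lemma cwbounded_fourier_packet w : cwbounded (fourier (packet c w)).
Proof.
have sp := packet_smooth w sc.
have p0 x : ~ cube M x -> packet c w x = 0 by move=> /c0 h; rewrite /packet h mul0r.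
have tf : tfamily (cube M) (fun _ : unit => packet c w).
  by split=> // ; apply: ufamily_indep => //; exact: compact_cube.
have [C CP] := fourier_decay 1 (@closed_cube _ _ _) (@subset_refl _ _) tf.
by apply: (cwboundedP (fourier_meas sp p0) (C := C)) => z; have := CP tt z.
Qed.

Lemma cwbounded_inverse w x : cwbounded (fun z => fourier (packet c w) z * cis (dotv x z)).
Proof.
have h := cwbounded_fourier_packet w.
suff : cwbounded (fun z => cis (dotv x z) * fourier (packet c w) z).
  by congr cwbounded; apply/funext => z; rewrite mulrC.
apply: (cwboundedM (C := 1) h) => [|z]; last by rewrite normc_cis.
by apply: cmeas_cis; have := dotv_vmeas x; congr vmeas; apply/funext => z; rewrite dotvC.
Qed.

End OnePacket.

Section Family.
Context {I : Type} (w : I -> rV).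

(** A Taylor term is a polynomial in z - w: [fourier_shift] turns it into derivatives of the
    amplitude, and inversion evaluates the integral exactly. *)
Lemma pol_integral M k b (c : I -> rV -> R[i]) i x : csmooth_on setT (c i) ->
  (forall x, ~ cube M x -> c i x = 0) ->
  let g z := pol k b x (w i) (z - w i) * (fourier (packet (c i) (w i)) z * cis (dotv x z)) in
  cwbounded g /\ cint_rV g = ((2 * pi) ^+ n)%:C * (tay w k b c i x * cis (dotv x (w i))).
Proof.
elim: k b c => [|k IH] b c sc c0.
  have h := cwbounded_inverse sc c0 (w i) x; split; first exact: cwboundedZ.
  have p0 y : ~ cube M y -> packet (c i) (w i) y = 0 by move=> /c0 h'; rewrite /packet h' mul0r.
  rewrite /= (cint_scale _ h) (fourier_inversion (packet_smooth (w i) sc) p0) /packet; ring.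
pose d j : I -> rV -> R[i] := fun i x => (0 -i* 1) * cderive (e_ j) (c i) x.

have sd j : csmooth_on setT (d j i).
  apply: csmooth_onM; [exact: openT|exact: csmooth_on_cst|exact: csmooth_on_derive].
have d0 j y : ~ cube M y -> d j i y = 0.
  move=> My; have := wderive_out [:: j] (@closed_cube R n M) c0 My.
  by rewrite wderive_cons wderive_nil /d => ->; rewrite mulr0.
have hj j := IH (fiber_derive j b) (d j) (sd j) (d0 j).
pose G j z := pol k (fiber_derive j b) x (w i) (z - w i) *
   (fourier (packet (d j i) (w i)) z * cis (dotv x z)).
have E : (fun z => pol k.+1 b x (w i) (z - w i) * (fourier (packet (c i) (w i)) z * cis (dotv x z))) =
    (fun z => \sum_j G j z).
  apply/funext => z; rewrite /= mulr_suml; apply: eq_bigr => j _.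
  rewrite /G (fourier_shift sc c0) !mxE; ring.
have wG j : cwbounded (G j) by have [] := hj j.
move=> g; rewrite /g E; split; first exact: cwbounded_sum.
rewrite (cint_sum _ wG) mulr_suml mulr_sumr; apply: eq_bigr => j _.
by have [_] := hj j.
Qed.

End Family.

Section Remainder.
Context (V : set rV) (oV : open V) {I : Type} (w : I -> rV).

Lemma fiber_meas b x : csmooth_on (V `*` setT) b -> V x -> cmeas (fun z => b (x, z)).
Proof.
move=> [sr si] Vx.
have aff (z : rV) (h : R) v : ((x, h *: v + z) : rV * rV) = h *: ((0, v) : rV * rV) + (x, z).
  by congr pair; rewrite /= scaler0 add0r.
have dp z : differentiable (fun z : rV => (x, z)) z.
  by apply: differentiable_pair.
have S (f : rV * rV -> R) : smooth_on (V `*` setT) f -> smooth_on setT (fun z => f (x, z)).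
  apply: (@smooth_on_affine _ _ _ _ setT (V `*` setT) (fun z : rV => (x, z)) (fun v : rV => (0, v) : rV * rV)).
  - exact: aff.
  - by move=> z Tz.
  - by move=> z Tz.
by split; [exact: smooth_vmeas (S _ sr)|exact: smooth_vmeas (S _ si)].
Qed.

Lemma Op_fourier M b u x : csmooth_on setT u -> (forall x, ~ cube M x -> u x = 0) ->
  Op b u x = ((2 * pi) ^- n)%:C * cint_rV (fun z => b (x, z) * (fourier u z * cis (dotv x z))).
Proof.
move=> su u0; congr (_ * cint_rV _); apply/funext => z.
have -> : b (x, z) * (fourier u z * cis (dotv x z)) = (b (x, z) * cis (dotv x z)) * fourier u z by ring.
rewrite -(cint_scale _ (cwbounded_wave z su u0)); congr cint_rV; apply/funext => y.
by rewrite dotvBl cisD; ring.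
Qed.

Definition expansion N b (c : I -> rV -> R[i]) (i : I) (x : rV) : R[i] :=
  \sum_(k < N) (k`!%:R^-1)%:C * tay w k b c i x.

(** The Taylor terms contribute exactly [expansion]; only the Taylor remainder is estimated, against
    the rapid decay of the transform of the amplitude. *)
Theorem Op_expansion N b c K X : compact K -> compact X -> X `<=` V ->
  symbol_on (- 0%:R) V b -> tfamily K c ->
  exists C : R, forall i x, X x ->
    cmod (Op b (packet (c i) (w i)) x - expansion (N + n.*2) b c i x * cis (dotv x (w i))) <=
    C * jb (w i) ^- N.
Proof.
move=> cK cX XV sb tc; have [M KM] := compact_in_cube cK.
have ccK := compact_closed (@norm_hausdorff _ _) cK.
(* The [n.*2] extra orders pay for moving the weight from z - w to z. Of the N' + 1 powers of the
   weight taken next, N' balance the growth of the remainder in z - w and one is integrated. *)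
pose N' := (N + n.*2)%N; have [Ct CtP] := symbol_taylor N' cX XV sb.
have [Cf CfP] := fourier_decay N'.+1 ccK KM tc.
pose C1 := `|Ct|; pose C2 := `|Cf|.
pose B := C1 * C2 * 2 ^+ N' * 2 ^+ n * (2 * pi ^+ n).
exists ((2 * pi) ^- n * B) => i x Xx.
have sc : csmooth_on setT (c i) by case: tc => -[h _] _.
have c0 y : ~ cube M y -> c i y = 0 by case: tc => _ h My; apply: h => /KM.
have p0 y : ~ cube M y -> packet (c i) (w i) y = 0 by move=> /c0 h; rewrite /packet h mul0r.
rewrite (Op_fourier b x (packet_smooth (w i) sc) p0).
pose g k z := pol k b x (w i) (z - w i) * (fourier (packet (c i) (w i)) z * cis (dotv x z)).
have wg k : cwbounded (g k) by have [] := pol_integral w k b x sc c0.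
have ig k : cint_rV (g k) = ((2 * pi) ^+ n)%:C * (tay w k b c i x * cis (dotv x (w i))).
  by have [] := pol_integral w k b x sc c0.
pose S z := \sum_(k < N') (k`!%:R^-1)%:C * g k z.
have wS : cwbounded S by apply: cwbounded_sum => k; exact: cwboundedZ.
pose D z := (b (x, z) - \sum_(k < N') (k`!%:R^-1)%:C * pol k b x (w i) (z - w i)) *
   (fourier (packet (c i) (w i)) z * cis (dotv x z)).
have wi := cwbounded_inverse sc c0 (w i) x.
have DE z : D z = b (x, z) * (fourier (packet (c i) (w i)) z * cis (dotv x z)) + (-1) * S z.
  rewrite /D mulrBl mulN1r; congr (_ - _); rewrite mulr_suml; apply: eq_bigr => k _.
  by rewrite -mulrA.
have p2 : 0 < (2 * pi) ^+ n :> R by rewrite exprn_gt0 ?mulr_gt0 ?pi_gt0.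
have Dle z : cmod (D z) <= C1 * C2 * 2 ^+ N' * 2 ^+ n * jb (w i) ^- N * weight z.
  rewrite !normcM normc_cis mulr1 fourier_packet.
  have h1 : cmod (b (x, z) - \sum_(k < N') (k`!%:R^-1)%:C * pol k b x (w i) (z - w i)) <=
      C1 * jb (z - w i) ^+ N'.*2 * jb (w i) ^- N'.
    have := CtP x (w i) (z - w i) Xx.
    have -> : w i + (z - w i) = z by rewrite addrC subrK.
    move=> /le_trans; apply.
    by rewrite -!mulrA ler_wpM2r ?ler_norm// mulr_ge0 ?invr_ge0 ?exprn_ge0 ?jb_ge0.
  have h2 : cmod (fourier (c i) (z - w i)) <= C2 * weight (z - w i) ^+ N'.+1.
    by apply: (le_trans (CfP i _)); rewrite ler_wpM2r ?ler_norm// exprn_ge0 ?weight_ge0.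
  have h3 := ler_pM (normc_ge0 _) (normc_ge0 _) h1 h2; apply: (le_trans h3).
  set j := jb (z - w i); set q := weight (z - w i).
  have h4 : j ^+ N'.*2 * q ^+ N' <= 2 ^+ N'.
    rewrite -mul2n exprM -exprMn; apply: lerXn2r; rewrite ?nnegrE ?mulr_ge0 ?jb_ge0 ?weight_ge0//.
    exact: jb_weight.
  have h5 : q <= 2 ^+ n * jb (w i) ^+ n.*2 * weight z := weight_shift z (w i).
  have -> : C1 * j ^+ N'.*2 * jb (w i) ^- N' * (C2 * q ^+ N'.+1) =
     C1 * C2 * jb (w i) ^- N' * ((j ^+ N'.*2 * q ^+ N') * q) by rewrite exprS; ring.
  have -> : C1 * C2 * 2 ^+ N' * 2 ^+ n * jb (w i) ^- N * weight z =
     C1 * C2 * jb (w i) ^- N' * (2 ^+ N' * (2 ^+ n * jb (w i) ^+ n.*2 * weight z)).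
    have : jb (w i) != 0 by rewrite gt_eqF ?jb_gt0.
    rewrite !exprD; move: (jb (w i)) (weight z) => J W J0.
    have := expf_neq0 N J0; have := expf_neq0 n.*2 J0.
    by move: (J ^+ N) (J ^+ n.*2) => u v u0 v0; field; rewrite u0.
  have C10 : 0 <= C1 := normr_ge0 _.
  have C20 : 0 <= C2 := normr_ge0 _.
  have J0 : 0 <= (jb (w i) ^+ N')^-1 by rewrite invr_ge0 exprn_ge0 ?jb_ge0.
  apply: ler_wpM2l; first by apply: mulr_ge0 J0; exact: mulr_ge0.
  by apply: ler_pM => //; [rewrite mulr_ge0 ?exprn_ge0 ?jb_ge0 ?weight_ge0|exact: weight_ge0].
have mD : cmeas D.
  have : cmeas (fun z => b (x, z) * (fourier (packet (c i) (w i)) z * cis (dotv x z)) + (-1) * S z).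
    apply: cmeasD; last by apply: cwbounded_meas; exact: cwboundedZ.
    apply: cmeasM; last exact: cwbounded_meas wi.
    by apply: fiber_meas; [exact: symbol_on_smooth sb|exact: XV].
  by congr cmeas; apply/funext => z.
have wD : cwbounded D := cwboundedP mD Dle.
have -> : (fun z => b (x, z) * (fourier (packet (c i) (w i)) z * cis (dotv x z))) = (fun z => D z + S z).
  by apply/funext => z; rewrite DE mulN1r subrK.
rewrite (cint_add wD wS).
have -> : cint_rV S = ((2 * pi) ^+ n)%:C * (expansion N' b c i x * cis (dotv x (w i))).
  rewrite (cint_sum (F := fun (k : 'I_N') z => (k`!%:R^-1)%:C * g k z) _ (fun k => cwboundedZ _ (wg k))).
  rewrite mulr_suml mulr_sumr.
  apply: eq_bigr => k _; rewrite (cint_scale _ (wg k)) ig; ring.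
rewrite mulrDr [X in _ + X - _]mulrA -rmorphM mulVf ?gt_eqF// mul1r addrK normcM normcR.
rewrite ger0_norm ?invr_ge0 ?(ltW p2)// -mulrA ler_wpM2l ?invr_ge0 ?(ltW p2)//.
apply: (le_trans (cint_weight_le mD Dle)); rewrite le_eqVlt /B; apply/orP; left; apply/eqP; ring.
Qed.

End Remainder.

Section Kernel.
Context (V : set rV) (oV : open V) {I : Type} (w : I -> rV).

Lemma kernel_ufamily (r : rV * rV -> R[i]) X K : compact X -> X `<=` V -> compact K -> K `<=` V ->
  csmooth_on (V `*` V) r -> ufamily V K (fun (x : {x | X x}) y => r (sval x, y)).
Proof.
move=> cX XV cK KV sr.
have aff (x z : rV) (h : R) v : ((x, h *: v + z) : rV * rV) = h *: ((0, v) : rV * rV) + (x, z).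
  by congr pair; rewrite /= scaler0 add0r.
have dp (x z : rV) : differentiable (fun z : rV => (x, z)) z.
  by apply: differentiable_pair.
have S x (f : rV * rV -> R) : V x -> smooth_on (V `*` V) f -> smooth_on V (fun z => f (x, z)).
  move=> Vx; apply: (@smooth_on_affine _ _ _ _ V (V `*` V) (fun z : rV => (x, z)) (fun v : rV => (0, v) : rV * rV)).
  - exact: aff.
  - by move=> z Tz.
  - by move=> z Tz.
split; first by move=> [x /XV Vx] /=; have [h1 h2] := sr; split; [exact: S Vx h1|exact: S Vx h2].
move=> s; pose ss := [seq ((0, e_ i) : rV * rV) | i <- s].
have [h1 h2] := csmooth_on_citer ss sr.
have cXK : compact (X `*` K) by exact: compact_setX.
have W (f : rV * rV -> R) : smooth_on (V `*` V) f -> exists C : R, forall p, (X `*` K) p -> `|f p| <= C.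
  move=> sf; apply: compact_bound_gen cXK _; apply: continuous_in_subspaceT => p.
  by rewrite inE => -[/XV Vp /KV Vq]; exact: smooth_on_continuous sf _.
have [C1 C1P] := W _ h1; have [C2 C2P] := W _ h2.
exists (C1 + C2) => -[x Xx] y Ky.
suff -> : wderive s (fun y => r (x, y)) y = citer_derive ss r (x, y).
  apply: (le_trans (normc_le _)); apply: lerD; first exact: (C1P (x, y)).
  exact: (C2P (x, y)).
transitivity (citer_derive [seq e_ i | i <- s] (fun y => r (x, y)) y) => //.
have -> : citer_derive [seq e_ i | i <- s] (fun y => r (x, y)) y = citer_derive ss r (x, y).
  congr (_ +i* _).
    have := iter_derive_affine (fun p => Re (r p)) [seq e_ i | i <- s] (aff x).
    by rewrite -map_comp => /(congr1 (fun f => f y)).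
  have := iter_derive_affine (fun p => Im (r p)) [seq e_ i | i <- s] (aff x).
  by rewrite -map_comp => /(congr1 (fun f => f y)).
by [].
Qed.

(** The image of a packet is the Fourier transform at -w of r(x, .) c. Joining the point [x] to the
    index of the family makes the decay uniform in [x]. *)
Theorem kernel_decay N r c K X : compact K -> K `<=` V -> compact X -> X `<=` V ->
  csmooth_on (V `*` V) r -> tfamily K c ->
  exists C : R, forall i x, X x -> cmod (kernel_op r (packet (c i) (w i)) x) <= C * jb (w i) ^- N.
Proof.
move=> cK KV cX XV sr tc; have [M KM] := compact_in_cube cK.
have ccK := compact_closed (@norm_hausdorff _ _) cK.
have ur := kernel_ufamily cX XV cK KV sr.
have tF : tfamily K (fun (p : {x | X x} * I) y => r (sval p.1, y) * c p.2 y).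
  apply: (tfamilyM oV ccK KV).
    exact: (ufamily_reindex (fun p : {x | X x} * I => p.1) ur).
  have [uc c0] := tc; split; first exact: (ufamily_reindex (fun p : {x | X x} * I => p.2) uc).
  by move=> p x Kx; exact: c0.
have [C CP] := fourier_decay N ccK KM tF; exists (`|C| * 2 ^+ N) => i x Xx.
have := CP (exist _ x Xx, i) (- w i).
have -> : fourier (fun y => r (x, y) * c i y) (- w i) = kernel_op r (packet (c i) (w i)) x.
  congr cint_rV; apply/funext => y.
  by rewrite mulrA; rewrite dotvC dotvNl opprK dotvC.
move=> /le_trans; apply; apply: (@le_trans _ _ (`|C| * weight (- w i) ^+ N)).
  by rewrite ler_wpM2r ?ler_norm// exprn_ge0 ?weight_ge0.
rewrite -mulrA ler_wpM2l//; apply: (le_trans (weight_jb _ _)).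
rewrite ler_wpM2l// /jb enormN lef_pV2 ?posrE ?exprn_gt0 ?jb_gt0//.
by apply: ler_weXn2l; [exact: jb_ge1|rewrite -addnn leq_addr].
Qed.

End Kernel.
End Expansion.

(** * Charts *)

Section Bump.
Context {R : realType}.
Implicit Types (p : {poly R}) (t : R).

(** The functions p(1 / t) e^(-1 / t) are stable under derivatives, p being replaced by X^2 (p -
    p'); p = 1 is the usual flat function. *)
Definition flat p t : R := if 0 < t then p.[t^-1] * expR (- t^-1) else 0.

Lemma poly_exp_bound p : exists C : R, forall s, 0 <= s -> `|p.[s]| * expR (- s) <= C.
Proof.
have mono i (s : R) : 0 <= s -> s ^+ i * expR (- s) <= i.+1%:R ^+ i.
  move=> s0; rewrite expRN ler_pdivrMr ?expR_gt0//.
  have h : s / i.+1%:R <= expR (s / i.+1%:R).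
    by apply: le_trans (expR_ge1Dx _); rewrite lerDr.
  have q0 : 0 <= s / i.+1%:R by rewrite divr_ge0.
  have h2 : (s / i.+1%:R) ^+ i <= expR (s / i.+1%:R) ^+ i by apply: lerXn2r; rewrite ?nnegrE.
  have h3 : expR (s / i.+1%:R) ^+ i <= expR s.
    rewrite -expRM_natl ler_expR mulrCA ler_piMr// ler_pdivrMr// mul1r ler_nat.
    exact: leqnSn.
  have := le_trans h2 h3; rewrite expr_div_n ler_pdivrMr ?exprn_gt0// mulrC; exact.
exists (\sum_(i < size p) `|p`_i| * i.+1%:R ^+ i) => s s0.
rewrite horner_coef; apply: (le_trans (ler_wpM2r (expR_ge0 _) (ler_norm_sum _ _ _))).
rewrite mulr_suml; apply: ler_sum => i _; rewrite normrM normrX (ger0_norm s0) -mulrA.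
by rewrite ler_wpM2l//; exact: mono.
Qed.

(** The quadratic bound gives the zero derivative at the origin; it holds for every [p], as the
    exponential beats all polynomials. *)
Lemma flat_sqr p : exists C : R, forall t, `|flat p t| <= C * t ^+ 2.
Proof.
have [C CP] := poly_exp_bound ('X^2 * p).
exists `|C| => t; rewrite /flat; case: ifPn => t0; last by rewrite normr0 mulr_ge0 ?sqr_ge0.
rewrite normrM (ger0_norm (expR_ge0 _)); have ti : 0 <= t^-1 by rewrite invr_ge0 ltW.
have := CP _ ti; rewrite hornerM hornerXn normrM ger0_norm ?exprn_ge0// exprVn.
rewrite -mulrA mulrC ler_pdivrMr ?exprn_gt0// => /le_trans; apply.
by rewrite ler_wpM2r ?sqr_ge0// ler_norm.
Qed.

Lemma is_derive_flat p t : is_derive t (1 : R) (flat p) (flat ('X^2 * (p - p^`())) t).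
Proof.
have [t0|t0|t0] := ltgtP 0 t; last first.
- rewrite -t0; have [C CP] := flat_sqr p.
  have c0 : h^-1 *: ((flat p \o shift (0 : R)) (h *: 1) - flat p 0) @[h --> 0^'] --> (0 : R).
    apply/cvgr0Pnorm_lt => e e0; near=> h.
    rewrite /= addr0 {2}/flat ltxx subr0 /GRing.scale/= mulr1 normrM normfV.
    have h0 : h != 0 by near: h; exact: nbhs_dnbhs_neq.
    rewrite mulrC ltr_pdivrMr ?normr_gt0//; apply: (le_lt_trans (CP h)).
    rewrite -(real_normK (num_real h)) mulrA ltr_pM2r ?normr_gt0//.
    apply: (@le_lt_trans _ _ ((`|C| + 1) * `|h|)).
      by rewrite ler_wpM2r// (le_trans (ler_norm _))// lerDl.
    rewrite -ltr_pdivlMl ?ltr_pwDr//; near: h; apply: dnbhs0_lt.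
    by rewrite mulr_gt0.
  apply: DeriveDef; first by apply/cvg_ex; exists 0.
  by rewrite /flat ltxx; apply/cvg_lim.
- have -> : flat ('X^2 * (p - p^`())) t = 0 by rewrite /flat ltNge (ltW t0).
  have o : open [set s : R | s < 0] by exact: open_lt.
  have eq0 s : [set s : R | s < 0] s -> 0 = flat p s by move=> s0; rewrite /flat ltNge (ltW s0).
  apply: DeriveDef.
    apply: diff_derivable; apply: (differentiable_eq_on o t0 eq0); exact: differentiable_cst.
  by rewrite -(derive_eq_on _ o t0 eq0) derive_cst.
have o : open [set s : R | 0 < s] by exact: open_gt.
pose f s := p.[s^-1] * expR (- s^-1).
have eqf s : [set s : R | 0 < s] s -> f s = flat p s by rewrite /flat => ->.
have tn : t != 0 by rewrite gt_eqF.
have di : is_derive t (1 : R) (fun s => s^-1) (- t ^- 2).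
  by have := is_deriveV tn (is_derive_id t (1 : R)); rewrite /GRing.scale/= mulr1.
have dp : is_derive (t^-1) (1 : R) (horner p) (p^`()).[t^-1].
  exact: is_derive_poly.
have d1 := is_derive1_comp dp di.
have d2 := @is_derive1_comp R expR (fun s => - s^-1) t _ _ (is_derive_expR (- t^-1)) (is_deriveN di).
have df : is_derive t (1 : R) f (flat ('X^2 * (p - p^`())) t).
  have := is_deriveM d1 d2; congr is_derive; rewrite /flat t0 /GRing.scale !hornerE /= exprVn.
  ring.
apply: DeriveDef.
  by apply: diff_derivable; apply: (differentiable_eq_on o t0 eqf); apply/derivable1_diffP; case: df.
by rewrite -(derive_eq_on _ o t0 eqf); exact: (@derive_val _ _ _ _ _ _ _ df).
Unshelve. all: by end_near.
Qed.

(** The value 2 at the centre leaves an open neighbourhood on which the function exceeds 1. *)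
Lemma smooth_bump {n} (x0 : 'rV[R]_n) (r : R) : 0 < r -> exists f : 'rV[R]_n -> R,
  [/\ smooth_on setT f, forall x, 0 <= f x, f x0 = 2 & forall x, r <= enorm (x - x0) -> f x = 0].
Proof.
move=> r0; pose q (x : 'rV[R]_n) := r ^+ 2 - \sum_i (x 0 i - x0 0 i) * (x 0 i - x0 0 i).
have qE x : q x = r ^+ 2 - enorm (x - x0) ^+ 2.
  by rewrite enorm_sqr; congr (_ - _); apply: eq_bigr => i _; rewrite !mxE.
have sq : smooth_on setT q.
  apply: smooth_onB; [exact: openT|exact: smooth_on_cst|].
  have sc i : smooth_on setT (fun x : 'rV[R]_n => x 0 i - x0 0 i).
    by apply: smooth_onB; [exact: openT|apply: smooth_coord; exact: openT|exact: smooth_on_cst].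
  by apply: smooth_on_sum => [|i]; [exact: openT|apply: smooth_onM; [exact: openT|exact: sc|exact: sc]].
pose P k : {poly R} := iter k (fun p => 'X^2 * (p - p^`())) 1.
have sf : smooth_on setT (fun x => flat 1 (q x)).
  apply: (smooth_on_comp1 (D := setT) (h := fun k => flat (P k))) => //; first exact: openT.
  by move=> k t _; exact: is_derive_flat.
have pos : 0 < flat 1 (q x0).
  rewrite qE subrr /enorm /dotv big1 => [|i _]; last by rewrite mxE mul0r.
  by rewrite sqrtr0 expr0n subr0 /flat exprn_gt0// hornerE mul1r expR_gt0.
exists (fun x => 2 / flat 1 (q x0) * flat 1 (q x)); split.
- by apply: smooth_onM => //; [exact: openT|exact: smooth_on_cst].
- move=> x; rewrite mulr_ge0 ?divr_ge0 ?(ltW pos)// /flat; case: ifP => // _.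
  by rewrite hornerE.
- by rewrite mulfVK// gt_eqF.
- move=> x xr; suff -> : flat 1 (q x) = 0 by rewrite mulr0.
  rewrite /flat qE subr_gt0 ltr_sqr ?nnegrE ?enorm_ge0 ?(ltW r0)//.
  by rewrite ltNge xr.
Qed.

Definition cbox {n} (x0 : 'rV[R]_n) (r : R) : set 'rV[R]_n := [set x | forall i, `|x 0 i - x0 0 i| <= r].

Lemma compact_cbox {n} (x0 : 'rV[R]_n) r : compact (cbox x0 r).
Proof.
have cl : closed (cbox x0 r).
  have -> : cbox x0 r = \bigcap_i [set x : 'rV[R]_n | `|x 0 i - x0 0 i| <= r].
    by apply/seteqP; split => x h => [i _|i]; exact: h.
  apply: closed_bigI => i _.
  have -> : [set x : 'rV[R]_n | `|x 0 i - x0 0 i| <= r] =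
    (fun x : 'rV[R]_n => `|x 0 i - x0 0 i|) @^-1` [set t | t <= r] by [].
  apply: closed_comp; last exact: closed_le.
  move=> x _; apply: (@continuous_comp _ _ _ (fun x : 'rV[R]_n => x 0 i - x0 0 i) Num.norm); last exact: norm_continuous.
  apply: smooth_on_continuous (I : setT x); apply: smooth_onB; [exact: openT| |exact: smooth_on_cst].
  by apply: smooth_coord; exact: openT.
apply: (subclosed_compact cl (@compact_cube R n (\sum_i (`|x0 0 i| + `|r|)))) => x h i.
apply: (@le_trans _ _ (`|x0 0 i| + `|r|)).
  have -> : x 0 i = x0 0 i + (x 0 i - x0 0 i) by rewrite addrC subrK.
  by apply: (le_trans (ler_normD _ _)); rewrite lerD2l (le_trans (h i))// ler_norm.
by rewrite (bigD1 i)//= lerDl sumr_ge0// => j _.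
Qed.

Lemma nbhs_cbox {n} (x0 : 'rV[R]_n) r : 0 < r -> nbhs x0 (cbox x0 r).
Proof.
move=> r0; apply/nbhs_ballP; exists r => //= x h i.
by have /rV_ball := h => /(_ r0 i); rewrite distrC => /ltW.
Qed.

Lemma open_cbox {n} (V : set 'rV[R]_n) x0 : open V -> V x0 -> exists2 r, 0 < r & cbox x0 r `<=` V.
Proof.
move=> oV Vx; have /nbhs_ballP[e /= e0 h] := open_nbhs_nbhs (conj oV Vx).
exists (e / 2); first by rewrite divr_gt0.
move=> x hx; apply: h; apply/rV_ball => // i; rewrite /ball/= distrC (le_lt_trans (hx i))//.
by rewrite ltr_pdivrMr// ltr_pMr// ltr1n.
Qed.

End Bump.

(** * Gluing charts of the maximal atlas *)

Section Charts.
Context {R : realType} {n : nat} {M : smoothManifold R n}.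
Implicit Types (k j l : chart R n M).
Local Notation rV := 'rV[R]_n.

Lemma open_chart_preimage k (A : set M) : open A -> open [set x | cod k x /\ A (bwd k x)].
Proof.
move=> oA; rewrite openE => x [cx Ax].
have h1 : nbhs x (cod k) by apply: open_nbhs_nbhs; split=> //; exact: cod_open.
have h2 : nbhs x (bwd k @^-1` A) by apply: (bwd_continuous cx); exact: open_nbhs_nbhs.
by apply: filterS (filterI h1 h2) => y.
Qed.

Lemma open_chart_image k (V : set rV) : open V -> open [set p | dom k p /\ V (fwd k p)].
Proof.
move=> oV; rewrite openE => p [dp Vp].
have h1 : nbhs p (dom k) by apply: open_nbhs_nbhs; split=> //; exact: dom_open.
have h2 : nbhs p (fwd k @^-1` V) by apply: (fwd_continuous dp); exact: open_nbhs_nbhs.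
by apply: filterS (filterI h1 h2) => y.
Qed.

Lemma open_transition_dom k l : open [set x | cod k x /\ dom l (bwd k x)].
Proof. exact: open_chart_preimage (dom_open l). Qed.

Lemma continuous_local (T U : topologicalType) (f g : T -> U) (A : set T) x : open A -> A x ->
  (forall y, A y -> f y = g y) -> {for x, continuous f} -> {for x, continuous g}.
Proof.
move=> oA Ax h cf; have near : \near x, f x = g x.
  by apply: filterS (open_nbhs_nbhs (conj oA Ax)) => y /h.
rewrite /prop_for /continuous_at -(h x Ax); apply: cvg_trans cf.
exact: near_eq_cvg.
Qed.

Section Glue.
Context (k j : chart R n M) (kM : charts k) (jM : charts j) (A B : set M) (v : rV).
Hypotheses (oA : open A) (oB : open B) (Ak : A `<=` dom k) (Bj : B `<=` dom j).
Hypothesis AB : forall p, A p -> B p -> False.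
Hypothesis vAB : forall p q, A p -> B q -> fwd k p <> fwd j q + v.

Let cA : set rV := [set x | cod k x /\ A (bwd k x)].
Let cB : set rV := [set x | cod j (x - v) /\ B (bwd j (x - v))].
Let gfwd p := if `[< A p >] then fwd k p else fwd j p + v.
Let gbwd x := if `[< cA x >] then bwd k x else bwd j (x - v).

Let cAB x : cA x -> cB x -> False.
Proof.
move=> [c1 a1] [c2 b2]; apply: (vAB a1 b2).
by rewrite !bwdK// subrK.
Qed.

Let fA p : A p -> gfwd p = fwd k p. Proof. by move=> Ap; rewrite /gfwd; case: asboolP. Qed.
Let fB p : B p -> gfwd p = fwd j p + v.
Proof. by move=> Bp; rewrite /gfwd; case: asboolP => // /AB /(_ Bp). Qed.
Let bA x : cA x -> gbwd x = bwd k x. Proof. by move=> Ax; rewrite /gbwd; case: asboolP. Qed.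
Let bB x : cB x -> gbwd x = bwd j (x - v).
Proof. by move=> Bx; rewrite /gbwd; case: asboolP => // /cAB /(_ Bx). Qed.

Let ocA : open cA. Proof. exact: open_chart_preimage. Qed.

Let shift_continuous : continuous (fun x : rV => x - v).
Proof.
move=> x; apply: differentiable_continuous.
by apply: differentiableB; [case: (is_diff_id x)|exact: differentiable_cst].
Qed.

Let ocB : open cB.
Proof.
have := @open_comp _ _ (fun x : rV => x - v) _ (fun x _ => @shift_continuous x) (@open_chart_preimage j B oB).
exact.
Qed.

Let imA p : A p -> cA (fwd k p).
Proof. by move=> Ap; split; [exact: fwd_cod (Ak Ap)|rewrite fwdK//; exact: Ak]. Qed.

Let imB p : B p -> cB (fwd j p + v).
Proof. by move=> Bp; rewrite /cB/= addrK; split; [exact: fwd_cod (Bj Bp)|rewrite fwdK//; exact: Bj]. Qed.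

(** A chart whose domain is the disjoint union of a piece of [k] and a piece of [j]. The translation
    [v] separates the two images, so that the inverse can be defined piecewise too. *)
Definition glue_chart : chart R n M.
Proof.
refine (@Chart R n M (A `|` B) (cA `|` cB) gfwd gbwd (openU oA oB) (openU ocA ocB) _ _ _ _ _ _).
- by move=> p [Ap|Bp]; [left; rewrite fA//; exact: imA|right; rewrite fB//; exact: imB].
- by move=> x [Ax|Bx]; [left; rewrite bA//; case: Ax|right; rewrite bB//; case: Bx].
- move=> p [Ap|Bp]; first by rewrite fA// bA ?fwdK//; [exact: Ak|exact: imA].
  by rewrite fB// bB ?addrK ?fwdK//; [exact: Bj|exact: imB].
- move=> x [Ax|Bx]; first by rewrite bA// fA; [rewrite bwdK//; case: Ax|case: Ax].
  by rewrite bB// fB; [rewrite bwdK ?subrK//; case: Bx|case: Bx].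
- move=> p [Ap|Bp].
    apply: (continuous_local oA Ap (f := fwd k)) => [q Aq|]; first by rewrite fA.
    by apply: fwd_continuous; exact: Ak.
  apply: (continuous_local oB Bp (f := fun p => fwd j p + v)) => [q Bq|]; first by rewrite fB.
  by apply: cvgD; [apply: fwd_continuous; exact: Bj|exact: cvg_cst].
- move=> x [Ax|Bx].
    apply: (continuous_local ocA Ax (f := bwd k)) => [q Aq|]; first by rewrite bA.
    by apply: bwd_continuous; case: Ax.
  apply: (continuous_local ocB Bx (f := fun x : rV => bwd j (x - v))) => [q Bq|]; first by rewrite bB.
  apply: (@continuous_comp _ _ _ (fun x : rV => x - v) (bwd j)); first exact: shift_continuous.
  by apply: bwd_continuous; case: Bx.
Defined.

(** Maximality of the atlas: every transition map restricts, on two open pieces, to transition maps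
    of [k] and of [j] up to the translation. *)
Lemma glue_charts : charts glue_chart.
Proof.
apply: charts_maximal => l lM; split.
  apply: (@smooth_onS _ _ _ ([set x | cA x /\ dom l (bwd k x)] `|` [set x | cB x /\ dom l (bwd j (x - v))])).
    move=> x [[cx|cx]] /=; [rewrite bA//; left|rewrite bB//; right]; by [].
  have o1 : open [set x | cA x /\ dom l (bwd k x)].
    have -> : [set x | cA x /\ dom l (bwd k x)] = cA `&` [set x | cod k x /\ dom l (bwd k x)].
      by apply/seteqP; split => x [h1 h2]; [split; case: h1|case: h2].
    apply: openI; [exact: ocA|exact: open_transition_dom].
  have oj : open [set x | cod j (x - v) /\ dom l (bwd j (x - v))].
    have := @open_comp _ _ (fun x : rV => x - v) _ (fun x _ => @shift_continuous x) (@open_transition_dom j l).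
    exact.
  have o2 : open [set x | cB x /\ dom l (bwd j (x - v))].
    have -> : [set x | cB x /\ dom l (bwd j (x - v))] = cB `&` [set x | cod j (x - v) /\ dom l (bwd j (x - v))].
      by apply/seteqP; split => x [h1 h2]; [split; case: h1|case: h2].
    apply: openI; [exact: ocB|exact: oj].
  apply: smooth_onU.
    apply: (smooth_on_eq o1 (f := transition k l)).
      by move=> x [cx _]; rewrite /transition/= bA.
    by apply: smooth_onS (charts_compatible kM lM) => x [[cx _] dx].
  apply: (smooth_on_eq o2 (f := transition j l \o (fun x => x - v))).
    by move=> x [cx _]; rewrite /transition/= bB.
  apply: (@smooth_on_affine _ _ _ _ _ [set x | cod j x /\ dom l (bwd j x)] (fun x : rV => x - v) id).
  - by move=> x h w; rewrite addrA.
  - by move=> x _.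
  - by move=> x [[cx _] dx].
  - exact: (charts_compatible jM lM).
have o1 : open [set x | cod l x /\ A (bwd l x)] by exact: open_chart_preimage.
have o2 : open [set x | cod l x /\ B (bwd l x)] by exact: open_chart_preimage.
apply: (@smooth_onS _ _ _ ([set x | cod l x /\ A (bwd l x)] `|` [set x | cod l x /\ B (bwd l x)])).
  by move=> x [cx [ax|bx]]; [left|right].
apply: smooth_onU.
  apply: (smooth_on_eq o1 (f := transition l k)).
    by move=> x [_ ax]; rewrite /transition/= fA.
  by apply: smooth_onS (charts_compatible lM kM) => x [cx /Ak].
apply: (smooth_on_eq o2 (f := fun x => transition l j x + v)).
  by move=> x [_ bx]; rewrite /transition/= fB.
apply: smooth_onD => //; last exact: smooth_on_cst.
by apply: smooth_onS (charts_compatible lM jM) => x [cx /Bj].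
Qed.

Lemma glue_fwdA p : A p -> fwd glue_chart p = fwd k p. Proof. exact: fA. Qed.
Lemma glue_bwdA x : cod k x -> A (bwd k x) -> cod glue_chart x /\ bwd glue_chart x = bwd k x.
Proof. by split; [left|apply: bA]. Qed.
End Glue.
End Charts.

(** Monotonicity in the constant lets local constants be replaced by one value far enough towards
    infinity. *)
Lemma compact_uniform (R : realType) (T : topologicalType) (K : set T) (P : R -> T -> Prop) :
  compact K -> (forall C D p, C <= D -> P C p -> P D p) ->
  (forall q, K q -> exists C, \forall p \near q, P C p) -> exists C, forall p, K p -> P C p.
Proof.
move=> cK mono loc; have /compact_near_coveringP nc := cK.
have h := nc R (pinfty_nbhs R) P _ _.
have [C [_ hC]] : \forall C \near +oo%R, K `<=` P C.
  apply: h => q Kq; have [C CP] := loc q Kq.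
  exists (P C, [set D | C <= D]) => /=; first by split=> //; apply: nbhs_pinfty_ge; exact: num_real.
  by move=> [p D] [/= Pp CD]; exact: mono Pp.
by exists (C + 1) => p Kp; apply: (hC (C + 1)) => //; rewrite ltrDl.
Qed.

Section Pullback.
Context {R : realType} {n : nat} {M : smoothManifold R n}.
Implicit Types (k l : chart R n M).
Local Notation rV := 'rV[R]_n.

Lemma chart_compact k (K : set rV) : compact K -> K `<=` cod k -> compact (bwd k @` K).
Proof.
move=> cK Kc; apply: continuous_compact => //; apply: continuous_in_subspaceT => x.
by rewrite inE => /Kc; exact: bwd_continuous.
Qed.

Lemma chart_closed k (K : set rV) : compact K -> K `<=` cod k -> closed (bwd k @` K).
Proof. by move=> cK Kc; apply: compact_closed; [exact: points_hausdorff|exact: chart_compact]. Qed.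

Lemma pullback_dom k (u : rV -> R[i]) p : dom k p -> pullback k u p = u (fwd k p).
Proof. by rewrite /pullback; case: asboolP. Qed.

Lemma pullback_out k (u : rV -> R[i]) p : ~ dom k p -> pullback k u p = 0.
Proof. by rewrite /pullback; case: asboolP. Qed.

(** In another chart the extension by zero is smooth on the overlap and vanishes off the image of
    the support; that image is closed because [M] is Hausdorff. *)
Lemma pullback_smooth k u : charts k -> test_function (cod k) u -> smooth_function (pullback k u).
Proof.
move=> kM [su [K [cK Kc u0]]] l lM.
have O1 : open [set x | cod l x /\ dom k (bwd l x)] by exact: open_transition_dom.
have cl := chart_closed cK Kc.
have O2 : open [set x | cod l x /\ (~` (bwd k @` K)) (bwd l x)].
  by apply: open_chart_preimage; exact: closed_openC.
apply: (csmooth_onS (A := [set x | cod l x /\ dom k (bwd l x)] `|` [set x | cod l x /\ (~` (bwd k @` K)) (bwd l x)])).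
  move=> x cx; have [dx|dx] := pselect (dom k (bwd l x)); [by left|right; split=> //].
  by move=> [y Ky yE]; apply: dx; rewrite -yE; exact: bwd_dom (Kc _ Ky).
apply: csmooth_onU.
  apply: (csmooth_on_eq O1 (f := u \o transition l k)).
    by move=> x [_ dx]; rewrite /= pullback_dom.
  have sT := charts_compatible lM kM.
  have [sr si] := su; split.
    by apply: (smooth_on_comp O1 openT (f := fun x => Re (u x)) _ sT sr) => x.
  by apply: (smooth_on_comp O1 openT (f := fun x => Im (u x)) _ sT si) => x.
apply: (csmooth_on_eq O2 (f := fun _ => 0)); last exact: csmooth_on_cst.
move=> x [cx nK] /=; have [dx|dx] := pselect (dom k (bwd l x)); last by rewrite pullback_out.
rewrite pullback_dom// u0// => Kx; apply: nK; exists (fwd k (bwd l x)) => //.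
by rewrite fwdK.
Qed.

Lemma tfamily_test (I : Type) k (K : set rV) (c : I -> rV -> R[i]) i : compact K -> K `<=` cod k ->
  tfamily K c -> test_function (cod k) (c i).
Proof. by move=> cK Kc [[sc _] c0]; split; [exact: sc|exists K; split=> //; exact: c0]. Qed.

Lemma packet_test k (u : rV -> R[i]) w : test_function (cod k) u -> test_function (cod k) (packet u w).
Proof.
move=> [su [K [cK Kc u0]]]; split; first exact: packet_smooth.
by exists K; split=> // x /u0 h; rewrite /packet h mul0r.
Qed.

(* A chart of the maximal atlas that agrees with [k] near the support and also contains the far point [q]: its domain is disconnected. *)
Lemma far_chart k (x0 : rV) r r' q : charts k -> (0 < n)%N -> 0 <= r < r' -> cbox x0 r' `<=` cod k ->
  ~ dom k q -> exists l, [/\ charts l, dom l q, cbox x0 r `<=` cod l, ~ cbox x0 r (fwd l q) &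
    forall u : rV -> R[i], (forall x, ~ cbox x0 r x -> u x = 0) -> pullback l u = pullback k u].
Proof.
move=> kM n0 /andP[r0 rr] Xc qk; have [j jM jq] := charts_cover q.
have r'0 : 0 < r' by exact: le_lt_trans rr.
have [s s0 sc] := open_cbox (@cod_open _ _ _ j) (fwd_cod jq).
pose obox (y : rV) (t : R) : set rV := [set x | forall i, `|x 0 i - y 0 i| < t].
have oobox y t : 0 < t -> open (obox y t).
  move=> t0; have -> : obox y t = ball y t; last exact: ball_open.
  by apply/seteqP; split => x h; [apply/rV_ball => // i|move: h => /rV_ball => /(_ t0) h i];
    have := h i; rewrite distrC.
pose A := [set p | dom k p /\ obox x0 r' (fwd k p)].
pose B := [set p | dom j p /\ obox (fwd j q) s (fwd j p)] `&` ~` (bwd k @` cbox x0 r').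
have oA : open A by apply: open_chart_image; exact: oobox.
have oB : open B.
  apply: openI; first by apply: open_chart_image; exact: oobox.
  by apply: closed_openC; apply: chart_closed => //; exact: compact_cbox.
have Ak : A `<=` dom k by move=> p [].
have Bj : B `<=` dom j by move=> p [[]].
have AB p : A p -> B p -> False.
  move=> [dp hp] [_ nb]; apply: nb; exists (fwd k p); last by rewrite fwdK.
  by move=> i; exact: ltW.
(* Moves the box around [q] beyond the one around [x0] in every coordinate. Comparing the images
   takes at least one coordinate, whence [n0]. *)
pose v : rV := x0 - fwd j q + const_mx (r' + s).
have vAB p p' : A p -> B p' -> fwd k p <> fwd j p' + v.
  move=> [dp hp] [[dp' hp'] _] E; pose i := Ordinal n0.
  have := hp i; have := hp' i; rewrite E !mxE.
  by rewrite !ltr_norml => /andP[h1 h2] /andP[h3 h4]; lra.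
pose l := glue_chart oA oB Ak Bj AB vAB.
have KA x : cbox x0 r x -> cod k x /\ A (bwd k x).
  move=> Kx; have cx : cod k x by apply: Xc => i; apply: (le_trans (Kx i)); exact: ltW.
  split=> //; split; first exact: bwd_dom.
  by rewrite bwdK// => i; exact: le_lt_trans (Kx i) rr.
have Bq : B q.
  split; first by split=> // i; rewrite subrr normr0.
  by move=> [x Xx xq]; apply: qk; rewrite -xq; exact: bwd_dom (Xc _ Xx).
have lq : dom l q by right.
have lK x : cbox x0 r x -> cod l x /\ bwd l x = bwd k x.
  by move=> /KA[cx ax]; exact: glue_bwdA.
have notB p : dom l p -> ~ A p -> ~ cbox x0 r (fwd l p).
  move=> dp nA Kp; have [_ E] := lK _ Kp; rewrite fwdK// in E.
  by apply: nA; rewrite E; have [] := KA _ Kp.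
exists l; split=> //.
- exact: glue_charts.
- by move=> x /lK[].
- by apply: (notB q lq) => Aq; apply: qk; exact: (Ak _ Aq).
- move=> u u0; apply/funext => p; have [Ap|nA] := pselect (A p).
    rewrite !pullback_dom; [|exact: (Ak _ Ap)|by left].
    by rewrite glue_fwdA.
  have -> : pullback k u p = 0.
    have [dp|dp] := pselect (dom k p); last by rewrite pullback_out.
    rewrite pullback_dom// u0// => Kp; have [_] := KA _ Kp; by rewrite fwdK.
  have [dp|dp] := pselect (dom l p); last by rewrite pullback_out.
  by rewrite pullback_dom// u0//; exact: notB.
Qed.

Lemma near_chart k q (V : set rV) : dom k q -> open V -> V (fwd k q) ->
  exists2 X, compact X /\ X `<=` V & \forall p \near q, dom k p /\ X (fwd k p).
Proof.
move=> dq oV Vq; have [s s0 sc] := open_cbox oV Vq.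
exists (cbox (fwd k q) s); first by split=> //; exact: compact_cbox.
have h1 : nbhs q (dom k) by apply: open_nbhs_nbhs; split=> //; exact: dom_open.
have h2 : nbhs q (fwd k @^-1` cbox (fwd k q) s) by apply: (fwd_continuous dq); exact: nbhs_cbox.
by apply: filterS (filterI h1 h2) => p.
Qed.

End Pullback.

(** * Images of packets on the whole manifold *)

Section Quasimode.
Context {R : realType} {n : nat} {M : smoothManifold R n} (M_compact : compact [set: M]).
Context (A : (M -> R[i]) -> M -> R[i]) (A_pseudo : pseudodifferential 0 A).
Context (a : cotangent M -> R[i]) (a_symbol : principal_symbol 0 A a).
Local Notation rV := 'rV[R]_n.
Context (k : chart R n M) (kM : charts k) (x0 : rV) (r r' : R) (rr : 0 <= r < r')
  (Xc : cbox x0 r' `<=` cod k).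
Context (b0 : rV * rV -> R[i]) (ab0 : local_expression k a b0) (sb0 : symbol_on 0 (cod k) b0).
Context (I : Type) (w : I -> rV) (c : I -> rV -> R[i]) (tc : tfamily (cbox x0 r) c).

Let K : set rV := cbox x0 r.
Let cK : compact K. Proof. exact: compact_cbox. Qed.
Let clK : closed K. Proof. exact: (compact_closed (@norm_hausdorff _ _) cK). Qed.
Let Kc : K `<=` cod k.
Proof. by move=> x Kx; apply: Xc => i; apply: (le_trans (Kx i)); have /andP[_ /ltW] := rr. Qed.
Let c0 i x : ~ K x -> c i x = 0. Proof. by case: tc => _; apply. Qed.

(** [tay] is differential in the amplitude, so it vanishes off its support; the positive factor in
    [tay_tfamily] cancels. *)
Lemma expansion_out (V : set rV) N b i x : open V -> K `<=` V -> symbol_on (- 0%:R) V b -> ~ K x ->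
  expansion w N b c i x = 0.
Proof.
move=> oV KV sb nK; apply: big1 => j _.
have [_ /(_ i x nK)] := tay_tfamily oV w j cK KV sb tc.
move/eqP; rewrite mulf_eq0 => /orP[|/eqP ->]; last by rewrite mulr0.
rewrite (inj_eq (@complexI R)) => /eqP h.
by have := exprn_gt0 (0 + j) (jb_gt0 (w i)); rewrite h ltxx.
Qed.

(** In the chart of [far_chart] the expansion vanishes near [q], and only decaying remainders are
    left. Positive dimension is asked for in the presence of an index, so that a family of large
    frequencies can supply it by itself. *)
Lemma far_bound N q : (I -> (0 < n)%N) -> ~ dom k q ->
  exists C : R, \forall p \near q, forall i, cmod (A (pullback k (packet (c i) (w i))) p) <= C * jb (w i) ^- N /\
    forall u : rV -> R[i], (forall x, ~ K x -> u x = 0) -> pullback k u p = 0.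
Proof.
move=> In qk; have [[i0]|nI] := pselect (inhabited I); last first.
  by exists 0; near=> p => i; exfalso; apply: nI.
have [l [lM lq Kl nKq lE]] := far_chart kM (In i0) rr Xc qk.
have [_ _ /(_ l lM)[b [sb [rl sr hA]]]] := A_pseudo.
have oV : open (cod l `&` ~` K) by apply: openI; [exact: cod_open|exact: closed_openC].
have [X [cX XV] Xq] := near_chart lq oV (conj (fwd_cod lq) nKq).
have Xl : X `<=` cod l by move=> x /XV[].
have sb' : symbol_on (- 0%:R) (cod l) b by rewrite oppr0.
have [C1 C1P] := Op_expansion w N cK cX Xl sb' tc.
have [C2 C2P] := kernel_decay (@cod_open _ _ _ l) w N cK Kl cX Xl sr tc.
exists (C1 + C2); apply: filterS Xq => p [lp Xp] i; have [_ nK] := XV _ Xp; split; last first.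
  by move=> u u0; rewrite -lE// pullback_dom// u0.
have t := packet_test (w i) (tfamily_test i cK Kl tc).
rewrite -lE; last by move=> x /c0 h; rewrite /packet h mul0r.
have := hA _ t _ (fwd_cod lp); rewrite fwdK// => ->.
have := C1P i _ Xp; rewrite (expansion_out _ _ (@cod_open _ _ _ l) Kl sb' nK) mul0r subr0 => h1.
by rewrite mulrDl; apply: (le_trans (normcD _ _)); apply: lerD => //; exact: C2P.
Unshelve. all: by end_near.
Qed.

(** The full symbol differs from [b0] by order -1, and the later terms of the expansion have order
    at most -1. Both go into [rem], which stays bounded once the factor 1 / jb is taken out. *)
Theorem quasimode N : (I -> (0 < n)%N) -> exists2 rem : I -> rV -> R[i], tfamily K rem &
  exists C : R, forall i p, cmod (A (pullback k (packet (c i) (w i))) p -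
    pullback k (packet (fun x => b0 (x, w i) * c i x + (jb (w i))^-1%:C * rem i x) (w i)) p) <=
    C * jb (w i) ^- N.
Proof.
move=> In; have [_ _ /(_ k kM)[b fb]] := A_pseudo; have [sb [rk sr hA]] := fb.
have sb' : symbol_on (- 0%:R) (cod k) b by rewrite oppr0.
have sd : symbol_on (- 1%:R) (cod k) (fun z => b z - b0 z).
  by have := a_symbol.2 k b b0 kM fb ab0; rewrite sub0r.
have oV := @cod_open _ _ _ k.
(* [L.+1] is the length of the expansion used by [Op_expansion] at order [N.+1]. *)
pose L := (N + n.*2)%N.
pose rem i x := (jb (w i))%:C * ((b (x, w i) - b0 (x, w i)) * c i x +
   \sum_(j < L) (j.+1`!%:R^-1)%:C * tay w j.+1 b c i x).
have remE i x : expansion w L.+1 b c i x = b0 (x, w i) * c i x + (jb (w i))^-1%:C * rem i x.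
  rewrite mulrA -rmorphM mulVf ?gt_eqF ?jb_gt0// mul1r.
  rewrite /expansion big_ord_recl invr1 mul1r mulrBl.
  by rewrite [RHS]addrA [b0 _ * _ + _]addrC subrK.
have trem : tfamily K rem.
  have t1 := tfamilyM oV clK Kc (symbol_ufamily oV w cK Kc sd) tc.
  have t2 j : tfamily K (fun i x => (jb (w i))%:C * ((j.+1`!%:R^-1)%:C * tay w j.+1 b c i x)).
    have := tfamilyZ (c := fun i => ((jb (w i) ^- j) * j.+1`!%:R^-1)%:C) clK (C := 1) _
      (tay_tfamily oV w j.+1 cK Kc sb' tc).
    move=> h; have := h _; rewrite add0n => h'.
    have : tfamily K (fun i x => ((jb (w i) ^- j) * j.+1`!%:R^-1)%:C * ((jb (w i) ^+ j.+1)%:C * tay w j.+1 b c i x)).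
      apply: h' => i; rewrite normcR ger0_norm ?mulr_ge0 ?invr_ge0 ?exprn_ge0 ?jb_ge0//.
      rewrite mulr_ile1 ?invr_ge0 ?exprn_ge0 ?jb_ge0//.
        by rewrite invf_le1 ?exprn_gt0 ?jb_gt0// exprn_ege1 ?jb_ge1.
      by rewrite invf_le1 ?fact_gt0// ler1n fact_gt0.
    congr tfamily; apply/funext => i; apply/funext => x; rewrite !mulrA -!rmorphM.
    have : jb (w i) != 0 by rewrite gt_eqF ?jb_gt0.
    rewrite exprS; move: (jb (w i)) => J J0; rewrite mulrAC.
    by rewrite mulrCA mulVf ?mulr1// expf_neq0.
  have t3 := tfamily_sum (index_enum 'I_L) clK (fun j : 'I_L => t2 j).
  have := tfamilyD t1 t3; congr tfamily; apply/funext => i; apply/funext => x.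
  have -> : rem i x = (jb (w i))%:C * ((b (x, w i) - b0 (x, w i)) * c i x) +
     (jb (w i))%:C * \sum_(j < L) (j.+1`!%:R^-1)%:C * tay w j.+1 b c i x by rewrite -mulrDr.
  by rewrite [in RHS]mulr_sumr mulrA.
exists rem => //.
pose P (C : R) (p : M) := forall i, cmod (A (pullback k (packet (c i) (w i))) p -
    pullback k (packet (fun x => b0 (x, w i) * c i x + (jb (w i))^-1%:C * rem i x) (w i)) p) <=
    C * jb (w i) ^- N.
suff [C CP] : exists C : R, forall p, [set: M] p -> P C p by exists C => i p; exact: CP.
apply: compact_uniform M_compact _ _.
  move=> C D p CD h i; apply: (le_trans (h i)); rewrite ler_wpM2r// invr_ge0 exprn_ge0 ?jb_ge0//.
have g0 i x : ~ K x -> packet (fun x => b0 (x, w i) * c i x + (jb (w i))^-1%:C * rem i x) (w i) x = 0.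
  by move=> nK; rewrite /packet c0// (trem.2 i x nK) !mulr0 addr0 mul0r.
(* Near a point of [dom k] the expansion in [k] is compared directly; near any other point the
   packet built from [b0] vanishes and [far_bound] applies. *)
move=> q _; have [qk|qk] := pselect (dom k q); last first.
  have [C CP] := far_bound N In qk; exists C; apply: filterS CP => p h i.
  have [h1 h2] := h i; rewrite h2 ?subr0//; exact: g0.
have [X [cX XV] Xq] := near_chart qk oV (fwd_cod qk).
have [C1 C1P] := Op_expansion w N.+1 cK cX XV sb' tc.
have [C2 C2P] := kernel_decay oV w N cK Kc cX XV sr tc.
exists (`|C1| + C2); apply: filterS Xq => p [kp Xp] i.
have t := packet_test (w i) (tfamily_test i cK Kc tc).
have := hA _ t _ (fwd_cod kp); rewrite fwdK// => ->; rewrite pullback_dom//.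
rewrite mulrDl addrAC; apply: (le_trans (normcD _ _)); apply: lerD; last exact: C2P.
have := C1P i _ Xp; rewrite remE => /le_trans; apply.
apply: (@le_trans _ _ (`|C1| * jb (w i) ^- N.+1)).
  by rewrite ler_wpM2r ?ler_norm// invr_ge0 exprn_ge0 ?jb_ge0.
rewrite ler_wpM2l// lef_pV2 ?posrE ?exprn_gt0 ?jb_gt0//.
by apply: ler_weXn2l; [exact: jb_ge1|exact: leqnSn].
Qed.

End Quasimode.

(** * Covectors and the dual norm *)

Section Cotangent.
Context {R : realType} {n : nat} {M : smoothManifold R n}.
Implicit Types (k l m : chart R n M) (p : M) (z : cotangent M).
Local Notation rV := 'rV[R]_n.

Definition jac k l p : 'M[R]_n := jacobian (transition k l) (fwd k p).

Lemma transition_diff k l p : charts k -> charts l -> dom k p -> dom l p ->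
  differentiable (transition k l) (fwd k p).
Proof.
move=> kM lM kp lp; apply: smooth_on_diff (charts_compatible kM lM) _.
by split; [exact: fwd_cod|rewrite fwdK].
Qed.

Lemma jac_mul k l p v : charts k -> charts l -> dom k p -> dom l p ->
  v *m jac k l p = 'd (transition k l) (fwd k p) v.
Proof.
by rewrite mul_rV_lin1.
Qed.

Lemma jac_comp k l m p : charts k -> charts l -> charts m -> dom k p -> dom l p -> dom m p ->
  jac k m p = jac k l p *m jac l m p.
Proof.
move=> kM lM mM kp lp mp.
have E : fwd l p = transition k l (fwd k p) by rewrite /transition/= fwdK.
have o : open [set x | [set x | cod k x /\ dom l (bwd k x)] x /\ [set x | cod k x /\ dom m (bwd k x)] x].
  apply: (@openI _ [set x | cod k x /\ dom l (bwd k x)] [set x | cod k x /\ dom m (bwd k x)]);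
  exact: open_transition_dom.
have Ax : [set x | [set x | cod k x /\ dom l (bwd k x)] x /\ [set x | cod k x /\ dom m (bwd k x)] x] (fwd k p).
  by split; split; rewrite ?fwdK//; exact: fwd_cod.
have d1 := transition_diff kM lM kp lp; have d2 := transition_diff lM mM lp mp.
have dk := transition_diff kM mM kp mp.
apply/row_matrixP => i; apply: etrans (rowE _ _) _; apply: etrans (jac_mul _ kM mM kp mp) _.
apply/esym; apply: etrans (rowE _ _) _; apply: etrans (mulmxA _ _ _) _.
apply: etrans (congr1 (fun u => u *m jac l m p) (jac_mul (delta_mx 0 i) kM lM kp lp)) _.
apply: etrans (jac_mul _ lM mM lp mp) _; apply/esym.
apply: etrans (esym (deriveE _ dk)) _.
have EE x : [set x | [set x | cod k x /\ dom l (bwd k x)] x /\ [set x | cod k x /\ dom m (bwd k x)] x] x ->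
    transition k m x = (transition l m \o transition k l) x.
  by move=> [[cx lx] _]; rewrite /transition/= fwdK.
apply: etrans (derive_eq_on _ o Ax EE) _.
rewrite E in d2 *.
apply: etrans (deriveE _ (differentiable_comp d1 d2)) _.
by apply: etrans (congr1 (fun h => h _) (diff_comp d1 d2)) _.
Qed.

Lemma jac_id k p : charts k -> dom k p -> jac k k p = 1%:M.
Proof.
move=> kM kp; apply/row_matrixP => i; rewrite !rowE mulmx1 (jac_mul _ kM kM kp kp).
have -> : 'd (transition k k) (fwd k p) (delta_mx 0 i) = 'D_(delta_mx 0 i) (transition k k) (fwd k p).
  by rewrite deriveE//; exact: transition_diff.
rewrite (derive_eq_on _ (@cod_open _ _ _ k) (fwd_cod kp) (g := id)); last by move=> x cx; exact: bwdK.
by rewrite derive_id.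
Qed.

(** The components are transported from [k] by Jacobians, and [jac_comp] makes them compatible. Thus
    bounds on [a] can be read as bounds on its local expression at every pair (x, xi). *)
Lemma cotangent_exists k p (xi : rV) : charts k -> dom k p ->
  exists z, base z = p /\ components z k = xi.
Proof.
move=> kM kp.
pose f l := if `[< charts l /\ dom l p >] then xi *m (jac l k p)^T else 0.
have fE l m : charts l -> charts m -> dom l p -> dom m p -> f l = f m *m (jac l m p)^T.
  move=> lM mM lp mp; rewrite /f; case: asboolP => [_|[]//]; case: asboolP => [_|[]//].
  by rewrite -mulmxA -trmx_mul (@jac_comp l m k).
have f0 l : ~ (charts l /\ dom l p) -> f l = 0 by move=> h; rewrite /f; case: asboolP.
exists (@Cotangent _ _ _ p f fE f0); split=> //=.
by rewrite /f; case: asboolP => [_|[]//]; rewrite jac_id// trmx1 mulmx1.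
Qed.

Context (g : riemannianMetric M).

Lemma dot_mul (x y : rV) (B : 'M[R]_n) : dotv (x *m B) y = (x *m B *m y^T) 0 0.
Proof. by rewrite [RHS]mxE; apply: eq_bigr => i _; rewrite [y^T _ _]mxE. Qed.

Lemma metric_unit k x : charts k -> cod k x -> metric_mx g k x \in unitmx.
Proof.
move=> kM cx; rewrite -row_free_unit; apply/inj_row_free => v v0.
apply/eqP; apply/negPn/negP => vn; have := metric_pos g kM cx vn.
by rewrite v0 /dotv big1 ?ltxx// => i _; rewrite mxE mul0r.
Qed.

Definition cometric k x (xi : rV) : R := dotv (xi *m invmx (metric_mx g k x)) xi.

Lemma cometric_change k l z : charts k -> charts l -> dom k (base z) -> dom l (base z) ->
  cometric k (fwd k (base z)) (components z k) = cometric l (fwd l (base z)) (components z l).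
Proof.
move=> kM lM kp lp; rewrite /cometric !dot_mul; set p := base z.
have ck := fwd_cod kp; have cl := fwd_cod lp.
have := metric_change g kM lM kp lp.
have uk := metric_unit kM ck; have ul := metric_unit lM cl.
have := componentsE kM lM kp lp; rewrite -/(jac k l p).
move: (metric_mx g k (fwd k p)) (metric_mx g l (fwd l p)) uk ul (jac k l p) => Gk Gl uk ul J -> GE.
have uJ : J \in unitmx by move: uk; rewrite GE !unitmx_mul => /andP[/andP[]].
rewrite GE; set x := components z l; have uk' := uk; rewrite GE in uk'.
have -> : x *m J^T *m invmx (J *m Gl *m J^T) = x *m invmx Gl *m invmx J.
  rewrite -[RHS](mulmxK uk').
  by rewrite !mulmxA mulmxKV// mulmxKV.
by rewrite trmx_mul trmxK mulmxA mulmxKV.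
Qed.

Lemma conorm_cometric k z : charts k -> dom k (base z) ->
  conorm g z = Num.sqrt (cometric k (fwd k (base z)) (components z k)).
Proof.
move=> kM kp; rewrite /conorm -/(cometric _ _ _) (@cometric_change (chart_at (base z)) k z)//.
  exact: (s2valP (cid2 (charts_cover (base z)))).
exact: (s2valP' (cid2 (charts_cover (base z)))).
Qed.

Lemma quadratic_bound (B : 'M[R]_n) C (v w : rV) : (forall i j, `|B i j| <= C) ->
  `|dotv (v *m B) w| <= C * n%:R ^+ 2 * (enorm v * enorm w).
Proof.
move=> BC; apply: (le_trans (ler_norm_sum _ _ _)).
have -> : C * n%:R ^+ 2 * (enorm v * enorm w) = \sum_(i < n) \sum_(j < n) C * (enorm v * enorm w).
  by rewrite sumr_const sumr_const card_ord; ring.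
apply: ler_sum => i _; rewrite mxE mulr_suml; apply: (le_trans (ler_norm_sum _ _ _)).
apply: ler_sum => j _; rewrite !normrM mulrAC mulrC ler_pM ?mulr_ge0//.
by apply: ler_pM => //; exact: coord_enorm.
Qed.

Lemma metric_entry k (K : set rV) : charts k -> compact K -> K `<=` cod k ->
  exists C : R, forall x i j, K x -> `|metric_mx g k x i j| <= C.
Proof.
move=> kM cK Kc.
have h i j : exists C : R, forall x, K x -> `|metric_mx g k x i j| <= C.
  apply: compact_bound_gen cK _; apply: continuous_in_subspaceT => x; rewrite inE => Kx.
  have := smooth_on_continuous (metric_smooth g kM) (Kc _ Kx) => cg.
  by apply: (@continuous_comp _ _ _ (metric_mx g k) (fun B : 'M[R]_n => B i j)) => //; exact: coord_continuous.
pose C i j := sval (cid (h i j)).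
have CP i j x : K x -> `|metric_mx g k x i j| <= C i j := svalP (cid (h i j)) x.
exists (\sum_i \sum_j `|C i j|) => x i j Kx; apply: (le_trans (CP i j x Kx)).
rewrite (bigD1 i)//= (bigD1 j)//=; apply: (le_trans (ler_norm _)).
rewrite -addrA lerDl addr_ge0//; first by apply: sumr_ge0.
by apply: sumr_ge0 => i' _; apply: sumr_ge0.
Qed.

Lemma cometric_sqr k x xi : charts k -> cod k x ->
  cometric k x xi = dotv (xi *m invmx (metric_mx g k x) *m metric_mx g k x) (xi *m invmx (metric_mx g k x)).
Proof. by move=> kM cx; rewrite mulmxKV ?metric_unit// dotvC. Qed.

Lemma cometric_ge0 k x xi : charts k -> cod k x -> 0 <= cometric k x xi.
Proof.
move=> kM cx; rewrite cometric_sqr//; set v := xi *m _.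
have [->|v0] := eqVneq v 0; last exact: ltW (metric_pos g kM cx v0).
by rewrite /dotv big1// => i _; rewrite mxE big1 ?mul0r// => j _; rewrite mxE mul0r.
Qed.

(* Cauchy-Schwarz for the metric, applied to xi g^-1 and xi. *)
Lemma enorm_le_cometric k x xi C : charts k -> cod k x -> (forall i j, `|metric_mx g k x i j| <= C) ->
  enorm xi ^+ 2 <= C * n%:R ^+ 2 * cometric k x xi.
Proof.
move=> kM cx hC; set G := metric_mx g k x; set v := xi *m invmx G.
have uG : G \in unitmx by exact: metric_unit.
have vG : v *m G = xi by rewrite mulmxKV.
have qE : dotv (v *m G) v = cometric k x xi by rewrite vG dotvC.
have sym u u' : dotv (u *m G) u' = dotv (u' *m G) u.
  rewrite !dot_mul; transitivity ((u *m G *m u'^T)^T 0 0); first by rewrite [RHS]mxE.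
  by rewrite !trmx_mul trmxK (Defs.metric_sym g kM cx) mulmxA.
have pos u : 0 <= dotv (u *m G) u.
  have [->|u0] := eqVneq u 0; last exact: ltW (metric_pos g kM cx u0).
  by rewrite /dotv big1// => i _; rewrite [X in _ * X]mxE mulr0.
have N2 : enorm xi ^+ 2 = dotv (v *m G) xi by rewrite vG sqr_sqrtr ?dotv_ge0.
have up : dotv (xi *m G) xi <= C * n%:R ^+ 2 * enorm xi ^+ 2.
  by apply: (le_trans (ler_norm _)); exact: quadratic_bound.
have [z0|z0] := eqVneq (enorm xi) 0.
  have C0 : 0 <= C * n%:R ^+ 2.
    case: (posnP n) => [->|n0]; first by rewrite expr0n mulr0.
    have := hC (Ordinal n0) (Ordinal n0) => h; rewrite mulr_ge0 ?exprn_ge0//; exact: le_trans h.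
  by rewrite z0 expr0n mulr_ge0// cometric_ge0.
have z1 : 0 < enorm xi ^+ 2 by rewrite exprn_even_gt0.
(* 0 <= <v - t xi, v - t xi>_G with 1 / t = C n^2 *)
set L := C * n%:R ^+ 2 in up *.
have L0 : 0 <= L by have := pos xi; move=> /le_trans /(_ up); rewrite pmulr_lge0.
have h t : 0 <= dotv (v *m G) v - 2 * t * dotv (v *m G) xi + t ^+ 2 * dotv (xi *m G) xi.
  have := pos (v - t *: xi); rewrite mulmxBl -scalemxAl dotvBl !dotvBr !dotvZl ![dotv _ (t *: xi)]dotvC !dotvZl.
  rewrite [dotv xi (v *m G)]dotvC [dotv xi (xi *m G)]dotvC [dotv (xi *m G) v]sym => h.
  by apply: le_trans h _; rewrite le_eqVlt; apply/orP; left; apply/eqP; ring.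
rewrite qE -N2 in h.
have [L1|L1] := eqVneq L 0.
  have up0 : dotv (xi *m G) xi <= 0 by move: up; rewrite L1 mul0r.
  have := h ((cometric k x xi + 1) / (2 * enorm xi ^+ 2)).
  have -> : 2 * ((cometric k x xi + 1) / (2 * enorm xi ^+ 2)) * enorm xi ^+ 2 = cometric k x xi + 1.
    by field.
  have := mulr_ge0_le0 (sqr_ge0 ((cometric k x xi + 1) / (2 * enorm xi ^+ 2))) up0.
  move=> h1; rewrite opprD addrA subrr add0r => h2; have := le_trans h2 (lerD (lexx (-1)) h1).
  by rewrite addr0 oppr_ge0 ler10.
have L2 : 0 < L by rewrite lt_neqAle eq_sym L1.
have := h L^-1; have := ler_wpM2l (sqr_ge0 L^-1) up.
have -> : L^-1 ^+ 2 * (L * enorm xi ^+ 2) = L^-1 * enorm xi ^+ 2 by field.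
move=> h1 h2; rewrite mulrC -ler_pdivrMr//.
by lra.
Qed.

(** Compactness of the product of [K] with the unit sphere, then homogeneity. *)
Lemma metric_lower k (K : set rV) : charts k -> compact K -> K `<=` cod k ->
  exists2 d : R, 0 < d & forall x v, K x -> d * enorm v ^+ 2 <= dotv (v *m metric_mx g k x) v.
Proof.
move=> kM cK Kc; pose S : set rV := [set v | enorm v = 1].
pose F (p : rV * rV) : R := dotv (p.2 *m metric_mx g k p.1) p.2.
have csum (T : topologicalType) (r : seq 'I_n) (f : 'I_n -> T -> R) (p : T) :
    (forall i, {for p, continuous (f i)}) -> {for p, continuous (fun q => \sum_(i <- r) f i q)}.
  move=> cf; elim: r => [|i r IH].
    have -> : (fun q => \sum_(i <- [::]) f i q) = cst 0 by apply/funext => q; rewrite big_nil.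
    exact: cst_continuous.
  have -> : (fun q => \sum_(i <- i :: r) f i q) = (fun q => f i q + \sum_(i <- r) f i q).
    by apply/funext => q; rewrite big_cons.
  by apply: continuousD.
have c2 (p : rV * rV) i : {for p, continuous (fun q : rV * rV => q.2 0 i)}.
  apply: (@continuous_comp _ _ _ snd (fun x : rV => x 0 i)); first exact: cvg_snd.
  by apply: smooth_on_continuous (I : setT _); apply: smooth_coord; exact: openT.
have cF (p : rV * rV) : K p.1 -> {for p, continuous F}.
  move=> Kp; have cg (i j : 'I_n) : {for p, continuous (fun q : rV * rV => metric_mx g k q.1 i j)}.
    apply: (@continuous_comp _ _ _ fst (fun x => metric_mx g k x i j)); first exact: cvg_fst.
    have := smooth_on_continuous (metric_smooth g kM) (Kc _ Kp) => cg.
    by apply: (@continuous_comp _ _ _ (metric_mx g k) (fun B : 'M[R]_n => B i j)) => //; exact: coord_continuous.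
  apply: (csum _ _ _ _) => j; apply: continuousM; last exact: c2.
  have -> : (fun q : rV * rV => (q.2 *m metric_mx g k q.1) 0 j) =
    (fun q => \sum_i q.2 0 i * metric_mx g k q.1 i j) by apply/funext => q; rewrite mxE.
  by apply: (csum _ _ _ _) => i; apply: continuousM.
have enc : continuous (fun v : rV => \sum_i v 0 i * v 0 i).
  move=> v; apply: (csum _ _ _ _) => i; have h : {for v, continuous (fun x : rV => x 0 i)}.
    by apply: smooth_on_continuous (I : setT _); apply: smooth_coord; exact: openT.
  exact: continuousM.
have clS : closed S.
  have -> : S = (fun v : rV => \sum_i v 0 i * v 0 i) @^-1` [set 1].
    apply/seteqP; split => v ; rewrite /S/= -/(dotv v v).
      by move=> h; have := congr1 (fun t => t ^+ 2) h; rewrite expr1n sqr_sqrtr ?dotv_ge0.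
    by move=> h; rewrite /enorm h sqrtr1.
  by apply: closed_comp => [v _|].
have cS : compact S.
  apply: (subclosed_compact clS (@compact_cube R n 1)) => v h i.
  by rewrite -h; exact: coord_enorm.
have [C CP] : exists C : R, forall p : rV * rV, (K `*` S) p -> 1 <= C * `|F p|.
  apply: compact_uniform (compact_setX cK cS) _ _.
    by move=> C D p CD h; apply: (le_trans h); rewrite ler_wpM2r.
  move=> p [Kp Sp]; have Fp : 0 < F p.
    apply: (metric_pos g kM (Kc _ Kp)); apply/negP => /eqP p0.
    by move: Sp; rewrite /S/= p0 /enorm /dotv big1 ?sqrtr0 => [/eqP|i _]; [rewrite eq_sym oner_eq0|rewrite mxE mul0r].
  exists (2 / F p); have /cvgr_dist_lt/(_ (F p / 2)) := cF p Kp.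
  have F2 : 0 < F p / 2 by rewrite divr_gt0.
  move=> /(_ F2); apply: filterS => q; rewrite ltr_distlC => /andP[h1 h2].
  have h3 : F p / 2 <= `|F q| by apply: le_trans (ler_norm _); lra.
  by rewrite mulrAC ler_pdivlMr// mul1r mulrC -ler_pdivrMr.
exists (`|C| + 1)^-1; first by rewrite invr_gt0.
move=> x v Kx; rewrite ler_pdivrMl ?ltr_pwDr//.
have [v0|v0] := eqVneq (enorm v) 0.
  have -> : v = 0.
    apply/rowP => i; have := coord_enorm v i; rewrite v0 normr_le0 => /eqP ->; by rewrite mxE.
  by rewrite /enorm /dotv !big1 ?sqrtr0 ?expr0n ?mulr0// => i _; rewrite !mxE mulr0.
have v1 : 0 < enorm v by rewrite lt_neqAle eq_sym v0 enorm_ge0.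
pose u := (enorm v)^-1 *: v.
have Su : S u by rewrite /S/= enormZ gtr0_norm ?invr_gt0// mulVf.
have := CP (x, u) (conj Kx Su); rewrite /F -scalemxAl dotvZl dotvC dotvZl dotvC.
set q := dotv _ _; have q0 : 0 <= q.
  have vn : v != 0 by apply: contraNneq v0 => ->; rewrite /enorm /dotv big1 ?sqrtr0// => i _; rewrite mxE mul0r.
  exact: ltW (metric_pos g kM (Kc _ Kx) vn).
have e0 : 0 <= (enorm v)^-1 by rewrite invr_ge0 ltW.
rewrite ger0_norm ?mulr_ge0// [_^-1 * (_ * q)]mulrA => h.
have : 1 <= (`|C| + 1) * ((enorm v)^-1 ^+ 2 * q).
  apply: (le_trans h); rewrite ler_wpM2r ?mulr_ge0 ?sqr_ge0//.
  by apply: (le_trans (ler_norm _)); rewrite lerDl.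
by rewrite mulrCA exprVn ler_pdivlMl ?exprn_gt0// mulr1.
Qed.

(** For v = xi g^-1 the squared conorm is g(v, v) >= d |v|^2 and also v.xi <= |v| |xi|; eliminating
    |v| bounds it by |xi|^2 / d. *)
Lemma conorm_upper k (K : set rV) : charts k -> compact K -> K `<=` cod k ->
  exists C : R, forall z, dom k (base z) -> K (fwd k (base z)) -> conorm g z <= C * enorm (components z k).
Proof.
move=> kM cK Kc; have [d d0 dP] := metric_lower kM cK Kc.
exists (Num.sqrt d^-1) => z kz Kz; rewrite (conorm_cometric kM kz); have cx := Kc _ Kz.
set x := fwd k _ in Kz cx *; set xi := components z k.
rewrite -[enorm xi]ger0_norm ?enorm_ge0// -sqrtr_sqr -sqrtrM ?invr_ge0 ?(ltW d0)//.
apply: ler_wsqrtr; rewrite ler_pdivlMl//.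
have qE := cometric_sqr xi kM cx; have := dP x (xi *m invmx (metric_mx g k x)) Kz; rewrite -qE.
set v := xi *m _; have q0 := cometric_ge0 xi kM cx.
have h1 : cometric k x xi <= enorm v * enorm xi by exact: dotv_cauchy.
move: (enorm_ge0 v) (enorm_ge0 xi) q0 h1; move: (cometric _ _ _) (enorm v) (enorm xi) => q a b a0 b0 q0 h1 h2.
have [->|qn] := eqVneq q 0; first by rewrite mulr0 sqr_ge0.
have q1 : 0 < q by rewrite lt_neqAle eq_sym qn.
rewrite -(ler_pM2l q1); have : d * (q * q) <= d * ((a * b) * (a * b)).
  by rewrite ler_wpM2l ?(ltW d0)//; apply: ler_pM.
have : d * a ^+ 2 * b ^+ 2 <= q * b ^+ 2 by rewrite ler_wpM2r ?sqr_ge0.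
move: (sqr_ge0 b) => b2 h3 h4; apply: le_trans (_ : d * a ^+ 2 * b ^+ 2 <= _) => //.
by apply: le_trans (_ : d * (q * q) <= _); [rewrite le_eqVlt; apply/orP; left; apply/eqP; ring|apply: (le_trans h4); rewrite le_eqVlt; apply/orP; left; apply/eqP; ring].
Qed.

Lemma conorm_lower k (K : set rV) : charts k -> compact K -> K `<=` cod k ->
  exists2 C : R, 0 < C & forall z, dom k (base z) -> K (fwd k (base z)) -> enorm (components z k) <= C * conorm g z.
Proof.
move=> kM cK Kc; have [C CP] := metric_entry kM cK Kc.
exists (Num.sqrt (`|C| * n%:R ^+ 2) + 1); first by rewrite ltr_pwDr.
move=> z kz Kz; rewrite (conorm_cometric kM kz); have cx := Kc _ Kz.
have h := enorm_le_cometric (components z k) kM cx (fun i j => CP _ i j Kz).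
rewrite mulrDl mul1r; apply: ler_wpDr; first exact: sqrtr_ge0.
rewrite -[enorm _]ger0_norm ?enorm_ge0// -sqrtr_sqr -sqrtrM ?exprn_ge0//.
apply: ler_wsqrtr; apply: (le_trans h); rewrite ler_wpM2r ?cometric_ge0//.
by rewrite ler_wpM2r ?exprn_ge0// ler_norm.
Qed.

End Cotangent.

(** * The Hilbert space L^2 *)

Section RealL2.
Context {R : realType} {d} {T : measurableType d} (mu : {measure set T -> \bar R}).
Implicit Types f g h : T -> R.

Lemma Lfun2P f : f \in Lfun mu 2%:E <->
  measurable_fun setT f /\ mu.-integrable setT (fun x => (f x ^+ 2)%:E).
Proof.
split=> [h|[mf ifx]].
  by split; [move: h; rewrite inE => /andP[]; rewrite inE|exact: Lfun2_integrable_sqr].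
apply/andP; split; rewrite inE//= /finite_norm unlock.
apply: poweR_lty; move/integrableP : ifx => [_]; apply: le_lt_trans.
apply: ge0_le_integral => //.
- by move=> x _; rewrite lee_fin.
- apply/measurable_EFinP; apply: (@measurableT_comp _ _ _ _ _ _ (fun x : R => x `^ 2)) => //.
  exact: measurableT_comp.
- by apply: measurableT_comp => //; apply/measurable_EFinP; exact: measurable_funX.
- by move=> x _; rewrite lee_fin powR_mulrn// -normrX.
Qed.

Lemma Lfun2_meas f : f \in Lfun mu 2%:E -> measurable_fun setT f.
Proof. by move=> /Lfun2P[]. Qed.

Lemma Lfun2_mul f g : f \in Lfun mu 2%:E -> g \in Lfun mu 2%:E ->
  mu.-integrable setT (fun x => (f x * g x)%:E).
Proof. by move=> hf hg; apply/Lfun1_integrable; exact: Lfun2_mul_Lfun1. Qed.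

Definition sqint f : R := \int[mu]_(x in [set: T]) (f x ^+ 2).

Lemma sqint_ge0 f : 0 <= sqint f.
Proof. by apply: Rintegral_ge0 => x _; exact: sqr_ge0. Qed.

Lemma sqintE f : f \in Lfun mu 2%:E -> (\int[mu]_x (f x ^+ 2)%:E = (sqint f)%:E)%E.
Proof. by move=> /Lfun2P[_ h]; rewrite fineK// integrable_fin_num. Qed.

Lemma Lfun2D f g c : f \in Lfun mu 2%:E -> g \in Lfun mu 2%:E ->
  (fun x => c * f x + g x) \in Lfun mu 2%:E.
Proof.
move=> hf hg; have := Lfun_submod_closed mu (lee1n 2) => -[_ /(_ c f g hf hg)].
exact.
Qed.

Lemma Lfun2B f g : f \in Lfun mu 2%:E -> g \in Lfun mu 2%:E ->
  (fun x => f x - g x) \in Lfun mu 2%:E.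
Proof.
move=> hf hg; have h := Lfun2D (-1) hg hf.
have -> : (fun x => f x - g x) = (fun x => -1 * g x + f x) by apply/funext => x; rewrite mulN1r addrC.
exact: h.
Qed.

(** A rapidly converging subsequence converges almost everywhere, and Fatou's lemma shows that its
    pointwise limit is the limit in mean square of the whole sequence. *)
Theorem riesz_fischer (u : nat -> T -> R) : (forall m, u m \in Lfun mu 2%:E) ->
  (forall e : R, 0 < e -> exists N : nat, forall m k, (N <= m)%N -> (N <= k)%N ->
     sqint (fun x => u m x - u k x) <= e) ->
  exists2 l, l \in Lfun mu 2%:E & forall e : R, 0 < e -> exists N : nat, forall k, (N <= k)%N ->
     sqint (fun x => u k x - l x) <= e.
Proof.
move=> uL uC.
(* The weight 2^k in [g] still leaves the summable 4^-k <= 2^-k. *)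
have e8 k : 0 < 8 ^- k :> R by rewrite invr_gt0.
pose N k := sval (cid (uC _ (e8 k))); have NP k := svalP (cid (uC _ (e8 k))).
(* Partial sums exceed all thresholds so far, which gives a subsequence without a recursive
   choice. *)
pose s k := (\sum_(j < k.+1) (N j).+1)%N.
have sN k : (N k <= s k)%N by rewrite /s big_ord_recr (leq_trans (leqnSn _))// leq_addl.
have sS k : (N k <= s k.+1)%N by rewrite /s big_ord_recr (leq_trans (sN k))// leq_addr.
have sk k : (k <= s k)%N.
  by elim: k => // k IH; rewrite /s big_ord_recr/= addnS ltnS (leq_trans IH)// leq_addr.
pose v k := u (s k); pose h k x := v k.+1 x - v k x.
have hL k : h k \in Lfun mu 2%:E by rewrite /h; apply: Lfun2B; exact: uL.
have hq k : sqint (h k) <= 8 ^- k by apply: NP; [exact: sS|exact: sN].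
pose g k x := (2 ^+ k * h k x ^+ 2)%:E.
have g0 k x : (0 <= g k x)%E by rewrite lee_fin mulr_ge0 ?sqr_ge0.
have mg k : measurable_fun setT (g k).
  by apply/measurable_EFinP; apply: measurable_funM => //; apply: measurable_funX; exact: Lfun2_meas.
have ig k : (\int[mu]_x g k x <= (2 ^- k)%:E)%E.
  rewrite /g; under eq_integral do rewrite EFinM.
  rewrite ge0_integralZl//=; last 2 first.
  - by apply/measurable_EFinP; apply: measurable_funX; exact: Lfun2_meas.
  - by move=> x _; rewrite lee_fin sqr_ge0.
  rewrite sqintE//; apply: (@le_trans _ _ (2 ^+ k * 8 ^- k)).
    by rewrite ler_wpM2l.
  have -> : 8 = 2 * 4 :> R by rewrite -natrM.
  rewrite exprMn invfM mulVKf ?expf_neq0// lef_pV2 ?posrE ?exprn_gt0//.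
  by apply: lerXn2r; rewrite ?nnegrE// ler_nat.
pose G x := (\sum_(0 <= k <oo) g k x)%E.
have mG : measurable_fun setT G by apply: ge0_emeasurable_sum => // k x _ _.
have G0 x : (0 <= G x)%E by apply: nneseries_ge0.
have geo m : \sum_(k < m) (2 ^- k : R) <= 2.
  have : \sum_(k < m) (2 ^- k : R) <= 2 - 2 * 2 ^- m.
    elim: m => [|m IH]; first by rewrite big_ord0 invr1; lra.
    rewrite big_ord_recr/=; apply: (le_trans (lerD IH (lexx _))).
    by rewrite exprS invfM mulVKf// mulr2n mulrDl mul1r opprD addrA subrK.
  by move=> /le_trans; apply; rewrite gerBl mulr_ge0// invr_ge0 exprn_ge0.
have iG : (\int[mu]_x G x < +oo)%E.
  rewrite integral_nneseries//.
  apply: (@le_lt_trans _ _ 2%:E); last exact: ltry.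
  apply: lime_le; first by apply: is_cvg_nneseries => k _ _; apply: integral_ge0 => x _; exact: g0.
  near=> m; rewrite big_mkord.
  apply: (@le_trans _ _ (\sum_(k < m) (2 ^- k)%:E)%E); first by apply: lee_sum => k _; exact: ig.
  by rewrite sumEFin lee_fin; exact: geo.
pose D := [set x | (G x < +oo)%E].
have mD : measurable D.
  by have := emeasurable_fun_infty_o measurableT mG +oo%E; rewrite setTI.
have cv x : D x -> cvgn (fun k => v k x).
  move=> Dx; have : cvgn [series `|h k x|]_k.
    apply: nondecreasing_is_cvgn; first by apply/nondecreasing_seqP => m; rewrite /series/= big_nat_recr//= lerDl.
    exists (fine (G x) + 2) => _ [m _ <-]; rewrite /series/= big_mkord.
    (* z <= 2^k z^2 + 2^-k passes from the squares summed in [G] to absolute values. *)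
    apply: (@le_trans _ _ (\sum_(k < m) (2 ^+ k * h k x ^+ 2 + 2 ^- k))).
      apply: ler_sum => k _; have t0 : 0 < 2 ^+ k :> R by rewrite exprn_gt0.
      rewrite -(real_normK (num_real (h k x))); move: (2 ^+ k) t0 `|h k x| => t t0 z.
      rewrite -subr_ge0; have -> : t * z ^+ 2 + t^-1 - z = t * (z - (2 * t)^-1) ^+ 2 + (3 / 4) * t^-1.
        by field; rewrite gt_eqF.
      by rewrite addr_ge0// mulr_ge0 ?sqr_ge0 ?invr_ge0 ?(ltW t0)// divr_ge0.
    rewrite big_split/=; apply: lerD; last exact: geo.
    rewrite -lee_fin fineK; last by rewrite ge0_fin_numE.
    rewrite -sumEFin; have := @nneseries_lim_ge R (fun k => g k x) xpredT 0%N m => hl.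
    by apply: le_trans (hl _); [rewrite big_mkord|move=> k _ _; exact: g0].
  move=> /normed_cvg cs.
  have -> : (fun k => v k x) = (fun k => v 0%N x + series (fun k => h k x) k).
    by apply/funext => k; rewrite /series/= /h telescope_sumr// addrC subrK.
  by apply: is_cvgD => //; exact: is_cvg_cst.
(* The upper limit is measurable everywhere and coincides with the limit on [D]. *)
pose l x := fine (limn_esup (fun k => (v k x)%:E)).
have wl x : D x -> v ^~ x @ \oo --> l x.
  move=> /cv c; have c' : (fun k => (v k x)%:E) @ \oo --> (limn (v^~ x))%:E.
    by apply: cvg_EFin; [exact: nearW|exact: c].
  by have [_ e] := cvg_limn_einf_sup c'; rewrite /l e; exact: c.
have ml : measurable_fun setT l.
  apply: measurableT_comp => //; apply: measurable_fun_limn_esup => k.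
  by apply/measurable_EFinP; exact: Lfun2_meas (uL _).
have Dae : mu.-negligible (~` D).
  have iGG : mu.-integrable setT G.
    apply/integrableP; split=> //; apply: le_lt_trans iG; apply: ge0_le_integral => //.
      exact: measurableT_comp.
    by move=> x _; rewrite gee0_abs.
  have := integrable_ae measurableT iGG; apply: negligibleS => x /= Dx h0; apply: Dx.
  by have := h0 I; rewrite ge0_fin_numE.
have md k : measurable_fun setT (fun x => ((u k x - l x) ^+ 2)%:E).
  by apply/measurable_EFinP; apply: measurable_funX; apply: measurable_funB => //; exact: Lfun2_meas (uL _).
have main (e : R) : 0 < e -> exists K : nat, forall k, (K <= k)%N ->
    (\int[mu]_x ((u k x - l x) ^+ 2)%:E <= e%:E)%E.
  move=> e0; have [K KP] := uC e e0; exists K => k Kk.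
  pose F m x := ((u k x - v m x) ^+ 2)%:E.
  have mF m : measurable_fun setT (F m).
    by apply/measurable_EFinP; apply: measurable_funX; apply: measurable_funB; exact: Lfun2_meas (uL _).
  have F0 m x : setT x -> (0 <= F m x)%E by move=> _; rewrite lee_fin sqr_ge0.
  have -> : (\int[mu]_x ((u k x - l x) ^+ 2)%:E = \int[mu]_x limn_einf (F ^~ x))%E.
    apply: ae_eq_integral => //.
      apply: (emeasurable_fun_cvg (fun m x => einfs (F ^~ x) m)) => [m|x _]; first exact: measurable_fun_einfs.
      by rewrite limn_einf_lim; exact: is_cvg_einfs.
    apply: negligibleS Dae => x /= h0 Dx; apply: h0 => _.
    have c : F ^~ x @ \oo --> ((u k x - l x) ^+ 2)%:E.
      apply: cvg_EFin; first exact: nearW.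
      have c1 : u k x - v m x @[m --> \oo] --> u k x - l x by apply: cvgB; [exact: cvg_cst|exact: wl].
      by rewrite /comp /F/= expr2; under eq_fun do rewrite expr2; exact: cvgM.
    by have [->] := cvg_limn_einf_sup c.
  apply: le_trans (fatou mu measurableT mF F0) _; rewrite limn_einf_lim.
  apply: lime_le; first exact: is_cvg_einfs.
  near=> m; apply: (@le_trans _ _ (\int[mu]_x F m x)%E); first by apply: ereal_inf_lbound; exists m => /=.
  rewrite sqintE; last by apply: Lfun2B; exact: uL.
  by rewrite lee_fin; apply: KP => //; apply: leq_trans (sk m); near: m; exact: nbhs_infty_ge.
have lL : l \in Lfun mu 2%:E.
  have [K KP] := main 1 ltr01.
  have hd : (fun x => u K x - l x) \in Lfun mu 2%:E.
    apply/Lfun2P; split; first by apply: measurable_funB => //; exact: Lfun2_meas (uL _).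
    apply/integrableP; split=> //; apply: le_lt_trans (ltry 1); apply: le_trans (KP K (leqnn _)).
    under eq_integral do rewrite gee0_abs ?lee_fin ?sqr_ge0//.
    exact: lexx.
  have := Lfun2B (uL K) hd; have -> // : (fun x => u K x - (u K x - l x)) = l.
  by apply/funext => x; rewrite subKr.
exists l => // e e0; have [K KP] := main e e0; exists K => k Kk.
by rewrite -lee_fin -sqintE; [exact: KP|exact: Lfun2B].
Unshelve. all: by end_near.
Qed.
End RealL2.

(** * Complex functions as pairs of real ones *)

Section ComplexL2.
Context {R : realType} {d} {T : measurableType d} (mu : {measure set T -> \bar R}).
Local Notation LT := (LfunType mu (lee1n 2)).
Local Notation V := (LT * LT)%type.
Implicit Types (u v w : V) (f g h : T -> R[i]) (lam : R[i]).

Definition cfun u (x : T) : R[i] := (u.1 : T -> R) x +i* (u.2 : T -> R) x.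

Definition mkL2 f (hf : L2 mu f) : V := (Lfun_Sub (lee1n 2) hf.1, Lfun_Sub (lee1n 2) hf.2).

(** Total, with the value 0 for functions that are not in L^2. *)
Definition toV f : V := if pselect (L2 mu f) is left hf then mkL2 hf else 0.

Lemma cfun_toV f : L2 mu f -> cfun (toV f) = f.
Proof.
move=> hf; rewrite /toV; case: pselect => // hf'; apply/funext => x.
by apply: complexE2.
Qed.

Lemma cfun_L2 u : L2 mu (cfun u).
Proof. by split; exact: LfunP. Qed.

Lemma cfunDZ (a : R) u v x : cfun (a *: u + v) x = a%:C * cfun u x + cfun v x.
Proof.
apply: complexE2.
  by change (a * u.1 x + v.1 x = a * u.1 x - 0 * u.2 x + v.1 x); ring.
by change (a * u.2 x + v.2 x = a * u.2 x + 0 * u.1 x + v.2 x); ring.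
Qed.

Lemma cfunB u v x : cfun (u - v) x = cfun u x - cfun v x.
Proof. by apply: complexE2. Qed.

Lemma cfun0 x : cfun 0 x = 0. Proof. by []. Qed.

(** The real part alone turns the pairs into a real Hilbert space; the imaginary part is recovered
    by multiplying an argument by ['i], see [cip_czscale]. *)
Definition cip u v : R := Re (inner mu (cfun u) (cfun v)).

Lemma LT_int (f g : LT) : mu.-integrable setT (fun x => (f x * g x)%:E).
Proof. by apply: Lfun2_mul; exact: LfunP. Qed.

Lemma cipE u v : cip u v = \int[mu]_(x in [set: T]) (u.1 x * v.1 x) + \int[mu]_(x in [set: T]) (u.2 x * v.2 x).
Proof.
rewrite /cip /= -RintegralD//; [|exact: LT_int|exact: LT_int].
by apply: eq_Rintegral => x _; rewrite mulrN opprK.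
Qed.

Lemma inner_Im u v : Im (inner mu (cfun u) (cfun v)) =
  \int[mu]_(x in [set: T]) (u.2 x * v.1 x) - \int[mu]_(x in [set: T]) (u.1 x * v.2 x).
Proof.
rewrite /= -RintegralB//; [|exact: LT_int|exact: LT_int].
by apply: eq_Rintegral => x _; rewrite mulrN addrC.
Qed.

Lemma cip_sqint u : cip u u = sqint mu u.1 + sqint mu u.2.
Proof. by rewrite cipE. Qed.

Lemma cip_norm u : cip u u = L2norm mu (cfun u) ^+ 2.
Proof.
have E : \int[mu]_(x in [set: T]) (cmod (cfun u x) ^+ 2) = cip u u.
  rewrite cip_sqint -RintegralD//; [|exact: ((Lfun2P mu _).1 (LfunP _)).2|exact: ((Lfun2P mu _).1 (LfunP _)).2].
  by apply: eq_Rintegral => x _; rewrite normc_sqr.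
rewrite /L2norm E sqr_sqrtr// cip_sqint addr_ge0//; exact: sqint_ge0.
Qed.

Theorem cip_hilbert : hilbert cip.
Proof.
split.
- by move=> u v; rewrite !cipE; congr (_ + _); apply: eq_Rintegral => x _; rewrite mulrC.
- move=> a u v w; rewrite !cipE.
  have L (f g h : LT) : \int[mu]_(x in [set: T]) ((a *: f + g) x * h x) =
      a * \int[mu]_(x in [set: T]) (f x * h x) + \int[mu]_(x in [set: T]) (g x * h x).
    rewrite -RintegralZl//; last exact: LT_int.
    rewrite -RintegralD//; [|by have := integrableZl measurableT a (LT_int f h)|exact: LT_int].
    by apply: eq_Rintegral => x _; rewrite mulrDl mulrA.
  by rewrite !L; ring.
- by move=> u; rewrite cip_sqint addr_ge0//; exact: sqint_ge0.
- move=> u uC.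
  have sub i j : cip (u i - u j) (u i - u j) =
      sqint mu (fun x => (u i).1 x - (u j).1 x) + sqint mu (fun x => (u i).2 x - (u j).2 x).
    by rewrite cip_sqint.
  have [|l1 L1 l1P] := @riesz_fischer _ _ _ mu (fun i => (u i).1) (fun i => LfunP _).
    move=> e e0; have [N NP] := uC e e0; exists N => m k Nm Nk.
    by apply: le_trans (NP m k Nm Nk); rewrite sub lerDl sqint_ge0.
  have [|l2 L2' l2P] := @riesz_fischer _ _ _ mu (fun i => (u i).2) (fun i => LfunP _).
    move=> e e0; have [N NP] := uC e e0; exists N => m k Nm Nk.
    by apply: le_trans (NP m k Nm Nk); rewrite sub lerDr sqint_ge0.
  exists (Lfun_Sub (lee1n 2) L1, Lfun_Sub (lee1n 2) L2') => e e0.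
  have e2 : 0 < e / 2 by rewrite divr_gt0.
  have [N1 N1P] := l1P _ e2; have [N2 N2P] := l2P _ e2.
  exists (maxn N1 N2) => k Nk; rewrite cip_sqint [leRHS]splitr; apply: lerD.
    exact: (N1P k (leq_trans (leq_maxl _ _) Nk)).
  exact: (N2P k (leq_trans (leq_maxr _ _) Nk)).
Qed.

Local Notation hip := cip_hilbert.
Local Notation q u := (cip u u).

Lemma sqint0 (f : LT) : sqint mu f = 0 <-> (f : T -> R) = cst 0 %[ae mu].
Proof.
have Lf := LfunP f.
have m2 : measurable_fun setT (fun x => (f x ^+ 2)%:E) by apply/measurable_EFinP; exact: measurable_funX.
have := @ae_eq_integral_abs _ _ _ mu setT measurableT (fun x => (f x ^+ 2)%:E) m2.
have -> : (\int[mu]_x `|(f x ^+ 2)%:E| = (sqint mu f)%:E)%E.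
  by rewrite -sqintE//; apply: eq_integral => x _; rewrite gee0_abs// lee_fin sqr_ge0.
move=> [h1 h2]; split.
  move=> h0; have : ae_eq mu setT (fun x => (f x ^+ 2)%:E) (cst 0%E) by apply: h1; rewrite h0.
  by apply: filterS => x /(_ I) /= [] /eqP; rewrite sqrf_eq0 => /eqP h _.
move=> h0; have : ae_eq mu setT (fun x => (f x ^+ 2)%:E) (cst 0%E).
  by move: h0; apply: filterS => x /= h _; rewrite h// expr0n.
by move=> /h2 [].
Qed.

(** The dictionary between null vectors of the abstract part and the equality almost everywhere in
    which operators and spectrum are defined. *)
Lemma cip0_ae u v : q (u - v) = 0 <-> cfun u = cfun v %[ae mu].
Proof.
rewrite cip_sqint; split.
  move/eqP; rewrite paddr_eq0 ?sqint_ge0// => /andP[/eqP/sqint0 h1 /eqP/sqint0 h2].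
  apply: filterS2 h1 h2 => x e1 e2 _; apply: complexE2; apply/eqP; rewrite -subr_eq0; apply/eqP.
    exact: (e1 I).
  exact: (e2 I).
move=> h; have e1 : sqint mu (u - v).1 = 0.
  by apply/sqint0; apply: filterS h => x h _; have [e1 _] := h I; change (u.1 x - v.1 x = 0); rewrite e1 subrr.
have e2 : sqint mu (u - v).2 = 0.
  by apply/sqint0; apply: filterS h => x h _; have [_ e2] := h I; change (u.2 x - v.2 x = 0); rewrite e2 subrr.
by rewrite e1 e2 addr0.
Qed.

Definition czscale lam u : V := (Re lam *: u.1 - Im lam *: u.2, Re lam *: u.2 + Im lam *: u.1).

Lemma cfun_czscale lam u x : cfun (czscale lam u) x = lam * cfun u x.
Proof.
case: lam => a b; apply: complexE2.
  by change (a * u.1 x - b * u.2 x = a * u.1 x - b * u.2 x).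
by change (a * u.2 x + b * u.1 x = a * u.2 x + b * u.1 x).
Qed.

Lemma cip_czscale lam u v : cip (czscale lam u) v =
  Re lam * cip u v - Im lam * Im (inner mu (cfun u) (cfun v)).
Proof.
have L (a b : R) (f g h : LT) : \int[mu]_(x in [set: T]) ((a *: f + b *: g) x * h x) =
    a * \int[mu]_(x in [set: T]) (f x * h x) + b * \int[mu]_(x in [set: T]) (g x * h x).
  rewrite -!RintegralZl//; [|exact: LT_int|exact: LT_int].
  rewrite -RintegralD//; [|by have := integrableZl measurableT a (LT_int f h)|by have := integrableZl measurableT b (LT_int g h)].
  by apply: eq_Rintegral => x _; rewrite mulrDl !mulrA.
by rewrite !cipE inner_Im /czscale -scaleNr !L; ring.
Qed.

Lemma inner_conj u v : Im (inner mu (cfun v) (cfun u)) = - Im (inner mu (cfun u) (cfun v)).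
Proof.
rewrite !inner_Im opprB; congr (_ - _); by apply: eq_Rintegral => x _; rewrite mulrC.
Qed.

Lemma czscale_adj lam u v : cip (czscale lam u) v = cip u (czscale lam^* v).
Proof.
rewrite (ipC hip u) !cip_czscale (ipC hip v) (inner_conj u v).
by case: lam => a b /=; ring.
Qed.

Lemma q_czscale lam u : q (czscale lam u) = cmod lam ^+ 2 * q u.
Proof.
rewrite czscale_adj (ipC hip) !cip_czscale; have := inner_conj u (czscale lam u).
move=> _; rewrite normc_sqr; case: lam => a b; have -> : Im (inner mu (cfun (czscale (a +i* b) u)) (cfun u)) = b * q u + a * Im (inner mu (cfun u) (cfun u)).
  have L (c e : R) (f g h : LT) : \int[mu]_(x in [set: T]) ((c *: f + e *: g) x * h x) =
      c * \int[mu]_(x in [set: T]) (f x * h x) + e * \int[mu]_(x in [set: T]) (g x * h x).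
    rewrite -!RintegralZl//; [|exact: LT_int|exact: LT_int].
    rewrite -RintegralD//; [|by have := integrableZl measurableT c (LT_int f h)|by have := integrableZl measurableT e (LT_int g h)].
    by apply: eq_Rintegral => x _; rewrite mulrDl !mulrA.
  by rewrite !inner_Im cipE /czscale/= -scaleNr !L; ring.
have : Im (inner mu (cfun u) (cfun u)) = 0.
  by have := inner_conj u u; lra.
by move=> -> /=; ring.
Qed.

End ComplexL2.

Section ComplexTopology.
Context {R : realType}.

Lemma normrCE (z : R[i]) : `|z| = (cmod z)%:C. Proof. by case: z. Qed.

Lemma ltr_re_C (x : R) (e : R[i]) : (x%:C < e) = (x < Re e) && (Im e == 0).
Proof. by rewrite ltcE andbC. Qed.

Lemma nbhs_complexP (l : R[i]) (U : set R[i]^o) : nbhs (l : R[i]^o) U <->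
  exists2 r : R, 0 < r & forall z : R[i], cmod (z - l) < r -> U z.
Proof.
split=> [[e /= e0 h]|[r r0 h]].
  have := e0; rewrite ltr_re_C => /andP[er ei]; exists (Re e) => // z zl; apply: h.
  by rewrite /ball/= ltr_re_C ei andbT -normcN opprB.
exists r%:C => /=; first by rewrite ltcE eqxx.
move=> z; rewrite /ball/= ltr_re_C => /andP[zl _]; apply: h.
by rewrite -normcN opprB.
Qed.

Lemma cvg_complexP (u : nat -> R[i]) (l : R[i]) : ((fun j => u j : R[i]^o) @ \oo --> (l : R[i]^o)) <->
  forall e : R, 0 < e -> exists N : nat, forall j, (N <= j)%N -> cmod (u j - l) < e.
Proof.
split=> [h e e0|h U /nbhs_complexP[r r0 rU]].
  have : nbhs (l : R[i]^o) [set z : R[i]^o | cmod (z - l) < e] by apply/nbhs_complexP; exists e.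
  by move=> /h [N _ NP]; exists N => j Nj; apply: NP.
by have [N NP] := h _ r0; exists N => // j Nj; apply: rU; apply: NP.
Qed.

End ComplexTopology.

(** * The spectrum in terms of lower bounds *)

Section Spectrum.
Context {R : realType} {d} {T : measurableType d} (mu : {measure set T -> \bar R}).
Local Notation LT := (LfunType mu (lee1n 2)).
Local Notation V := (LT * LT)%type.
Local Notation hip := (cip_hilbert mu).
Local Notation ip := (cip (mu:=mu)).
Local Notation q u := (ip u u).
Local Notation toV := (toV mu).
Implicit Types (u v w : V) (f g h : T -> R[i]) (lam : R[i]).

Lemma L2DZ lam f g : L2 mu f -> L2 mu g -> L2 mu (fun x => lam * f x + g x).
Proof.
move=> hf hg; have -> : (fun x => lam * f x + g x) = cfun (czscale lam (toV f) + toV g).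
  apply/funext => x; have := cfunDZ 1 (czscale lam (toV f)) (toV g) x.
  by rewrite scale1r mul1r cfun_czscale !cfun_toV.
exact: cfun_L2.
Qed.

Lemma cfunD u v x : cfun (u + v) x = cfun u x + cfun v x.
Proof. by have := cfunDZ 1 u v x. Qed.

Lemma cfunZ (a : R) u x : cfun (a *: u) x = a%:C * cfun u x.
Proof. by have := cfunDZ a u 0 x; rewrite !addr0. Qed.

Lemma czscaleE lam u : czscale lam u = Re lam *: u + Im lam *: czscale 'i u.
Proof.
apply/eqP; rewrite xpair_eqE /=; apply/andP; split.
  by rewrite scale0r scale1r sub0r scalerN.
by rewrite scale0r scale1r add0r.
Qed.

Lemma czscale_real (t : R) u : czscale t%:C u = t *: u.
Proof. by rewrite czscaleE scale0r addr0. Qed.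

Lemma czscaleN lam u : czscale (- lam) u = - czscale lam u.
Proof.
rewrite (czscaleE (- lam)) (czscaleE lam) opprD -!scaleNr.
by have [-> ->] : Re (- lam) = - Re lam /\ Im (- lam) = - Im lam by case: lam.
Qed.

Lemma toV_ae f g : L2 mu f -> L2 mu g -> f = g %[ae mu] -> q (toV f - toV g) = 0.
Proof. by move=> hf hg fg; apply/cip0_ae; rewrite !cfun_toV. Qed.

Lemma toV_cfun u : q (toV (cfun u) - u) = 0.
Proof. by apply/cip0_ae; rewrite cfun_toV; [exact: ae_eq_refl|exact: cfun_L2]. Qed.

Variable H : (T -> R[i]) -> (T -> R[i]).
Hypotheses (Hb : bounded_operator mu H) (Hs : self_adjoint mu H).

Definition opV lam u : V := toV (H (cfun u)) - czscale lam u.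
Local Notation S := (fun u => toV (H (cfun u))).

Lemma cfun_opV lam u x : cfun (opV lam u) x = H (cfun u) x - lam * cfun u x.
Proof. by rewrite cfunB cfun_czscale cfun_toV//; apply: bop_L2 => //; exact: cfun_L2. Qed.

Lemma adjointS u v : ip (S u) v = ip u (S v).
Proof.
by rewrite /cip !cfun_toV ?Hs//; try apply: bop_L2 => //; exact: cfun_L2.
Qed.

Lemma adjoint_opV lam : adjoint ip (opV lam) (opV lam^*).
Proof.
move=> u v; rewrite (ipDl hip) (ipNl hip) (ipDr hip) (ipNr hip) adjointS.
by rewrite czscale_adj.
Qed.

Lemma opV_bounded lam : exists K, bounded_by ip K (opV lam).
Proof.
have [C CP] := bop_bounded Hb.
have qS u : q (S u) <= C ^+ 2 * q u.
  rewrite !cip_norm cfun_toV; last by apply: bop_L2 => //; exact: cfun_L2.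
  by rewrite -exprMn lerXn2r ?nnegrE ?(le_trans _ (CP _ _)) ?sqrtr_ge0//; exact: cfun_L2.
exists (2 * C ^+ 2 + 2 * cmod lam ^+ 2 + 1); split.
  by have := sqr_ge0 C; have := sqr_ge0 (cmod lam); lra.
move=> u; apply: (le_trans (q_sub_le hip _ _)); rewrite q_czscale.
by have := qS u; have := ip_ge0 hip u; lra.
Qed.

Lemma opV_shift (s t : R) u : op_shift (opV s%:C) t u = opV (s + t)%:C u.
Proof. by rewrite /op_shift /opV !czscale_real scalerDl opprD addrA. Qed.

Lemma bounded_below_ext (P Q : V -> V) : P =1 Q -> bounded_below ip P -> bounded_below ip Q.
Proof. by move=> e [C CP]; exists C => v; rewrite -e. Qed.

(** For real s the vectors (H - s) u and i u are orthogonal in [ip], so |(H - lam) u|^2 >= (Im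
    lam)^2 |u|^2. *)
Lemma opV_nonreal lam : Im lam != 0 -> bounded_below ip (opV lam).
Proof.
move=> b0; exists (Im lam ^- 2) => u.
have iJ v w : ip (czscale 'i v) w = - Im (inner mu (cfun v) (cfun w)).
  by rewrite cip_czscale mul0r mul1r sub0r.
have Ju : ip (czscale 'i u) u = 0 by rewrite iJ; have := inner_conj u u; lra.
have JS : ip (czscale 'i u) (S u) = 0.
  have L : L2 mu (H (cfun u)) by apply: bop_L2 => //; exact: cfun_L2.
  have := inner_conj u (S u); rewrite iJ cfun_toV// Hs; [|exact: cfun_L2|exact: cfun_L2].
  by lra.
have qJ : q (czscale 'i u) = q u by rewrite q_czscale normc_sqr /=; ring.
have := ip_ge0 hip (S u - Re lam *: u).
have -> : opV lam u = (S u - Re lam *: u) - Im lam *: czscale 'i u.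
  by rewrite /opV (czscaleE lam) opprD addrA.
rewrite (q_sub hip (S u - Re lam *: u)) (q_scale hip) (ipZr hip) qJ.
set w := S u - Re lam *: u => h.
have wJ : ip w (czscale 'i u) = 0.
  by rewrite (ipC hip) (ipDr hip) (ipNr hip) (ipZr hip) Ju mulr0 subr0.
rewrite wJ.
rewrite mulrC ler_pdivlMr; first by lra.
by rewrite lt_def sqr_ge0 sqrf_eq0 b0.
Qed.

Lemma resolvent_below lam : resolvent_set mu H lam -> bounded_below ip (opV lam).
Proof.
move=> [B Bb BP]; have [C CP] := bop_bounded Bb; exists (C ^+ 2) => u.
have Lu := cfun_L2 u; have LT := cfun_L2 (opV lam u).
have E : (fun x => H (cfun u) x - lam * cfun u x) = cfun (opV lam u).
  by apply/funext => x; rewrite cfun_opV.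
have [h _] := BP _ Lu; rewrite E in h.
have LB := bop_L2 Bb LT.
have : q (toV (B (cfun (opV lam u))) - u) = 0 by apply/cip0_ae; rewrite cfun_toV.
move=> /(q_congr hip) <-; rewrite !cip_norm cfun_toV// -exprMn.
by rewrite lerXn2r// ?nnegrE ?(le_trans _ (CP _ _))// ?sqrtr_ge0//; try exact: CP.
Qed.

Lemma opV_lin lam c u v : q (opV lam (czscale c u + v) - (czscale c (opV lam u) + opV lam v)) = 0.
Proof.
apply/cip0_ae; have := bop_linear Hb c (cfun_L2 u) (cfun_L2 v).
have E : (fun x => c * cfun u x + cfun v x) = cfun (czscale c u + v).
  by apply/funext => x; rewrite cfunD cfun_czscale.
rewrite [X in H X]E; apply: filterS => x h /h; rewrite cfun_opV (cfunD (czscale c u) v) (cfunD (czscale c (opV lam u)) (opV lam v)).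
rewrite !cfun_czscale !cfun_opV => ->.
by ring.
Qed.

(** [adjoint_onto] gives preimages. As [opV lam] is injective up to null vectors, any choice of them
    is linear, bounded and compatible with equality almost everywhere. *)
Lemma resolventP lam : bounded_below ip (opV lam) -> bounded_below ip (opV lam^*) ->
  resolvent_set mu H lam.
Proof.
move=> b1 b2; have [K TK] := opV_bounded lam.
have /choice[Bv BvP] : forall f : V, exists u, q (opV lam u - f) = 0.
  by move=> f; apply: adjoint_onto hip _ _ _ f (adjoint_opV lam) TK b1 b2.
have [C CP] := b1.
have inj u v : q (opV lam u - opV lam v) = 0 -> q (u - v) = 0.
  move=> h; have := CP (u - v); rewrite (adjoint_qsub hip _ _ (adjoint_opV lam)) h mulr0 => h2.
  by apply/eqP; rewrite eq_le h2 (ip_ge0 hip).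
have null_trans u v w : q (u - v) = 0 -> q (w - v) = 0 -> q (u - w) = 0.
  move=> /(cip0_ae _ _) h1 /(cip0_ae _ _) h2; apply/cip0_ae; apply: filterS2 h1 h2 => x e1 e2 _.
  by rewrite e1// e2.
have nD u v u' v' c : q (u - u') = 0 -> q (v - v') = 0 -> q ((czscale c u + v) - (czscale c u' + v')) = 0.
  move=> /(cip0_ae _ _) h1 /(cip0_ae _ _) h2; apply/cip0_ae; apply: filterS2 h1 h2 => x e1 e2 _.
  by rewrite !cfunD !cfun_czscale e1// e2.
have nC u v : q (u - v) = 0 -> q (v - u) = 0 by rewrite -(q_opp hip) opprB.
exists (fun f => cfun (Bv (toV f))); first split.
- by move=> f _; exact: cfun_L2.
- move=> f g Lf Lg fg; apply/cip0_ae; apply: inj.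
  by apply: (null_trans _ _ _ (BvP _)); apply: (null_trans _ _ _ (BvP _)); exact: toV_ae.
- move=> c f g Lf Lg.
  suff : q (Bv (toV (fun x => c * f x + g x)) - (czscale c (Bv (toV f)) + Bv (toV g))) = 0.
    by move=> /(cip0_ae _ _); apply: filterS => x h /h ->; rewrite cfunD cfun_czscale.
  apply: inj; apply: (null_trans _ _ _ (BvP _)).
  apply: (null_trans _ _ _ (opV_lin _ _ _ _)).
  apply: (@null_trans _ (czscale c (toV f) + toV g)); last by apply: nD; exact: BvP.
  apply/cip0_ae; rewrite cfun_toV; last exact: L2DZ.
  by apply: aeW => x _; rewrite cfunD cfun_czscale !cfun_toV.
- exists (C ^+ 2 + 1) => f Lf; have := CP (Bv (toV f)); rewrite (q_congr hip (BvP _)) !cip_norm cfun_toV// => h.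
  have C2 : C <= (C ^+ 2 + 1) ^+ 2 by have := sqr_ge0 (C ^+ 2 + 1); nra.
  rewrite -(@ler_pXn2r _ 2%N)// ?nnegrE ?sqrtr_ge0//; last first.
    by rewrite mulr_ge0 ?sqrtr_ge0// addr_ge0 ?sqr_ge0.
  rewrite exprMn; apply: (le_trans h); apply: ler_wpM2r => //; exact: sqr_ge0.
move=> f Lf; have Ef : q (toV f - toV f) = 0 by rewrite subrr (ip0l hip).
have E : (fun x => H f x - lam * f x) = cfun (opV lam (toV f)).
  by apply/funext => x; rewrite cfun_opV cfun_toV.
split.
  rewrite E -[X in _ = X %[ae _]](cfun_toV Lf); apply/cip0_ae; apply: inj.
  by apply: (null_trans _ _ _ (BvP _)); apply: nC; exact: toV_cfun.
have /(cip0_ae _ _) := BvP (toV f); rewrite cfun_toV//; apply: filterS => x h /h <-.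
by rewrite cfun_opV.
Qed.

Lemma nonreal_resolvent lam : Im lam != 0 -> resolvent_set mu H lam.
Proof.
move=> h; apply: resolventP; apply: opV_nonreal => //.
by case: lam h => a b ; rewrite oppr_eq0.
Qed.

Lemma real_resolventP (t : R) : resolvent_set mu H t%:C <-> bounded_below ip (opV t%:C).
Proof.
split; first exact: resolvent_below.
move=> h; apply: resolventP; first exact: h.
have -> : (t%:C)^* = t%:C by apply: complexE2; [done|exact: oppr0].
exact: h.
Qed.

Lemma eigenfunctionP lam u : eigenfunction mu H lam (cfun u) <-> q (opV lam u) = 0.
Proof.
have E : q (opV lam u) = q (toV (H (cfun u)) - czscale lam u) by [].
split.
  move=> [_ h]; apply/cip0_ae; rewrite cfun_toV; last by apply: bop_L2 => //; exact: cfun_L2.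
  by move: h; apply: filterS => x h /h ->; rewrite cfun_czscale.
move=> /(cip0_ae _ _) h; split; first exact: cfun_L2.
rewrite cfun_toV in h; last by apply: bop_L2 => //; exact: cfun_L2.
by move: h; apply: filterS => x h /h ->; rewrite cfun_czscale.
Qed.

(** The lower bounds concern real shifts; nonreal points lie in the resolvent set anyway, so [t] is
    isolated in the complex plane. *)
Lemma isolated_finite_discrete (t : R) :
  isolated_finite ip (opV t%:C) -> discrete_spectrum mu H t%:C.
Proof.
move=> [[e qe Te] [es esP] [r r0 rP]]; split.
- split.
    apply/mem_set => /= /real_resolventP [C CP]; have := CP e; rewrite qe Te mulr0.
    by rewrite ler10.
  exists [set z : R[i]^o | cmod (z - t%:C) < r]; first by apply/nbhs_complexP; exists r.
  apply/seteqP; split=> [z [/= zt zS]|z /= ->]; last first.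
    split; first by rewrite subrr normc0.
    move=> /real_resolventP [C CP]; have := CP e; rewrite qe Te mulr0.
    by rewrite ler10.
  apply: contrapT => znt; apply: zS.
  have [z0|zn0] := eqVneq (Im z) 0; last exact: nonreal_resolvent.
  have zE : z = (Re z)%:C by apply: complexE2.
  rewrite zE; apply/real_resolventP.
  have st : Re z - t != 0.
    by apply/eqP => h; apply: znt; rewrite zE; congr _%:C; lra.
  apply: bounded_below_ext (rP _ st _).
    by move=> u; rewrite opV_shift addrC subrK.
  by rewrite zE in zt; rewrite -normcR rmorphB.
- exists (cfun e); first exact/eigenfunctionP.
  move=> h; have : q (e - 0) = 0 by apply/cip0_ae.
  by rewrite subr0 qe => /eqP; rewrite oner_eq0.
- exists (size es), (fun i => cfun (nth 0 es i)) => f [Lf fP].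
  exists (fun i => (ip (toV f) (nth 0 es i))%:C).
  have : q (opV t%:C (toV f)) = 0 by apply/eigenfunctionP; rewrite cfun_toV.
  move=> /esP /(cip0_ae _ _); rewrite cfun_toV//; apply: filterS => x h /h ->.
  rewrite /proj_on (big_nth 0) big_mkord.
  elim/big_rec2: _ => [|i y1 y2 _]; first by rewrite cfun0.
  by rewrite cfunDZ => ->.
Qed.

Definition inspan (es : seq V) u := exists2 l : seq (R * V), (forall p, p \in l -> p.2 \in es) &
  q (u - \sum_(p <- l) p.1 *: p.2) = 0.

(** The functions [e] need not be square integrable, so a spanning list is extracted from the
    subspace itself. Elimination: an element with nonzero first coefficient is recorded and used to
    clear that coefficient elsewhere. With it goes its multiple by ['i], as the span is real. *)
Lemma span_L2 N (e : 'I_N -> T -> R[i]) (P : V -> Prop) :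
  (forall lam u v, P u -> P v -> P (czscale lam u + v)) ->
  (forall u, P u -> exists c : 'I_N -> R[i], cfun u = (fun x => \sum_(i < N) c i * e i x) %[ae mu]) ->
  exists es : seq V, forall u, P u -> inspan es u.
Proof.
elim: N e P => [|N IH] e P Plin PE.
  exists [::] => u /PE[c h]; exists [::] => //; rewrite big_nil; apply/cip0_ae.
  by move: h; apply: filterS => x h /h ->; rewrite big_ord0.
pose Q u := P u /\ exists c : 'I_N -> R[i], cfun u = (fun x => \sum_(i < N) c i * e (lift ord0 i) x) %[ae mu].
have Qlin lam u v : Q u -> Q v -> Q (czscale lam u + v).
  move=> [Pu [c cP]] [Pv [c' cP']]; split; first exact: Plin.
  exists (fun i => lam * c i + c' i); apply: filterS2 cP cP' => x h1 h2 _.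
  rewrite cfunD cfun_czscale h1// h2// mulr_sumr -big_split.
  by apply: eq_bigr => i _; rewrite mulrDl mulrA.
have [es esP] := IH _ Q Qlin (fun u Qu => Qu.2).
have [[u0 [Pu0 [c0 [u0E c0n]]]]|no] := pselect (exists u0, P u0 /\ exists c : 'I_N.+1 -> R[i],
    cfun u0 = (fun x => \sum_(i < N.+1) c i * e i x) %[ae mu] /\ c ord0 != 0); last first.
  exists es => u Pu; apply: esP; split=> //; have [c cE] := PE u Pu.
  have c00 : c ord0 = 0.
    by apply: contrapT => /eqP h; apply: no; exists u; split=> //; exists c.
  exists (fun i => c (lift ord0 i)); move: cE; apply: filterS => x h /h ->.
  by rewrite big_ord_recl c00 mul0r add0r.
exists (u0 :: czscale 'i u0 :: es) => u Pu; have [c cE] := PE u Pu.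
pose z := c ord0 / c0 ord0.
have Qv : Q (czscale (- z) u0 + u).
  split; first exact: Plin.
  exists (fun i => - z * c0 (lift ord0 i) + c (lift ord0 i)); apply: filterS2 u0E cE => x h1 h2 _.
  rewrite cfunD cfun_czscale h1// h2// !big_ord_recl mulrDr mulrA.
  have -> : - z * c0 ord0 = - c ord0 by rewrite mulNr divfK.
  rewrite mulNr addrACA addNr add0r mulr_sumr -big_split.
  by apply: eq_bigr => i _; rewrite mulrDl mulrA.
have [l ls lP] := esP _ Qv.
exists ((Re z, u0) :: (Im z, czscale 'i u0) :: l).
  move=> p; rewrite !inE => /orP[/eqP ->/=|/orP[/eqP ->/=|/ls ->]]; rewrite ?eqxx ?orbT//.
rewrite !big_cons addrA -czscaleE.
suff -> : u - (czscale z u0 + \sum_(j <- l) j.1 *: j.2) =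
  czscale (- z) u0 + u - \sum_(p <- l) p.1 *: p.2 by [].
by rewrite opprD addrA czscaleN [- _ + u]addrC.
Qed.

(** [weyl_criterion] takes coefficients as a function of the vector; removing duplicates keeps a
    repeated vector from counting twice. *)
Lemma inspan_coef es u : inspan es u -> exists c : V -> R,
  q (u - \sum_(e <- undup es) c e *: e) = 0.
Proof.
move=> [l ls lP]; suff [c cE] : exists c : V -> R,
    \sum_(p <- l) p.1 *: p.2 = \sum_(e <- undup es) c e *: e by exists c; rewrite -cE.
elim: l ls {lP} => [|[a e0] l IH] ls.
  by exists (fun=> 0); rewrite big_nil big1// => e _; rewrite scale0r.
have [|c cE] := IH; first by move=> p pl; apply: ls; rewrite inE pl orbT.
exists (fun e => (if e == e0 then a else 0) + c e).
rewrite big_cons cE/=; under [RHS]eq_bigr do rewrite scalerDl.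
rewrite big_split/=; congr (_ + _).
have e0s : e0 \in undup es by rewrite mem_undup; apply: (ls (a, e0)); rewrite mem_head.
rewrite (bigD1_seq e0)//= ?undup_uniq// eqxx big1 ?addr0// => e /negbTE ->.
by rewrite scale0r.
Qed.

Lemma weyl_essential (t : R) :
  (forall (e : R) (hs : seq V), 0 < e -> exists u, [/\ q u = 1, q (opV t%:C u) <= e &
     forall v, v \in hs -> ip u v ^+ 2 <= e]) ->
  essential_spectrum mu H t%:C.
Proof.
move=> W; have [K TK] := opV_bounded t%:C.
have aT : adjoint ip (opV t%:C) (opV t%:C).
  have := adjoint_opV t%:C; have -> // : (t%:C)^* = t%:C.
  by apply: complexE2; [done|exact: oppr0].
have [nb nf] := weyl_criterion hip aT TK W.
split; first by move=> /real_resolventP.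
move=> [[tS [U /nbhs_complexP[r r0 rU] UE]] _ [N [e eP]]]; apply: nf; split.
  have [||es esP] := @span_L2 N e (fun u => q (opV t%:C u) = 0).
  - move=> lam u v qu qv; rewrite (q_congr hip (opV_lin _ _ _ _)).
    have -> : czscale lam (opV t%:C u) + opV t%:C v = opV t%:C v + czscale lam (opV t%:C u) by rewrite addrC.
    rewrite (q_add hip) q_czscale qu qv (ip_null hip)//; ring.
  - by move=> u /eigenfunctionP /eP.
  by exists (undup es) => f /esP /inspan_coef.
exists r => // s s0 sr; apply: (@bounded_below_ext (opV (t + s)%:C)).
  by move=> u; rewrite opV_shift.
apply/real_resolventP; apply: contrapT => h.
have : (U `&` (spectrum mu H : set R[i]^o)) (t + s)%:C.
  split=> //; apply: rU; have -> : (t + s)%:C - t%:C = s%:C by rewrite -rmorphB; ring.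
  by rewrite normcR.
rewrite UE => /= /(congr1 (@complex.Re R)) /= /eqP; rewrite -subr_eq0 => /eqP h2.
by lra.
Qed.

End Spectrum.

(** If [Q K] failed, the sets whose complement in [K] satisfies [Q] would form a proper filter
    without cluster point in [K]. This replaces finite subcovers, for points as well as for
    frequencies. *)
Lemma compact_ideal (T : topologicalType) (Q : set T -> Prop) (K : set T) : compact K -> Q set0 ->
  (forall A B, A `<=` B -> Q B -> Q A) -> (forall A B, Q A -> Q B -> Q (A `|` B)) ->
  (forall x, K x -> exists2 U, nbhs x U & Q U) -> Q K.
Proof.
move=> cK Q0 QS QU loc; apply: contrapT => nQ; pose F : set_system T := [set A | Q (K `\` A)].
have FF : ProperFilter F.
  split; first by rewrite /F/= setD0.
  split; first by rewrite /F/= setDT.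
    by move=> A B FA FB; rewrite /F/= setDIr; exact: QU.
  by move=> A B AB; apply: QS => x [Kx nB]; split=> // /AB.
have [|x [Kx cx]] := cK F FF; first by rewrite /F/= setDv.
have [U xU QUU] := loc x Kx.
have [y [yU]] : ~` U `&` U !=set0.
  by apply: cx => //; rewrite /F/= setDE setCK; apply: QS QUU => y [].
by [].
Qed.

(** Counts the levels below [t] for a layer-cake approximation; the strict inequality makes the
    level sets of a continuous function open. *)
Lemma count_floor (R : realType) N (t : R) : 0 <= t <= N%:R ->
  t - 1 <= \sum_(j < N) (j.+1%:R < t)%R%:R <= t.
Proof.
elim: N t => [|N IH] t /andP[t0 tN].
  by rewrite big_ord0; lra.
rewrite big_ord_recr/=; have [tN'|tN'] := leP t N%:R.
  have /andP[h1 h2] := IH t (introT andP (conj t0 tN')).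
  have -> : (N.+1%:R < t) = false by apply/negbTE; rewrite -leNgt (le_trans tN')// ler_nat.
  by rewrite addr0 h1.
have -> : (N.+1%:R < t) = false by apply/negbTE; rewrite -leNgt.
have -> : \sum_(i < N) (i.+1%:R < t)%R%:R = N%:R :> R.
  transitivity (\sum_(i < N) (1 : R)); last by rewrite sumr_const card_ord.
  apply: eq_bigr => i _; have -> // : i.+1%:R < t.
  by apply: le_lt_trans tN'; rewrite ler_nat.
rewrite addr0; lra.
Qed.

(** * Smooth densities *)

Section ManifoldMeasure.
Context {R : realType} {n : nat} (M : smoothManifold R n).
Local Notation rV := 'rV[R]_n.
Implicit Types (k l : chart R n M) (f : M -> R[i]) (F : M -> R).

Lemma continuous_borel F : continuous F -> measurable_fun setT (F : borel M -> R).
Proof.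
move=> cF; apply: (measurability _ (RGenOpens.measurableE R)).
move=> _ [_ [a [b ->] <-]]; rewrite setTI.
by apply: sub_sigma_algebra; apply: open_comp => [x _|].
Qed.

Lemma smooth_function_continuous f : smooth_function f ->
  continuous (fun p => Re (f p)) /\ continuous (fun p => Im (f p)).
Proof.
have P (h : M -> R) : (forall k, charts k -> smooth_on (cod k) (h \o bwd k)) -> continuous h.
  move=> sh p; have [k kM dp] := charts_cover p.
  apply: (@continuous_local M R ((h \o bwd k) \o fwd k) h (dom k) p (@dom_open _ _ _ k) dp).
    by move=> y dy /=; rewrite fwdK.
  apply: continuous_comp; first exact: fwd_continuous.
  by apply: (smooth_on_continuous (sh k kM)); exact: fwd_cod.
by move=> sf; split; apply: P => k kM; have [h1 h2] := sf k kM.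
Qed.

(** The values of [f] off [V] are hidden by the indicator. A preimage contains the complement of [K]
    exactly when the interval contains 0, whence the two cases. *)
Lemma vmeas_patch (V K : set rV) (f : rV -> R) : open V -> closed K -> K `<=` V ->
  (forall x, V x -> {for x, continuous f}) -> vmeas (fun x => f x * \1_K x).
Proof.
move=> oV cK KV cf; apply: (measurability _ (RGenOpens.measurableE R)).
move=> _ [_ [a [b ->] <-]]; rewrite setTI comp_preimage; set O := `]a, b[%classic.
have mK : measurable (@vec R n @^-1` K : set (E n)).
  by rewrite -[K]setCK; apply: measurableC; apply: open_vec; exact: closed_openC.
have mU : measurable (@vec R n @^-1` [set x | V x /\ O (f x)] : set (E n)).
  apply: open_vec; rewrite openE => x [Vx Ox].
  have h1 : nbhs x V by apply: open_nbhs_nbhs.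
  have h2 : nbhs x (f @^-1` O).
    by apply: (cf x Vx); apply: open_nbhs_nbhs.
  by apply: filterS2 h1 h2 => y ? ?.
have [hO|hO] := pselect (O 0).
  have -> : @vec R n @^-1` ((fun x => f x * \1_K x) @^-1` O) =
      (@vec R n @^-1` K `&` @vec R n @^-1` [set x | V x /\ O (f x)]) `|` ~` (@vec R n @^-1` K) :> set (E n).
    apply/seteqP; split=> e /=.
      have [Ke|nK] := pselect (K (vec e)); last by right.
      by rewrite indicE mem_set// mulr1; left; split=> //; split=> //; exact: KV.
    move=> [[Ke [_ Oe]]|nK]; rewrite indicE; first by rewrite mem_set// mulr1.
    by rewrite memNset// mulr0.
  by apply: measurableU; [exact: measurableI|exact: measurableC].
have -> : @vec R n @^-1` ((fun x => f x * \1_K x) @^-1` O) =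
    @vec R n @^-1` K `&` @vec R n @^-1` [set x | V x /\ O (f x)] :> set (E n).
  apply/seteqP; split=> e /=.
    have [Ke|nK] := pselect (K (vec e)).
      by rewrite indicE mem_set// mulr1 => h; split=> //; split=> //; exact: KV.
    by rewrite indicE memNset// mulr0.
  by move=> [Ke [_ Oe]]; rewrite indicE mem_set// mulr1.
exact: measurableI.
Qed.

Lemma rV_compact_closed (K : set rV) : compact K -> closed K.
Proof. by apply: compact_closed. Qed.

Lemma wbounded_patch (V K : set rV) (f : rV -> R) : open V -> compact K -> K `<=` V ->
  (forall x, V x -> {for x, continuous f}) -> wbounded (fun x => f x * \1_K x).
Proof.
move=> oV cK KV cf; have clK := rV_compact_closed cK.
split; first exact: (vmeas_patch oV clK KV cf).
have [A KA] := compact_in_cube cK.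
have [C CP] : exists C, forall x, K x -> `|f x| <= C.
  apply: (compact_uniform cK) => [C D p CD h|x Kx]; first exact: le_trans h CD.
  exists (`|f x| + 1); have h : \forall y \near x, ball (f x) 1 (f y).
    exact: (cf x (KV x Kx) _ (nbhsx_ballx (f x) 1 ltr01)).
  apply: filterS h => y; rewrite /ball/= => h.
  have := ler_normD (f y - f x) (f x); rewrite subrK distrC; lra.
exists (`|C| * (1 + A ^+ 2) ^+ n); apply: bounded_cube_weight => x.
  rewrite indicE; case: (boolP (x \in K)) => [/set_mem Kx|_]; last by rewrite mulr0 normr0.
  by rewrite mulr1; apply: (le_trans (CP x Kx)); exact: ler_norm.
by move=> nA; rewrite indicE memNset ?mulr0// => /KA.
Qed.

Variable mu : {measure set (borel M) -> \bar R}.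
Hypotheses (M_compact : compact [set: M]) (mu_density : smooth_positive_density mu).

Lemma open_borel (U : set M) : open U -> measurable (U : set (borel M)).
Proof. exact: sub_sigma_algebra. Qed.

Lemma closed_borel (B : set M) : closed B -> measurable (B : set (borel M)).
Proof. by move=> cB; rewrite -[B]setCK; apply: measurableC; apply: open_borel; exact: closed_openC. Qed.

Section InChart.
Variables (k : chart R n M) (kM : charts k) (rho : rV -> R).
Hypotheses (rho_smooth : smooth_on (cod k) rho) (rho_pos : forall x, cod k x -> 0 < rho x).
Hypothesis rhoE : forall B : set (borel M), measurable B -> B `<=` dom k ->
  mu B = int_rV (fun x => (rho x * \1_(fwd k @` B) x)%:E).
Variables (K : set rV) (cK : compact K) (Kk : K `<=` cod k).

Lemma wbounded_rho : wbounded (fun x => rho x * \1_K x).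
Proof.
apply: (wbounded_patch (@cod_open _ _ _ k) cK Kk) => x; exact: smooth_on_continuous.
Qed.

Lemma rho_ge0 x : 0 <= rho x * \1_K x.
Proof.
rewrite indicE; case: (boolP (x \in K)) => [/set_mem Kx|_]; last by rewrite mulr0.
by rewrite mulr1; exact: ltW (rho_pos (Kk Kx)).
Qed.

(** The density is known through measures of sets; this evaluates the measures of the level sets
    from which [chart_integral] is built. *)
Lemma mu_level (O : set M) : open O ->
  mu (bwd k @` K `&` O) = (rint (fun x => rho x * \1_K x * \1_[set x | cod k x /\ O (bwd k x)] x))%:E /\
  wbounded (fun x => rho x * \1_K x * \1_[set x | cod k x /\ O (bwd k x)] x).
Proof.
move=> oO; have wb : wbounded (fun x => rho x * \1_K x * \1_[set x | cod k x /\ O (bwd k x)] x).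
  have mG : vmeas (\1_[set x | cod k x /\ O (bwd k x)] : rV -> R).
    have oG : open [set x | cod k x /\ O (bwd k x)] by apply: open_chart_preimage.
    by have := @measurable_indic _ (E n) R setT _ (open_vec oG).
  under eq_fun do rewrite mulrC; apply: (wboundedM wbounded_rho mG); exists 1 => x.
  by rewrite ger0_norm.
split=> //; rewrite rhoE; last 2 first.
- by apply: measurableI; [apply: closed_borel; exact: chart_closed|exact: open_borel].
- by move=> p [[x Kx <-] _]; apply: bwd_dom; exact: Kk.
rewrite fineK; last by rewrite int_rV_wbounded//; exact: integrable_fin_num (wbounded_integrable wb).
congr int_rV; apply/funext => x /=; rewrite -mulrA; congr (_ * _)%:E.
rewrite -natrM mulnb; congr (nat_of_bool _)%:R; apply/idP/andP.
  move=> /set_mem [p [[y Ky <-] Op] <-]; rewrite bwdK; last exact: Kk.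
  by split; apply/mem_set => //=; split=> //; exact: Kk.
move=> [/set_mem Kx /set_mem /= [cx Ox]]; apply/mem_set; exists (bwd k x); last by rewrite bwdK.
by split.
Qed.

Lemma mu_chart_fin : (mu (bwd k @` K) < +oo)%E.
Proof.
by have [h _] := mu_level openT; rewrite setIT in h; rewrite h ltry.
Qed.

End InChart.

Lemma mu_fin : (mu setT < +oo)%E.
Proof.
pose Q (A : set M) := exists B : set (borel M), [/\ measurable B, A `<=` B & (mu B < +oo)%E].
have [B [mB AB fB]] : Q setT.
  apply: (compact_ideal M_compact).
  - by exists set0; split=> //; rewrite measure0.
  - by move=> A B AB [C [mC BC fC]]; exists C; split=> // x /AB /BC.
  - move=> A B [C [mC AC fC]] [D [mD BD fD]]; exists (C `|` D); split; [exact: measurableU|exact: setUSS|].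
    by apply: (le_lt_trans (measureU2 _ mC mD)); apply: lte_add_pinfty.
  - move=> p _; have [k kM dp] := charts_cover p; have [r r0 rk] := open_cbox (@cod_open _ _ _ k) (fwd_cod dp).
    have [rho [s1 s2 s3]] := mu_density kM; have cc := @compact_cbox R n (fwd k p) r.
    exists [set q | dom k q /\ cbox (fwd k p) r (fwd k q)].
      have h1 : nbhs p (dom k) by apply: open_nbhs_nbhs; split=> //; exact: dom_open.
      have h2 : nbhs p (fwd k @^-1` cbox (fwd k p) r) by apply: (fwd_continuous dp); exact: nbhs_cbox.
      by apply: filterS2 h1 h2.
    exists (bwd k @` cbox (fwd k p) r); split.
    - by apply: closed_borel; exact: chart_closed.
    - by move=> q [dq cq]; exists (fwd k q) => //; rewrite fwdK.
    - exact: (mu_chart_fin s1 s3 cc rk).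
by apply: le_lt_trans fB; apply: le_measure; rewrite ?inE.
Qed.

Lemma continuous_bounded F : continuous F -> exists C, forall p, `|F p| <= C.
Proof.
move=> cF; have [C CP] : exists C, forall p, setT p -> `|F p| <= C.
  apply: (compact_uniform M_compact) => [C D p CD h|p _]; first exact: le_trans h CD.
  exists (`|F p| + 1); have h : \forall y \near p, ball (F p) 1 (F y).
    exact: (cF p _ (nbhsx_ballx (F p) 1 ltr01)).
  apply: filterS h => y; rewrite /ball/= => h.
  have := ler_normD (F y - F p) (F p); rewrite subrK distrC; lra.
by exists C => p; exact: CP.
Qed.

Lemma continuous_integrable F : continuous F -> mu.-integrable setT (EFin \o F).
Proof.
move=> cF; apply: measurable_bounded_integrable => //; [exact: mu_fin|exact: continuous_borel|].
have [C CP] := continuous_bounded cF.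
by exists C; split; [exact: num_real|move=> x Cx y _ ; exact: le_trans (CP y) (ltW Cx)].
Qed.

Lemma smooth_L2 f : smooth_function f -> L2 mu f.
Proof.
move=> /smooth_function_continuous [c1 c2].
have P F : continuous F -> (F : borel M -> R) \in Lfun mu 2%:E.
  move=> cF; apply/Lfun2P; split; first exact: continuous_borel.
  have cF2 : continuous (fun p => F p ^+ 2).
    by move=> p; apply: continuousM; exact: cF.
  exact: (continuous_integrable cF2).
by split; apply: P.
Qed.

Lemma Rintegral_sum_ord N (f : 'I_N -> borel M -> R) : (forall j, mu.-integrable setT (EFin \o f j)) ->
  mu.-integrable setT (EFin \o (fun p => \sum_(j < N) f j p)) /\
  \int[mu]_(p in setT) (\sum_(j < N) f j p) = \sum_(j < N) \int[mu]_(p in setT) f j p.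
Proof.
elim: N f => [|N IH] f fi.
  have -> : (fun p => \sum_(j < 0) f j p) = cst 0 by apply/funext => p; rewrite big_ord0.
  by rewrite big_ord0; split; [exact: integrable0|rewrite Rintegral_cst// mul0r].
have [h1 h2] := IH (fun j => f (widen_ord (leqnSn N) j)) (fun j => fi _).
have -> : (fun p => \sum_(j < N.+1) f j p) =
    (fun p => \sum_(j < N) f (widen_ord (leqnSn N) j) p + f ord_max p).
  by apply/funext => p; rewrite big_ord_recr.
split; first by have := integrableD measurableT h1 (fi ord_max).
by rewrite RintegralD// h2 big_ord_recr.
Qed.

Lemma rint_sum_ord N (f : 'I_N -> rV -> R) : (forall j, wbounded (f j)) ->
  wbounded (fun x => \sum_(j < N) f j x) /\ rint (fun x => \sum_(j < N) f j x) = \sum_(j < N) rint (f j).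
Proof.
elim: N f => [|N IH] f fi.
  under eq_fun do rewrite big_ord0; rewrite big_ord0.
  have w0 : wbounded (fun _ : rV => 0 : R).
    by have := wboundedZ 0 (@wbounded_weight R n); under eq_fun do rewrite mul0r.
  have := rintZ 0 w0; under eq_fun do rewrite mul0r; by rewrite mul0r.
have [h1 h2] := IH (fun j => f (widen_ord (leqnSn N) j)) (fun j => fi _).
have -> : (fun x => \sum_(j < N.+1) f j x) =
    (fun x => \sum_(j < N) f (widen_ord (leqnSn N) j) x + f ord_max x).
  by apply/funext => p; rewrite big_ord_recr.
by split; [exact: wboundedD|rewrite rintD// h2 big_ord_recr].
Qed.

End ManifoldMeasure.

(** * Integrals in a chart *)

Section ManifoldIntegral.
Context {R : realType} {n : nat} {M : smoothManifold R n}.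
Local Notation rV := 'rV[R]_n.
Implicit Types (f : M -> R[i]) (F : M -> R).
Variable mu : {measure set (borel M) -> \bar R}.
Hypotheses (M_compact : compact [set: M]) (mu_density : smooth_positive_density mu).

Section ChartIntegral.
Variables (k : chart R n M) (kM : charts k) (rho : rV -> R).
Hypotheses (rho_smooth : smooth_on (cod k) rho) (rho_pos : forall x, cod k x -> 0 < rho x).
Hypothesis rhoE : forall B : set (borel M), measurable B -> B `<=` dom k ->
  mu B = int_rV (fun x => (rho x * \1_(fwd k @` B) x)%:E).
Variables (K : set rV) (cK : compact K) (Kk : K `<=` cod k).

Lemma wbounded_chart F : continuous F -> wbounded (fun x => rho x * F (bwd k x) * \1_K x).
Proof.
move=> cF; apply: (wbounded_patch (@cod_open _ _ _ k) cK Kk) => x cx.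
apply: continuousM; first exact: (smooth_on_continuous rho_smooth).
by apply: continuous_comp; [exact: bwd_continuous|exact: cF].
Qed.

Let r0 x : 0 <= rho x * \1_K x.
Proof. exact: (rho_ge0 rho_pos Kk). Qed.

(** Layer-cake sums over the open sets where [F] exceeds a multiple of [c]. By [mu_level] the levels
    have equal measure on both sides, so the same [S] is a lower sum of both integrals, up to
    O(c). *)
Lemma chart_integral_approx F (N : nat) (C : R) : continuous F -> 0 < C -> (forall p, 0 <= F p <= C) ->
  (forall p, ~ (bwd k @` K) p -> F p = 0) -> let c := C / N.+1%:R in
  exists S : R, [/\ S <= \int[mu]_(p in [set: borel M]) F p, 
    \int[mu]_(p in [set: borel M]) F p <= S + c * fine (mu (bwd k @` K)),
    S <= rint (fun x => rho x * F (bwd k x) * \1_K x) &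
    rint (fun x => rho x * F (bwd k x) * \1_K x) <= S + c * rint (fun x => rho x * \1_K x)].
Proof.
move=> cF C0 FC F0 c; have c0 : 0 < c by rewrite divr_gt0.
pose O (j : 'I_N.+1) : set M := [set p | c * j.+1%:R < F p].
have oO j : open (O j) by apply: (@open_comp _ _ F [set y | c * j.+1%:R < y]) => [p _|].
have OK j : bwd k @` K `&` O j = O j.
  apply/seteqP; split=> [p []//|p Op]; split=> //; apply: contrapT => /F0 Fp.
  by move: Op; rewrite /O/= Fp ltNge mulr_ge0// ltW.
have rhoj j := mu_level rho_smooth rhoE cK Kk (oO j).
have count p : let S := \sum_(j < N.+1) c * \1_(O j) p in S <= F p <= S + c.
  have h0 : 0 <= F p / c <= N.+1%:R.
    have /andP[h1 h2] := FC p; rewrite divr_ge0 ?(ltW c0)//= ler_pdivrMr// mulrC divfK ?pnatr_eq0//.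
  have := count_floor h0 => /=.
  have E : \sum_(j < N.+1) (j.+1%:R < F p / c)%R%:R = \sum_(j < N.+1) \1_(O j) p :> R.
    apply: eq_bigr => j _; congr (nat_of_bool _)%:R.
    rewrite ltr_pdivlMr// mulrC; apply/idP/idP => [h|/set_mem//]; exact/mem_set.
  rewrite E => /andP[h1 h2]; rewrite -mulr_sumr; apply/andP; split.
    by rewrite -ler_pdivlMl// mulrC.
  rewrite -[X in _ + X]mulr1 -mulrDr -ler_pdivrMl; lra.
have iB (B : set (borel M)) : measurable B -> mu.-integrable [set: borel M] (EFin \o \1_B).
  move=> mB; apply: measurable_bounded_integrable => //; first exact: (mu_fin M_compact mu_density).
  exists 1; split; [exact: num_real|move=> x x1 y _ /=]; apply: (le_trans _ (ltW x1)).
  by rewrite ger0_norm.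
have iO j : mu.-integrable [set: borel M] (EFin \o (fun p => c * \1_(O j) p)).
  by have := integrableZl measurableT c (iB _ (open_borel (oO j))).
have mK : measurable (bwd k @` K : set (borel M)) by apply: closed_borel; exact: chart_closed.
have [i1 i2] := Rintegral_sum_ord iO.
pose S := \sum_(j < N.+1) c * fine (mu (O j)).
have SE : \int[mu]_(p in [set: borel M]) (\sum_(j < N.+1) c * \1_(O j) p) = S.
  rewrite i2; apply: eq_bigr => j _; rewrite RintegralZl//; last by apply: iB; exact: open_borel.
  by rewrite /Rintegral integral_indic ?setIT//; exact: open_borel.
pose w (j : 'I_N.+1) x := c * (rho x * \1_K x * \1_[set x | cod k x /\ O j (bwd k x)] x).
have ww j : wbounded (w j) by apply: wboundedZ; exact: (rhoj j).2.
have [w1 w2] := rint_sum_ord ww.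
have SE' : rint (fun x => \sum_(j < N.+1) w j x) = S.
  rewrite w2; apply: eq_bigr => j _; rewrite rintZ; last exact: (rhoj j).2.
  by have := (rhoj j).1; rewrite OK => ->.
have iF : mu.-integrable [set: borel M] (EFin \o F) := continuous_integrable M_compact mu_density cF.
have iK : mu.-integrable [set: borel M] (EFin \o (fun p => c * \1_(bwd k @` K) p)).
  by have := integrableZl measurableT c (iB _ mK).
have wx x : \sum_(j < N.+1) w j x = rho x * \1_K x * \sum_(j < N.+1) c * \1_(O j) (bwd k x).
  rewrite mulr_sumr; apply: eq_bigr => j _; rewrite /w !indicE; case: (boolP (x \in K)) => [/set_mem Kx|_]; last by rewrite !(mulr0, mul0r).
  rewrite mulrCA; congr (_ * (_ * (nat_of_bool _)%:R)).
  apply/idP/idP => /set_mem; first by move=> [_ h]; apply/mem_set.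
  by move=> h; apply/mem_set; split=> //; exact: Kk.
have wr := wbounded_rho rho_smooth cK Kk.
exists S; split.
- rewrite -SE; apply: le_Rintegral => // p _; by have /andP[] := count p.
- rewrite -SE; have <- : \int[mu]_(p in [set: borel M]) (c * \1_(bwd k @` K) p) = c * fine (mu (bwd k @` K)).
    rewrite RintegralZl//; last exact: iB.
    by rewrite /Rintegral integral_indic ?setIT.
  rewrite -RintegralD//; apply: le_Rintegral => //; first by have := integrableD measurableT i1 iK.
  move=> p _; have /andP[_] := count p; rewrite indicE; case: (boolP (p \in bwd k @` K)) => [_|/negP h _].
    by rewrite mulr1.
  rewrite F0 ?mulr0 ?addr0; last by move=> /mem_set.
  by apply: sumr_ge0 => j _; rewrite mulr_ge0// ltW.
- rewrite -SE'; apply: le_rint => //; first exact: wbounded_chart.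
  move=> x; rewrite wx [leRHS]mulrAC ler_wpM2l; by have /andP[] := count (bwd k x).
- rewrite -SE' -rintZ// -rintD//; last exact: wboundedZ.
  apply: le_rint; [exact: wbounded_chart|apply: wboundedD => //; exact: wboundedZ|].
  move=> x; rewrite wx [c * (rho x * _)]mulrC -mulrDr [leLHS]mulrAC ler_wpM2l; by have /andP[] := count (bwd k x).
Qed.

Lemma chart_integral_pos F : continuous F -> (forall p, 0 <= F p) ->
  (forall p, ~ (bwd k @` K) p -> F p = 0) ->
  \int[mu]_(p in [set: borel M]) F p = rint (fun x => rho x * F (bwd k x) * \1_K x).
Proof.
move=> cF Fp F0; have [C CP] := continuous_bounded M_compact cF.
set a := LHS; set b := RHS; pose D := fine (mu (bwd k @` K)) + rint (fun x => rho x * \1_K x).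
pose C1 := `|C| + 1; have C10 : 0 < C1 by rewrite ltr_wpDl.
have FC p : 0 <= F p <= C1.
  rewrite Fp; have := CP p; have := ler_norm (F p); have := ler_norm C; rewrite /C1; lra.
have D0 : 0 <= D.
  by apply: addr_ge0; [exact: fine_ge0|exact: (rint_ge0 r0 (wbounded_rho rho_smooth cK Kk))].
have h N : `|a - b| <= C1 / N.+1%:R * D.
  have [S [h1 h2 h3 h4]] := chart_integral_approx N cF C10 FC F0.
  have c0 : 0 <= C1 / N.+1%:R by rewrite divr_ge0// ltW.
  have m0 : 0 <= C1 / N.+1%:R * fine (mu (bwd k @` K)) by rewrite mulr_ge0.
  have m1 : 0 <= C1 / N.+1%:R * rint (fun x => rho x * \1_K x).
    by rewrite mulr_ge0//; exact: (rint_ge0 r0 (wbounded_rho rho_smooth cK Kk)).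
  move: h1 h2 h3 h4 m0 m1; rewrite -/a -/b ler_norml mulrDr.
  move: (_ * fine _) (_ * rint _) => u v h1 h2 h3 h4 m0 m1; lra.
apply/eqP; rewrite -subr_eq0 -normr_le0; apply/ler_addgt0Pr => e e0; rewrite add0r.
have CD0 : 0 < C1 * D + 1 by rewrite ltr_wpDl// mulr_ge0// ltW.
have [N NP] := archi_inv (divr_gt0 e0 CD0).
apply: (le_trans (h N)); have := NP N (leqnn N); rewrite ler_pdivlMr// => h2.
apply: le_trans h2; rewrite mulrAC mulrC; rewrite ler_wpM2l ?invr_ge0//; lra.
Qed.

Theorem chart_integral F : continuous F -> (forall p, ~ (bwd k @` K) p -> F p = 0) ->
  \int[mu]_(p in [set: borel M]) F p = rint (fun x => rho x * F (bwd k x) * \1_K x).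
Proof.
move=> cF F0; pose F1 p := (`|F p| + F p) / 2; pose F2 p := (`|F p| - F p) / 2.
have cN : continuous (fun p => `|F p|) by move=> p; apply: continuous_comp; [exact: cF|exact: norm_continuous].
have c1 : continuous F1.
  move=> p; apply: (@continuousM _ _ (fun p => `|F p| + F p) (fun=> 2^-1)); last exact: cst_continuous.
  by apply: continuousD; [exact: cN|exact: cF].
have c2 : continuous F2.
  move=> p; apply: (@continuousM _ _ (fun p => `|F p| - F p) (fun=> 2^-1)); last exact: cst_continuous.
  by apply: continuousB; [exact: cN|exact: cF].
have FE p : F p = F1 p - F2 p by rewrite /F1 /F2; field.
have p1 p : 0 <= F1 p by rewrite /F1; have := ler_norm (- F p); rewrite normrN; lra.
have p2 p : 0 <= F2 p by rewrite /F2; have := ler_norm (F p); lra.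
have -> : \int[mu]_(p in [set: borel M]) F p = \int[mu]_(p in [set: borel M]) (F1 p - F2 p).
  by apply: eq_Rintegral => p _.
rewrite RintegralB//; [|exact: (continuous_integrable M_compact mu_density c1)|exact: (continuous_integrable M_compact mu_density c2)].
rewrite !chart_integral_pos//; last 2 first.
- by move=> p /F0 h; rewrite /F2 h normr0 subrr mul0r.
- by move=> p /F0 h; rewrite /F1 h normr0 addr0 mul0r.
rewrite -rintB; [|exact: wbounded_chart|exact: wbounded_chart].
by congr rint; apply/funext => x; rewrite -mulrBl -mulrBr -FE.
Qed.

End ChartIntegral.

End ManifoldIntegral.

(** * Density of smooth functions *)

Section Density.
Context {R : realType} {n : nat} {M : smoothManifold R n}.
Local Notation rV := 'rV[R]_n.
Implicit Types (f : M -> R[i]) (s : M -> R) (U : set M).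

Definition rsmooth s := forall k, charts k -> smooth_on (cod k) (s \o bwd k).

Lemma rsmooth_C s : rsmooth s -> smooth_function (fun p => (s p)%:C).
Proof. by move=> h k kM; apply: csmooth_on_real; exact: h. Qed.

Lemma rsmooth_cst (c : R) : rsmooth (fun=> c).
Proof. by move=> k kM; exact: smooth_on_cst. Qed.

Lemma rsmooth_continuous s : rsmooth s -> continuous s.
Proof. by move=> /rsmooth_C /smooth_function_continuous []. Qed.

Lemma smooth_functionDZ (c : R[i]) f1 f2 : smooth_function f1 -> smooth_function f2 ->
  smooth_function (fun p => c * f1 p + f2 p).
Proof.
move=> s1 s2 k kM; apply: csmooth_onD; [exact: cod_open| |exact: s2].
by apply: csmooth_onM; [exact: cod_open|exact: csmooth_on_cst|exact: s1].
Qed.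

Lemma manifold_bump p U : open U -> U p ->
  exists s, [/\ rsmooth s, forall q, 0 <= s q, 0 < s p & forall q, ~ U q -> s q = 0].
Proof.
move=> oU Up; have [k kM dp] := charts_cover p; pose x0 := fwd k p.
have oW : open [set x | cod k x /\ U (bwd k x)] by apply: open_chart_preimage.
have [|r r0 rW] := @open_cbox R n _ x0 oW; first by split; [exact: fwd_cod|rewrite fwdK].
have [f [sf f0 fx fout]]  := smooth_bump x0 r0.
have fc x : ~ cbox x0 r x -> f x = 0.
  move=> h; apply: fout; rewrite leNgt; apply/negP => hr; apply: h => i.
  by have := coord_enorm (x - x0) i; rewrite !mxE => h'; exact: le_trans h' (ltW hr).
pose u x := (f x)%:C.
have tu : test_function (cod k) u.
  split; first exact: csmooth_on_real.
  exists (cbox x0 r); split; [exact: compact_cbox|by move=> x /rW []|by move=> x /fc; rewrite /u => ->].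
exists (fun q => Re (pullback k u q)); split.
- by move=> l lM; have [h _] := pullback_smooth kM tu lM.
- by move=> q; rewrite /pullback; case: ifP => _ //=.
- by rewrite pullback_dom//= fx.
- move=> q nU; have [dq|dq] := pselect (dom k q); last by rewrite pullback_out.
  rewrite pullback_dom// /u fc// => /rW [_]; rewrite fwdK//.
Qed.

(** A countable base gives countably many nonnegative smooth functions that vanish off [U], one of
    them positive at each point of [U]. With t_N their partial sums, N t_N / (1 + N t_N) tends to
    the indicator. *)
Lemma open_approx U : open U -> exists g : nat -> M -> R,
  [/\ forall N, rsmooth (g N), forall N p, 0 <= g N p <= 1 & forall p, (fun N => g N p) @ \oo --> (\1_U p : R)].
Proof.
move=> oU; have [B cB [oB bB]] := @points_second_countable _ _ M.
(* Number [m] carries a suitable function for the base set of code [m] if there is one, and zero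
   otherwise. *)
have [h hinj] := elimT (countable_injP B) cB.
pose good (b : set M) s := [/\ rsmooth s, forall q, 0 <= s q, forall q, ~ U q -> s q = 0 & forall q, b q -> 0 < s q].
have /choice[s sP] : forall m : nat, exists s, [/\ rsmooth s, forall q, 0 <= s q, forall q, ~ U q -> s q = 0 &
    forall b, B b -> h b = m -> (exists s', good b s') -> forall q, b q -> 0 < s q].
  move=> m; have [[b [Bb hb [s' gs]]]|no] := pselect (exists b, [/\ B b, h b = m & exists s', good b s']).
    have [g1 g2 g3 g4] := gs; exists s'; split=> // b' Bb' hb' _.
    by have -> : b' = b by apply: hinj; rewrite ?inE// hb.
  exists (fun=> 0); split=> //; first exact: rsmooth_cst.
  by move=> b Bb hb gb; exfalso; apply: no; exists b.
have rs m : rsmooth (s m) by case: (sP m).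
have s0 m q : 0 <= s m q by case: (sP m).
pose t N p := \sum_(m < N) s m p.
have t0 N p : 0 <= t N p by apply: sumr_ge0 => i _.
have tn N p : 0 < 1 + N%:R * t N p by rewrite ltr_pwDl// mulr_ge0.
exists (fun N p => N%:R * t N p * (1 + N%:R * t N p)^-1); split.
- move=> N k kM; have st : smooth_on (cod k) (fun x => N%:R * t N (bwd k x)).
    apply: (@smooth_onM _ _ (cod k) (fun=> N%:R) (fun x => t N (bwd k x))); [exact: cod_open|exact: smooth_on_cst|].
    by apply: smooth_on_sum; [exact: cod_open|move=> m; exact: rs].
  have [|||h1 _] := @csmooth_on_inv R n (cod k) _ (fun x => (1 + N%:R * t N (bwd k x))%:C).
  + exact: cod_open.
  + apply: csmooth_on_real; apply: smooth_onD => //; [exact: cod_open|exact: smooth_on_cst].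
  + by move=> x _; rewrite (inj_eq (@complexI _)) gt_eqF.
  apply: smooth_onM => //; first exact: cod_open.
  apply: smooth_on_eq h1; first exact: cod_open.
  by move=> x _; rewrite -fmorphV.
- move=> N p; rewrite ?mulr_ge0 ?invr_ge0 ?(ltW (tn _ _))//=.
  by rewrite ler_pdivrMr// mul1r lerDr.
move=> p; have [Up|nU] := pselect (U p); last first.
  rewrite indicE memNset//; apply: cvg_near_cst; apply: nearW => N.
  have -> : t N p = 0 by apply: big1 => m _; have [_ _ z _] := sP m; exact: z.
  by rewrite mulr0 mul0r.
rewrite indicE mem_set; have [b0 [rb0 b00 b0p b0U]] := manifold_bump oU Up.
have : nbhs p [set q | 0 < b0 q].
  apply: open_nbhs_nbhs; split=> //; apply: (@open_comp _ _ b0 [set y | 0 < y]) => [q _|]; last exact: open_gt.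
  exact: rsmooth_continuous.
move=> /(bB p) [b [Bb bp] bsub].
have [_ _ _ /(_ b Bb erefl)] := sP (h b).
have gb : good b b0 by split=> // q /bsub.
move=> /(_ (ex_intro _ _ gb) p bp) d0; set d := s (h b) p in d0.
apply/cvgrPdist_le => e e0; near=> N.
have td : d <= t N p.
  have hN : (h b < N)%N by near: N.
  by rewrite /t (bigD1 (Ordinal hN))//= lerDl sumr_ge0.
have -> : 1 - N%:R * t N p * (1 + N%:R * t N p)^-1 = (1 + N%:R * t N p)^-1.
  by field; rewrite gt_eqF.
rewrite ger0_norm ?invr_ge0 ?(ltW (tn _ _))// -[leRHS]invrK lef_pV2 ?posrE ?invr_gt0.
have : e^-1 / d <= N%:R by near: N; exact: nbhs_infty_ger.
rewrite ler_pdivrMr// => h1; have : N%:R * d <= N%:R * t N p by rewrite ler_wpM2l.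
lra.
Unshelve. all: by end_near.
Qed.

Variable mu : {measure set (borel M) -> \bar R}.
Hypotheses (M_compact : compact [set: M]) (mu_density : smooth_positive_density mu).
Local Notation LT := (LfunType mu (lee1n 2)).
Local Notation ip := (cip (mu:=mu)).

Section Orthogonal.
Variable w : LT.
Hypothesis w_orth : forall s, rsmooth s -> (\int[mu]_(p in [set: borel M]) (w p * s p)%:E = 0)%E.

Let w_int : mu.-integrable [set: borel M] (EFin \o w).
Proof.
have L1 : (cst 1 : borel M -> R) \in Lfun mu 2%:E.
  have [h _] := smooth_L2 M_compact mu_density (rsmooth_C (rsmooth_cst 1)); exact: h.
have := Lfun2_mul (LfunP w) L1; by under eq_fun do rewrite mulr1.
Qed.

Lemma dominated_orth (g : nat -> borel M -> R) (B : set (borel M)) : measurable B ->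
  (forall N, measurable_fun setT (g N)) -> (forall N p, 0 <= g N p <= 1) ->
  (forall p, (fun N => g N p) @ \oo --> (\1_B p : R)) ->
  (forall N, \int[mu]_(p in [set: borel M]) (w p * g N p)%:E = 0)%E ->
  (\int[mu]_(p in [set: borel M]) (w p * \1_B p)%:E = 0)%E.
Proof.
move=> mB mg g01 gcvg g0.
have [] := @dominated_convergence _ _ _ mu setT measurableT (fun N p => (w p * g N p)%:E)
  (fun p => (w p * \1_B p)%:E) (fun p => `|w p|%:E).
- by move=> N; apply/measurable_EFinP; exact: measurable_funM.
- by apply/measurable_EFinP; apply: measurable_funM.
- apply: aeW => p _; apply/cvg_EFin; first by apply: nearW => N.
  by apply: cvgM; [exact: cvg_cst|exact: gcvg].
- by have := integrable_abse w_int.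
- apply: aeW => p N _; rewrite lee_fin normrM ler_piMr//.
  by have /andP[h1 h2] := g01 N p; rewrite ger0_norm.
move=> _ _ h; apply/esym; apply: (cvg_unique _ _ h); first exact: ereal_hausdorff.
by apply: cvg_near_cst; apply: nearW => N; exact: g0.
Qed.

(** The measurable sets with vanishing integral form a lambda system that contains the open sets,
    which are stable under intersection. *)
Lemma orth_borel (B : set (borel M)) : measurable B ->
  (\int[mu]_(p in [set: borel M]) (w p * \1_B p)%:E = 0)%E.
Proof.
have iw (A : set (borel M)) : measurable A -> mu.-integrable setT (fun p => (w p * \1_A p)%:E).
  move=> mA; apply: le_integrable w_int => //.
    by apply/measurable_EFinP; apply: measurable_funM.
  move=> p _ ; rewrite lee_fin normrM ler_piMr// ger0_norm ?indicE//.
  by case: (_ \in _).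
pose H := [set A : set (borel M) | measurable A /\ (\int[mu]_(p in [set: borel M]) (w p * \1_A p)%:E = 0)%E].
suff : <<s setT, (@open M : set (set M)) >> `<=` (H : set (set M)).
  by move=> h /h [].
apply: lambda_system_subset.
- exact: openI.
- split=> //.
  + split; first exact: measurableT.
    by under eq_integral do rewrite indicT; exact: (w_orth (rsmooth_cst 1)).
  + move=> A C CA [mA A0] [mC C0]; split; first exact: measurableD.
    have E p : (w p * \1_(A `\` C) p)%:E = ((w p * \1_A p)%:E - (w p * \1_C p)%:E)%E.
      rewrite -EFinB -mulrBr; congr (_ * _)%:E; rewrite !indicE.
      have [Cp|nC] := pselect (C p).
        by rewrite (mem_set Cp) (mem_set (CA _ Cp)) memNset ?subrr// => -[].
      rewrite (memNset nC) subr0; congr (nat_of_bool _)%:R.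
      by apply/idP/idP => /set_mem h; apply/mem_set; [case: h|split].
    under eq_integral do rewrite E.
    by rewrite integralB//; [rewrite C0 sube0|exact: iw|exact: iw].
  + move=> F ndF FH; have mF i : measurable (F i : set (borel M)) by case: (FH i).
    have mU : measurable (\bigcup_i F i : set (borel M)) by exact: bigcupT_measurable.
    split=> //; apply: (dominated_orth (g := fun N => \1_(F N))) => //.
    * by move=> N p; rewrite indicE; case: (_ \in _); rewrite lexx ler01.
    * move=> p; apply: cvg_near_cst; rewrite !indicE.
      have [[i _ Fi]|no] := pselect ((\bigcup_i F i) p).
        near=> N; have : (F i <= F N)%O by apply: ndF; near: N; exact: nbhs_infty_ge.
        rewrite subsetEset => /(_ p Fi) FN; rewrite indicE (mem_set FN) mem_set//; by exists i.
      apply: nearW => N; rewrite indicE !memNset// => h; apply: no; by exists N.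
    * by move=> N; case: (FH N).
- move=> U oU; split; first exact: open_borel.
  have [g [sg g01 gc]] := open_approx oU.
  apply: (dominated_orth (g := g)) => //; first exact: open_borel.
    by move=> N; apply: continuous_borel; exact: rsmooth_continuous.
  by move=> N; exact: w_orth.
Unshelve. all: by end_near.
Qed.

(** The integral of |w| is the difference of the integrals of w over the sets of positive and
    negative values. *)
Lemma orth_null : sqint mu w = 0.
Proof.
have mw := Lfun2_meas (LfunP w); apply/sqint0.
have mpos : measurable [set p : borel M | 0 < w p].
  by rewrite -[X in measurable X]setTI; exact: (measurable_fun_ltr (@measurable_cst _ _ _ _ _ _) mw).
have mneg : measurable [set p : borel M | w p < 0].
  by rewrite -[X in measurable X]setTI; exact: (measurable_fun_ltr mw (@measurable_cst _ _ _ _ _ _)).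
have iw (A : set (borel M)) : measurable A -> mu.-integrable setT (fun p => (w p * \1_A p)%:E).
  move=> mA; apply: le_integrable w_int => //.
    by apply/measurable_EFinP; apply: measurable_funM.
  move=> p _ ; rewrite lee_fin normrM ler_piMr// ger0_norm ?indicE//.
  by case: (_ \in _).
have E : (\int[mu]_(p in [set: borel M]) `|(w p)%:E| = 0)%E.
  transitivity (\int[mu]_(p in [set: borel M]) ((w p * \1_[set p | (0 < w p)%R] p)%:E - (w p * \1_[set p | (w p < 0)%R] p)%:E))%E.
    apply: eq_integral => p _; rewrite -EFinB /= !indicE.
    have [h|h|->] := ltgtP (w p) 0.
    - by rewrite memNset ?mem_set ?mulr1 ?mulr0 ?sub0r ?ltr0_norm//; apply/negP; rewrite -leNgt ltW.
    - by rewrite mem_set// memNset ?mulr1 ?mulr0 ?subr0 ?gtr0_norm//; apply/negP; rewrite -leNgt ltW.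
    - by rewrite normr0 !mul0r subr0.
  by rewrite integralB//; [rewrite !orth_borel// sube0|exact: iw|exact: iw].
have [h _] := @ae_eq_integral_abs _ _ _ mu setT measurableT (EFin \o w) ((measurable_EFinP _ _).2 mw).
by have := h E; apply: filterS => p /(_ I) [].
Qed.

End Orthogonal.

(** The part [v] of [u] orthogonal to the smooth functions is tested with real functions and their
    multiples by ['i], which annihilates both of its components. *)
Theorem smooth_dense (u : LT * LT) (e : R) : 0 < e ->
  exists2 s : M -> R[i], smooth_function s & ip (u - toV mu s) (u - toV mu s) <= e.
Proof.
have hip := cip_hilbert mu.
move=> e0; have [||v vP vA] := projection hip (X := fun v => exists2 s, smooth_function s & cfun v = s) u.
- by exists (fun=> 0) => //; move=> k kM; exact: csmooth_on_cst.
- move=> a x y [s1 ss1 E1] [s2 ss2 E2]; exists (fun p => a%:C * s1 p + s2 p); first exact: smooth_functionDZ.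
  by apply/funext => p; rewrite cfunDZ E1 E2.
have sL (s : M -> R[i]) : smooth_function s -> ip v (toV mu s) = 0.
  by move=> ss; apply: vP; exists s => //; rewrite cfun_toV//; exact: smooth_L2.
have v0 : ip v v = 0.
  have E (s : M -> R[i]) (ss : smooth_function s) : ip v (toV mu s) = \int[mu]_(x in [set: borel M]) (v.1 x * Re (s x)) +
      \int[mu]_(x in [set: borel M]) (v.2 x * Im (s x)).
    have L := smooth_L2 M_compact mu_density ss; rewrite cipE; congr (_ + _); apply: eq_Rintegral => x _; congr (_ * _).
      by have := congr1 (fun h => Re (h x)) (cfun_toV L).
    by have := congr1 (fun h => Im (h x)) (cfun_toV L).
  have fin (w : LT) s (rs : rsmooth s) : \int[mu]_(x in [set: borel M]) (w x * s x) = 0 ->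
      (\int[mu]_(p in [set: borel M]) (w p * s p)%:E = 0)%E.
    move=> h; have := integrable_fin_num measurableT (Lfun2_mul (LfunP w) (smooth_L2 M_compact mu_density (rsmooth_C rs)).1).
    by move=> /fineK <-; rewrite -[fine _]/(\int[mu]_(x in [set: borel M]) (w x * s x)) h.
  rewrite cip_sqint !orth_null ?addr0// => s rs; apply: fin => //.
    have ss : smooth_function (fun p => 'i * (s p)%:C + 0).
      by apply: smooth_functionDZ; [exact: rsmooth_C|move=> k kM; exact: csmooth_on_cst].
    rewrite -(sL _ ss) E// [X in _ = X + _](_ : _ = 0); last first.
      by under eq_Rintegral do rewrite /= mul0r mul1r subr0 addr0 mulr0; rewrite Rintegral_cst// mul0r.
    by rewrite add0r; apply: eq_Rintegral => x _; rewrite /= mul0r mul1r add0r addr0.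
  rewrite -(sL _ (rsmooth_C rs)) E; last exact: rsmooth_C.
  rewrite [X in _ = _ + X](_ : _ = 0) ?addr0//.
  by under eq_Rintegral do rewrite mulr0; rewrite Rintegral_cst// mul0r.
have [x [s ss xs] xe] := vA e e0; exists s => //.
have E1 : ip (u - v - x - (u - toV mu s)) (u - v - x - (u - toV mu s)) = 0.
  have -> : u - v - x - (u - toV mu s) = (toV mu s - x) - v by rewrite opprB addrACA [- x + _]addrC addrC -!addrA addrCA !addrA subrK addrC addrA.
  have q1 : ip (toV mu s - x) (toV mu s - x) = 0.
    apply/cip0_ae; rewrite cfun_toV; last exact: smooth_L2.
    by rewrite xs; apply: aeW.
  by rewrite (q_sub hip) q1 v0 (ip_null hip _ q1); ring.
by rewrite -(q_congr hip E1).
Qed.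

End Density.

(** Schur's test: for u = sum a_m v_m with a_m = ip s v_m and S = sum a_m^2 one has |u|^2 <= B S. As
    ip s u = S, Cauchy-Schwarz gives S^2 <= |s|^2 B S. *)
Lemma almost_orthogonal (R : realType) (V : lmodType R) (ip : V -> V -> R) (hip : hilbert ip)
  (J : finType) (v : J -> V) (B : R) (s : V) :
  0 <= B -> (forall l, \sum_m `|ip (v m) (v l)| <= B) -> \sum_m ip s (v m) ^+ 2 <= B * ip s s.
Proof.
move=> B0 vB; pose a m := ip s (v m); pose S := \sum_m a m ^+ 2; pose u := \sum_m a m *: v m.
have sS : ip s u = S.
  rewrite (ipC hip) (ip_suml hip); apply: eq_bigr => m _.
  by rewrite (ipZl hip) (ipC hip).
have uS : ip u u <= B * S.
  have -> : ip u u = \sum_m \sum_l a m * a l * ip (v m) (v l).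
    rewrite (ip_suml hip); apply: eq_bigr => m _.
    rewrite (ipC hip) (ip_suml hip); apply: eq_bigr => l _.
    by rewrite (ipZl hip) (ipZr hip) (ipC hip (v l)); ring.
  apply: (@le_trans _ _ (\sum_m \sum_l (a m ^+ 2 + a l ^+ 2) / 2 * `|ip (v m) (v l)|)).
    apply: ler_sum => m _; apply: ler_sum => l _.
    apply: (le_trans (ler_norm _)); rewrite normrM ler_wpM2r// ler_norml.
    by have := sqr_ge0 (a m - a l); have := sqr_ge0 (a m + a l); lra.
  have sym : \sum_m \sum_l a m ^+ 2 / 2 * `|ip (v m) (v l)| <= B * S / 2.
    apply: (@le_trans _ _ (\sum_m a m ^+ 2 / 2 * B)); last first.
      by rewrite -!mulr_suml mulrAC [S * B]mulrC.
    apply: ler_sum => m _; rewrite -mulr_sumr ler_wpM2l ?divr_ge0 ?sqr_ge0//.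
    by apply: le_trans (vB m); apply: ler_sum => l _; rewrite (ipC hip).
  have E : \sum_m \sum_l (a m ^+ 2 + a l ^+ 2) / 2 * `|ip (v m) (v l)| =
      (\sum_m \sum_l a m ^+ 2 / 2 * `|ip (v m) (v l)|) + \sum_m \sum_l a m ^+ 2 / 2 * `|ip (v m) (v l)|.
    rewrite [X in _ = _ + X]exchange_big -big_split; apply: eq_bigr => m _.
    rewrite -big_split; apply: eq_bigr => l _ /=.
    by rewrite (ipC hip (v l)); ring.
  by lra.
have S0 : 0 <= S by apply: sumr_ge0 => m _; exact: sqr_ge0.
have := ip_cauchy hip s u; rewrite sS => h.
have qs := ip_ge0 hip s; rewrite -/S; have [->|Sn] := eqVneq S 0.
  by rewrite mulr_ge0.
have Sp : 0 < S by rewrite lt_def Sn.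
rewrite -(ler_pM2l Sp); apply: (le_trans h).
by rewrite mulrA [S * B]mulrC [leRHS]mulrC ler_wpM2l.
Qed.

(** * Elliptic estimate and Weyl sequences *)

Section PacketCells.
Context {R : realType} {n : nat}.
Local Notation rV := 'rV[R]_n.

Lemma sum_weight_box N (p : {ffun 'I_n -> 'I_N.*2} -> rV) : (forall m, cell m (p m)) ->
  \sum_m weight (p m) <= 32 ^+ n.
Proof.
move=> pP; have := @sum_weight_shift R n N p 0 (fun=> N) pP.
under eq_bigr do rewrite subr0; apply => i.
by rewrite mxE subrr lexx add0r ltr01.
Qed.

Lemma jb_weight_ge (z : rV) : jb z ^- n.*2 <= weight z.
Proof.
rewrite -mul2n exprM -exprVn -[n in _ ^+ n]card_ord -prodr_const; apply: ler_prod => i _.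
have q0 (t : R) : 0 < 1 + t ^+ 2 by rewrite ltr_pwDl ?sqr_ge0.
rewrite invr_ge0 exprn_ge0 ?jb_ge0//= lef_pV2 ?posrE ?exprn_gt0 ?jb_gt0//.
have := coord_enorm z i => h; have h2 : z 0 i ^+ 2 <= enorm z ^+ 2.
  by rewrite -[leLHS]real_normK ?num_real// lerXn2r ?nnegrE ?enorm_ge0.
by rewrite /jb; have := enorm_ge0 z; lra.
Qed.

Lemma iter_deriveN (f : rV -> R) (s : seq rV) : smooth_on setT f ->
  iter_derive s (fun x => - f x) = (fun x => - iter_derive s f x).
Proof.
move=> sf; elim: s => [//|v s IH] /=; apply/funext => x; rewrite IH.
by rewrite deriveN//; apply: diff_derivable; exact: sf.
Qed.

Lemma tfamily_conj (I : Type) (K : set rV) (c : I -> rV -> R[i]) : tfamily K c ->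
  tfamily K (fun i x => (c i x)^*).
Proof.
move=> [[sc bc] c0]; split=> [|i x Kx]; last by rewrite c0// rmorph0.
split=> [i|s]; first by apply: csmooth_on_conj; [exact: openT|exact: sc].
have [C CP] := bc s; exists C => i x Kx; apply: le_trans (CP i x Kx).
have [_ sI] := sc i; rewrite -normc_conj le_eqVlt; apply/orP; left; apply/eqP; congr (cmod _).
apply: complexE2; rewrite /=.
  by congr (iter_derive _ _ x); apply/funext => y; case: (c i y).
have -> : (fun y => Im (c i y)^*) = (fun y => - Im (c i y)) by apply/funext => y; case: (c i y).
by rewrite iter_deriveN// opprK.
Qed.

Lemma tfamily_reindex (I J : Type) (K : set rV) (c : I -> rV -> R[i]) (h : J -> I) : tfamily K c ->
  tfamily K (fun j => c (h j)).
Proof. by move=> [u c0]; split=> [|j x Kx]; [exact: ufamily_reindex|exact: c0]. Qed.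

(** Extends by zero a family defined for certain frequencies, so that any vector may serve as
    index. *)
Lemma tfamily_if (P : rV -> Prop) (K : set rV) (c : {z | P z} -> rV -> R[i]) : tfamily K c ->
  tfamily K (fun z => if pselect (P z) is left h then c (exist _ z h) else fun=> 0).
Proof.
move=> [[sc bc] c0]; split=> [|z x Kx]; last by case: pselect => // h; exact: c0.
split=> [z|s]; first by case: pselect => [h|_]; [exact: sc|exact: csmooth_on_cst].
have [C CP] := bc s; exists `|C| => z x Kx; case: pselect => [h|_].
  exact: le_trans (CP _ _ Kx) (ler_norm _).
by rewrite wderive_cst; case: (s) => [|? ?]; rewrite normc0.
Qed.

Lemma cis_near1 (e : R) : 0 < e -> exists2 d, 0 < d & forall t : R, `|t| <= d -> cmod (cis t - 1) <= e.
Proof.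
move=> e0; have e2 : 0 < e / 2 by rewrite divr_gt0.
have h1 : \forall t \near (0 : R), `|cos t - cos 0| < e / 2.
  by have := @continuous_cos R 0 => /cvgrPdist_lt /(_ _ e2); apply: filterS => t; rewrite distrC.
have h2 : \forall t \near (0 : R), `|sin t - sin 0| < e / 2.
  by have := @continuous_sin R 0 => /cvgrPdist_lt /(_ _ e2); apply: filterS => t; rewrite distrC.
have : nbhs (0 : R) [set t : R | `|cos t - cos 0| < e / 2 /\ `|sin t - sin 0| < e / 2].
  exact: filterI h1 h2.
rewrite -nbhs_ballE => -[d /= d0 dP].
exists (d / 2) => [|t td]; first by rewrite divr_gt0.
have [|h3 h4] := dP t.
  by rewrite /ball/= sub0r normrN; apply: (le_lt_trans td); rewrite ltr_pdivrMr// ltr_pMr// ltr1n.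
have := normc_le (cis t - 1); rewrite Re_add Im_add.
rewrite (_ : Im (- 1) = - 0)// => h.
rewrite cos0 in h3; rewrite sin0 in h4; apply: (le_trans h).
by [by []|lra].
Qed.

End PacketCells.

(** * Packets carried to the manifold *)

Section ChartPackets.
Context {R : realType} {n : nat} {M : smoothManifold R n} (M_compact : compact [set: M]).
Context (mu : {measure set (borel M) -> \bar R}) (mu_density : smooth_positive_density mu).
Local Notation rV := 'rV[R]_n.
Local Notation LT := (LfunType mu (lee1n 2)).
Local Notation V := (LT * LT)%type.
Local Notation hip := (cip_hilbert mu).
Local Notation ip := (cip (mu:=mu)).
Local Notation q u := (ip u u).
Local Notation toV := (toV mu).
Local Notation mM := (fine (mu setT)).

Lemma smooth_functionM (f h : M -> R[i]) : smooth_function f -> smooth_function h ->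
  smooth_function (fun p => f p * h p).
Proof. by move=> sf sh k kM; apply: csmooth_onM; [exact: cod_open|exact: sf|exact: sh]. Qed.

Lemma smooth_function_conj (f : M -> R[i]) : smooth_function f -> smooth_function (fun p => (f p)^*).
Proof. by move=> sf k kM; apply: csmooth_on_conj; [exact: cod_open|exact: sf]. Qed.

Lemma q_sup (u : V) C : (forall p, cmod (cfun u p) <= C) -> q u <= C ^+ 2 * mM.
Proof.
move=> uC; have E : q u = \int[mu]_(p in [set: borel M]) (cmod (cfun u p) ^+ 2).
  rewrite cip_norm sqr_sqrtr//; apply: Rintegral_ge0 => p _; exact: sqr_ge0.
rewrite E -(Rintegral_cst mu measurableT); apply: le_Rintegral => //.
- have h1 := (Lfun2P mu u.1).1 (LfunP _); have h2 := (Lfun2P mu u.2).1 (LfunP _).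
  apply: eq_integrable (integrableD measurableT h1.2 h2.2) => // p _.
  exact: (congr1 EFin (esym (normc_sqr (cfun u p)))).
- apply: measurable_bounded_integrable => //; first exact: mu_fin.
  by exists (`|C ^+ 2|); split; [exact: num_real|move=> x Cx y _ ; exact: ltW].
- move=> p _; apply: lerXn2r; rewrite ?nnegrE ?normc_ge0//; exact: (le_trans (normc_ge0 _) (uC p)).
Qed.

Context (k : chart R n M) (kM : charts k) (x0 : rV) (r : R) (Kk : cbox x0 r `<=` cod k).
Let K := cbox x0 r.
Let cK : compact K. Proof. exact: compact_cbox. Qed.
Let clK : closed K. Proof. exact: rV_compact_closed. Qed.

Definition lift_packet (c : rV -> R[i]) (w : rV) : V := toV (pullback k (packet c w)).

Lemma packet_test_function c w : csmooth_on setT c -> (forall x, ~ K x -> c x = 0) ->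
  test_function (cod k) (packet c w).
Proof. by move=> sc c0; apply: packet_test; split=> //; exists K. Qed.

Lemma pullback_packet_smooth c w : csmooth_on setT c -> (forall x, ~ K x -> c x = 0) ->
  smooth_function (pullback k (packet c w)).
Proof. by move=> sc c0; apply: pullback_smooth => //; exact: packet_test_function. Qed.

Lemma cfun_lift c w : csmooth_on setT c -> (forall x, ~ K x -> c x = 0) ->
  cfun (lift_packet c w) = pullback k (packet c w).
Proof. by move=> sc c0; rewrite cfun_toV//; apply: smooth_L2 => //; exact: pullback_packet_smooth. Qed.

Context (rho : rV -> R).
Hypotheses (rho_smooth : smooth_on (cod k) rho) (rho_pos : forall x, cod k x -> 0 < rho x).
Hypothesis rhoE : forall B : set (borel M), measurable B -> B `<=` dom k ->
  mu B = int_rV (fun x => (rho x * \1_(fwd k @` B) x)%:E).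

(** Contains the density and the conjugate amplitude, so that the pairing of [s] with a packet is
    the real part of the Fourier transform of this function. *)
Definition local_part (s : M -> R[i]) (c : rV -> R[i]) (x : rV) : R[i] :=
  (rho x)%:C * s (bwd k x) * (c x)^*.

Lemma local_part_smooth s c : smooth_function s -> csmooth_on setT c -> (forall x, ~ K x -> c x = 0) ->
  csmooth_on setT (local_part s c) /\ forall x, ~ K x -> local_part s c x = 0.
Proof.
move=> ss sc c0; have l0 x : ~ K x -> local_part s c x = 0.
  by move=> /c0 h; rewrite /local_part h rmorph0 mulr0.
split=> //; apply: (csmooth_supp (@cod_open _ _ _ k) clK Kk) => //.
apply: csmooth_onM; [exact: cod_open| |].
  by apply: csmooth_onM; [exact: cod_open|exact: csmooth_on_real|exact: ss].
by apply: csmooth_on_conj; [exact: cod_open|exact: csmooth_onS sc].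
Qed.

Lemma ip_lift s c w : smooth_function s -> csmooth_on setT c -> (forall x, ~ K x -> c x = 0) ->
  ip (toV s) (lift_packet c w) = Re (fourier (local_part s c) w).
Proof.
move=> ss sc c0; have sp := pullback_packet_smooth w sc c0.
rewrite /cip !cfun_toV; [|exact: smooth_L2|exact: smooth_L2].
rewrite /=; pose F p := Re (s p * (pullback k (packet c w) p)^*).
have cF : continuous F.
  by have [] := smooth_function_continuous (smooth_functionM ss (smooth_function_conj sp)).
rewrite (chart_integral M_compact mu_density rho_smooth rho_pos rhoE cK Kk cF); last first.
  move=> p np; rewrite /F; have [dp|dp] := pselect (dom k p); last by rewrite pullback_out// rmorph0 mulr0.
  rewrite pullback_dom// /packet c0 ?mul0r ?rmorph0 ?mulr0// => Kp.
  by apply: np; exists (fwd k p) => //; rewrite fwdK.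
congr (fine (int_rV _)); apply/funext => x; congr _%:E.
rewrite indicE; case: (boolP (x \in K)) => [/set_mem Kx|/negP nK]; last first.
  have -> : local_part s c x = 0.
    by rewrite /local_part c0 ?rmorph0 ?mulr0// => /mem_set.
  by rewrite mulr0 mul0r.
rewrite mulr1 /F pullback_dom; last by apply: bwd_dom; exact: Kk.
rewrite bwdK; last exact: Kk.
rewrite cisN rmorphM -[in RHS]mulrA -[in RHS]mulrA.
by rewrite [RHS]Re_mul mul0r subr0.
Qed.

Lemma ip_lift2 c w c' w' : csmooth_on setT c -> (forall x, ~ K x -> c x = 0) ->
  csmooth_on setT c' -> (forall x, ~ K x -> c' x = 0) ->
  `|ip (lift_packet c w) (lift_packet c' w')| <= cmod (fourier (fun x => (rho x)%:C * (c x * (c' x)^*)) (w' - w)).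
Proof.
move=> sc c0 sc' c0'; rewrite ip_lift//; last exact: pullback_packet_smooth.
apply: (le_trans (normc_Re _)); rewrite -fourier_packet le_eqVlt; apply/orP; left; apply/eqP; congr cmod.
congr cint_rV; apply/funext => x; rewrite /local_part /packet.
have [Kx|nK] := pselect (K x); last by rewrite c0' ?rmorph0 ?mulr0 ?mul0r.
rewrite pullback_dom; last by apply: bwd_dom; exact: Kk.
by rewrite bwdK; [ring|exact: Kk].
Qed.

(** Gram entries are bounded by Fourier transforms at differences of frequencies, hence by the
    weight; the hypothesis bounds the row sums, and [almost_orthogonal] applies. *)
Lemma lift_bessel (I : Type) (c : I -> rV -> R[i]) (w : I -> rV) : tfamily K c ->
  exists2 B, 0 <= B & forall (s : V) (J : finType) (h : J -> I),
    (forall l, \sum_m weight (w (h m) - w (h l)) <= 32 ^+ n) ->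
    \sum_m ip s (lift_packet (c (h m)) (w (h m))) ^+ 2 <= B * q s.
Proof.
move=> tc; have [A KA] := compact_in_cube cK.
have tG : tfamily K (fun (j : I * I) x => (rho x)%:C * (c j.1 x * (c j.2 x)^*)).
  apply: (tfamilyM (@cod_open _ _ _ k) clK Kk).
    by apply: (ufamily_indep _ cK Kk); exact: csmooth_on_real.
  apply: (tfamilyM openT clK (@subsetT _ _)); last exact: (tfamily_conj (tfamily_reindex (fun j : I * I => j.2) tc)).
  by have [u _] := tfamily_reindex (fun j : I * I => j.1) tc.
have [C CP] := fourier_decay 1 clK KA tG.
exists (`|C| * 32 ^+ n) => [|s J h hw]; first by rewrite mulr_ge0// exprn_ge0.
apply: (almost_orthogonal hip) => [|l]; first by rewrite mulr_ge0// exprn_ge0.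
apply: (@le_trans _ _ (\sum_m `|C| * weight (w (h m) - w (h l)))); last first.
  by rewrite -mulr_sumr ler_wpM2l.
have [[sc _] c0] := tc; apply: ler_sum => m _; rewrite (ipC hip).
apply: (le_trans (ip_lift2 (w (h l)) (w (h m)) (sc _) (c0 _) (sc _) (c0 _))).
apply: (le_trans (CP (h l, h m) _)); rewrite expr1 ler_wpM2r ?weight_ge0//; exact: ler_norm.
Qed.

Lemma lift_near (c : rV -> R[i]) (w : rV) (e : R) : csmooth_on setT c -> (forall x, ~ K x -> c x = 0) -> 0 < e ->
  exists2 d, 0 < d & forall z, cbox w d z -> q (lift_packet c z - lift_packet c w) <= e.
Proof.
move=> sc c0 e0; have [A KA] := compact_in_cube cK.
have tc : tfamily K (fun _ : unit => c).
  by split=> //; apply: (ufamily_indep _ cK (@subsetT _ _) sc).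
have [C CP] := tfamily_bound tc.
have m0 : 0 <= mM by exact: fine_ge0.
pose D := (`|C| + 1) ^+ 2 * (mM + 1); have D0 : 0 < D.
  by rewrite mulr_gt0 ?exprn_gt0// ltr_wpDl.
have [e1 e10 e1D] : exists2 e1, 0 < e1 & D * e1 ^+ 2 <= e.
  exists (Num.sqrt (e / D)); first by rewrite sqrtr_gt0 divr_gt0.
  by rewrite sqr_sqrtr ?divr_ge0 ?(ltW e0) ?(ltW D0)// mulrC divfK// gt_eqF.
have [d d0 dP] := cis_near1 e10.
have A1 : 0 < n%:R * `|A| + 1 by rewrite ltr_wpDl// mulr_ge0.
exists (d / (n%:R * `|A| + 1)) => [|z zd]; first by rewrite divr_gt0.
apply: (@le_trans _ _ (((`|C| + 1) * e1) ^+ 2 * mM)); last first.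
  apply: le_trans e1D; rewrite (_ : D * e1 ^+ 2 = ((`|C| + 1) * e1) ^+ 2 * (mM + 1)); last first.
    by rewrite exprMn mulrAC.
  by rewrite ler_wpM2l ?sqr_ge0// lerDl.
apply: q_sup => p; rewrite cfunB !cfun_lift//.
have C1 : 0 <= `|C| + 1 by rewrite addr_ge0.
have [dp|dp] := pselect (dom k p); last first.
  by rewrite !pullback_out// subrr normc0 mulr_ge0// ltW.
rewrite !pullback_dom// /packet; set x := fwd k p.
have [Kx|nK] := pselect (K x); last by rewrite c0// !mul0r subrr normc0 mulr_ge0// ltW.
have -> : c x * cis (dotv x z) - c x * cis (dotv x w) = c x * cis (dotv x w) * (cis (dotv x (z - w)) - 1).
  have -> : dotv x z = dotv x w + dotv x (z - w).
    by rewrite /dotv -big_split; apply: eq_bigr => i _ /=; rewrite !mxE; ring.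
  by rewrite cisD; ring.
rewrite !normcM normc_cis mulr1; apply: ler_pM; rewrite ?normc_ge0//.
  by apply: (le_trans (CP tt x)); apply: (le_trans (ler_norm _)); rewrite lerDl.
apply: dP; apply: (@le_trans _ _ (\sum_(i < n) `|A| * (d / (n%:R * `|A| + 1)))).
  apply: (le_trans (ler_norm_sum _ _ _)); apply: ler_sum => i _; rewrite normrM; apply: ler_pM => //.
    by apply: (le_trans (KA x Kx i)); exact: ler_norm.
  by rewrite !mxE; exact: zd.
rewrite sumr_const card_ord.
have -> : `|A| * (d / (n%:R * `|A| + 1)) *+ n = d * (n%:R * `|A| / (n%:R * `|A| + 1)).
  by rewrite -mulr_natl; move: ((n%:R * `|A| + 1)^-1) => y; ring.
rewrite ler_piMr ?(ltW d0)//; by rewrite ler_pdivrMr// mul1r lerDl.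
Qed.

(** Packets depend continuously on the frequency, so finitely many of them form a net over a bounded
    set. Replacing a packet by a neighbour costs e / 2, doubled by expanding the square. *)
Lemma low_frequency (c : rV -> R[i]) (N e : R) : csmooth_on setT c -> (forall x, ~ K x -> c x = 0) -> 0 < e ->
  exists C (phi : seq V), 0 <= C /\ forall (s : V) z, cbox 0 N z ->
    ip s (lift_packet c z) ^+ 2 <= e * q s + C * coef2 ip phi s.
Proof.
move=> sc c0 e0.
pose Q (A : set rV) := exists C (phi : seq V), 0 <= C /\ forall (s : V) z, A z ->
    ip s (lift_packet c z) ^+ 2 <= e * q s + C * coef2 ip phi s.
have cf phi s : 0 <= coef2 ip phi s by apply: sumr_ge0 => *; exact: sqr_ge0.
have cfcat phi psi s : coef2 ip (phi ++ psi) s = coef2 ip phi s + coef2 ip psi s by rewrite /coef2 big_cat.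
suff : Q (cbox 0 N) by [].
apply: (@compact_ideal _ Q _ (@compact_cbox R n 0 N)).
- by exists 0, [::]; split.
- by move=> A B AB [C [phi [C0 h]]]; exists C, phi; split=> // s z /AB; exact: h.
- move=> A B [C [phi [C0 h]]] [D [psi [D0 h']]]; exists (C + D), (phi ++ psi); split; first exact: addr_ge0.
  move=> s z; have := cf phi s; have := cf psi s; rewrite cfcat => f1 f2 [/(h s)|/(h' s)] => h1; apply: (le_trans h1);
    rewrite lerD2l; nra.
- move=> w _; have e2 : 0 < e / 2 by rewrite divr_gt0.
  have [d d0 dP] := lift_near w sc c0 e2.
  exists (cbox w d); first exact: nbhs_cbox.
  exists 2, [:: lift_packet c w]; split=> // s z /dP h.
  rewrite /coef2 big_seq1; have := ip_cauchy hip s (lift_packet c z - lift_packet c w).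
  have -> : ip s (lift_packet c z) = ip s (lift_packet c w) + ip s (lift_packet c z - lift_packet c w).
    by rewrite -(ipDr hip) addrC subrK.
  move: (ip s (lift_packet c w)) (ip s _) => x y h2; have := sqr_ge0 (x - y).
  have : q s * q (lift_packet c z - lift_packet c w) <= q s * (e / 2) by rewrite ler_wpM2l// (ip_ge0 hip).
  lra.
Qed.

End ChartPackets.

Lemma q_subl (R : realType) (V : lmodType R) (ip : V -> V -> R) (hip : hilbert ip) (x y z : V) :
  ip (x - y) (x - y) = 0 -> ip (x - z) (x - z) = ip (y - z) (y - z).
Proof. by move=> h; apply: (q_congr hip); rewrite opprB addrA subrK. Qed.

Lemma sqr_sub3_le (R : realType) (x y w : R) : (x - y - w) ^+ 2 <= 3 * (x ^+ 2 + y ^+ 2 + w ^+ 2).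
Proof. by have := sqr_ge0 (x + y); have := sqr_ge0 (x + w); have := sqr_ge0 (y - w); lra. Qed.

Lemma cell_term_le (R : realType) (x j d eta qs y B w v : R) : j * d <= eta * d -> qs * y <= qs * (B * (eta * w)) ->
  0 <= v -> 3 * (x + j * d + qs * y) <= 3 * x + 3 * eta * d + (3 * qs * B * eta * w + v).
Proof. by nra. Qed.

Lemma cell_total_le (R : realType) (u v w e qs D qT cs B : R) : u + v = w -> w <= e / 2 * qs -> 0 <= D * qT ->
  0 <= B * cs -> 3 * (B * qT) + u + (v + (e / 2 * qs + D * cs)) <= e * qs + (3 * B + D) * (qT + cs).
Proof. by nra. Qed.

Lemma ip_split (R : realType) (V : lmodType R) (ip : V -> V -> R) (hip : hilbert ip) (s x y p d : V) c :
  ip (y - (p + c *: d)) (y - (p + c *: d)) = 0 -> ip s p = ip s x - c * ip s d - ip s (x - y).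
Proof.
move=> h; rewrite (ipDr hip) (ipNr hip) (ipC hip s y) (ip_congr hip _ h) (ipDl hip) (ipZl hip).
by rewrite (ipC hip p) (ipC hip d); ring.
Qed.

Lemma control_add (R : realType) (x1 x2 e q y C1 C2 u v : R) : 0 <= C1 -> 0 <= C2 -> 0 <= u -> 0 <= v ->
  x1 <= e * q + C1 * (y + u) -> x2 <= e * q + C2 * (y + v) -> x1 + x2 <= 2 * e * q + (C1 + C2) * (y + (u + v)).
Proof. by move=> C10 C20 u0 v0; have := mulr_ge0 C10 v0; have := mulr_ge0 C20 u0; lra. Qed.

Lemma control_perturb (R : realType) (qu qS qTS qTu cS cu d C K Z : R) : qu <= 2 * qS + 2 * d -> qS <= C * (qTS + cS) ->
  C * (qTS + cS) <= C * (2 * qTu + 2 * (K * d) + (2 * cu + 2 * (Z * d))) ->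
  qu <= 4 * C * (qTu + cu) + (2 * d + 4 * C * K * d + 4 * C * Z * d).
Proof. by lra. Qed.

Section Lipschitz.
Context {R : realType} {n : nat}.
Local Notation rV := 'rV[R]_n.

(** The function is read on pairs with an idle first variable, so that [is_derive_ray] gives its
    derivative along the segment. *)
Lemma smooth_lipschitz (f : rV -> R) B (x y : rV) : smooth_on setT f ->
  (forall j z, `|'D_(delta_mx 0 j : rV) f z| <= B) -> `|f x - f y| <= B * \sum_j `|x 0 j - y 0 j|.
Proof.
move=> sf fB; pose v := x - y; pose G (p : rV * rV) := f p.2.
have aff (p : rV * rV) h (w : rV * rV) : (h *: w + p).2 = h *: w.2 + p.2 by [].
have sG : smooth_on (setT `*` setT) G.
  apply: (@smooth_on_affine R (rV * rV)%type rV R _ setT snd snd f aff) => // p _.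
  by apply: linear_differentiable => z; exact: cvg_snd.
have DG j (p : rV * rV) : 'D_((0, delta_mx 0 j) : rV * rV) G p = 'D_(delta_mx 0 j : rV) f p.2.
  have := @iter_derive_affine R (rV * rV)%type rV R snd snd f [:: (0, delta_mx 0 j)] aff.
  by move=> /(congr1 (fun h => h p)).
pose f' s := \sum_j v 0 j * 'D_((0, delta_mx 0 j) : rV * rV) G (0, y + s *: v).
have df s : is_derive s (1 : R) (fun s : R => f (y + s *: v) - f y) (f' s).
  have := is_deriveB (is_derive_ray (x := 0) y v s sG I) (is_derive_cst (f y) s (1 : R)).
  by rewrite subr0.
have := @mvt_bound R _ f' (B * \sum_j `|v 0 j|) 1 df.
have yv : y + v = x by rewrite addrC subrK.
rewrite scale0r addr0 subrr scale1r yv => /(_ erefl).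
have -> : \sum_j `|v 0 j| = \sum_j `|x 0 j - y 0 j| by apply: eq_bigr => j _; rewrite !mxE.
apply; last by rewrite ler01 lexx.
move=> s _; apply: (le_trans (ler_norm_sum _ _ _)); rewrite mulr_sumr; apply: ler_sum => j _.
by rewrite normrM mulrC DG !mxE ler_wpM2r.
Qed.

Lemma tfamily_lipschitz (I : Type) (K : set rV) (F : I -> rV -> R[i]) : closed K -> tfamily K F ->
  exists2 C, 0 <= C & forall i x y, cmod (F i x - F i y) <= C * \sum_j `|x 0 j - y 0 j|.
Proof.
move=> cK tF; have h j : exists C, forall i x, cmod (cderive (delta_mx 0 j) (F i) x) <= C.
  exact: (tfamily_bound (tfamily_derive j cK tF)).
pose C j := sval (cid (h j)); have CP j := svalP (cid (h j)); pose B := \sum_j `|C j|.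
have CB j i x : cmod (cderive (delta_mx 0 j) (F i) x) <= B.
  by apply: (le_trans (CP j i x)); apply: (le_trans (ler_norm _)); rewrite /B (bigD1 j)//= lerDl sumr_ge0.
exists (2 * B) => [|i x y]; first by rewrite mulr_ge0// sumr_ge0.
have [[sF _] _] := tF; have [sr si] := sF i.
apply: (le_trans (normc_le _)); rewrite -mulrA mulr_natl mulr2n; apply: lerD; rewrite ?Re_add ?Im_add.
  have := @smooth_lipschitz _ B x y sr (fun j z => le_trans (normc_Re _) (CB j i z)).
  by case: (F i x) (F i y) => ? ? [].
have := @smooth_lipschitz _ B x y si (fun j z => le_trans (normc_Im _) (CB j i z)).
by case: (F i x) (F i y) => ? ? [].
Qed.

End Lipschitz.

(** * Norms and weak limits of packets *)

Section Weyl.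
Context {R : realType} {n : nat} {M : smoothManifold R n} (M_compact : compact [set: M]).
Context (mu : {measure set (borel M) -> \bar R}) (mu_density : smooth_positive_density mu).
Local Notation rV := 'rV[R]_n.
Local Notation LT := (LfunType mu (lee1n 2)).
Local Notation V := (LT * LT)%type.
Local Notation hip := (cip_hilbert mu).
Local Notation ip := (cip (mu:=mu)).
Local Notation q u := (ip u u).
Local Notation toV := (toV mu).

Lemma q_integral (u : V) : q u = \int[mu]_(p in [set: borel M]) (cmod (cfun u p) ^+ 2).
Proof. by rewrite cip_norm sqr_sqrtr//; apply: Rintegral_ge0 => p _; exact: sqr_ge0. Qed.

Lemma q_le (u v : V) om : 0 <= om -> (forall p, cmod (cfun u p) <= om * cmod (cfun v p)) -> q u <= om ^+ 2 * q v.
Proof.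
move=> om0 uv; have qi (w : V) : mu.-integrable [set: borel M] (EFin \o (fun p => cmod (cfun w p) ^+ 2)).
  have h1 := (Lfun2P mu w.1).1 (LfunP _); have h2 := (Lfun2P mu w.2).1 (LfunP _).
  apply: eq_integrable (integrableD measurableT h1.2 h2.2) => // p _.
  exact: (congr1 EFin (esym (normc_sqr (cfun w p)))).
rewrite !q_integral -RintegralZl//; apply: le_Rintegral => //.
  by have := integrableZl measurableT (om ^+ 2) (qi v).
by move=> p _; rewrite -exprMn; apply: lerXn2r; rewrite ?nnegrE ?normc_ge0// mulr_ge0// normc_ge0.
Qed.

Context (k : chart R n M) (kM : charts k) (x0 : rV) (r : R) (Kk : cbox x0 r `<=` cod k).
Let K := cbox x0 r.
Local Notation lift := (lift_packet mu k).
Context (rho : rV -> R).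
Hypotheses (rho_smooth : smooth_on (cod k) rho) (rho_pos : forall x, cod k x -> 0 < rho x).
Hypothesis rhoE : forall B : set (borel M), measurable B -> B `<=` dom k ->
  mu B = int_rV (fun x => (rho x * \1_(fwd k @` B) x)%:E).

(** Waves have modulus 1, so the two frequencies may differ; for equal amplitudes this shows that
    the norm does not depend on the frequency. *)
Lemma q_lift_le (c c' : rV -> R[i]) w w' om : 0 <= om -> csmooth_on setT c -> (forall x, ~ K x -> c x = 0) ->
  csmooth_on setT c' -> (forall x, ~ K x -> c' x = 0) -> (forall x, cmod (c x) <= om * cmod (c' x)) ->
  q (lift c w) <= om ^+ 2 * q (lift c' w').
Proof.
move=> om0 sc c0 sc' c0' cc; apply: q_le => // p; rewrite !(cfun_lift M_compact mu_density kM Kk)//.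
have [dp|dp] := pselect (dom k p); last by rewrite !pullback_out// normc0 mulr0.
by rewrite !pullback_dom// !normcM !normc_cis !mulr1.
Qed.

(** If the norm vanished, so would all pairings with packets of amplitude c and i c, that is, the
    whole transform of [local_part]; inversion would then give rho c^2 = 0 at [x]. *)
Lemma q_lift_gt0 (c : rV -> R) w : smooth_on setT c -> (forall x, ~ K x -> c x = 0) -> (exists x, c x != 0) ->
  0 < q (lift (fun x => (c x)%:C) w).
Proof.
move=> sc c0 [x cx]; rewrite lt_def (ip_ge0 hip) andbT; apply/eqP => q0.
pose c1 x := (c x)%:C; pose c2 x := 'i * c1 x.
have s1 : csmooth_on setT c1 by exact: csmooth_on_real.
have s2 : csmooth_on setT c2 by apply: csmooth_onM; [exact: openT|exact: csmooth_on_cst|].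
have z1 y : ~ K y -> c1 y = 0 by move=> /c0 h; rewrite /c1 h.
have z2 y : ~ K y -> c2 y = 0 by move=> /z1 h; rewrite /c2 h mulr0.
have ni : cmod ('i : R[i]) = 1 by rewrite cmodE expr0n expr1n add0r sqrtr1.
have n1 z : q (lift c1 z) = 0.
  apply/eqP; rewrite eq_le (ip_ge0 hip) andbT; have := @q_lift_le c1 c1 z w 1 ler01 s1 z1 s1 z1.
  by rewrite q0 mulr0; apply=> y; rewrite mul1r.
have n2 z : q (lift c2 z) = 0.
  apply/eqP; rewrite eq_le (ip_ge0 hip) andbT; have := @q_lift_le c2 c1 z w 1 ler01 s2 z2 s1 z1.
  by rewrite q0 mulr0; apply=> y; rewrite normcM ni.
have sp := pullback_packet_smooth kM Kk 0 s1 z1.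
set s := pullback k (packet c1 0) in sp.
have [sL L0] := local_part_smooth kM Kk rho_smooth sp s1 z1.
have il c' : csmooth_on setT c' -> (forall y, ~ K y -> c' y = 0) -> (forall z, q (lift c' z) = 0) ->
    forall z, Re (fourier (local_part k rho s c') z) = 0.
  move=> sc' c0' q0' z; have e1 : ip (toV s) (lift c' z) = 0.
    by rewrite (ipC hip); exact: (ip_null hip _ (q0' z)).
  rewrite -e1; apply/esym; exact: (ip_lift M_compact mu_density kM Kk rho_smooth rho_pos rhoE).
have LF z : fourier (local_part k rho s c1) z = 0.
  apply: complexE2.
    exact: il n1 z.
  transitivity (Re (fourier (local_part k rho s c2) z)).
    rewrite /fourier /cint_rV /=; congr (fine (int_rV _)); apply/funext => y; congr _%:E.
    rewrite /local_part /c2 /c1; move: (rho y) (s _) (c y) (cis _) => ? [? ?] ? [? ?].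
    by rewrite /=; ring.
  exact: il n2 z.
have [Ac KA] := compact_in_cube (@compact_cbox R n x0 r).
have L0A y : ~ cube Ac y -> local_part k rho s c1 y = 0 by move=> nA; apply: L0 => /KA.
have Kx : K x by apply: contrapT => /c0 h; move: cx; rewrite h eqxx.
have := fourier_inversion sL L0A x.
under eq_fun do rewrite LF mul0r.
have -> : cint_rV (fun _ : rV => 0 : R[i]) = 0.
  have w0 : rint (fun _ : rV => 0) = 0 :> R.
    have := rintZ 0 (@wbounded_weight R n); rewrite mul0r => h.
    transitivity (rint (fun x : rV => 0 * weight x)) => //.
    by congr rint; apply/funext => y; rewrite mul0r.
  by apply: complexE2.
move=> /esym/eqP; apply/negP; rewrite mulf_neq0//.
  by rewrite -[0]/(0%:C) (inj_eq (@complexI _)) expf_neq0// mulf_neq0// lt0r_neq0// pi_gt0.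
rewrite /local_part /s pullback_dom; last exact: bwd_dom (Kk Kx).
rewrite bwdK; last exact: Kk.
rewrite /packet -normr_eq0 normrCE !normcM normc_conj normc_cis mulr1 -[0]/(0%:C) (inj_eq (@complexI _)).
rewrite /c1 !normcR !mulf_neq0 ?normr_eq0//; exact: lt0r_neq0 (rho_pos (Kk Kx)).
Qed.

(** Against a smooth function the pairing is a Fourier transform, which decays in [w]; a general
    vector is approximated by [smooth_dense], the packets having norm 1. *)
Lemma lift_weak (c : rV -> R[i]) (al e : R) (hs : seq V) : csmooth_on setT c -> (forall x, ~ K x -> c x = 0) ->
  (forall w, q (al *: lift c w) = 1) -> 0 < e ->
  exists D, forall w, D <= enorm w -> forall v, v \in hs -> ip (al *: lift c w) v ^+ 2 <= e.
Proof.
move=> sc c0 q1 e0; elim: hs => [|v hs [D DP]]; first by exists 0.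
have e4 : 0 < e / 4 by rewrite divr_gt0.
have [s ss vs] := smooth_dense M_compact mu_density v e4.
have [sL L0] := local_part_smooth kM Kk rho_smooth ss sc c0.
have cK := @compact_cbox R n x0 r; have [Ac KA] := compact_in_cube cK.
have tL : tfamily K (fun _ : unit => local_part k rho s c).
  by split=> //; apply: (ufamily_indep _ cK (@subsetT _ _) sL).
have [C CP] := fourier_decay 1 (rV_compact_closed cK) KA tL.
pose B := (al * (2 * C)) ^+ 2; have B0 : 0 <= B by exact: sqr_ge0.
exists (`|D| + B / (e / 4)) => w Dw v'; rewrite inE => /orP[/eqP ->|]; last first.
  apply: DP; apply: le_trans Dw; apply: (le_trans (ler_norm D)).
  by rewrite lerDl divr_ge0// ltW.
have jw : B <= e / 4 * jb w.
  rewrite mulrC -ler_pdivrMr//; apply: (@le_trans _ _ (enorm w)); last by rewrite lerDr.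
  by apply: le_trans Dw; rewrite lerDr.
have h1 : ip (al *: lift c w) (toV s) ^+ 2 <= e / 4.
  rewrite (ipZl hip) (ipC hip) (ip_lift M_compact mu_density kM Kk rho_smooth rho_pos rhoE)//.
  have f1 : `|Re (fourier (local_part k rho s c) w)| <= `|2 * C| / jb w.
    apply: (le_trans (normc_Re _)); apply: (le_trans (CP tt w)).
    rewrite ler_pdivlMr ?jb_gt0//; apply: le_trans (ler_norm _); rewrite mulrAC [2 * C]mulrC.
    have C0 : 0 <= C by have := le_trans (normc_ge0 _) (CP tt 0); rewrite pmulr_lge0 ?weight_gt0.
    rewrite -mulrA ler_wpM2l//; apply: le_trans (jb_weight w).
    by rewrite ler_wpM2r ?weight_ge0// ler_peMl ?jb_ge0 ?jb_ge1.
  rewrite exprMn -[Re _ ^+ 2]real_normK ?num_real//.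
  have f2 : `|Re (fourier (local_part k rho s c) w)| ^+ 2 <= (2 * C) ^+ 2 / jb w.
    apply: (@le_trans _ _ ((`|2 * C| / jb w) ^+ 2)); first by apply: lerXn2r; rewrite ?nnegrE// divr_ge0 ?jb_ge0.
    rewrite exprMn real_normK ?num_real// ler_wpM2l ?sqr_ge0// ler_piMr ?invr_ge0 ?jb_ge0//.
    by rewrite invf_le1 ?jb_gt0 ?jb_ge1.
  apply: (@le_trans _ _ (al ^+ 2 * ((2 * C) ^+ 2 / jb w))); first by rewrite ler_wpM2l ?sqr_ge0.
  by rewrite mulrA ler_pdivrMr ?jb_gt0// -exprMn.
have := ip_cauchy hip (al *: lift c w) (v - toV s); rewrite q1 mul1r => h2.
have -> : ip (al *: lift c w) v = ip (al *: lift c w) (toV s) + ip (al *: lift c w) (v - toV s).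
  by rewrite -(ipDr hip) addrC subrK.
move: h1 (le_trans h2 vs); move: (ip _ (toV s)) (ip _ (v - _)) => y1 y2.
by have := sqr_ge0 (y1 - y2); lra.
Qed.

End Weyl.

(** * The operator on packets and its spectrum *)

Section Operator.
Context {R : realType} {n : nat} {M : smoothManifold R n} (M_compact : compact [set: M]).
Context (mu : {measure set (borel M) -> \bar R}) (mu_density : smooth_positive_density mu).
Context (g : riemannianMetric M) (A H : (M -> R[i]) -> M -> R[i]).
Context (A_pseudo : pseudodifferential 0 A) (H_bounded : bounded_operator mu H).
Context (H_extends_A : forall u, smooth_function u -> H u = A u %[ae mu]) (H_self_adjoint : self_adjoint mu H).
Context (a : cotangent M -> R[i]) (a_symbol : principal_symbol 0 A a).
Local Notation rV := 'rV[R]_n.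
Local Notation LT := (LfunType mu (lee1n 2)).
Local Notation V := (LT * LT)%type.
Local Notation hip := (cip_hilbert mu).
Local Notation ip := (cip (mu:=mu)).
Local Notation q u := (ip u u).
Local Notation toV := (toV mu).
Local Notation mM := (fine (mu setT)).

Section OnChart.
Local Notation T lam := (opV (mu:=mu) H lam).

Lemma opV_smooth lam u : smooth_function u ->
  q (T lam (toV u) - (toV (A u) - czscale lam (toV u))) = 0.
Proof.
move=> su; rewrite /opV opprB addrA subrK cfun_toV; last exact: smooth_L2.
have sA : smooth_function (A u) by have [h _ _] := A_pseudo; exact: h.
apply: toV_ae; [by apply: (bop_L2 H_bounded); exact: smooth_L2|exact: smooth_L2|exact: H_extends_A].
Qed.

Context (k : chart R n M) (kM : charts k) (x0 : rV) (r r' : R) (rr : 0 <= r < r') (Xc : cbox x0 r' `<=` cod k).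
Context (b0 : rV * rV -> R[i]) (ab0 : local_expression k a b0) (sb0 : symbol_on 0 (cod k) b0).
Let K := cbox x0 r.
Local Notation lift := (lift_packet mu k).

Let cK : compact K. Proof. exact: compact_cbox. Qed.
Let clK : closed K. Proof. exact: rV_compact_closed. Qed.

Lemma cbox_cod : cbox x0 r `<=` cod k.
Proof. by move=> x Kx; apply: Xc => i; apply: (le_trans (Kx i)); have /andP[_ /ltW] := rr. Qed.
Let Kk := cbox_cod.

Lemma symbol_sub_ufamily (I : Type) (w : I -> rV) lam :
  ufamily (cod k) K (fun i x => b0 (x, w i) - lam).
Proof.
have sb' : symbol_on (- 0%:R) (cod k) b0 by rewrite oppr0.
have u1 := symbol_ufamily (@cod_open _ _ _ k) w cK Kk sb'.
have u2 : ufamily (cod k) K (fun (_ : I) (_ : rV) => - lam) by apply: (ufamily_cst _ _ (C := cmod (- lam))).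
have := ufamilyD (@cod_open _ _ _ k) Kk u1 u2; congr ufamily.
by apply/funext => i; apply/funext => x; rewrite mul1r.
Qed.

(** The uniform bound of [quasimode] becomes a bound in L^2 because [mu] is finite; the square
    doubles the exponent. *)
Lemma lift_quasimode lam (I : Type) (w : I -> rV) (c : I -> rV -> R[i]) N : tfamily K c -> (I -> (0 < n)%N) ->
  exists2 rem : I -> rV -> R[i], tfamily K rem & exists2 C, 0 <= C & forall i,
    q (T lam (lift (c i) (w i)) -
       lift (fun x => (b0 (x, w i) - lam) * c i x + (jb (w i))^-1%:C * rem i x) (w i)) <= C * jb (w i) ^- N.*2.
Proof.
move=> tc In.
have [rem tr [C CP]] := quasimode M_compact A_pseudo a_symbol kM rr Xc ab0 w tc N In.
exists rem => //; exists (C ^+ 2 * mM) => [|i]; first by rewrite mulr_ge0 ?sqr_ge0.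
have [[sc _] c0] := tc; have [[sr _] r0] := tr.
have [[sG _] G0] := tfamilyM (@cod_open _ _ _ k) clK Kk (symbol_sub_ufamily w lam) tc.
pose G x := (b0 (x, w i) - lam) * c i x + (jb (w i))^-1%:C * rem i x.
have sGi : csmooth_on setT G.
  apply: csmooth_onD; [exact: openT|exact: sG|].
  by apply: csmooth_onM; [exact: openT|exact: csmooth_on_cst|exact: sr].
have G0i x : ~ K x -> G x = 0 by move=> nK; rewrite /G (G0 i x nK) r0// mulr0 addr0.
have sp := pullback_packet_smooth kM Kk (w i) (sc i) (c0 i).
set u := pullback k (packet (c i) (w i)) in sp *.
have E1 := opV_smooth lam sp.
rewrite (q_subl hip (lift G (w i)) E1).
have -> : C ^+ 2 * mM * jb (w i) ^- N.*2 = (C / jb (w i) ^+ N) ^+ 2 * mM.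
  by rewrite exprMn exprVn -exprM muln2 mulrAC.
apply: (q_sup M_compact mu_density) => p.
have LA : L2 mu (A u) by apply: smooth_L2 => //; have [h _ _] := A_pseudo; exact: h.
rewrite !cfunB cfun_czscale (cfun_toV LA) (cfun_lift M_compact mu_density kM Kk (w i) sGi G0i).
rewrite cfun_toV; last exact: smooth_L2.
apply: le_trans (CP i p); rewrite le_eqVlt; apply/orP; left; apply/eqP; congr cmod.
rewrite -addrA; rewrite -opprD; rewrite /u.
have [dp|dp] := pselect (dom k p); last by rewrite !pullback_out// mulr0 addr0.
by rewrite !pullback_dom// /packet /G; ring.
Qed.

Context (t : R) (delta N1 : R) (delta0 : 0 < delta).
Hypothesis far : forall z, N1 <= conorm g z -> delta <= cmod (a z - t%:C).

Lemma adjointT : adjoint ip (T t%:C) (T t%:C).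
Proof.
have := adjoint_opV H_bounded H_self_adjoint t%:C.
by have -> : (t%:C)^* = t%:C by apply: complexE2; [done|exact: oppr0].
Qed.

(** [far] concerns covectors and the conorm: [cotangent_exists] realizes each pair (x, z), and
    [conorm_lower] compares the norms over the compact box. *)
Lemma symbol_far : exists2 N2, 0 < N2 & forall x z, cbox x0 r' x -> N2 <= enorm z ->
  delta <= cmod (b0 (x, z) - t%:C).
Proof.
have [C C0 CP] := conorm_lower g kM (@compact_cbox R n x0 r') Xc.
exists (C * (`|N1| + 1)) => [|x z Kx zN]; first by rewrite mulr_gt0.
have cx := Xc Kx; have [ze [zb zc]] := cotangent_exists z kM (bwd_dom cx).
have dz : dom k (base ze) by rewrite zb; exact: bwd_dom.
have fz : fwd k (base ze) = x by rewrite zb bwdK.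
have := far (z := ze); rewrite (ab0 dz) fz zc; apply.
have := CP ze dz; rewrite fz zc => /(_ Kx) h.
have : C * (`|N1| + 1) <= C * conorm g ze := le_trans zN h.
by rewrite ler_pM2l// => h2; apply: le_trans h2; apply: (le_trans (ler_norm _)); rewrite lerDl.
Qed.

(** [c] is the quotient of [th] by the shifted symbol and [d] the first remainder of its quasimode;
    the factor 3 comes from squaring a sum of three terms. *)
Lemma high_frequency (th : rV -> R[i]) : csmooth_on setT th -> (forall x, ~ K x -> th x = 0) ->
  exists2 N2, 0 < N2 & exists2 B, 0 <= B & exists c d : rV -> rV -> R[i], [/\ tfamily K c, tfamily K d &
    forall z, N2 <= enorm z -> forall s : V, ip s (lift th z) ^+ 2 <=
      3 * (ip (T t%:C s) (lift (c z) z) ^+ 2 + jb z ^- 2 * ip s (lift (d z) z) ^+ 2 +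
           q s * (B * jb z ^- n.+1.*2))].
Proof.
move=> sth th0; have [N2 N20 farb] := symbol_far; exists N2 => //.
pose I := {z : rV | N2 <= enorm z}.
have In (i : I) : (0 < n)%N.
  rewrite lt0n; apply/eqP => n0; have [z /= zN] := i; move: zN.
  rewrite /enorm /dotv big1 ?sqrtr0 ?leNgt ?N20// => j _.
  by have := ltn_ord j; rewrite {2}n0.
(* The quotient has to be smooth on an open set around [K]; the symbol is far from [t] on the whole
   larger box. *)
pose W := interior (cbox x0 r').
have oW : open W by exact: open_interior.
have Wk : W `<=` cod k by move=> x /interior_subset /Xc.
have KW : K `<=` W.
  move=> x Kx; have /andP[_ rr'] := rr; have d0 : 0 < r' - r by rewrite subr_gt0.
  apply: filterS (nbhs_cbox x d0) => y yx i; have := yx i; have := Kx i.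
  have := ler_normD (y 0 i - x 0 i) (x 0 i - x0 0 i); rewrite addrA subrK => h1 h2 h3.
  by apply: (le_trans h1); rewrite -(subrK r r'); exact: lerD.
have uF : ufamily W K (fun (i : I) x => b0 (x, val i) - t%:C).
  by apply: ufamilyS (symbol_sub_ufamily (fun i : I => val i) t%:C).
have F0 (i : I) x : cbox x0 r' x -> b0 (x, val i) - t%:C != 0.
  move=> Kx; have := farb x (val i) Kx (valP i) => h; apply/eqP => h0.
  by move: h; rewrite h0 normc0 leNgt delta0.
have KX x : K x -> cbox x0 r' x by move=> /KW /interior_subset.
have uV := ufamilyV oW KW uF (fun i x Wx => F0 i x (interior_subset Wx)) delta0
  (fun i x Kx => farb x (val i) (KX x Kx) (valP i)).
have tth : tfamily K (fun _ : I => th).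
  by split=> //; apply: (ufamily_indep _ cK (@subsetT _ _) sth).
have tc := tfamilyM oW clK KW uV tth.
(* Order n + 1: in the squared error jb^(-2 n - 2), the factor jb^(-2 n) is dominated by the weight
   and summable over cells, and jb^(-2) is small. *)
have [rem tr [B B0 BP]] := lift_quasimode t%:C (fun i : I => val i) n.+1 tc In.
exists B => //.
pose c0 (z : rV) := if pselect (N2 <= enorm z) is left h then
  (fun x => (b0 (x, z) - t%:C)^-1 * th x) else fun=> 0.
pose d0 (z : rV) := if pselect (N2 <= enorm z) is left h then rem (exist _ z h) else fun=> 0.
exists c0, d0; split; [exact: (tfamily_if tc)|exact: (tfamily_if tr)|].
move=> z zN s; rewrite /c0 /d0; case: pselect => [h|//].
have := BP (exist _ z h); rewrite /=; set c := fun x => (b0 (x, z) - t%:C)^-1 * th x.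
set d := rem _; have [[sd _] dout] := tr; have sdz := sd (exist _ z h); have d0z := dout (exist _ z h).
have cth x : (b0 (x, z) - t%:C) * c x = th x.
  have [Kx|nK] := pselect (K x); last by rewrite /c th0// !mulr0.
  by rewrite mulrA mulfV ?mul1r//; exact: (F0 (exist _ z h) x (KX x Kx)).
set G := fun x => _ => qG.
have sG : csmooth_on setT G.
  have -> : G = (fun x => th x + (jb z)^-1%:C * d x) by apply/funext => x; rewrite /G cth.
  apply: csmooth_onD; [exact: openT|exact: sth|].
  by apply: csmooth_onM; [exact: openT|exact: csmooth_on_cst|exact: sdz].
have G0 x : ~ K x -> G x = 0 by move=> nK; rewrite /G cth th0// /d d0z// mulr0 addr0.
have EG : q (lift G z - (lift th z + (jb z)^-1 *: lift d z)) = 0.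
  apply/cip0_ae.
  apply: aeW => p _; rewrite cfunD cfunZ !(cfun_lift M_compact mu_density kM Kk)//.
  have [dp|dp] := pselect (dom k p); last by rewrite !pullback_out// mulr0 addr0.
  by rewrite !pullback_dom// /packet /G cth; ring.
set E := T t%:C (lift c z) - lift G z in qG.
have key : ip s (lift th z) = ip (T t%:C s) (lift c z) - (jb z)^-1 * ip s (lift d z) - ip s E.
  by rewrite adjointT; exact: (ip_split hip _ _ EG).
have cE : ip s E ^+ 2 <= q s * (B * jb z ^- n.+1.*2).
  by apply: (le_trans (ip_cauchy hip _ _)); rewrite ler_wpM2l ?(ip_ge0 hip).
rewrite key -exprVn -exprMn.
move: (ip (T t%:C s) _) (_^-1 * _) (ip s E) cE => x y w cE.
apply: (@le_trans _ _ (3 * (x ^+ 2 + y ^+ 2 + w ^+ 2))); last by rewrite ler_pM2l// lerD2l.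
exact: sqr_sub3_le.
Qed.

Context (rho : rV -> R).
Hypotheses (rho_smooth : smooth_on (cod k) rho) (rho_pos : forall x, cod k x -> 0 < rho x).
Hypothesis rhoE : forall B : set (borel M), measurable B -> B `<=` dom k ->
  mu B = int_rV (fun x => (rho x * \1_(fwd k @` B) x)%:E).

(** High frequencies are handled by [high_frequency] and [lift_bessel], low ones by [low_frequency].
    The constants depend neither on the number of cells nor on the points chosen in them. *)
Lemma cell_sum (th : rV -> R[i]) e : csmooth_on setT th -> (forall x, ~ K x -> th x = 0) -> 0 < e ->
  exists C (phi : seq V), 0 <= C /\ forall (s : V) N (p : {ffun 'I_n -> 'I_N.*2} -> rV), (forall m, cell m (p m)) ->
    \sum_m ip s (lift th (p m)) ^+ 2 <= e * q s + C * (q (T t%:C s) + coef2 ip phi s).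
Proof.
move=> sth th0 e0; have [N2 N20 [B B0 [c [d [tc td hP]]]]] := high_frequency sth th0.
have [B1 B10 B1P] := lift_bessel M_compact mu_density kM Kk rho_smooth rho_pos rhoE id tc.
have [B2 B20 B2P] := lift_bessel M_compact mu_density kM Kk rho_smooth rho_pos rhoE id td.
pose L : R := 32 ^+ n; have L0 : 0 < L by exact: exprn_gt0.
(* The coefficient of [eta * q s] after summation over the cells, which dictates [eta]. *)
pose D := 3 * (B2 + B * L).
have D0 : 0 <= D by rewrite mulr_ge0// addr_ge0// mulr_ge0// ltW.
pose eta := e / (2 * (D + 1)); have D1 : 0 < D + 1 by rewrite ltr_wpDl.
have eta0 : 0 < eta by rewrite divr_gt0// mulr_gt0.
have etaD : eta * D <= e / 2.
  have -> : eta * D = e / 2 * (D / (D + 1)) by rewrite /eta invfM; ring.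
  by rewrite ler_piMr ?divr_ge0 ?(ltW e0)// ler_pdivrMr// mul1r lerDl.
pose N3 := N2 + eta^-1.
have jbe z : N3 <= enorm z -> jb z ^- 2 <= eta.
  move=> h; have h1 : eta^-1 <= jb z by rewrite /jb; move: h; rewrite /N3; lra.
  rewrite -[leRHS]invrK lef_pV2 ?posrE ?exprn_gt0 ?jb_gt0 ?invr_gt0//.
  by apply: (le_trans h1); rewrite ler_peMl ?jb_ge0 ?jb_ge1.
(* A lower bound of the weight on low frequencies; dividing by it lets the low terms be summed with
   the same weights as the high ones. *)
pose w0 : R := (1 + N3 ^+ 2)^-1 ^+ n.
have w00 : 0 < w0 by rewrite exprn_gt0// invr_gt0 ltr_pwDl// sqr_ge0.
have [Lp w0p etap] : [/\ 0 <= L, 0 <= w0 & 0 <= eta] by split; exact: ltW.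
have e'0 : 0 < e / 2 * w0 / L by rewrite divr_gt0// mulr_gt0// divr_gt0.
have [C [phi [C0 lowP]]] := low_frequency M_compact mu_density kM Kk N3 sth th0 e'0.
exists (3 * B1 + C * L / w0), phi; split; first by apply: addr_ge0; rewrite !mulr_ge0 ?invr_ge0.
move=> s N p pP; have qs := ip_ge0 hip s; have qT := ip_ge0 hip (T t%:C s); have cs := coef2_ge0 ip phi s.
have sh l : \sum_m weight (p m - p l) <= 32 ^+ n by exact: sum_weight_cells.
have S1 := B1P (T t%:C s) _ p sh; have S2 := B2P s _ p sh; have S3 := sum_weight_box pP.
pose Y := (e / 2 * w0 / L * q s + C * coef2 ip phi s) / w0.
have Yn : 0 <= e / 2 * w0 / L * q s + C * coef2 ip phi s.
  by apply: addr_ge0; [apply: mulr_ge0 => //; exact: ltW|exact: mulr_ge0].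
have Y0 : 0 <= Y by exact: divr_ge0.
(* A majorant valid in both ranges of frequency, so that the sum need not be split. *)
pose X m := 3 * ip (T t%:C s) (lift (c (p m)) (p m)) ^+ 2 + 3 * eta * ip s (lift (d (p m)) (p m)) ^+ 2 +
  (3 * q s * B * eta + Y) * weight (p m).
have XP m : ip s (lift th (p m)) ^+ 2 <= X m.
  have w1 := weight_ge0 (p m); have s1 := sqr_ge0 (ip (T t%:C s) (lift (c (p m)) (p m))).
  have s2 := sqr_ge0 (ip s (lift (d (p m)) (p m))).
  have t1 : 0 <= 3 * eta * ip s (lift (d (p m)) (p m)) ^+ 2.
    by apply: mulr_ge0 s2; exact: mulr_ge0.
  have t2 : 0 <= 3 * q s * B * eta * weight (p m) by do 4 apply: mulr_ge0 => //.
  have t3 : 0 <= Y * weight (p m) by rewrite mulr_ge0.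
  have [h|h] := leP N3 (enorm (p m)); last first.
    have cb : cbox 0 N3 (p m).
      by move=> i; rewrite mxE subr0; exact: le_trans (coord_enorm _ _) (ltW h).
    apply: (le_trans (lowP s _ cb)); apply: (@le_trans _ _ (Y * weight (p m))); last first.
      rewrite /X [(_ + Y) * _]mulrDl addrA lerDr.
      exact: (addr_ge0 (addr_ge0 (mulr_ge0 (ler0n _ 3) s1) t1) t2).
    have -> : e / 2 * w0 / L * q s + C * coef2 ip phi s = Y * w0 by rewrite divfK ?gt_eqF.
    rewrite ler_wpM2l//; apply: weight_cube => i.
    by have := cb i; rewrite mxE subr0.
  have h2 : N2 <= enorm (p m) by apply: le_trans h; rewrite lerDl invr_ge0.
  apply: (le_trans (hP _ h2 s)).
  have jw : jb (p m) ^- n.+1.*2 <= eta * weight (p m).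
    rewrite doubleS -addn2 exprD invfM mulrC; apply: ler_pM; rewrite ?invr_ge0 ?exprn_ge0 ?jb_ge0//.
      exact: jbe.
    exact: jb_weight_ge.
  have u1 : jb (p m) ^- 2 * ip s (lift (d (p m)) (p m)) ^+ 2 <= eta * ip s (lift (d (p m)) (p m)) ^+ 2.
    by apply: ler_wpM2r => //; exact: jbe.
  have u2 : q s * (B * jb (p m) ^- n.+1.*2) <= q s * (B * (eta * weight (p m))).
    by apply: ler_wpM2l => //; exact: ler_wpM2l.
  by rewrite /X [(_ + Y) * _]mulrDl; exact: (cell_term_le _ u1 u2 t3).
apply: (le_trans (ler_sum _ (fun m _ => XP m))).
rewrite !big_split -!mulr_sumr.
have Z0 : 0 <= 3 * q s * B * eta + Y by apply: addr_ge0 => //; do 3 apply: mulr_ge0 => //.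
apply: (@le_trans _ _ (3 * (B1 * q (T t%:C s)) + 3 * eta * (B2 * q s) + (3 * q s * B * eta + Y) * L)).
  by apply: lerD; [apply: lerD; [rewrite ler_pM2l|rewrite ler_wpM2l// mulr_ge0]|rewrite ler_wpM2l].
have YL : Y * L = e / 2 * q s + C * L / w0 * coef2 ip phi s.
  by rewrite /Y; field; rewrite !gt_eqF.
have h1 : 3 * eta * (B2 * q s) + 3 * q s * B * eta * L = eta * D * q s by rewrite /D; ring.
have h2 : eta * D * q s <= e / 2 * q s by rewrite ler_wpM2r.
have h3 : 0 <= C * L / w0 * q (T t%:C s).
  by apply: mulr_ge0 => //; apply: divr_ge0 => //; exact: mulr_ge0.
have h4 : 0 <= B1 * coef2 ip phi s by rewrite mulr_ge0.
by rewrite [(_ + Y) * _]mulrDl YL; exact: (cell_total_le h1 h2 h3 h4).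
Qed.

End OnChart.

Section Elliptic.
Context (t delta N1 : R) (delta0 : 0 < delta) (far : forall z, N1 <= conorm g z -> delta <= cmod (a z - t%:C)).
Local Notation T := (opV (mu:=mu) H t%:C).

Definition mass (s : M -> R[i]) (B : set (borel M)) : R :=
  \int[mu]_(p in [set: borel M]) (cmod (s p) ^+ 2 * \1_B p).

(** The property given to [compact_ideal]: it has to pass to arbitrary subsets, whence the
    measurable superset [B]. The term in [e] is absorbed once [B] is all of [M]. *)
Definition controlled (U : set M) := exists B : set (borel M), [/\ measurable B, U `<=` B &
  forall e, 0 < e -> exists C (phi : seq V), 0 <= C /\ forall s, smooth_function s ->
    mass s B <= e * q (toV s) + C * (q (T (toV s)) + coef2 ip phi (toV s))].

Lemma smooth_cmod_continuous (s : M -> R[i]) : smooth_function s -> continuous (fun p => cmod (s p) ^+ 2).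
Proof.
move=> /smooth_function_continuous [c1 c2].
have -> : (fun p => cmod (s p) ^+ 2) = (fun p => Re (s p) * Re (s p) + Im (s p) * Im (s p)).
  by apply/funext => p; rewrite normc_sqr.
move=> p; apply: (@continuousD _ _ _ (fun p => Re (s p) * Re (s p)) (fun p => Im (s p) * Im (s p))).
  by apply: continuousM; exact: c1.
by apply: continuousM; exact: c2.
Qed.

Lemma mass_integrable s (B : set (borel M)) : smooth_function s -> measurable B ->
  mu.-integrable [set: borel M] (EFin \o (fun p => cmod (s p) ^+ 2 * \1_B p)).
Proof.
move=> ss mB; have cs := smooth_cmod_continuous ss.
apply: le_integrable (continuous_integrable M_compact mu_density cs) => //.
  by apply/measurable_EFinP; apply: measurable_funM; [exact: continuous_borel|exact: measurable_indic].
move=> p _ ; rewrite lee_fin normrM ler_piMr// ger0_norm ?indicE//.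
by case: (_ \in _).
Qed.

Lemma mass_setT s : smooth_function s -> mass s setT = q (toV s).
Proof.
move=> ss; rewrite cip_norm cfun_toV; last exact: smooth_L2.
rewrite sqr_sqrtr; last by apply: Rintegral_ge0 => p _; exact: sqr_ge0.
by apply: eq_Rintegral => p _; rewrite indicT mulr1.
Qed.

Lemma controlled_local (p : M) : exists2 U : set M, nbhs p U & controlled U.
Proof.
have [k kM dp] := charts_cover p; pose x0 := fwd k p.
have [sa _] := a_symbol; have [b0 ab0 sb0] := sa k kM.
have [r' r'0 Xc] := open_cbox (@cod_open _ _ _ k) (fwd_cod dp).
pose r := r' / 2; have r0 : 0 < r by rewrite divr_gt0.
have rr : 0 <= r < r' by rewrite ltW//= ltr_pdivrMr// ltr_pMr// ltr1n.
have [f [sf f0 fx fout]] := smooth_bump x0 r0.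
have fK x : ~ cbox x0 r x -> f x = 0.
  move=> h; apply: fout; rewrite leNgt; apply/negP => hr; apply: h => i.
  by have := coord_enorm (x - x0) i; rewrite !mxE => h'; exact: le_trans h' (ltW hr).
have Kk : cbox x0 r `<=` cod k by exact: cbox_cod rr Xc.
have cK := @compact_cbox R n x0 r; have clK := rV_compact_closed cK.
have [rho [rs rp rE]] := mu_density kM.
pose th1 x := (f x)%:C; pose th2 x := 'i * (f x)%:C.
have s1 : csmooth_on setT th1 by exact: csmooth_on_real.
have s2 : csmooth_on setT th2 by apply: csmooth_onM; [exact: openT|exact: csmooth_on_cst|].
have z1 x : ~ cbox x0 r x -> th1 x = 0 by move=> /fK h; rewrite /th1 h.
have z2 x : ~ cbox x0 r x -> th2 x = 0 by move=> /fK h; rewrite /th2 h mulr0.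
pose B : set M := [set p | dom k p /\ 1 < f (fwd k p)].
have oB : open B.
  apply: (@open_chart_image _ _ _ k [set x | 1 < f x]).
  apply: (@open_comp _ _ f [set y | 1 < y]) => [x _|]; last exact: open_gt.
  exact: smooth_on_continuous sf _.
exists B; first by apply: open_nbhs_nbhs; split=> //; split=> //; rewrite fx ltr1n.
exists B; split=> //; first exact: open_borel.
move=> e e0.
(* Plancherel produces the square of the density while the measure contains it once; [kap] bounds
   the inverse of the surplus factor. *)
have [kap kapP] : exists C, forall x, cbox x0 r x -> `|(rho x)^-1| <= C.
  apply: compact_bound_gen => //; apply: continuous_in_subspaceT => x /set_mem Kx.
  apply: continuousV; first exact: lt0r_neq0 (rp x (Kk x Kx)).
  exact: smooth_on_continuous rs (Kk x Kx).
pose c1 : R := `|kap| * ((2 * pi) ^- n * 2).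
have c10 : 0 <= c1 by rewrite !mulr_ge0 ?invr_ge0 ?exprn_ge0 ?mulr_ge0 ?pi_ge0.
have c1p : 0 < 2 * c1 + 1 by rewrite ltr_wpDl// mulr_ge0.
pose e1 := e / (2 * c1 + 1); have e10 : 0 < e1 by rewrite divr_gt0.
have cs := cell_sum kM rr Xc ab0 sb0 delta0 far rs rp rE.
have [C1 [phi1 [C10 P1]]] := cs _ _ s1 z1 e10.
have [C2 [phi2 [C20 P2]]] := cs _ _ s2 z2 e10.
exists (c1 * (C1 + C2)), (phi1 ++ phi2); split; first by rewrite mulr_ge0// addr_ge0.
move=> s ss; set S := toV s; pose X := q (T S) + coef2 ip (phi1 ++ phi2) S.
pose L := local_part k rho s th1.
have [sL L0] := local_part_smooth kM Kk rs ss s1 z1.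
have [Ac KA] := compact_in_cube cK.
have tL : tfamily (cbox x0 r) (fun _ : unit => L).
  by split=> //; apply: (ufamily_indep _ cK (@subsetT _ _) sL).
have [D DP] := fourier_decay 1 clK KA tL.
have F2 z : cmod (fourier L z) ^+ 2 <= D ^+ 2 * weight z ^+ 2.
  have h := DP tt z; rewrite -exprMn; apply: lerXn2r; rewrite ?nnegrE ?normc_ge0//.
  exact: le_trans (normc_ge0 _) h.
have L0A x : ~ cube Ac x -> L x = 0 by move=> nA; apply: L0 => /KA.
have wF : wbounded (fun z => cmod (fourier L z) ^+ 2).
  split; last first.
    exists (D ^+ 2) => z; rewrite ger0_norm ?sqr_ge0//; apply: (le_trans (F2 z)).
    by rewrite ler_wpM2l ?sqr_ge0// ler_piMr ?weight_ge0// weight_le1.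
  have [m1 m2] := fourier_meas sL L0A.
  rewrite /vmeas (_ : _ \o _ = (fun e : E n => Re (fourier L (vec e)) ^+ 2 + Im (fourier L (vec e)) ^+ 2)).
    by apply: measurable_funD; apply: measurable_funX.
  by apply/funext => z; rewrite /comp normc_sqr.
(* The integral is replaced by a sum over cells. The error [h] is arbitrary, as the constants of
   [cell_sum] do not depend on the number of cells. *)
have bound : rint (fun z => cmod (fourier L z) ^+ 2) <= 2 * (2 * e1 * q S + (C1 + C2) * X).
  apply/ler_addgt0Pr => h h0; rewrite addrC.
  have [N [pm pP le1]] := rint_le_cells wF (fun z => sqr_ge0 _) F2 h0.
  apply: (le_trans le1); rewrite lerD2l ler_pM2l//.
  have E z : cmod (fourier L z) ^+ 2 = ip S (lift_packet mu k th1 z) ^+ 2 + ip S (lift_packet mu k th2 z) ^+ 2.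
    rewrite normc_sqr !(ip_lift M_compact mu_density kM Kk rs rp rE)//; congr (_ + _ ^+ 2).
    congr (fine (int_rV _)); apply/funext => y; congr _%:E.
    rewrite /L /local_part /th1 /th2; move: (rho y) (s _) (f y) (cis _) => ? [? ?] ? [? ?].
    by rewrite /=; ring.
  under eq_bigr do rewrite E; rewrite big_split.
  have E3 : coef2 ip (phi1 ++ phi2) S = coef2 ip phi1 S + coef2 ip phi2 S by rewrite /coef2 big_cat.
  by rewrite /X E3; apply: control_add C10 C20 (coef2_ge0 _ _ _) (coef2_ge0 _ _ _) (P1 S N pm pP) (P2 S N pm pP).
pose F p := cmod (s p) ^+ 2 * cmod (pullback k th1 p) ^+ 2.
have t1 : test_function (cod k) th1 by split=> //; exists (cbox x0 r).
have cF : continuous F.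
  have := smooth_cmod_continuous (smooth_functionM ss (pullback_smooth kM t1)).
  have -> // : F = (fun p0 => cmod (s p0 * pullback k th1 p0) ^+ 2).
  by apply/funext => y; rewrite normcM exprMn.
have Fout y : ~ (bwd k @` cbox x0 r) y -> F y = 0.
  move=> ny; rewrite /F; have [dy|dy] := pselect (dom k y); last by rewrite pullback_out// normc0 expr0n mulr0.
  rewrite pullback_dom// z1 ?normc0 ?expr0n ?mulr0// => Ky.
  by apply: ny; exists (fwd k y) => //; rewrite fwdK.
have step1 : mass s B <= \int[mu]_(y in [set: borel M]) F y.
  apply: le_Rintegral => //; [by apply: mass_integrable => //; exact: open_borel|exact: continuous_integrable|].
  move=> y _; rewrite ler_wpM2l ?sqr_ge0// indicE; case: (boolP (y \in B)) => [/set_mem [dy fy]|_]; last exact: sqr_ge0.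
  by rewrite pullback_dom// normcR ger0_norm// exprn_ege1// ltW.
have step2 : \int[mu]_(y in [set: borel M]) F y <= `|kap| * rint (fun x => cmod (L x) ^+ 2).
  rewrite (chart_integral M_compact mu_density rs rp rE cK Kk cF Fout).
  have LE x : cmod (L x) ^+ 2 = rho x * (rho x * F (bwd k x)) * \1_(cbox x0 r) x.
    rewrite indicE; case: (boolP (x \in cbox x0 r)) => [/set_mem Kx|/negP nK]; last first.
      have Lx : L x = 0 by apply: L0 => /mem_set.
    by rewrite mulr0 Lx normc0 expr0n.
    rewrite mulr1 /F pullback_dom; last by apply: bwd_dom; exact: Kk.
    by rewrite bwdK; [rewrite !normcM normc_conj normcR !exprMn real_normK ?num_real; ring|exact: Kk].
  have wL : wbounded (fun x => cmod (L x) ^+ 2).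
    under eq_fun do rewrite LE; apply: (wbounded_patch (@cod_open _ _ _ k) cK Kk) => x cx.
    apply: continuousM; first exact: smooth_on_continuous rs cx.
    apply: continuousM; first exact: smooth_on_continuous rs cx.
    by apply: continuous_comp; [exact: bwd_continuous|exact: cF].
  rewrite -rintZ//; apply: le_rint; [exact: wbounded_chart|exact: wboundedZ|].
  move=> x; rewrite LE indicE; case: (boolP (x \in cbox x0 r)) => [/set_mem Kx|_]; last by rewrite !mulr0.
  rewrite !mulr1; have rx := rp x (Kk x Kx).
  have F0 : 0 <= F (bwd k x) by rewrite mulr_ge0 ?sqr_ge0.
  have rF : 0 <= rho x * F (bwd k x) by apply: mulr_ge0 F0; exact: ltW.
  rewrite mulrA ler_peMl// -ler_pdivrMr// div1r.
  by apply: (le_trans (ler_norm _)); apply: (le_trans (kapP x Kx)); exact: ler_norm.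
apply: (le_trans step1); apply: (le_trans step2); rewrite (plancherel sL L0A) mulrA.
apply: (@le_trans _ _ (`|kap| * (2 * pi) ^- n * (2 * (2 * e1 * q S + (C1 + C2) * X)))).
  by rewrite ler_wpM2l// mulr_ge0// invr_ge0 exprn_ge0// mulr_ge0// pi_ge0.
have -> : `|kap| * (2 * pi) ^- n * (2 * (2 * e1 * q S + (C1 + C2) * X)) =
  2 * c1 * e1 * q S + c1 * (C1 + C2) * X by rewrite /c1; ring.
rewrite lerD2r ler_wpM2r ?(ip_ge0 hip)// mulrA ler_pdivrMr// mulrC ler_wpM2l ?(ltW e0)//.
by rewrite lerDl.
Qed.

Lemma smooth_estimate : exists C (phi : seq V), 0 <= C /\ forall s, smooth_function s ->
  q (toV s) <= C * (q (T (toV s)) + coef2 ip phi (toV s)).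
Proof.
have [B [mB BT h]] : controlled setT.
  apply: (compact_ideal M_compact).
  - exists set0; split=> // e e0; exists 0, [::]; split=> // s ss; rewrite mul0r addr0.
    rewrite /mass; under eq_Rintegral do rewrite indic0 mulr0.
    by rewrite Rintegral_cst// mul0r mulr_ge0 ?(ltW e0)// (ip_ge0 hip).
  - by move=> U W UW [B [mB WB h]]; exists B; split=> // p /UW /WB.
  - move=> U W [B [mB UB hB]] [D [mD WD hD]]; exists (B `|` D); split; [exact: measurableU|exact: setUSS|].
    move=> e e0; have e2 : 0 < e / 2 by rewrite divr_gt0.
    have [C1 [phi1 [C10 P1]]] := hB _ e2; have [C2 [phi2 [C20 P2]]] := hD _ e2.
    exists (C1 + C2), (phi1 ++ phi2); split; first exact: addr_ge0.
    move=> s ss; have := P1 s ss; have := P2 s ss; set S := toV s.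
    have le1 : mass s (B `|` D) <= mass s B + mass s D.
      rewrite -RintegralD//; [|exact: mass_integrable|exact: mass_integrable].
      apply: le_Rintegral => //; [by apply: mass_integrable => //; exact: measurableU| |].
        exact: (integrableD measurableT (mass_integrable ss mB) (mass_integrable ss mD)).
      move=> p _; rewrite -mulrDr ler_wpM2l ?sqr_ge0// -natrD ler_nat.
      by rewrite in_setU; case: (_ \in _).
    have E3 : coef2 ip (phi1 ++ phi2) S = coef2 ip phi1 S + coef2 ip phi2 S by rewrite /coef2 big_cat.
    move=> h2 h1; apply: (le_trans le1); rewrite E3.
    by have := control_add C10 C20 (coef2_ge0 ip phi1 S) (coef2_ge0 ip phi2 S) h1 h2; rewrite mulrCA mulfV// mulr1.
  - by move=> p _; exact: controlled_local.
(* With e = 1 / 2 the small term moves to the left-hand side, which doubles the constant. *)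
have h0 : 0 < 1 / 2 :> R by [].
have [C [phi [C0 P]]] := h _ h0.
exists (2 * C), phi; split=> [|s ss]; first by rewrite mulr_ge0.
have BE : B = setT by apply/seteqP.
by have := P s ss; rewrite BE mass_setT//; lra.
Qed.

(** The list [phi] is fixed, so both sides are continuous in [u] and the smooth functions suffice;
    the factor 4 leaves room for the approximation. *)
Theorem elliptic_estimate : exists phi : seq V, estimate ip T phi [::].
Proof.
have [C [phi [C0 P]]] := smooth_estimate; exists phi, (4 * C) => u.
have aT := adjointT t.
have [K [K0 TK]] := opV_bounded H_bounded t%:C.
pose Z := \sum_(f <- phi) q f; have Z0 : 0 <= Z by apply: sumr_ge0 => f _; exact: (ip_ge0 hip).
have W0 : 0 < 2 + 4 * C * K + 4 * C * Z 
  by have := mulr_ge0 C0 (ltW K0); have := mulr_ge0 C0 Z0; lra.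
rewrite [coef2 _ [::] _]/coef2 big_nil addr0; apply/ler_addgt0Pr => e e0.
have [s ss us] := smooth_dense M_compact mu_density u (divr_gt0 e0 W0).
set S := toV s in us; set d := e / _ in us; have d0 : 0 <= d by rewrite divr_ge0 ?ltW.
have h1 : q u <= 2 * q S + 2 * d.
  have := q_add_le hip S (u - S); rewrite addrC subrK => h; apply: (le_trans h); rewrite lerD2l ler_pM2l//.
have h2 : q (T S) <= 2 * q (T u) + 2 * (K * d).
  have := q_sub_le hip (T u) (T u - T S); rewrite subKr => h; apply: (le_trans h); rewrite lerD2l ler_pM2l//.
  by rewrite -(adjoint_qsub hip _ _ aT); apply: (le_trans (TK _)); rewrite ler_wpM2l// ltW.
have h3 : coef2 ip phi S <= 2 * coef2 ip phi u + 2 * (Z * d).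
  rewrite /coef2 /Z !mulr_sumr mulr_suml mulr_sumr -big_split; apply: ler_sum => f _ /=.
  have -> : ip S f = ip u f - ip (u - S) f by rewrite (ipDl hip) (ipNl hip) opprB addrC subrK.
  have := ip_cauchy hip (u - S) f; have : q (u - S) * q f <= q f * d by rewrite mulrC ler_wpM2l// (ip_ge0 hip).
  by move: (ip u f) (ip (u - S) f) => x y; have := sqr_ge0 (x + y); lra.
have h4 := P s ss; have eE : e = 2 * d + 4 * C * K * d + 4 * C * Z * d.
  by rewrite -[LHS](divfK (lt0r_neq0 W0)) -/d; ring.
have h5 : C * (q (T S) + coef2 ip phi S) <= C * (2 * q (T u) + 2 * (K * d) + (2 * coef2 ip phi u + 2 * (Z * d))).
  by rewrite ler_wpM2l// lerD.
by rewrite {1}eE; exact: control_perturb h1 h4 h5.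
Qed.

Theorem elliptic_not_essential : ~ essential_spectrum mu H t%:C.
Proof.
have [phi est] := elliptic_estimate; have [K TK] := opV_bounded H_bounded t%:C.
have aT := adjointT t.
move=> [tS tnd]; have [bb|isf] := fredholm_alternative hip aT TK est.
  by apply: tS; apply/real_resolventP.
by apply: tnd; exact: isolated_finite_discrete.
Qed.

End Elliptic.

Section WeylSequence.
Context (lam : R[i]) (z : nat -> cotangent M).
Context (z_inf : (fun j => conorm g (z j)) @ \oo --> +oo).
Context (z_lim : (fun j => a (z j) : R[i]^o) @ \oo --> (lam : R[i]^o)).
Local Notation T := (opV (mu:=mu) H lam).

(** In dimension 0 every conorm is 0 and cannot tend to infinity. *)
Lemma dim_gt0 : (0 < n)%N.
Proof.
rewrite lt0n; apply/eqP => n0; move/cvgryPge: z_inf => /(_ 1) [N _ /(_ N (leqnn N))] .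
rewrite /conorm /dotv big1 ?sqrtr0 ?ler10// => j _.
by have := ltn_ord j; rewrite {2}n0.
Qed.

(** A cluster point serves in place of a convergent subsequence: [weyl_vector] needs a single index,
    beyond a given bound, with base point near [p0]. *)
Lemma base_cluster : exists p0 : M, forall (U : set M) N, nbhs p0 U -> exists2 j, (N <= j)%N & U (base (z j)).
Proof.
pose F := (fun j => base (z j)) @ \oo.
have [|p0 [_ cl]] := M_compact (F := F) _; first by exact: filterT.
exists p0 => U N Up; have [|p [[j Nj <-] Uj]] := cl ((fun j => base (z j)) @` [set j | (N <= j)%N]) U _ Up.
  by exists N => // j Nj; exists j.
by exists j.
Qed.

Lemma opV_scale (al : R) (u : V) : q (T (al *: u)) = al ^+ 2 * q (T u).
Proof.
have aT := adjoint_opV H_bounded H_self_adjoint lam.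
rewrite -(q_scale hip); apply: (q_congr hip); apply: (eq_from_ip hip) => w.
have := adjoint_lin hip al u 0 w aT; rewrite addr0 => ->.
by rewrite (ipZl hip) (aT 0) (ip0l hip) addr0.
Qed.

(** Proved for complex [lam], since it also serves to exclude nonreal limits. *)
Lemma weyl_vector e (hs : seq V) : 0 < e ->
  exists u, [/\ q u = 1, q (T u) <= e & forall v, v \in hs -> ip u v ^+ 2 <= e].
Proof.
move=> e0; have [p0 p0P] := base_cluster; have [k kM dp0] := charts_cover p0; pose x0 := fwd k p0.
have [sa _] := a_symbol; have [b0 ab0 sb0] := sa k kM; have [rho [rs rp rE]] := mu_density kM.
have [r' r'0 Xc] := open_cbox (@cod_open _ _ _ k) (fwd_cod dp0).
pose r := r' / 2; have r0 : 0 < r by rewrite divr_gt0.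
have rr : 0 <= r < r' by rewrite ltW//= ltr_pdivrMr// ltr_pMr// ltr1n.
have Kk : cbox x0 r `<=` cod k by exact: cbox_cod rr Xc.
have cK := @compact_cbox R n x0 r; have clK := rV_compact_closed cK.
have outK (f : rV -> R) d : (forall x, d <= enorm (x - x0) -> f x = 0) -> forall x, ~ cbox x0 d x -> f x = 0.
  move=> fout x h; apply: fout; rewrite leNgt; apply/negP => hr; apply: h => i.
  by have := coord_enorm (x - x0) i; rewrite !mxE => h'; exact: le_trans h' (ltW hr).
have [chi [schi chi0 chix /outK chiK]] := smooth_bump x0 r0.
pose w j := components (z j) k.
(* The cutoff gives all [F j] a common support, hence a Lipschitz constant independent of [j]. Near
   [x0] it is at least 1, so that it can be kept in the amplitude. *)
pose F j x := (b0 (x, w j) - lam) * (chi x)%:C.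
have tF : tfamily (cbox x0 r) F.
  apply: (tfamilyM (@cod_open _ _ _ k) clK Kk); first exact: (symbol_sub_ufamily rr Xc sb0).
  split; first by apply: (ufamily_indep _ cK (@subsetT _ _)); exact: csmooth_on_real.
  by move=> j x /chiK ->.
have [CL CL0 lip] := tfamily_lipschitz clK tF.
have [d1 d10 d1P] : exists2 d, 0 < d & cbox x0 d `<=` [set x | 1 < chi x].
  apply: open_cbox; last by rewrite /= chix ltr1n.
  apply: (@open_comp _ _ chi [set y | 1 < y]) => [x _|]; last exact: open_gt.
  exact: smooth_on_continuous schi _.
(* The principal part will contribute 2 * 2 * (2 om)^2 = 16 om^2 to the final bound. *)
have [om om0 ome] : exists2 om : R, 0 < om & 16 * om ^+ 2 <= e / 2.
  exists (Num.sqrt (e / 32)); first by rewrite sqrtr_gt0 divr_gt0.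
  by rewrite sqr_sqrtr; lra.
have D0 : 0 < CL * (n%:R * 2) + 1 by rewrite ltr_wpDl// !mulr_ge0.
(* In a box of this radius each [F j] varies by at most [om], whatever the frequency. *)
pose d := Num.min (Num.min d1 r) (om / (CL * (n%:R * 2) + 1)).
have d0 : 0 < d by rewrite !lt_min d10 r0 divr_gt0.
have dd1 : d <= d1 by rewrite !ge_min lexx.
have dr : d <= r by rewrite !ge_min lexx orbT.
have dom_ : CL * (n%:R * (2 * d)) <= om.
  have : d <= om / (CL * (n%:R * 2) + 1) by rewrite !ge_min lexx orbT.
  rewrite ler_pdivlMr// => h; apply: le_trans h; rewrite mulrDr mulr1.
  have -> : CL * (n%:R * (2 * d)) = d * (CL * (n%:R * 2)) by ring.
  by rewrite lerDl ltW.
have [psi [spsi psi0 psix /outK psiK]] := smooth_bump x0 d0.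
have dK x : cbox x0 d x -> cbox x0 r x by move=> h i; exact: le_trans (h i) dr.
pose c x := chi x * psi x.
have sc : smooth_on setT c by apply: smooth_onM => //; exact: openT.
have c0 x : ~ cbox x0 r x -> c x = 0 by move=> /chiK h; rewrite /c h mul0r.
pose cc x := (c x)%:C.
have scc : csmooth_on setT cc by exact: csmooth_on_real.
have cc0 x : ~ cbox x0 r x -> cc x = 0 by move=> /c0 h; rewrite /cc h.
pose m := q (lift_packet mu k cc 0).
have m0 : 0 < m.
  apply: (q_lift_gt0 M_compact mu_density kM Kk rs rp rE) => //.
  by exists x0; rewrite /c chix psix.
have mE y : q (lift_packet mu k cc y) = m.
  apply/eqP; rewrite eq_le; apply/andP; split.
    have := @q_lift_le _ _ _ M_compact _ mu_density k kM x0 r Kk cc cc y 0 1 ler01 scc cc0 scc cc0.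
    by rewrite expr1n mul1r; apply=> x; rewrite mul1r.
  have := @q_lift_le _ _ _ M_compact _ mu_density k kM x0 r Kk cc cc 0 y 1 ler01 scc cc0 scc cc0.
  by rewrite expr1n mul1r; apply=> x; rewrite mul1r.
pose al := (Num.sqrt m)^-1.
have al2 : al ^+ 2 = m^-1 by rewrite exprVn sqr_sqrtr// ltW.
have q1 y : q (al *: lift_packet mu k cc y) = 1 by rewrite (q_scale hip) mE al2 mulVf// lt0r_neq0.
have [D1 weak] := lift_weak M_compact mu_density kM Kk rs rp rE hs scc cc0 q1 e0.
have tc : tfamily (cbox x0 r) (fun _ : nat => cc).
  by split=> //; apply: (ufamily_indep _ cK (@subsetT _ _) scc).
have [rem tr [C C0 CP]] := lift_quasimode kM rr Xc ab0 sb0 lam w 1 tc (fun=> dim_gt0).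
have [C2 C2P] := tfamily_bound tr.
have [Cu CuP] := conorm_upper g kM (@compact_cbox R n x0 r') Xc.
have [Cc CcP] : exists Cc, forall x, cbox x0 r x -> `|chi x| <= Cc.
  apply: compact_bound_gen => //; apply: continuous_in_subspaceT => x _.
  exact: smooth_on_continuous schi _.
(* The coefficient of 1 / jb in the final bound, from the quasimode error and from its amplitude of
   order -1. *)
pose B := (2 * C + 4 * (C2 ^+ 2 * mM)) / m.
have B0 : 0 <= B.
  apply: divr_ge0 (ltW m0); apply: addr_ge0; apply: mulr_ge0 => //; apply: mulr_ge0 => //; exact: sqr_ge0.
pose D := `|D1| + B / (e / 2).
have e20 : 0 < e / 2 by rewrite divr_gt0.
have [Na NaP] := (cvg_complexP _ _).1 z_lim (om / (`|Cc| + 1)) (divr_gt0 om0 (ltr_wpDl (normr_ge0 _) ltr01)).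
move/cvgryPge: z_inf => /(_ ((`|Cu| + 1) * D)) [Nb _ NbP].
have UU : nbhs p0 [set p | dom k p /\ cbox x0 d (fwd k p)].
  have h1 : nbhs p0 (dom k) by apply: open_nbhs_nbhs; split=> //; exact: dom_open.
  have h2 : nbhs p0 (fwd k @^-1` cbox x0 d) by apply: (fwd_continuous dp0); exact: nbhs_cbox.
  by apply: filterS2 h1 h2.
have [j Nj [dj yj]] := p0P _ (maxn Na Nb) UU; move: Nj; rewrite geq_max => /andP[/NaP aj /NbP /= cj].
set y := fwd k (base (z j)) in yj.
have yK' : cbox x0 r' y by move=> i; apply: (le_trans (dK _ yj i)); have /andP[_ /ltW] := rr.
have Dw : D <= enorm (w j).
  have Cu1 : 0 < `|Cu| + 1 by rewrite ltr_wpDl.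
  rewrite -(ler_pM2l Cu1); apply: (le_trans cj); apply: (le_trans (CuP _ dj yK')).
  by rewrite ler_wpM2r ?enorm_ge0//; apply: (le_trans (ler_norm _)); rewrite lerDl.
have jbB : B / jb (w j) <= e / 2.
  rewrite ler_pdivrMr ?jb_gt0// mulrC -ler_pdivrMr//.
  by apply: (@le_trans _ _ (enorm (w j))); [apply: le_trans Dw; rewrite lerDr|rewrite lerDr].
exists (al *: lift_packet mu k cc (w j)); split; [exact: q1| |]; last first.
  by apply: weak; apply: le_trans Dw; apply: (le_trans (ler_norm _)); rewrite lerDl divr_ge0// ltW.
have [[srem _] rem0] := tr; have sF := (tF.1).1 j; have F0 := tF.2 j.
pose G1 x := F j x * (psi x)%:C.
have sG1 : csmooth_on setT G1 by apply: csmooth_onM; [exact: openT|exact: sF|exact: csmooth_on_real].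
have G10 x : ~ cbox x0 r x -> G1 x = 0 by move=> nK; rewrite /G1 F0// mul0r.
(* At the base point [y] of the covector the symbol is close to [lam]; in the rest of the small box
   [F j] differs from its value there by at most [om]. *)
have G1le x : cmod (G1 x) <= 2 * om * cmod (cc x).
  have [dx|nd] := pselect (cbox x0 d x); last by rewrite /G1 psiK// mulr0 normc0 mulr_ge0 ?normc_ge0// mulr_ge0// ltW.
  rewrite /G1 /cc /c rmorphM normcM (normcM (chi x)%:C) mulrA; apply: ler_wpM2r; first exact: normc_ge0.
  have chi1 : 1 <= cmod (chi x)%:C by rewrite normcR ger0_norm//; apply: ltW; apply: d1P => i; exact: le_trans (dx i) dd1.
  apply: (@le_trans _ _ (2 * om)); last by rewrite ler_peMr// mulr_ge0// ltW.
  have -> : F j x = F j y + (F j x - F j y) by rewrite addrC subrK.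
  apply: (le_trans (normcD _ _)); rewrite mulr_natl mulr2n; apply: lerD.
    rewrite /F -(ab0 _ dj) normcM normcR.
    apply: (@le_trans _ _ (om / (`|Cc| + 1) * (`|Cc| + 1))); last by rewrite divfK// lt0r_neq0// ltr_wpDl.
    apply: ler_pM; rewrite ?normc_ge0//; first exact: ltW.
    apply: (le_trans (CcP _ (dK _ yj))); apply: (le_trans (ler_norm _)); by rewrite lerDl.
  apply: (le_trans (lip j x y)); apply: le_trans dom_; rewrite ler_wpM2l//.
  rewrite mulr_natl -[n in _ *+ n]card_ord -sumr_const; apply: ler_sum => i _.
  have := ler_normB (x 0 i - x0 0 i) (y 0 i - x0 0 i); rewrite opprB addrA subrK => h.
  by apply: (le_trans h); rewrite mulr_natl mulr2n; exact: lerD.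
have qG1 : q (lift_packet mu k G1 (w j)) <= (2 * om) ^+ 2 * m.
  rewrite -(mE (w j)); apply: (q_lift_le M_compact mu_density kM Kk) => //.
  by rewrite mulr_ge0// ltW.
have qR : q (lift_packet mu k (rem j) (w j)) <= C2 ^+ 2 * mM.
  apply: (q_sup M_compact mu_density) => p; rewrite (cfun_lift M_compact mu_density kM Kk _ (srem j) (rem0 j)).
  have [dp|dp] := pselect (dom k p); last by rewrite pullback_out// normc0 (le_trans (normc_ge0 _) (C2P 0%N 0)).
  by rewrite pullback_dom// /packet normcM normc_cis mulr1.
set jw := jb (w j) in jbB *; have jw1 : 1 <= jw by exact: jb_ge1.
have jw0 : 0 < jw by exact: jb_gt0.
have qG : q (lift_packet mu k (fun x => (b0 (x, w j) - lam) * cc x + jw^-1%:C * rem j x) (w j)) <=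
    2 * ((2 * om) ^+ 2 * m) + 2 * (C2 ^+ 2 * mM / jw).
  have EG : q (lift_packet mu k (fun x => (b0 (x, w j) - lam) * cc x + jw^-1%:C * rem j x) (w j) -
      (lift_packet mu k G1 (w j) + jw^-1 *: lift_packet mu k (rem j) (w j))) = 0.
    have FE : (fun x => (b0 (x, w j) - lam) * cc x + jw^-1%:C * rem j x) = (fun x => G1 x + jw^-1%:C * rem j x).
      by apply/funext => x; rewrite /G1 /F /cc /c rmorphM mulrA.
    have sG : csmooth_on setT (fun x => G1 x + jw^-1%:C * rem j x).
      apply: csmooth_onD; [exact: openT|exact: sG1|].
      by apply: csmooth_onM; [exact: openT|exact: csmooth_on_cst|exact: srem].
    have G0 x : ~ cbox x0 r x -> G1 x + jw^-1%:C * rem j x = 0 by move=> nK; rewrite G10// rem0// mulr0 addr0.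
    rewrite FE; apply/cip0_ae; rewrite (cfun_lift M_compact mu_density kM Kk (w j) sG G0).
    apply: aeW => p' _; rewrite cfunD cfunZ (cfun_lift M_compact mu_density kM Kk _ sG1 G10).
    rewrite (cfun_lift M_compact mu_density kM Kk _ (srem j) (rem0 j)).
    have [dp|dp] := pselect (dom k p'); last by rewrite !pullback_out// mulr0 addr0.
    by rewrite !pullback_dom// /packet; ring.
  rewrite (q_congr hip EG); apply: (le_trans (q_add_le hip _ _)); apply: lerD; rewrite ler_pM2l//.
  rewrite (q_scale hip) mulrC; apply: ler_pM; rewrite ?(ip_ge0 hip) ?sqr_ge0//.
  by rewrite expr2 ler_piMr ?invr_ge0 ?(ltW jw0)// invf_le1.
rewrite opV_scale al2.
have TE : q (T (lift_packet mu k cc (w j))) <= 2 * (C / jw) + 2 * (2 * ((2 * om) ^+ 2 * m) + 2 * (C2 ^+ 2 * mM / jw)).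
  have := q_add_le hip (T (lift_packet mu k cc (w j)) - lift_packet mu k (fun x => (b0 (x, w j) - lam) * cc x + jw^-1%:C * rem j x) (w j))
    (lift_packet mu k (fun x => (b0 (x, w j) - lam) * cc x + jw^-1%:C * rem j x) (w j)); rewrite subrK => h.
  apply: (le_trans h); apply: lerD; rewrite ler_pM2l//.
  apply: (le_trans (CP j)); rewrite ler_wpM2l// lef_pV2 ?posrE ?exprn_gt0//.
  by rewrite expr2 ler_peMr// ltW.
rewrite mulrC ler_pdivrMr//; apply: (le_trans TE).
have -> : 2 * (C / jw) + 2 * (2 * ((2 * om) ^+ 2 * m) + 2 * (C2 ^+ 2 * mM / jw)) =
  (16 * om ^+ 2 + B / jw) * m by rewrite /B; field; rewrite !lt0r_neq0.
by rewrite ler_wpM2r ?(ltW m0)// [leRHS]splitr lerD.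
Qed.

(** A nonreal [lam] is excluded, since [opV lam] would be bounded below, against [weyl_vector]; a
    real one is covered by [weyl_essential]. *)
Theorem weyl_spectrum : essential_spectrum mu H lam.
Proof.
have [l0|ln] := eqVneq (Im lam) 0.
  have lE : lam = (Re lam)%:C by apply: complexE2.
  by rewrite lE; apply: weyl_essential => // e hs e0; rewrite -lE; exact: weyl_vector.
have [C CP] := opV_nonreal H_bounded H_self_adjoint ln.
have C1 : 0 < `|C| + 1 by rewrite ltr_wpDl.
have [u [qu Tu _]] := weyl_vector [::] (divr_gt0 ltr01 (mulr_gt0 (ltr0Sn R 1) C1)).
have := CP u; rewrite qu; have := ler_norm C; have := ip_ge0 hip (T u).
move: Tu; rewrite ler_pdivlMr ?mulr_gt0//; move: (q (T u)) => y; nra.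
Qed.

End WeylSequence.

End Operator.

(** Failure of the conclusion for d = 1 / (j + 1) and N = j provides the j-th term of a sequence
    that the hypothesis forbids. *)
Lemma conorm_far (R : realType) (n : nat) (M : smoothManifold R n) (g : riemannianMetric M)
  (a : cotangent M -> R[i]) (lam : R[i]) :
  ~ (exists z : nat -> cotangent M, (fun j => conorm g (z j)) @ \oo --> +oo /\
       (fun j => a (z j) : R[i]^o) @ \oo --> (lam : R[i]^o)) ->
  exists2 d, 0 < d & exists N, forall z, N <= conorm g z -> d <= cmod (a z - lam).
Proof.
move=> no; apply: contrapT => nf; apply: no.
have /choice[z zP] : forall j : nat, exists z, j%:R <= conorm g z /\ cmod (a z - lam) < (j.+1%:R)^-1.
  move=> j; apply: contrapT => nz; apply: nf; exists (j.+1%:R)^-1; first by rewrite invr_gt0.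
  by exists j%:R => z jz; rewrite leNgt; apply/negP => h; apply: nz; exists z.
exists z; split.
  apply/cvgryPge => c; near=> j; apply: le_trans (zP j).1.
  by near: j; exact: nbhs_infty_ger.
apply/cvg_complexP => e e0; have [N NP] := archi_inv e0.
by exists N => j Nj; exact: lt_le_trans (zP j).2 (NP j Nj).
Unshelve. all: by end_near.
Qed.

Theorem theorem1 (R : realType) (n : nat) (M : smoothManifold R n)
  (M_compact : compact [set: M])
  (mu : {measure set (borel M) -> \bar R})
  (mu_density : smooth_positive_density mu)
  (g : riemannianMetric M)
  (A H : (M -> R[i]) -> (M -> R[i]))
  (A_pseudo : pseudodifferential 0 A)
  (H_bounded : bounded_operator mu H)
  (H_extends_A : forall u, smooth_function u -> H u = A u %[ae mu])
  (H_self_adjoint : self_adjoint mu H)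
  (a : cotangent M -> R[i])
  (a_symbol : principal_symbol 0 A a) :
  essential_spectrum mu H =
  [set lambda : R[i] | exists z : nat -> cotangent M,
     (fun j => conorm g (z j)) @ \oo --> +oo /\
     (fun j => a (z j) : R[i]^o) @ \oo --> (lambda : R[i]^o)].
Proof.
apply/seteqP; split=> [lam ess|lam [z [z_inf z_lim]]]; last first.
  exact: (weyl_spectrum M_compact mu_density A_pseudo H_bounded H_extends_A H_self_adjoint a_symbol z_inf z_lim).
have [lam0|lamN] := eqVneq (Im lam) 0; last first.
  by case: ess => /(_ (nonreal_resolvent H_bounded H_self_adjoint lamN)).
have lamE : lam = (Re lam)%:C by apply: complexE2.
apply: contrapT => /= /conorm_far[d d0 [N far]]; move: ess far; rewrite lamE => ess far.
exact: (elliptic_not_essential M_compact mu_density A_pseudo H_bounded H_extends_A H_self_adjoint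
  a_symbol d0 far) ess.
Qed.
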